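(* In the continuous ergodic setting described in the context, let $A$ be a symmetric $d\times d$ matrix on $X$ with $A_{i,j}\in L^\infty(X,\mu)$ such that for some constants $\nu_1>0$ and $\nu_2$, for almost all $\eta\in X$ and all $\xi\in\mathbb{R}^d$, $\nu_1|\xi|^2\le{}^t\xi A(\eta)\xi\le\nu_2|\xi|^2$. Let $\sigma(A,\mu)$ be the positive definite symmetric matrix defined by $${}^t\xi\,\sigma(A,\mu)\,\xi=\inf_{v\in F^2_{pot}}\big\langle{}^t(\xi+v)A(\xi+v)\big\rangle,\qquad \xi\in\mathbb{R}^d.$$ For real $N>0$ and $\eta\in X$, let $A^N(\cdot,\eta)$ be the $N\mathbb{Z}^d$-periodic matrix field $A^N(x,\eta)=A(x-N[x/N],\eta)$, where $A(x,\eta)=A(\tau_{-x}\eta)$ and $[\cdot]$ is the (componentwise) integer part, and let $\sigma(A^N,\eta)$ be the positive definite symmetric matrix defined by $${}^t\xi\,\sigma(A^N,\eta)\,\xi=\inf_{f\in C^\infty(T^d_N)}N^{-d}\int_{T^d_N}{}^t(\xi+\nabla f(x))A^N(x,\eta)(\xi+\nabla f(x))\,dx,\qquad \xi\in\mathbb{R}^d.$$ Then for $\mu$-almost all $\eta\in X$, $$\lim_{N\to+\infty}\sigma(A^N,\eta)=\sigma(A,\mu).$$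
   Context: $d\ge 1$. $(X,\mathcal{G},\mu)$ is a probability space, $\langle f\rangle=\int_X f\,d\mu$, $\mathbb{L}^2(X,\mu)=(L^2(\mu))^d$. A group $\{\tau_x: x\in\mathbb{R}^d\}$ ($\tau_{x+y}=\tau_x\tau_y$) acts on $X$ such that: $\mu(\tau_xB)=\mu(B)$ for all $x$ and $B\in\mathcal{G}$; if $B\in\mathcal{G}$ satisfies $\tau_xB=B$ for all $x$ then $\mu(B)\in\{0,1\}$; for every measurable $f$ on $X$, $(\eta,x)\mapsto (T_xf)(\eta):=f(\tau_{-x}\eta)$ is measurable on $X\times\mathbb{R}^d$. $F^2_{pot}$ is the set of $f\in\mathbb{L}^2(X,\mu)$ with $\langle f\rangle=0$ such that for almost all $\eta$ the realization $h(x)=f(\tau_{-x}\eta)$ is potential (vortex-free), i.e. $\int_{\mathbb{R}^d}(h_i\partial_j\phi-h_j\partial_i\phi)\,dx=0$ for all $i,j$ and all $\phi\in C_0^\infty(\mathbb{R}^d)$. $T^d_N=\mathbb{R}^d/(N\mathbb{Z}^d)$ is the torus of dimension $d$ and side $N$. *)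

(* Defs.v *)
From HB Require Import structures.
From mathcomp Require Import all_boot all_order all_algebra.
From mathcomp Require Import all_classical all_reals all_analysis.
From mathcomp Require Import ring lra.

Set Implicit Arguments.
Unset Strict Implicit.
Unset Printing Implicit Defensive.

Import Order.TTheory GRing.Theory Num.Theory.
Import numFieldNormedType.Exports.

Local Open Scope classical_set_scope.
Local Open Scope ring_scope.

(* R^n is the type of row vectors 'rV[R]_n, with the n-fold product of the
   Borel sigma-algebra of R. *)
Definition measure_rV_display : measure_display.
Proof. exact: default_measure_display. Qed.

Section measurable_rV.
Context {R : realType} (n : nat).

Let coors : 'I_n -> 'rV[R]_n -> R := fun i x => x 0 i.

Let rV_set0 : g_sigma_preimage coors set0.
Proof. exact: sigma_algebra0. Qed.

Let rV_setC A : g_sigma_preimage coors A -> g_sigma_preimage coors (~` A).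
Proof. exact: sigma_algebraC. Qed.

Let rV_bigcup (F : _^nat) : (forall i, g_sigma_preimage coors (F i)) ->
  g_sigma_preimage coors (\bigcup_i (F i)).
Proof. exact: sigma_algebra_bigcup. Qed.

HB.instance Definition _ := @isMeasurable.Build measure_rV_display
  'rV[R]_n (g_sigma_preimage coors) rV_set0 rV_setC rV_bigcup.

End measurable_rV.

Section lebesgue_rV.
Context {R : realType}.

Definition cons_rV n (p : R * 'rV[R]_n) : 'rV[R]_n.+1 := row_mx p.1%:M p.2.

Lemma cons_rV0 n (p : R * 'rV[R]_n) : cons_rV p 0 ord0 = p.1.
Proof.
rewrite (_ : ord0 = lshift n (0 : 'I_1)); last exact/val_inj.
by apply: etrans (row_mxEl p.1%:M p.2 0 _) _; rewrite mxE eqxx.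
Qed.

Lemma cons_rVS n (p : R * 'rV[R]_n) i : cons_rV p 0 (lift ord0 i) = p.2 0 i.
Proof.
rewrite (_ : lift ord0 i = rshift 1 i); last exact/val_inj.
exact: (row_mxEr p.1%:M p.2 0 i).
Qed.

Lemma measurable_coord_rV n (i : 'I_n) :
  measurable_fun [set: 'rV[R]_n] (fun x : 'rV[R]_n => x 0 i).
Proof.
move=> _ Y mY; rewrite setTI; apply: sub_sigma_algebra => /=.
rewrite -bigcup_seq/=; exists i => /=; first by rewrite mem_index_enum.
by exists Y => //; rewrite setTI.
Qed.

Lemma measurable_fun_rV d (T : measurableType d) n (f : T -> 'rV[R]_n) :
  (forall i, measurable_fun [set: T] (fun t => f t 0 i)) ->
  measurable_fun [set: T] f.
Proof.
move=> mf; apply: (@measurability _ _ _ _ setT f _ erefl).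
move=> _ [B + <-]; rewrite -bigcup_seq/= => -[i _ [C mC <-]].
by rewrite setTI; exact: mf.
Qed.

Lemma measurable_cons_rV n : measurable_fun setT (@cons_rV n).
Proof.
apply: measurable_fun_rV => i; have [j ->|->] := unliftP ord0 i.
  under eq_fun do rewrite cons_rVS.
  exact: measurableT_comp (measurable_coord_rV j) measurable_snd.
under eq_fun do rewrite cons_rV0.
exact: measurable_fst.
Qed.

Section lebesgue_cons.
Context n (m : {measure set 'rV[R]_n -> \bar R}).
Local Open Scope ereal_scope.

Definition lebesgue_cons : set 'rV[R]_n.+1 -> \bar R :=
  pushforward (lebesgue_measure \x^ m) (@cons_rV n).

HB.instance Definition _ := Measure.copy lebesgue_cons
  (measure_function_pushforward__canonical__measure_function_Measure
     (lebesgue_measure \x^ m) (@measurable_cons_rV n)).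

End lebesgue_cons.

Fixpoint lebesgue_rV n : {measure set 'rV[R]_n -> \bar R} :=
  match n with
  | 0 => \d_(0 : 'rV[R]_0)
  | n.+1 => lebesgue_cons (lebesgue_rV n)
  end.

Lemma lebesgue_rV_box n (B : 'I_n -> set R) : (forall i, measurable (B i)) ->
  lebesgue_rV n [set x : 'rV[R]_n | forall i, B i (x 0 i)] =
  (\prod_(i < n) lebesgue_measure (B i))%E.
Proof.
elim: n B => [|n IH] B mB; first by rewrite big_ord0 /= diracE mem_set//= => -[].
rewrite big_ord_recl -IH//.
pose C := [set x : 'rV[R]_n | forall i, B (lift ord0 i) (x 0 i)].
have mC : measurable C.
  rewrite (_ : C = \bigcap_(i in [set: 'I_n])
      (fun x : 'rV[R]_n => x 0 i) @^-1` B (lift ord0 i)).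
    apply: fin_bigcap_measurable => // i _.
    by rewrite -[X in measurable X]setTI; exact: measurable_coord_rV.
  by apply/seteqP; split=> [x Cx i _|x Cx i]; [exact: Cx|exact: (Cx i I)].
rewrite -[RHS](product_measure2E lebesgue_measure (lebesgue_rV n))//; last first.
  exact: mB.
rewrite /= /lebesgue_cons /pushforward; congr (product_measure2 _ _ _).
apply/seteqP; split => -[a x] /= => [Bx|[Ba Bx] i].
  split => [|i]; first by have := Bx ord0; rewrite cons_rV0.
  by have := Bx (lift ord0 i); rewrite cons_rVS.
by have [j ->|->] := unliftP ord0 i; rewrite ?cons_rVS ?cons_rV0//; exact: Bx.
Qed.

End lebesgue_rV.

Section smooth_functions.
Context {R : realType} {d : nat}.
Implicit Types (f : 'rV[R]_d -> R) (h : 'rV[R]_d -> 'rV[R]_d) (i j : 'I_d).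

Definition partial i f : 'rV[R]_d -> R := fun x => 'D_(delta_mx 0 i) f x.

Definition gradient f : 'rV[R]_d -> 'rV[R]_d := fun x => \row_i partial i f x.

Definition iter_partial (s : seq 'I_d) f : 'rV[R]_d -> R := foldr partial f s.

(* C^infinity: the iterated partial derivatives of all orders are
   differentiable, hence exist and are continuous. *)
Definition smooth f : Prop :=
  forall (s : seq 'I_d) x, differentiable (iter_partial s f) x.

Definition test_function f : Prop :=
  smooth f /\ compact (closure [set x | f x != 0]).

Definition vortex_free h : Prop := forall i j phi, test_function phi ->
  (\int[lebesgue_rV d]_x
     (h x 0 i * partial j phi x - h x 0 j * partial i phi x)%:E = 0)%E.

(* Functions on the torus R^d / (N Z^d) are N Z^d-periodic functions on R^d;
   integrals over the torus are integrals over the fundamental cell [0, N[^d. *)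
Definition smooth_torus (N : R) : set ('rV[R]_d -> R) :=
  [set f | smooth f /\
    forall (k : 'rV[int]_d) x, f (x + N *: map_mx intr k) = f x].

Definition cell (N : R) : set 'rV[R]_d := [set x | forall i, 0 <= x 0 i < N].

Definition intpart (x : 'rV[R]_d) : 'rV[R]_d :=
  \row_i (Num.floor (x 0 i))%:~R.

End smooth_functions.

Section quadratic_forms.
Context {R : realType} {d : nat}.

Definition qform (M : 'M[R]_d) (xi : 'rV[R]_d) : R := (xi *m M *m xi^T) 0 0.

(* The norm of 'rV[R]_d in the library is the sup norm. *)
Definition sqnorm (xi : 'rV[R]_d) : R := \sum_i xi 0 i ^+ 2.

Definition is_form_matrix (q : 'rV[R]_d -> \bar R) (S : 'M[R]_d) : Prop :=
  [/\ S^T = S, forall xi, xi != 0 -> 0 < qform S xi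
    & forall xi, (qform S xi)%:E = q xi].

Lemma is_form_matrix_uniq q S S' :
  is_form_matrix q S -> is_form_matrix q S' -> S = S'.
Proof.
move=> [Ssym _ Sq] [S'sym _ S'q].
have qE xi : qform S xi = qform S' xi by apply: EFin_inj; rewrite Sq S'q.
have bilE (M : 'M[R]_d) (i j : 'I_d) :
    ((delta_mx 0 i : 'rV_d) *m M *m (delta_mx 0 j : 'rV_d)^T) 0 0 = M i j.
  by rewrite -rowE trmx_delta -colE !mxE.
have addE (B C : 'M[R]_1) : (B + C) 0 0 = B 0 0 + C 0 0 by rewrite mxE.
have polar (M : 'M[R]_d) i j : M^T = M ->
    qform M (delta_mx 0 i + delta_mx 0 j) = M i i + M j j + M i j *+ 2.
  move=> Msym; rewrite /qform linearD/= !mulmxDl !mulmxDr !addE !bilE.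
  have -> : M j i = M i j by rewrite -[in LHS]Msym mxE.
  ring.
apply/matrixP => i j.
have diag k : S k k = S' k k.
  by have := qE (delta_mx 0 k); rewrite /qform !bilE.
have := qE (delta_mx 0 i + delta_mx 0 j).
rewrite (polar _ i j Ssym) (polar _ i j S'sym) !diag.
by move=> /addrI SS'; lra.
Qed.

(* Unique by [is_form_matrix_uniq]; the default value [point] when no such
   matrix exists. *)
Definition form_matrix (q : 'rV[R]_d -> \bar R) : 'M[R]_d :=
  get (is_form_matrix q).

End quadratic_forms.

Section ergodic_homogenization.
Context {R : realType} {d : nat} {disp : measure_display}
  {X : measurableType disp} (mu : probability X R)
  (tau : 'rV[R]_d -> X -> X).

Record ergodic_action : Prop := ErgodicAction {
  action0 : forall eta, tau 0 eta = eta ;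
  actionD : forall x y eta, tau (x + y) eta = tau x (tau y eta) ;
  action_invariant : forall x B, measurable B -> mu (tau x @` B) = mu B ;
  action_ergodic : forall B, measurable B -> (forall x, tau x @` B = B) ->
    mu B = 0%E \/ mu B = 1%E ;
  action_measurable : forall f : X -> R, measurable_fun [set: X] f ->
    measurable_fun [set: X * 'rV[R]_d] (fun p => f (tau (- p.2) p.1)) }.

Definition F2pot : set (X -> 'rV[R]_d) :=
  [set v : X -> 'rV[R]_d | [/\ forall i, (fun eta => v eta 0 i) \in Lfun mu 2%:E,
      forall i, (\int[mu]_eta (v eta 0 i)%:E = 0)%E
    & {ae mu, forall eta, vortex_free (fun x => v (tau (- x) eta))}]].

Context (A : X -> 'M[R]_d).

Definition effective_form (xi : 'rV[R]_d) : \bar R :=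
  ereal_inf [set (\int[mu]_eta (qform (A eta) (xi + v eta))%:E)%E
            | v in F2pot].

Definition realization (x : 'rV[R]_d) (eta : X) : 'M[R]_d := A (tau (- x) eta).

Definition periodized (N : R) (x : 'rV[R]_d) (eta : X) : 'M[R]_d :=
  realization (x - N *: intpart (N^-1 *: x)) eta.

Definition periodized_form (N : R) (eta : X) (xi : 'rV[R]_d) : \bar R :=
  ereal_inf [set ((N ^- d)%:E *
      \int[lebesgue_rV d]_(x in cell N)
        (qform (periodized N x eta) (xi + gradient f x))%:E)%E
    | f in smooth_torus N].

Definition sigma_eff : 'M[R]_d := form_matrix effective_form.

Definition sigma_per (N : R) (eta : X) : 'M[R]_d :=
  form_matrix (periodized_form N eta).

End ergodic_homogenization.

(* Main.v *)
(* Call "gradient field" a bounded [w] on [X] whose realizations are the gradients of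
   the realizations of a bounded smooth [g]. Convolving along orbits with [m_j], where
   [sum_j partial j m_j] is a mollifier minus a long-range average, approximates any
   [v] of [F2pot] in L^2 by gradient fields, since the long-range averages of [v] die by
   the mean ergodic theorem. So the effective form is an infimum over gradient fields.

   Upper bound: multiply the potential of a nearly optimal gradient field by a cut-off
   of the cell. As [g] is bounded, the result is a periodic competitor whose energy
   exceeds an average along the orbit by [O(1/N)] plus a thin boundary layer, and the
   multidimensional ergodic theorem computes the limit of the average.

   Lower bound: the flux [A (xi + w)] of a near-minimizer is nearly divergence free,
   hence L^2-close to its mean plus the divergence of a skew field of bounded
   potentials. Cutting these potentials off in the cell makes integration by parts
   against [xi + grad f] exact for every periodic [f], and the duality
   [q(y) >= 2 b(x, y) - q(x)] then bounds the cell energy from below uniformly in [f].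

   An infimum of quadratic energies over a linear family is a quadratic form, whose
   matrix is recovered by polarization from the values at finitely many [xi]. *)
From HB Require Import structures.
Require Import Defs.
From mathcomp Require Import all_boot all_order all_algebra.
From mathcomp Require Import all_classical all_reals all_analysis.
From mathcomp Require Import measurable_realfun.
From mathcomp Require Import ring lra.

Set Implicit Arguments.
Unset Strict Implicit.
Unset Printing Implicit Defensive.

Import Order.TTheory GRing.Theory Num.Theory.
Import numFieldNormedType.Exports.

Local Open Scope classical_set_scope.
Local Open Scope ring_scope.

(** * Bounded measurable functions and their integrals *)

(** Neither a corrector nor a minimizer of a cell problem is ever constructed: near-minimizers
    suffice, so that no compactness, Sobolev space or weak limit enters. The potential of a general
    element of [F2pot] need not be bounded, and cutting it off would require control of its growth;
    the convolved fields are used because their potentials are bounded by construction. The price is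
    a choice of scales in two rounds. The kernels [m_j] are selected by looking at one field, and
    their operator norms, over which there is no control, amplify any failure of the curl or
    divergence condition. They are therefore selected from a coarse approximation (a truncation, or
    a near-minimizer), which is afterwards exchanged for one that is fine compared with the norms
    just obtained. Null sets depend on the tolerance and on [xi], so only countably many of them may
    be used. Since symmetry and ellipticity hold only almost everywhere, [A] is replaced by an
    everywhere elliptic matrix, which alters neither the effective form nor, for almost every [eta],
    the periodized ones. Nearly all integrals are of bounded functions on sets of finite measure,
    which keeps integrability out of the algebra. *)

Section bounded_measurable.
Context {R : realType} {disp : measure_display} {T : measurableType disp}.
Implicit Types (f g : T -> R) (D : set T).

(** Measurability is global while the bound is only on [D]: smooth functions are bounded on cubes
    but not on the whole space, and global measurability lets shifts and compositions with the
    action go through without restricting domains. *)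
Definition bdm D f :=
  measurable_fun [set: T] f /\ exists C, forall x, D x -> `|f x| <= C.

Lemma bdm_bound D f : bdm D f ->
  exists2 C, 0 < C & forall x, D x -> `|f x| <= C.
Proof.
move=> [_ [C fC]]; exists (`|C| + 1) => [|x Dx].
  by rewrite ltr_pwDr.
by rewrite (le_trans (fC _ Dx))// (le_trans (ler_norm C))// lerDl.
Qed.

Lemma bdm_sub D D' f : D' `<=` D -> bdm D f -> bdm D' f.
Proof. by move=> DD' [mf [C fC]]; split => //; exists C => x /DD'/fC. Qed.

Lemma bdm_cst D c : bdm D (fun=> c).
Proof. by split; [exact: measurable_cst|exists `|c|]. Qed.

Lemma bdmD D f g : bdm D f -> bdm D g -> bdm D (fun x => f x + g x).
Proof.
move=> [mf [C fC]] [mg [C' gC]]; split; first exact: measurable_funD.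
exists (C + C') => x Dx.
by rewrite (le_trans (ler_normD _ _))// lerD ?fC ?gC.
Qed.

Lemma bdmM D f g : bdm D f -> bdm D g -> bdm D (fun x => f x * g x).
Proof.
move=> [mf [C fC]] [mg [C' gC]]; split; first exact: measurable_funM.
by exists (C * C') => x Dx; rewrite normrM ler_pM ?fC ?gC.
Qed.

Lemma bdmZ D c f : bdm D f -> bdm D (fun x => c * f x).
Proof. exact/bdmM/bdm_cst. Qed.

Lemma bdmN D f : bdm D f -> bdm D (fun x => - f x).
Proof.
move=> bf; under eq_fun do rewrite -mulN1r.
exact: bdmZ.
Qed.

Lemma bdmB D f g : bdm D f -> bdm D g -> bdm D (fun x => f x - g x).
Proof. by move=> bf bg; exact: bdmD (bdmN bg). Qed.

Lemma bdmX D f k : bdm D f -> bdm D (fun x => f x ^+ k).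
Proof.
move=> bf; elim: k => [|k IH]; first by under eq_fun do rewrite expr0; exact: bdm_cst.
by under eq_fun do rewrite exprS; exact: bdmM.
Qed.

Lemma bdm_norm D f : bdm D f -> bdm D (fun x => `|f x|).
Proof.
move=> [mf [C fC]]; split; last by exists C => x Dx; rewrite normr_id fC.
exact: measurableT_comp.
Qed.

Lemma bdm_sum D (I : Type) (r : seq I) (P : pred I) (F : I -> T -> R) :
  (forall i, bdm D (F i)) -> bdm D (fun x => \sum_(i <- r | P i) F i x).
Proof.
move=> bF; elim: r => [|i r IH].
  by under eq_fun do rewrite big_nil; exact: bdm_cst.
under eq_fun do rewrite big_cons.
by case: (P i) => //; exact: bdmD.
Qed.

Lemma bdm_prod D (I : Type) (r : seq I) (P : pred I) (F : I -> T -> R) :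
  (forall i, bdm D (F i)) -> bdm D (fun x => \prod_(i <- r | P i) F i x).
Proof.
move=> bF; elim: r => [|i r IH].
  by under eq_fun do rewrite big_nil; exact: bdm_cst.
under eq_fun do rewrite big_cons.
by case: (P i) => //; exact: bdmM.
Qed.

Lemma bdm_indic D E : measurable E -> bdm D (\1_E : T -> R).
Proof.
move=> mE; split; first exact: measurable_indic.
by exists 1 => x _; rewrite indicE; case: (_ \in _); rewrite ?normr1 ?normr0.
Qed.

End bounded_measurable.

Section bounded_integral.
Context {R : realType} {disp : measure_display} {T : measurableType disp}.
Context (m : {measure set T -> \bar R}) (D : set T).
Hypotheses (mD : measurable D) (Dfin : (m D < +oo)%E).
Implicit Types (f g : T -> R).

Lemma bdm_int f : bdm D f -> m.-integrable D (EFin \o f).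
Proof.
move=> [mf [C fC]]; apply: measurable_bounded_integrable => //.
  exact: measurable_funS mf.
exists C; split; first exact: num_real.
by move=> M CM x Dx /=; rewrite (le_trans (fC _ Dx))// ltW.
Qed.

Lemma bRintD f g : bdm D f -> bdm D g ->
  \int[m]_(x in D) (f x + g x) = \int[m]_(x in D) f x + \int[m]_(x in D) g x.
Proof. by move=> bf bg; rewrite RintegralD//; exact: bdm_int. Qed.

Lemma bRintB f g : bdm D f -> bdm D g ->
  \int[m]_(x in D) (f x - g x) = \int[m]_(x in D) f x - \int[m]_(x in D) g x.
Proof. by move=> bf bg; rewrite RintegralB//; exact: bdm_int. Qed.

Lemma bRintZ c f : bdm D f ->
  \int[m]_(x in D) (c * f x) = c * \int[m]_(x in D) f x.
Proof. by move=> bf; rewrite RintegralZl//; exact: bdm_int. Qed.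

Lemma bRintN f : bdm D f ->
  \int[m]_(x in D) (- f x) = - \int[m]_(x in D) f x.
Proof.
move=> bf; rewrite -mulN1r -bRintZ//.
by under [RHS]eq_Rintegral do rewrite mulN1r.
Qed.

Lemma Rint0 : \int[m]_(x in D) (0 : R) = 0.
Proof. by rewrite Rintegral_cst// mul0r. Qed.

Lemma bRint_sum (I : Type) (r : seq I) (P : pred I) (F : I -> T -> R) :
  (forall i, bdm D (F i)) ->
  \int[m]_(x in D) (\sum_(i <- r | P i) F i x) =
  \sum_(i <- r | P i) \int[m]_(x in D) F i x.
Proof.
move=> bF; elim: r => [|i r IH].
  by rewrite big_nil; under eq_Rintegral do rewrite big_nil; exact: Rint0.
rewrite big_cons; under eq_Rintegral do rewrite big_cons.
case: (P i) => //; rewrite -IH bRintD//.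
exact: bdm_sum.
Qed.

Lemma bRint_le f g : bdm D f -> bdm D g -> (forall x, D x -> f x <= g x) ->
  \int[m]_(x in D) f x <= \int[m]_(x in D) g x.
Proof. by move=> bf bg fg; apply: le_Rintegral => //; exact: bdm_int. Qed.

Lemma bRint_norm f : bdm D f ->
  `|\int[m]_(x in D) f x| <= \int[m]_(x in D) `|f x|.
Proof. by move=> bf; apply: le_normr_Rintegral => //; exact: bdm_int. Qed.

Lemma bRint_bound f C : bdm D f -> (forall x, D x -> `|f x| <= C) ->
  `|\int[m]_(x in D) f x| <= C * fine (m D).
Proof.
move=> bf fC; rewrite (le_trans (bRint_norm bf))//.
rewrite -Rintegral_cst//; apply: bRint_le => //.
- exact: bdm_norm.
- exact: bdm_cst.
Qed.

Lemma EFin_bRint f : bdm D f ->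
  (\int[m]_(x in D) f x)%:E = (\int[m]_(x in D) (f x)%:E)%E.
Proof.
move=> bf; rewrite fineK//.
exact/integrable_fin_num/bdm_int.
Qed.

(* Expand [0 <= int (f * int g^2 - g * int (f g))^2]. *)
Lemma bRint_CauchySchwarz f g : bdm D f -> bdm D g ->
  (\int[m]_(x in D) (f x * g x)) ^+ 2 <=
  (\int[m]_(x in D) (f x ^+ 2)) * (\int[m]_(x in D) (g x ^+ 2)).
Proof.
move=> bf bg; have bff := bdmX 2 bf; have bgg := bdmX 2 bg; have bfg := bdmM bf bg.
set a := \int[m]_(x in D) (f x ^+ 2); set b := \int[m]_(x in D) (g x ^+ 2).
set c := \int[m]_(x in D) (f x * g x).
have quad s t : 0 <= s ^+ 2 * a + (2 * s * t * c + t ^+ 2 * b).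
  rewrite -!bRintZ// -!bRintD//; do ?exact: bdmZ; last first.
    by apply: bdmD; exact: bdmZ.
  apply: Rintegral_ge0 => x _.
  rewrite (_ : _ + _ = (s * f x + t * g x) ^+ 2) ?sqr_ge0//; ring.
have a0 : 0 <= a by apply: Rintegral_ge0 => x _; exact: sqr_ge0.
have b0 : 0 <= b by apply: Rintegral_ge0 => x _; exact: sqr_ge0.
move: b0; rewrite le_eqVlt => /orP[/eqP b0|b0].
  have := quad c (- (a + 1)); rewrite -b0 => h.
  have : c ^+ 2 * (a + 2) <= 0 by nra.
  rewrite mulr0 pmulr_lle0//; lra.
have := quad b (- c); rewrite -subr_ge0 => h.
rewrite -(pmulr_rge0 _ b0); move: h; congr (0 <= _); ring.
Qed.

Lemma bRint_sq f : bdm D f ->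
  (\int[m]_(x in D) f x) ^+ 2 <= fine (m D) * \int[m]_(x in D) (f x ^+ 2).
Proof.
move=> bf; have := bRint_CauchySchwarz (bdm_cst D 1) bf.
under eq_Rintegral do rewrite mul1r.
under [X in _ <= X * _ -> _]eq_Rintegral do rewrite expr1n.
by rewrite Rintegral_cst// mul1r.
Qed.

Lemma bRint_sub E f : measurable E -> E `<=` D -> bdm D f ->
  (forall x, D x -> ~ E x -> f x = 0) ->
  \int[m]_(x in D) f x = \int[m]_(x in E) f x.
Proof.
move=> mE ED bf f0; rewrite (Rintegral_mkcond _ E) (Rintegral_mkcond _ D).
apply: eq_Rintegral => x _; rewrite /patch.
case: ifPn => [|Dx]; rewrite ?inE; case: ifPn; rewrite ?inE//.
  by rewrite notin_setE => nE Dx; rewrite f0.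
by move=> /ED Ex; move: Dx; rewrite notin_setE.
Qed.

End bounded_integral.

Lemma integrable_indic_lty {R : realType} {disp : measure_display}
    {T : measurableType disp} (m : {measure set T -> \bar R}) (A : set T) (c : R) :
  measurable A -> (m A < +oo)%E ->
  m.-integrable setT (EFin \o (fun x => c * \1_A x)).
Proof.
move=> mA Afin.
rewrite (_ : EFin \o _ = fun x => c%:E * (\1_A x)%:E)%E//; apply: integrableZl => //.
apply/integrableP; split; first exact/measurable_EFinP.
rewrite (eq_integral (fun x => (\1_A x)%:E)); last first.
  by move=> t _; rewrite gee0_abs// lee_fin.
by rewrite integral_indic// setIT.
Qed.

(** * Fubini for bounded functions on products of sets of finite measure *)

Section product_integral.
Context {R : realType} {d1 d2 : measure_display}.
Context {T1 : measurableType d1} {T2 : measurableType d2}.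
Context (m1 : {sigma_finite_measure set T1 -> \bar R}).
Context (m2 : {sigma_finite_measure set T2 -> \bar R}).

(** Tonelli gives measurability for nonnegative integrands, so the integral is written as the
    difference of the integrals of the positive and negative parts. Both [fine] and the difference
    of extended reals are measurable, whether or not the integrals are finite. *)
Lemma measurable_Rint (D2 : set T2) (F : T1 * T2 -> R) : measurable D2 ->
  measurable_fun [set: T1 * T2] F ->
  measurable_fun [set: T1] (fun x => \int[m2]_(y in D2) F (x, y)).
Proof.
move=> mD2 mF.
suff mh : measurable_fun [set: T1] (fun x => \int[m2]_(y in D2) (F (x, y))%:E)%E.
  exact: (measurableT_comp (fine_measurable measurableT) mh).
have mF' : measurable_fun [set: T1 * T2]
    (fun z => (F z * \1_D2 z.2)%:E : \bar R).
  apply/measurable_EFinP; apply: measurable_funM => //.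
  apply: measurableT_comp; last exact: measurable_snd.
  exact: measurable_indic.
rewrite (_ : (fun x => _) = (fun x => fubini_F m2 ((fun z => (F z * \1_D2 z.2)%:E)^\+)%E x -
    fubini_F m2 ((fun z => (F z * \1_D2 z.2)%:E)^\-)%E x)%E); last first.
  apply/funext => x; rewrite integral_mkcond.
  rewrite [LHS](_ : _ = \int[m2]_y (F (x, y) * \1_D2 y)%:E)%E; last first.
    apply: eq_integral => y _; rewrite /patch indicE.
    by case: ifPn => _; rewrite ?mulr1 ?mulr0.
  rewrite integralE; congr (_ - _)%E; apply: eq_integral => y _;
    by rewrite ?funeposE ?funenegE.
apply: emeasurable_funB.
  apply: measurable_fun_fubini_tonelli_F => //.
  exact: measurable_funepos.
apply: measurable_fun_fubini_tonelli_F => //.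
exact: measurable_funeneg.
Qed.

Lemma bdm_Rint (D1 : set T1) (D2 : set T2) (F : T1 * T2 -> R) : measurable D2 ->
  (m2 D2 < +oo)%E -> bdm (D1 `*` D2) F ->
  bdm D1 (fun x => \int[m2]_(y in D2) F (x, y)).
Proof.
move=> mD2 D2fin [mF [C FC]]; split; first exact: measurable_Rint.
exists (C * fine (m2 D2)) => x Dx.
apply: bRint_bound => //; last by move=> y Dy; apply: FC.
split; last by exists C => y Dy; apply: FC.
exact: measurableT_comp.
Qed.

(** Multiplying by the two indicators turns [F] into a function integrable on the whole product, to
    which the full-space Fubini theorem applies. Its sections are integrable at every point, not
    just almost every one, so that [fine] can be moved inside the outer integral. *)
Let bRint_prod_subproof (D1 : set T1) (D2 : set T2) (F : T1 * T2 -> R) :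
  measurable D1 -> measurable D2 ->
  (m1 D1 < +oo)%E -> (m2 D2 < +oo)%E -> bdm (D1 `*` D2) F ->
  \int[m1]_(x in D1) (\int[m2]_(y in D2) F (x, y)) =
    \int[m2]_(y in D2) (\int[m1]_(x in D1) F (x, y)) /\
  \int[(m1 \x^ m2)%E]_(z in D1 `*` D2) F z =
    \int[m1]_(x in D1) (\int[m2]_(y in D2) F (x, y)).
Proof.
move=> mD1 mD2 D1fin D2fin bF; have [mF [C FC]] := bF.
pose G z := F z * (\1_D1 z.1 * \1_D2 z.2).
have mG : measurable_fun [set: T1 * T2] G.
  by apply: measurable_funM => //; apply: measurable_funM;
    apply: measurableT_comp; [exact: measurable_indic|exact: measurable_fst|
      exact: measurable_indic|exact: measurable_snd].
have GE x y : D1 x -> D2 y -> G (x, y) = F (x, y).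
  by move=> Dx Dy; rewrite /G/= !indicE !mem_set// !mulr1.
have Gx0 x y : ~ D1 x -> G (x, y) = 0.
  by move=> Dx; rewrite /G/= indicE memNset// mul0r mulr0.
have Gy0 x y : ~ D2 y -> G (x, y) = 0.
  by move=> Dy; rewrite /G/= [X in _ * X]mulrC indicE memNset// mul0r mulr0.
have iG : (m1 \x m2)%E.-integrable setT (EFin \o G).
  apply: (@le_integrable _ _ _ _ _ _ _ (EFin \o (fun z => C * \1_(D1 `*` D2) z))) => //=.
  - exact/measurable_EFinP.
  - move=> z _; rewrite lee_fin /G normrM !indicE.
    have [[D1z D2z]|nD] := pselect (D1 z.1 /\ D2 z.2).
      rewrite !mem_set// !mulr1 normr1 mulr1.
      by rewrite (le_trans _ (ler_norm _))// FC.
    rewrite (@memNset _ (D1 `*` D2) z nD) mulr0 normr0.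
    have [D1z|D1z] := pselect (D1 z.1); last first.
      by rewrite (memNset D1z) mul0r normr0 mulr0.
    have [D2z|D2z] := pselect (D2 z.2); last first.
      by rewrite (memNset D2z) mulr0 normr0 mulr0.
    by exfalso; apply: nD.
  - apply: integrable_indic_lty => //.
      exact: measurableX.
    apply: (@le_lt_trans _ _ (m1 D1 * m2 D2)%E).
      by rewrite -(product_measure1E m1 m2 mD1 mD2).
    by rewrite lte_mul_pinfty// ge0_fin_numE.
have i1 x : m2.-integrable setT (fun y => (G (x, y))%:E).
  apply: (@le_integrable _ _ _ _ _ _ _ (EFin \o (fun y => `|C| * \1_D2 y))) => //=.
  - by apply/measurable_EFinP; exact: measurableT_comp mG _.
  - move=> y _; rewrite lee_fin indicE.
    have [D2y|D2y] := pselect (D2 y); last first.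
      by rewrite Gy0// normr0 (memNset D2y) mulr0 normr0.
    rewrite mem_set// mulr1 normr_id.
    have [D1x|D1x] := pselect (D1 x); last by rewrite Gx0// normr0.
    by rewrite GE// (le_trans _ (ler_norm _))// FC.
  - exact: integrable_indic_lty.
have i2 y : m1.-integrable setT (fun x => (G (x, y))%:E).
  apply: (@le_integrable _ _ _ _ _ _ _ (EFin \o (fun x => `|C| * \1_D1 x))) => //=.
  - by apply/measurable_EFinP; exact: measurableT_comp mG _.
  - move=> x _; rewrite lee_fin indicE.
    have [D1x|D1x] := pselect (D1 x); last first.
      by rewrite Gx0// normr0 (memNset D1x) mulr0 normr0.
    rewrite mem_set// mulr1 normr_id.
    have [D2y|D2y] := pselect (D2 y); last by rewrite Gy0// normr0.
    by rewrite GE// (le_trans _ (ler_norm _))// FC.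
  - exact: integrable_indic_lty.
have step : \int[m1]_(x in D1) (\int[m2]_(y in D2) F (x, y)) =
    fine (\int[m1]_x \int[m2]_y (G (x, y))%:E)%E.
  rewrite Rintegral_mkcond; congr fine; apply: eq_integral => x _.
  rewrite /patch; case: ifPn; rewrite ?inE ?notin_setE => D1x; last first.
    by rewrite integral0_eq// => y _; rewrite Gx0.
  rewrite Rintegral_mkcond fineK; last first.
    have := integrable_fin_num measurableT (i1 x).
    congr (_ \is a fin_num); apply: eq_integral => y _; rewrite /patch.
    by case: ifPn; rewrite ?inE ?notin_setE => D2y; [rewrite GE|rewrite Gy0].
  apply: eq_integral => y _; rewrite /patch.
  by case: ifPn; rewrite ?inE ?notin_setE => D2y; [rewrite GE|rewrite Gy0].
split; last first.
  rewrite step Rintegral_mkcond.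
  transitivity (fine (\int[m1 \x^ m2]_z (EFin \o G) z)%E).
    congr fine; apply: eq_integral => -[x y] _; rewrite /patch.
    case: ifPn; rewrite ?inE ?notin_setE/= => Dz; first by rewrite GE//; case: Dz.
    have [D1x|D1x] := pselect (D1 x); last by rewrite Gx0.
    have [D2y|D2y] := pselect (D2 y); last by rewrite Gy0.
    by exfalso; apply: Dz.
  by rewrite -(integral12_prod_meas2 iG).
rewrite step (Fubini iG); symmetry.
rewrite Rintegral_mkcond; congr fine; apply: eq_integral => y _.
rewrite /patch; case: ifPn; rewrite ?inE ?notin_setE => D2y; last first.
  by rewrite [RHS]integral0_eq// => x _ /=; rewrite Gy0.
rewrite Rintegral_mkcond fineK; last first.
  have := integrable_fin_num measurableT (i2 y).
  congr (_ \is a fin_num); apply: eq_integral => x _; rewrite /patch.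
  by case: ifPn; rewrite ?inE ?notin_setE => D1x; [rewrite GE|rewrite Gx0].
apply: eq_integral => x _; rewrite /patch.
by case: ifPn; rewrite ?inE ?notin_setE => D1x; [rewrite /= GE|rewrite /= Gx0].
Qed.

Lemma bRint_Fubini (D1 : set T1) (D2 : set T2) (F : T1 * T2 -> R) :
  measurable D1 -> measurable D2 ->
  (m1 D1 < +oo)%E -> (m2 D2 < +oo)%E -> bdm (D1 `*` D2) F ->
  \int[m1]_(x in D1) (\int[m2]_(y in D2) F (x, y)) =
  \int[m2]_(y in D2) (\int[m1]_(x in D1) F (x, y)).
Proof. by move=> *; have [] := @bRint_prod_subproof D1 D2 F. Qed.

Lemma bRint_prod (D1 : set T1) (D2 : set T2) (F : T1 * T2 -> R) :
  measurable D1 -> measurable D2 ->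
  (m1 D1 < +oo)%E -> (m2 D2 < +oo)%E -> bdm (D1 `*` D2) F ->
  \int[(m1 \x^ m2)%E]_(z in D1 `*` D2) F z =
  \int[m1]_(x in D1) (\int[m2]_(y in D2) F (x, y)).
Proof. by move=> *; have [] := @bRint_prod_subproof D1 D2 F. Qed.

End product_integral.

(** * Lebesgue measure on [R^n] *)

Section lebesgue_Rn.
Context {R : realType}.
Implicit Types (n : nat).

(** A plain set function to which canonical structures can be attached: the fixpoint [lebesgue_rV]
    already returns a bundled measure, and Fubini needs a sigma-finite one. *)
Definition lebn n : set 'rV[R]_n -> \bar R := lebesgue_rV n.

HB.instance Definition _ n := Measure.on (@lebn n).

Definition boxn n (B : 'I_n -> set R) : set 'rV[R]_n :=
  [set x | forall i, B i (x 0 i)].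

Lemma measurable_boxn n (B : 'I_n -> set R) :
  (forall i, measurable (B i)) -> measurable (boxn B).
Proof.
move=> mB; rewrite (_ : boxn B = \bigcap_(i in [set: 'I_n])
    (fun x : 'rV[R]_n => x 0 i) @^-1` B i).
  apply: fin_bigcap_measurable => // i _.
  by rewrite -[X in measurable X]setTI; exact: measurable_coord_rV.
by apply/seteqP; split=> [x Cx i _|x Cx i]; [exact: Cx|exact: (Cx i I)].
Qed.

Lemma lebn_boxn n (B : 'I_n -> set R) : (forall i, measurable (B i)) ->
  lebn (boxn B) = (\prod_(i < n) lebesgue_measure (B i))%E.
Proof. exact: lebesgue_rV_box. Qed.

Definition cube n (a b : R) : set 'rV[R]_n := boxn (fun=> `[a, b[%classic).

Lemma measurable_cube n a b : measurable (@cube n a b).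
Proof. by apply: measurable_boxn => i. Qed.

Lemma lebn_cube n a b : a <= b -> lebn (@cube n a b) = ((b - a) ^+ n)%:E.
Proof.
move=> ab; rewrite lebn_boxn//.
rewrite (eq_bigr (fun=> (b - a)%:E)) => [|i _]; last first.
  rewrite lebesgue_measure_itv/= lte_fin EFinB.
  by case: ltgtP ab => // ->; rewrite subee.
by rewrite prodEFin big_const_ord iter_mulr_1.
Qed.

Lemma lebn_cube_fin n a b : (lebn (@cube n a b) < +oo)%E.
Proof.
have [ab|ba] := leP a b; first by rewrite lebn_cube// ltry.
apply: (@le_lt_trans _ _ (lebn (@cube n b a))); last first.
  by rewrite lebn_cube ?ltry// ltW.
apply: le_measure; rewrite ?inE; [exact: measurable_cube..|].
move=> x xab i; have := xab i; rewrite /= !in_itv/= => /andP[h1 h2].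
by have := lt_trans (le_lt_trans h1 h2) ba; rewrite ltxx.
Qed.

Lemma coord_le_norm n (x : 'rV[R]_n) i : `|x 0 i| <= `|x|.
Proof.
rewrite [leRHS]/Num.norm/= mx_normrE.
exact: (le_bigmax _ (fun ij : 'I_1 * 'I_n => `|x ij.1 ij.2|) (0, i)).
Qed.

Lemma norm_le_coord n (x : 'rV[R]_n) C : 0 <= C ->
  (forall i, `|x 0 i| <= C) -> `|x| <= C.
Proof.
move=> C0 xC; rewrite [leLHS]/Num.norm/= mx_normrE.
by apply/bigmax_leP; split => // -[i j] _ /=; rewrite ord1.
Qed.

Definition cube_exhaust n k : set 'rV[R]_n := cube (- k%:R) k%:R.

Lemma cube_exhaustT n : \bigcup_k @cube_exhaust n k = setT.
Proof.
apply/seteqP; split => // x _.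
exists (Num.truncn `|x|).+1 => //= i; rewrite /= in_itv/=.
suff : `|x 0 i| < (Num.truncn `|x|).+1%:R by rewrite ltr_norml => /andP[/ltW -> ->].
exact: le_lt_trans (coord_le_norm _ _) (truncnS_gt _).
Qed.

Lemma sigma_finite_lebn n : sigma_finite setT (@lebn n).
Proof.
exists (@cube_exhaust n); first by rewrite cube_exhaustT.
by move=> k; split; [exact: measurable_cube|exact: lebn_cube_fin].
Qed.

HB.instance Definition _ n := @Measure_isSigmaFinite.Build _ _ _ (@lebn n)
  (@sigma_finite_lebn n).

Definition boxes n : set (set 'rV[R]_n) :=
  [set E | exists2 B, (forall i, measurable (B i)) & E = boxn B].

Lemma setI_boxes n : setI_closed (@boxes n).
Proof.
move=> _ _ [B mB ->] [C mC ->]; exists (fun i => B i `&` C i).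
  by move=> i; exact: measurableI.
apply/seteqP; split => x /=; first by move=> [xB xC] i; split.
by move=> xBC; split => i; have [] := xBC i.
Qed.

Lemma measurable_boxesE n : @measurable _ 'rV[R]_n = <<s @boxes n >>.
Proof.
apply/seteqP; split => [E|E]; last first.
  apply: smallest_sub; first exact: sigma_algebra_measurable.
  by move=> _ [B mB ->]; exact: measurable_boxn.
apply: smallest_sub; first exact: smallest_sigma_algebra.
move=> A; rewrite -bigcup_seq/= => -[i _ [C mC <-]].
apply: sub_sigma_algebra; rewrite setTI.
exists (fun j => if j == i then C else setT) => [j|]; first by case: ifP.
apply/seteqP; split => x /=; last by move=> /(_ i); rewrite eqxx.
by move=> xC j; case: eqP => [->|].
Qed.

(** Boxes form a pi-system that generates the sigma-algebra, and cubes of finite measure exhaust the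
    space. Invariance under translation and reflection thereby reduces to dimension one, factor by
    factor. *)
Lemma lebn_unique n (m : {measure set 'rV[R]_n -> \bar R}) :
  (forall B, (forall i, measurable (B i)) -> m (boxn B) = lebn (boxn B)) ->
  forall E, measurable E -> m E = lebn E.
Proof.
move=> mE E mE'; apply/esym.
apply: (measure_unique (@boxes n) (@cube_exhaust n)) => //.
- exact: measurable_boxesE.
- exact: setI_boxes.
- by move=> k; exists (fun=> `[- k%:R, k%:R[%classic).
- exact: cube_exhaustT.
- by move=> _ [B mB ->]; rewrite mE.
- by move=> k; exact: lebn_cube_fin.
Qed.

Lemma measurable_addr n (a : 'rV[R]_n) :
  measurable_fun [set: 'rV[R]_n] (fun x => x + a).
Proof.
apply: measurable_fun_rV => i.
under eq_fun do rewrite mxE.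
by apply: measurable_funD => //; exact: measurable_coord_rV.
Qed.

Lemma measurable_opprV n : measurable_fun [set: 'rV[R]_n] (fun x => - x).
Proof.
apply: measurable_fun_rV => i.
under eq_fun do rewrite mxE.
by apply: measurable_funN; exact: measurable_coord_rV.
Qed.

Lemma lebesgue_measure_shift (a : R) (B : set R) : measurable B ->
  lebesgue_measure ((fun t => t + a) @^-1` B) = lebesgue_measure B.
Proof.
move=> mB; have ma : measurable_fun [set: R] (fun t : R => t + a).
  exact: measurable_funD.
rewrite -[LHS]/(pushforward lebesgue_measure (fun t : measurableTypeR R => (t + a : measurableTypeR R)) B).
apply/esym/lebesgue_measure_unique => //= _ [[u v]] _ <-.
rewrite /pushforward (_ : _ @^-1` _ = `]u - a, v - a]%classic); last first.
  by apply/seteqP; split => t /=; rewrite !in_itv/= ltrBlDr lerBrDr.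
by rewrite !lebesgue_measure_itv/= !lte_fin ltrD2r; case: ifP => // _; congr EFin; lra.
Qed.

Lemma lebn_shift n (a : 'rV[R]_n) (E : set 'rV[R]_n) : measurable E ->
  pushforward (@lebn n) (fun x => x + a) E = lebn E.
Proof.
move=> mE; apply: (@lebn_unique n (pushforward (@lebn n) (fun x => x + a))) => //; first exact: measurable_addr.
move=> mf B mB; rewrite -[LHS]/(lebn (_ @^-1` boxn B)).
rewrite (_ : _ @^-1` _ = boxn (fun i => (fun t => t + a 0 i) @^-1` B i)); last first.
  by apply/seteqP; split => x /= xB i; have := xB i; rewrite /= mxE.
rewrite !lebn_boxn//; first by apply: eq_bigr => i _; rewrite lebesgue_measure_shift.
move=> i; rewrite -[X in measurable X]setTI.
exact: (measurable_funD (@measurable_id _ _ _) (@measurable_cst _ _ _ _ _ (a 0 i))).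
Qed.

Lemma lebn_opp n (E : set 'rV[R]_n) : measurable E ->
  pushforward (@lebn n) (fun x => - x) E = lebn E.
Proof.
move=> mE; apply: (@lebn_unique n (pushforward (@lebn n) (fun x => - x))) => //; first exact: measurable_opprV.
move=> mf B mB; rewrite -[LHS]/(lebn (_ @^-1` boxn B)).
rewrite (_ : _ @^-1` _ = boxn (fun i => -%R @^-1` B i)); last first.
  by apply/seteqP; split => x /= xB i; have := xB i; rewrite /= mxE.
rewrite !lebn_boxn//; first by apply: eq_bigr => i _; exact: lebesgue_measureN.
move=> i; rewrite -[X in measurable X]setTI.
exact: oppr_measurable.
Qed.

End lebesgue_Rn.

Section lebesgue_Rn_integral.
Context {R : realType}.
Local Notation lambda := (@lebn R _).

Let measurable_ball_boxn n (x : 'I_n -> R) (e : R) :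
  measurable [set y : 'rV[R]_n | forall i, `|y 0 i - x i| < e].
Proof.
apply: (@measurable_boxn _ _ (fun i => [set t | `|t - x i| < e])) => i.
rewrite (_ : [set t | _] = `]x i - e, x i + e[%classic)//.
by apply/seteqP; split => t /=; rewrite in_itv/= ltr_norml => /andP[? ?]; apply/andP; split; lra.
Qed.

Lemma open_measurable_rV n (U : set 'rV[R]_n) : open U -> measurable U.
Proof.
(* [U] is a countable union of rational boxes. *)
move=> oU.
pose bx (p : 'rV[rat]_n * nat) : set 'rV[R]_n :=
  [set y | forall i, `|y 0 i - ratr (p.1 0 i)| < p.2.+1%:R^-1].
have mbx p : measurable (bx p).
  exact: (@measurable_ball_boxn n (fun i => ratr (p.1 0 i))).
pose g p := [set x | bx p x /\ bx p `<=` U].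
have mg p : measurable (g p).
  have [pU|pU] := pselect (bx p `<=` U).
    by rewrite (_ : g p = bx p)//; apply/seteqP; split => x //= [].
  by rewrite (_ : g p = set0)//; apply/seteqP; split => x //= [].
rewrite (_ : U = \bigcup_p g p).
  by apply: countable_bigcupT_measurable => //; exact: countableP.
apply/seteqP; split => [x Ux|x [p _ [px pU]]]; last exact: pU.
have /nbhs_ballP[e /= e0 xeU] : nbhs x U by exact: open_nbhs_nbhs.
pose k := Num.truncn (2 / e).
have ke : k.+1%:R^-1 * 2 < e.
  rewrite mulrC ltr_pdivrMr// mulrC -ltr_pdivrMr//.
  exact: truncnS_gt.
have /choice[q qP] : forall i, exists q : rat, ratr q \in `]x 0 i, (x 0 i + k.+1%:R^-1)[.
  by move=> i; apply: rat_in_itvoo; rewrite ltrDl invr_gt0.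
have xq i : `|x 0 i - ratr (q i)| < k.+1%:R^-1.
  have := qP i; rewrite in_itv/= => /andP[q1 q2].
  by rewrite ltr0_norm ?subr_lt0// opprB ltrBlDl.
exists (\row_i q i, k) => //=; split; first by move=> i; rewrite /= mxE.
move=> y /= hy; apply: xeU; rewrite -ball_normE/=.
apply: le_lt_trans ke.
apply: norm_le_coord => [|i]; first by rewrite mulr_ge0// invr_ge0.
have := hy i; rewrite !mxE => hyi.
rewrite mulr2n mulrDr mulr1 -(subrKA (ratr (q i))) (le_trans (ler_normD _ _))//.
by rewrite lerD ?ltW// ?xq// distrC.
Qed.

Lemma continuous_measurable_rV n (f : 'rV[R]_n -> R) : continuous f ->
  measurable_fun [set: 'rV[R]_n] f.
Proof.
move=> cf; apply: (measurability _ (RGenOInfty.measurableE R)) => //.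
move=> _ [_ [a ->] <-]; rewrite setTI.
apply: open_measurable_rV.
by move/continuousP : cf; apply; exact: interval_open.
Qed.

(** The change of variables for pushforwards is used on nonnegative functions; the positive and
    negative parts of [f] are treated separately, which avoids any discussion of integrability. *)
Lemma integral_shift n (a : 'rV[R]_n) (f : 'rV[R]_n -> \bar R) :
  measurable_fun setT f ->
  (\int[lambda]_x f (x + a)%R = \int[lambda]_x f x)%E.
Proof.
move=> mf; wlog f0 : f mf / forall x, (0 <= f x)%E => [hw|].
  rewrite integralE [RHS]integralE; congr (_ - _)%E.
    transitivity (\int[lambda]_x (f^\+)%E (x + a)%R)%E; last first.
      by apply: hw => //; exact: measurable_funepos.
    by apply: eq_integral => x _; rewrite !funeposE.
  transitivity (\int[lambda]_x (f^\-)%E (x + a)%R)%E; last first.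
    by apply: hw => //; exact: measurable_funeneg.
  by apply: eq_integral => x _; rewrite !funenegE.
transitivity (\int[pushforward (@lebn R n) (fun x : 'rV[R]_n => (x + a)%R)]_x f x)%E.
  by rewrite (ge0_integral_pushforward (measurable_addr a)).
apply: (eq_measure_integral (@lebn R n)); first exact: measurable_addr.
by move=> mf' E mE _; exact: lebn_shift.
Qed.

Lemma integral_opp n (f : 'rV[R]_n -> \bar R) :
  measurable_fun setT f ->
  (\int[lambda]_x f (- x)%R = \int[lambda]_x f x)%E.
Proof.
move=> mf; wlog f0 : f mf / forall x, (0 <= f x)%E => [hw|].
  rewrite integralE [RHS]integralE; congr (_ - _)%E.
    transitivity (\int[lambda]_x (f^\+)%E (- x)%R)%E; last first.
      by apply: hw => //; exact: measurable_funepos.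
    by apply: eq_integral => x _; rewrite !funeposE.
  transitivity (\int[lambda]_x (f^\-)%E (- x)%R)%E; last first.
    by apply: hw => //; exact: measurable_funeneg.
  by apply: eq_integral => x _; rewrite !funenegE.
transitivity (\int[pushforward (@lebn R n) (fun x : 'rV[R]_n => (- x)%R)]_x f x)%E.
  by rewrite (ge0_integral_pushforward (@measurable_opprV R n)).
apply: (eq_measure_integral (@lebn R n)); first exact: measurable_opprV.
by move=> mf' E mE _; exact: lebn_opp.
Qed.

Lemma Rint_shift n (a : 'rV[R]_n) (D : set 'rV[R]_n) (f : 'rV[R]_n -> R) :
  measurable D -> measurable_fun setT f ->
  \int[lambda]_(x in [set x | D (x + a)]) f (x + a) = \int[lambda]_(x in D) f x.
Proof.
move=> mD mf; rewrite Rintegral_mkcond [RHS]Rintegral_mkcond.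
rewrite /Rintegral; congr fine; rewrite -[RHS](integral_shift a).
  apply: eq_integral => x _; rewrite /patch.
  by have [Dx|Dx] := pselect (D (x + a)); rewrite ?(mem_set Dx) ?(memNset Dx)//;
    rewrite ?(@mem_set _ [set x | D (x + a)] x Dx) ?(@memNset _ [set x | D (x + a)] x Dx).
by apply/measurable_EFinP/(measurable_restrictT _ mD); exact: measurable_funTS.
Qed.

Lemma cube_cons n (a b : R) t (x : 'rV[R]_n) :
  cube a b (cons_rV (t, x)) <-> (`[a, b[%classic t /\ cube a b x).
Proof.
split => [h|[ht hx] i].
  split => [|i]; first by have := h ord0; rewrite cons_rV0.
  by have := h (lift ord0 i); rewrite cons_rVS.
by have [j ->|->] := unliftP ord0 i; rewrite ?cons_rVS ?cons_rV0//; exact: hx.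
Qed.

Lemma lebnS n : @lebn R n.+1 =
  pushforward (lebesgue_measure \x^ lebesgue_rV n)%E (@cons_rV R n)
  :> (set 'rV[R]_n.+1 -> \bar R).
Proof. by []. Qed.

(** Peels off the first coordinate: [lebesgue_rV n.+1] is by definition the image of a product
    measure under [cons_rV]. This is the step of the inductions on the dimension. *)
Lemma bRint_cube_cons n (a b : R) (F : 'rV[R]_n.+1 -> R) :
  bdm (cube a b) F ->
  \int[lambda]_(x in cube a b) F x =
  \int[lebesgue_measure]_(t in `[a, b[) (\int[lambda]_(x in cube a b) F (cons_rV (t, x))).
Proof.
move=> bF; have [mF [C FC]] := bF.
have bFc : bdm (`[a, b[%classic `*` cube a b) (F \o @cons_rV R n).
  split; first exact: (measurableT_comp mF (@measurable_cons_rV R n)).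
  by exists C => -[t x] [ht hx]; apply: FC; apply/cube_cons.
have mcF : measurable (@cons_rV R n @^-1` cube a b).
  by rewrite -[X in measurable X]setTI; apply: measurable_cons_rV => //; exact: measurable_cube.
have bFcc : bdm (@cons_rV R n @^-1` cube a b) (F \o @cons_rV R n).
  split; first exact: (measurableT_comp mF (@measurable_cons_rV R n)).
  by exists C => -[t x] ?; exact: FC.
have abfin : (lebesgue_measure `[a, b[%classic < +oo)%E.
  by rewrite lebesgue_measure_itv/= lte_fin; case: ifP => // _; rewrite -EFinB ltry.
rewrite -(@bRint_prod R _ _ (measurableTypeR R) 'rV[R]_n lebesgue_measure (@lebn R n) _ _ (F \o @cons_rV R n))//.
- rewrite /Rintegral lebnS; congr fine.
  pose phi : measurableTypeR R * 'rV[R]_n -> 'rV[R]_n.+1 := @cons_rV R n.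
  have mphi : measurable_fun setT phi by exact: measurable_cons_rV.
  apply: etrans; first apply: (integral_pushforward mphi (mu := (lebesgue_measure \x^ lebesgue_rV n)%E)
    (D := cube a b) (f := EFin \o F)).
    + exact/measurable_EFinP.
    + by apply: (@bdm_int _ _ _ (lebesgue_measure \x^ lebesgue_rV n)%E _ _ _ (F \o @cons_rV R n));
        [exact: mcF|exact: (@lebn_cube_fin R n.+1)|exact: bFcc].
    + exact: measurable_cube.
  congr (integral _ _ _).
  by apply/seteqP; split => -[t x] /cube_cons.
- exact: measurable_cube.
- exact: lebn_cube_fin.
Qed.

End lebesgue_Rn_integral.

Lemma cvg_sumr {R : numFieldType} {T : Type} (F : set_system T) {FF : Filter F}
    (I : Type) (r : seq I) (P : pred I) (f : I -> T -> R) (l : I -> R) :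
  (forall i, f i t @[t --> F] --> l i) ->
  (\sum_(i <- r | P i) f i t) @[t --> F] --> \sum_(i <- r | P i) l i.
Proof.
move=> fl; elim: r => [|i r IH].
  rewrite big_nil; under eq_fun do rewrite big_nil; exact: cvg_cst.
rewrite big_cons; under eq_fun do rewrite big_cons.
by case: (P i) => //; apply: cvgD.
Qed.

(** * Smooth functions *)

Section differential_rV.
Context {R : realType} {d : nat}.
Implicit Types (f : 'rV[R]_d -> R) (x u g : 'rV[R]_d) (i j : 'I_d).

Definition dotv (g u : 'rV[R]_d) : R := \sum_i u 0 i * g 0 i.

Lemma dotv_is_linear g : linear_for *%R (dotv g).
Proof.
move=> k u v; rewrite /dotv mulr_sumr -big_split; apply: eq_bigr => i _ /=.
by rewrite !mxE mulrDl mulrA.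
Qed.

HB.instance Definition _ g :=
  GRing.isLinear.Build R 'rV[R]_d R *%R (dotv g) (dotv_is_linear g).

Lemma dotv_continuous (g : 'rV[R]_d) : continuous (dotv g).
Proof.
move=> x; apply: (@cvg_sumr _ _ (nbhs x)) => i.
exact: (@cvgM _ _ (nbhs x) _ _ _ _ _ (@coord_continuous R 1 d 0 i x) (cvg_cst _)).
Qed.

(** A quadratic remainder is [o(u)], and uniqueness of the differential identifies [g]. The
    criterion replaces differentiation under the integral sign: integrating a uniform Taylor
    estimate gives the required bound directly. *)
Lemma diff_quadratic_remainder f x (g : 'rV[R]_d) C : (forall u, `|u| < 1 ->
    `|f (x + u) - f x - dotv g u| <= C * `|u| ^+ 2) ->
  differentiable f x /\ forall u, 'd f x u = dotv g u.
Proof.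
move=> H.
have E : f \o shift x = (cst (f x) : 'rV[R]_d -> (R : normedModType R)) + dotv g
    +o_ (0 : 'rV[R]_d) id.
  apply/eqaddoP => e e0; near=> u.
  rewrite /= -[X in `|X|]/(f (u + x) - (f x + dotv g u)).
  rewrite opprD addrA (addrC u x).
  apply: le_trans (H u _) _; first by near: u; exact: (@cvgr0_norm_lt _ _ _ _ _ id).
  rewrite expr2 mulrA ler_wpM2r//.
  have [u0|u0] := eqVneq `|u| 0; first by rewrite u0 mulr0 ltW.
  apply: (@le_trans _ _ (`|C| * `|u|)); first by rewrite ler_wpM2r// ler_norm.
  apply: (@le_trans _ _ ((`|C| + 1) * `|u|)); first by rewrite ler_wpM2r// lerDl.
  rewrite -ler_pdivlMl ?ltr_wpDl// mulrC; apply/ltW.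
  near: u; apply: (@cvgr0_norm_lt _ _ _ _ _ id) => //.
  by rewrite divr_gt0// ltr_wpDl.
have dE := diff_unique (@dotv_continuous g) E.
split; last by move=> u; rewrite dE.
by apply/diff_locallyP; rewrite dE; split => //; exact: dotv_continuous.
Unshelve. all: by end_near. Qed.

Lemma dotvE u (h : 'I_d -> R) : dotv (\row_i h i) u = \sum_i u 0 i * h i.
Proof. by apply: eq_bigr => i _; rewrite mxE. Qed.

Lemma diff_partial f x u : differentiable f x ->
  'd f x u = \sum_i u 0 i * partial i f x.
Proof.
move=> df; rewrite [in LHS](row_sum_delta u) linear_sum; apply: eq_bigr => i _.
by rewrite linearZ /partial deriveE.
Qed.

Lemma is_derive_line f x u (t : R) : (forall y, differentiable f y) ->
  is_derive t 1 (fun s : R => f (x + s *: u)) (\sum_i u 0 i * partial i f (x + t *: u)).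
Proof.
move=> df; have dl : is_diff t (fun s : R => x + s *: u) (fun s : R => s *: u).
  have d1 : is_diff t (fun s : R => s *: u) (fun s : R => s *: u).
    exact: is_diff_scalel.
  apply: (is_diff_eq (is_diffD (is_diff_cst x t) d1)).
  by rewrite add0r.
have dl1 : differentiable (fun s : R => x + s *: u) t by exact: ex_diff.
have dc : differentiable (f \o (fun s : R => x + s *: u)) t.
  by apply: differentiable_comp; [exact: dl1|exact: df].
split; first exact/derivable1_diffP.
rewrite deriveE// diff_comp; [|exact: dl1|exact: df].
by rewrite /= diff_val scale1r diff_partial.
Qed.

Lemma MVT_line f x u : (forall y, differentiable f y) ->
  exists2 c, 0 <= c <= 1 & f (x + u) - f x = \sum_i u 0 i * partial i f (x + c *: u).
Proof.
move=> df.
have dl t := is_derive_line x u t df.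
have cl : {within `[0, 1], continuous (fun s : R => f (x + s *: u))}.
  by apply: derivable_within_continuous => t _; have [] := dl t.
have [c c01 E] := @MVT R (fun s : R => f (x + s *: u))
  (fun t => \sum_i u 0 i * partial i f (x + t *: u)) 0 1 ltr01 (fun t _ => dl t) cl.
exists c; last by move: E; rewrite scale1r scale0r addr0 subr0 mulr1.
by move: c01; rewrite in_itv/= => /andP[/ltW -> /ltW ->].
Qed.

End differential_rV.

Section smooth_classes.
Context {R : realType} {d : nat}.
Implicit Types (f g : 'rV[R]_d -> R) (x a : 'rV[R]_d) (i j : 'I_d).

(** Smoothness graded by the order of differentiation. Unlike the list form of [smooth], it supports
    induction on [n]: a partial derivative of a product is a sum of products of functions whose
    class is one order lower. *)
Fixpoint CN n f : Prop :=
  if n is m.+1 then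
    (forall x, differentiable f x) /\ forall i, CN m (partial i f)
  else True.

Lemma iter_partial_rcons s i f :
  iter_partial (rcons s i) f = iter_partial s (partial i f).
Proof. by rewrite /iter_partial foldr_rcons. Qed.

Lemma smooth_partial f i : smooth f -> smooth (partial i f).
Proof. by move=> sf s x; rewrite -iter_partial_rcons; exact: sf. Qed.

Lemma smooth_differentiable f x : smooth f -> differentiable f x.
Proof. by move=> sf; exact: (sf [::]). Qed.

Lemma smoothP f : smooth f <-> forall n, CN n f.
Proof.
split=> [sf n|cf s].
  elim: n f sf => //= n IH f sf; split => [x|i]; first exact: smooth_differentiable.
  by apply: IH; exact: smooth_partial.
elim/last_ind: s f cf => [|s i IH] f cf x.
  by have [+ _] := cf 1%N; exact.
rewrite iter_partial_rcons; apply: IH => n.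
by have [_] := cf n.+1; exact.
Qed.

Lemma CN_S n f : CN n.+1 f -> CN n f.
Proof.
elim: n f => // n IH f [df cf]; split => // i.
by apply: IH; exact: cf.
Qed.

Lemma partialD i f g x : differentiable f x -> differentiable g x ->
  partial i (fun x => f x + g x) x = partial i f x + partial i g x.
Proof. by move=> df dg; apply: deriveD; exact: diff_derivable. Qed.

Lemma partialM i f g x : differentiable f x -> differentiable g x ->
  partial i (fun x => f x * g x) x = f x * partial i g x + g x * partial i f x.
Proof. by move=> df dg; apply: deriveM; exact: diff_derivable. Qed.

Lemma partialZ i k f x : differentiable f x ->
  partial i (fun x => k * f x) x = k * partial i f x.
Proof. by move=> df; apply: deriveZ; exact: diff_derivable. Qed.

Lemma partial_cst i k x : partial i (fun=> k) x = 0.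
Proof. exact: derive_cst. Qed.

Lemma CN_cst n k : CN n (fun=> k).
Proof.
elim: n k => // n IH k; split => [x|i]; first exact: differentiable_cst.
rewrite (_ : partial i _ = fun=> 0); first exact: IH.
by apply/funext => x; exact: partial_cst.
Qed.

Lemma CN_D n f g : CN n f -> CN n g -> CN n (fun x => f x + g x).
Proof.
elim: n f g => // n IH f g [df cf] [dg cg]; split => [x|i].
  exact: differentiableD.
rewrite (_ : partial i _ = fun x => partial i f x + partial i g x).
  by apply: IH; [exact: cf|exact: cg].
by apply/funext => x; rewrite partialD.
Qed.

Lemma CN_M n f g : CN n f -> CN n g -> CN n (fun x => f x * g x).
Proof.
elim: n f g => // n IH f g cf cg; have [df cf'] := cf; have [dg cg'] := cg.
split => [x|i]; first exact: differentiableM.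
rewrite (_ : partial i _ = fun x => f x * partial i g x + g x * partial i f x).
  by apply: CN_D; apply: IH; [exact: CN_S cf|exact: cg'|exact: CN_S cg|exact: cf'].
by apply/funext => x; rewrite partialM.
Qed.

Lemma is_diff_affine (c : R) a x :
  is_diff x (fun y : 'rV[R]_d => c *: y + a) (fun u => c *: u).
Proof.
apply: (is_diff_eq (is_diffD (is_diff_scaler c x) (is_diff_cst a x))).
by rewrite addr0.
Qed.

Lemma differentiable_affine f (c : R) a x : differentiable f (c *: x + a) ->
  differentiable (fun y => f (c *: y + a)) x.
Proof.
move=> df; have dl := is_diff_affine c a x.
have dl1 : differentiable (fun y : 'rV[R]_d => c *: y + a) x by exact: ex_diff.
exact: (@differentiable_comp _ _ _ _ _ f x dl1 df).
Qed.

Lemma partial_affine i f (c : R) a x : differentiable f (c *: x + a) ->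
  partial i (fun y => f (c *: y + a)) x = c * partial i f (c *: x + a).
Proof.
move=> df; have dl := is_diff_affine c a x.
have dl1 : differentiable (fun y : 'rV[R]_d => c *: y + a) x by exact: ex_diff.
rewrite /partial deriveE; last exact: differentiable_affine.
have -> : 'd (fun y => f (c *: y + a)) x = 'd f (c *: x + a) \o 'd (fun y => c *: y + a) x :> ('rV[R]_d -> R).
  exact: (@diff_comp _ _ _ _ _ f x dl1 df).
by rewrite /= diff_val linearZ/= deriveE.
Qed.

Lemma CN_affine n f (c : R) a : CN n f -> CN n (fun y => f (c *: y + a)).
Proof.
elim: n f => // n IH f [df cf]; split => [x|i].
  exact: differentiable_affine.
rewrite (_ : partial i _ = fun x => c * partial i f (c *: x + a)).
  by apply: CN_M; [exact: CN_cst|apply: IH; exact: cf].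
by apply/funext => x; rewrite partial_affine.
Qed.

Lemma near_eq_differentiable f g x : (\forall y \near x, f y = g y) ->
  differentiable g x -> differentiable f x.
Proof.
move=> fg dg.
have fgx : f x = g x by exact: nbhs_singleton fg.
have E : f \o shift x = (cst (f x) : 'rV[R]_d -> (R : normedModType R)) + 'd g x
    +o_ (0 : 'rV[R]_d) id.
  apply/eqaddoP => e e0.
  have /eqaddoP/(_ e e0) := diff_locally dg.
  have : \forall u \near (0 : 'rV[R]_d), f (u + x) = g (u + x).
    by move: fg; rewrite (near_shift 0 x); apply: filterS => u; rewrite /= subr0.
  apply: filterS2 => u fgu; rewrite fgx.
  by rewrite /= -[X in `|X|]/(g (u + x) - (g x + 'd g x u)) -fgu.
have dE := diff_unique (diff_continuous dg) E.
by apply/diff_locallyP; rewrite dE; split => //; exact: diff_continuous.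
Qed.

Lemma near_eq_partial f g x i : (\forall y \near x, f y = g y) ->
  \forall y \near x, partial i f y = partial i g y.
Proof.
move=> /nbhs_interior; apply: filterS => y yfg.
exact: near_eq_derive.
Qed.

(** Smoothness is local. This serves the periodization, which coincides near each point with a
    translate of a fixed smooth function. *)
Lemma near_CN n f : (forall x, exists2 g, CN n g & (\forall y \near x, f y = g y)) -> CN n f.
Proof.
elim: n f => // n IH f H; split => [x|i].
  by have [g [dg _] fg] := H x; exact: near_eq_differentiable fg (dg x).
apply: IH => x; have [g [_ cg] fg] := H x.
by exists (partial i g); [exact: cg|exact: near_eq_partial fg].
Qed.

Lemma smooth_cst (k : R) : smooth (fun _ : 'rV[R]_d => k).
Proof. by apply/smoothP => n; exact: CN_cst. Qed.

Lemma smoothD f g : smooth f -> smooth g -> smooth (fun x => f x + g x).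
Proof. by move=> /smoothP cf /smoothP cg; apply/smoothP => n; exact: CN_D. Qed.

Lemma smoothM f g : smooth f -> smooth g -> smooth (fun x => f x * g x).
Proof. by move=> /smoothP cf /smoothP cg; apply/smoothP => n; exact: CN_M. Qed.

Lemma smoothZ k f : smooth f -> smooth (fun x => k * f x).
Proof. exact/smoothM/smooth_cst. Qed.

Lemma smooth_affine f (c : R) a : smooth f -> smooth (fun y => f (c *: y + a)).
Proof. by move=> /smoothP cf; apply/smoothP => n; exact: CN_affine. Qed.

Lemma near_smooth f :
  (forall x, exists2 g, smooth g & (\forall y \near x, f y = g y)) -> smooth f.
Proof.
move=> H; apply/smoothP => n; apply: near_CN => x.
by have [g /smoothP cg fg] := H x; exists g.
Qed.

Lemma smooth_continuous f : smooth f -> continuous f.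
Proof. by move=> sf x; apply: differentiable_continuous; exact: smooth_differentiable. Qed.

Lemma smooth_measurable f : smooth f -> measurable_fun setT f.
Proof. by move=> sf; apply: continuous_measurable_rV; exact: smooth_continuous. Qed.

End smooth_classes.

Section bounded_support.
Context {R : realType} {d : nat}.
Implicit Types (f : 'rV[R]_d -> R) (x u : 'rV[R]_d) (i j : 'I_d).

Definition bsupp f := exists M : R, forall x, M <= `|x| -> f x = 0.

Lemma bsupp_cube f : bsupp f -> exists2 M, 0 < M & forall x, ~ cube (- M) M x -> f x = 0.
Proof.
move=> [M fM]; exists (`|M| + 1); first by rewrite ltr_wpDl.
move=> x nx; apply: fM; rewrite leNgt; apply/negP => xM; apply: nx => i /=.
rewrite in_itv/=; have := le_lt_trans (coord_le_norm x i) xM.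
rewrite ltr_norml => /andP[h1 h2]; have := ler_norm M => h3.
by apply/andP; split; lra.
Qed.

Lemma bsupp_partial f i : bsupp f -> bsupp (partial i f).
Proof.
move=> [M fM]; exists (M + 1) => x xM.
rewrite -[RHS](partial_cst i (0 : R) x).
apply: near_eq_derive.
near=> y; apply: fM.
suff : `|x - y| < 1.
  have := ler_normD (x - y) y; rewrite subrK => h1 h2.
  by rewrite -(lerD2r 1) (le_trans xM)// (le_trans h1)// addrC lerD2l ltW.
by near: y; apply: cvgr_dist_lt => //; exact: cvg_id.
Unshelve. all: by end_near. Qed.

Lemma bsuppMl f (g : 'rV[R]_d -> R) : bsupp f -> bsupp (fun x => f x * g x).
Proof. by move=> [M fM]; exists M => x /fM ->; rewrite mul0r. Qed.

Lemma compact_norm_le (M : R) : compact [set x : 'rV[R]_d | `|x| <= M].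
Proof.
apply: bounded_closed_compact.
  exists M; split; first exact: num_real.
  by move=> C MC x /= xM; rewrite (le_trans xM)// ltW.
rewrite (_ : [set x : 'rV[R]_d | _] = (@Num.norm R 'rV[R]_d) @^-1` [set t | t <= M])//.
apply: closed_comp; last exact: closed_le.
by move=> x _; exact: norm_continuous.
Qed.

Lemma bsupp_bounded f : continuous f -> bsupp f ->
  exists2 C, 0 <= C & forall x, `|f x| <= C.
Proof.
move=> cf [M fM].
have cA := @compact_norm_le (`|M|).
have A0 : [set x : 'rV[R]_d | `|x| <= `|M|] !=set0 by exists 0 => /=; rewrite normr0.
have cf' : {within [set x : 'rV[R]_d | `|x| <= `|M|], continuous (fun x => `|f x|)}.
  apply: continuous_subspaceT => x; apply: continuous_comp; first exact: cf.
  exact: norm_continuous.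
have [c cAc cmax] := EVT_max_rV A0 cA cf'.
exists `|f c| => // x; have [xM|Mx] := leP `|x| `|M|.
  by apply: cmax; rewrite inE.
by rewrite fM ?normr0// (le_trans (ler_norm M))// ltW.
Qed.

(** Compact support amounts to bounded support by Heine-Borel; the bounded form is the one that
    passes easily to derivatives, products and reflections. *)
Lemma test_functionP f : test_function f <-> smooth f /\ bsupp f.
Proof.
split=> [[sf cf]|[sf [M fM]]]; split => //.
  have [M [Mr fM]] := compact_bounded cf.
  exists (`|M| + 2) => x xM; apply/eqP; apply/negPn/negP => fx0.
  have /fM : M < `|M| + 1 by have := ler_norm M; lra.
  have cx : closure [set x | f x != 0] x by apply: subset_closure.
  by move=> /(_ x cx) /=; lra.
apply: (@subclosed_compact _ _ [set x | `|x| <= `|M|]).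
- exact: closed_closure.
- exact: compact_norm_le.
- have clB : closed [set x : 'rV[R]_d | `|x| <= `|M|].
    by apply: compact_closed; [exact: norm_hausdorff|exact: compact_norm_le].
  rewrite [X in _ `<=` X]((closure_id _).1 clB); apply: closure_subset.
  move=> x /= fx0; rewrite leNgt; apply/negP => Mx.
  by move/eqP: fx0; apply; apply: fM; rewrite (le_trans (ler_norm M))// ltW.
Qed.

Lemma test_function_partial f i : test_function f -> test_function (partial i f).
Proof.
move=> /test_functionP[sf bf]; apply/test_functionP; split.
  exact: smooth_partial.
exact: bsupp_partial.
Qed.

Lemma test_function_bounded f : test_function f ->
  exists2 C, 0 <= C & forall x, `|f x| <= C.
Proof.
move=> /test_functionP[sf bf]; apply: bsupp_bounded => //.
exact: smooth_continuous.
Qed.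

Lemma bounded_partial_lipschitz f C : (forall x, differentiable f x) ->
  (forall i x, `|partial i f x| <= C) ->
  forall x u, `|f (x + u) - f x| <= d%:R * C * `|u|.
Proof.
move=> df fC x u; have [c _ ->] := MVT_line x u df.
rewrite (le_trans (ler_norm_sum _ _ _))//.
rewrite -mulrA mulr_natl -[X in _ *+ X](card_ord d) -sumr_const.
apply: ler_sum => i _; rewrite normrM mulrC ler_pM//.
exact: coord_le_norm.
Qed.

(** Second derivatives of a test function are globally bounded, so the mean value theorem followed
    by the Lipschitz bound on the first derivatives gives a constant independent of [x]. Uniformity
    in [x] is what allows the estimate to be integrated against a bounded function. *)
Lemma test_function_Taylor f : test_function f -> exists2 C, 0 <= C &
  forall x u, `|f (x + u) - f x - \sum_i u 0 i * partial i f x| <= C * `|u| ^+ 2.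
Proof.
move=> tf.
have [K K0 KP] : exists2 K, 0 <= K & forall i j x, `|partial j (partial i f) x| <= K.
  have /choice[K KP] : forall ij : 'I_d * 'I_d, exists K, 0 <= K /\
      forall x, `|partial ij.2 (partial ij.1 f) x| <= K.
    move=> ij; have [K K0 KP] := test_function_bounded
      (test_function_partial ij.2 (test_function_partial ij.1 tf)).
    by exists K.
  exists (\sum_ij K ij) => [|i j x]; first by apply: sumr_ge0 => ij _; case: (KP ij).
  rewrite (bigD1 (i, j))//= (le_trans ((KP (i, j)).2 x))// lerDl.
  by apply: sumr_ge0 => ij _; case: (KP ij).
have df (g : 'rV[R]_d -> R) y : test_function g -> differentiable g y.
  by move=> /test_functionP[sg _]; exact: smooth_differentiable.
exists (d%:R * (d%:R * K)) => [|x u]; first by rewrite !mulr_ge0.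
have [c /andP[c0 c1] ->] := MVT_line x u (fun y => df f y tf).
rewrite -sumrB (le_trans (ler_norm_sum _ _ _))//.
rewrite -mulrA mulr_natl -[X in _ *+ X](card_ord d) -sumr_const.
apply: ler_sum => i _; rewrite -mulrBr normrM expr2 mulrCA.
apply: ler_pM => //; first exact: coord_le_norm.
have dfi y : differentiable (partial i f) y by apply/df/test_function_partial.
rewrite (le_trans (bounded_partial_lipschitz dfi (KP i) x (c *: u)))//.
by rewrite ler_wpM2l ?mulr_ge0// normrZ ger0_norm// ler_piMl.
Qed.

(* Both mixed derivatives are limits of the same second difference quotient. *)
Lemma partial_comm f i j x : smooth f ->
  partial i (partial j f) x = partial j (partial i f) x.
Proof.
move=> sf.
have dfp s y : differentiable (iter_partial s f) y by exact: sf.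
pose e k : 'rV[R]_d := delta_mx 0 k.
have sume k (F : 'I_d -> R) (s : R) : \sum_l (s *: e k) 0 l * F l = s * F k.
  rewrite (bigD1 k)//= big1 => [|l lk]; first by rewrite !mxE !eqxx mulr1 addr0.
  by rewrite !mxE eqxx (negPf lk) mulr0 mul0r.
have ne k : `|e k| <= 1.
  by apply: norm_le_coord => // l; rewrite !mxE eqxx/=; case: (_ == _); rewrite ?normr1 ?normr0.
have quot k l (s : R) : exists c c', [/\ 0 <= c <= 1, 0 <= c' <= 1 &
   f (x + s *: e k + s *: e l) - f (x + s *: e k) - f (x + s *: e l) + f x =
   s * (s * partial l (partial k f) (x + c *: (s *: e k) + c' *: (s *: e l)))].
  pose F y := f (1 *: y + s *: e l) + (-1) * f y.
  have dF y : differentiable F y.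
    apply: differentiableD; first by apply: differentiable_affine; exact: (dfp [::]).
    by apply: (differentiableM (differentiable_cst _ _)); exact: (dfp [::]).
  have [c c01 E] := MVT_line x (s *: e k) dF.
  have [c' c'01 E'] := MVT_line (x + c *: (s *: e k)) (s *: e l) (dfp [:: k]).
  exists c, c'; split => //.
  transitivity (F (x + s *: e k) - F x); first by rewrite /F !scale1r; ring.
  rewrite E sume; congr (_ * _).
  rewrite /F partialD; last 2 first.
  - by apply: differentiable_affine; exact: (dfp [::]).
  - by apply: (differentiableM (differentiable_cst _ _)); exact: (dfp [::]).
  rewrite partial_affine; last exact: (dfp [::]).
  rewrite partialZ; last exact: (dfp [::]).
  by rewrite !scale1r mul1r mulN1r E' sume.
apply/eqP; rewrite -subr_eq0; apply/negPn/negP => ab.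
have e0 : 0 < `|partial i (partial j f) x - partial j (partial i f) x| / 2 by rewrite divr_gt0// normr_gt0.
have ca : {for x, continuous (partial i (partial j f))}.
  by apply: differentiable_continuous; exact: (dfp [:: i; j]).
have cb : {for x, continuous (partial j (partial i f))}.
  by apply: differentiable_continuous; exact: (dfp [:: j; i]).
have na := @cvgr_dist_lt _ _ _ _ _ _ _ ca _ e0.
have nb := @cvgr_dist_lt _ _ _ _ _ _ _ cb _ e0.
have [r /= r0 rab] := (@nbhs_ballP _ _ _ _).1 (filterI (na (nbhs_filter x)) (nb (nbhs_filter x))).
have [s s0 sr] : exists2 s : R, 0 < s & s + s < r.
  by exists (r / 4); clear -r0; lra.
have inball k l c c' : 0 <= c <= 1 -> 0 <= c' <= 1 ->
    ball x r (x + c *: (s *: e k) + c' *: (s *: e l)).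
  move=> /andP[c0 c1] /andP[c'0 c'1]; rewrite -ball_normE/= -addrA opprD addrA subrr sub0r normrN.
  rewrite (le_lt_trans (ler_normD _ _))// !normrZ !ger0_norm ?(ltW s0)//.
  have h1 : c * (s * `|e k|) <= s.
    by rewrite mulrCA -[leRHS]mulr1 ler_wpM2l ?(ltW s0)// mulr_ile1.
  have h2 : c' * (s * `|e l|) <= s.
    by rewrite mulrCA -[leRHS]mulr1 ler_wpM2l ?(ltW s0)// mulr_ile1.
  exact: (le_lt_trans (lerD h1 h2)).
have [c1 [c2 [c1P c2P E1]]] := quot j i s.
have [c3 [c4 [c3P c4P E2]]] := quot i j s.
have [q1 _] := rab _ (inball j i _ _ c1P c2P).
have [_ q2] := rab _ (inball i j _ _ c3P c4P).
have : s * (s * partial i (partial j f) (x + c1 *: (s *: e j) + c2 *: (s *: e i))) =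
       s * (s * partial j (partial i f) (x + c3 *: (s *: e i) + c4 *: (s *: e j))).
  apply: etrans (etrans _ E2); first exact: esym E1.
  by rewrite (addrAC x) (addrAC _ (- f (x + s *: e j))).
move=> /(mulfI (lt0r_neq0 s0))/(mulfI (lt0r_neq0 s0)) EE.
move: q1 q2; rewrite EE.
move: (partial j (partial i f) (x + _ + _)) (partial i (partial j f) x)
  (partial j (partial i f) x) => c a b q1 q2.
have := ler_normB (a - c) (b - c).
rewrite opprB addrA subrK => h; have := le_lt_trans h (ltrD q1 q2).
by rewrite -splitr ltxx.
Unshelve. all: by end_near. Qed.

End bounded_support.

(** * Correlations with test functions are smooth *)

Section convolution.
Context {R : realType} {d : nat}.
Local Notation lambda := (@lebn R d).
Implicit Types (phi h : 'rV[R]_d -> R) (x u : 'rV[R]_d) (i j : 'I_d).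

Lemma Rint_support (E : set 'rV[R]_d) (f : 'rV[R]_d -> R) :
  (forall x, ~ E x -> f x = 0) -> \int[lambda]_x f x = \int[lambda]_(x in E) f x.
Proof.
move=> fE; rewrite [RHS]Rintegral_mkcond; apply: eq_Rintegral => x _.
by rewrite /patch; case: ifPn => //; rewrite notin_setE => /fE ->.
Qed.

(* Correlation rather than convolution: this is what
   [\int phi y * f (tau (- y) eta)] becomes along an orbit. *)
Definition corr phi h x := \int[lambda]_y (phi (y - x) * h y).

(** One cube serves all increments [u] of norm at most one, so the increments of a correlation are
    integrals over a common set of finite measure. *)
Lemma bsupp_shift_cube phi x : bsupp phi -> exists2 M, 0 < M &
  forall u y, `|u| <= 1 -> ~ cube (- M) M y -> phi (y - (x + u)) = 0.
Proof.
move=> [M phiM]; exists (`|M| + `|x| + 2); first by rewrite ltr_wpDl// addr_ge0.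
move=> u y u1 ny; apply: phiM; rewrite leNgt; apply/negP => yM; apply: ny => i /=.
rewrite in_itv/=.
have : `|y 0 i| < `|M| + `|x| + 2.
  rewrite (le_lt_trans (coord_le_norm y i))//.
  rewrite -[y](subrK (x + u)) (le_lt_trans (ler_normD _ _))//.
  have := ler_normD x u; have := ler_norm M; lra.
by rewrite ltr_norml => /andP[/ltW -> ->].
Qed.

(** The Taylor estimate for [phi] at [y - x] with increment [- u] is integrated against [h] over a
    fixed cube, which leaves a quadratic remainder. The derivative falls on the kernel, with a sign
    because [x] enters through [y - x]; in this way rough realizations become smooth. *)
Lemma corr_diff phi h x : test_function phi -> bdm setT h ->
  differentiable (corr phi h) x /\
  forall i, partial i (corr phi h) x = - corr (partial i phi) h x.
Proof.
move=> tphi bh.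
have [mh [Ch hC]] := bh.
have [sphi bphi] := (test_functionP phi).1 tphi.
have [C C0 TC] := test_function_Taylor tphi.
have [M M0 MP] := bsupp_shift_cube x bphi.
have /choice[Mi MiP] : forall i, exists Mi, 0 < Mi /\
  forall u y, `|u| <= 1 -> ~ cube (- Mi) Mi y -> partial i phi (y - (x + u)) = 0.
  by move=> i; have [Mi ? ?] := bsupp_shift_cube x (bsupp_partial i bphi); exists Mi.
pose K := M + \sum_i Mi i.
have cubeS (a b : R) : a <= b -> @cube R d (- a) a `<=` cube (- b) b.
  move=> ab y ya i; have := ya i; rewrite /= !in_itv/= => /andP[h1 h2].
  by apply/andP; split; lra.
have MK : M <= K by rewrite lerDl sumr_ge0// => i _; have [/ltW] := MiP i.
have MiK i : Mi i <= K.
  rewrite /K (bigD1 i)//= addrCA lerDl addr_ge0 ?(ltW M0)// sumr_ge0// => j _.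
  by have [/ltW] := MiP j.
pose Q : set 'rV[R]_d := cube (- K) K.
have mQ : measurable Q by exact: measurable_cube.
have Qfin : (lambda Q < +oo)%E by exact: lebn_cube_fin.
have supp u y : `|u| <= 1 -> ~ Q y -> phi (y - (x + u)) = 0.
  by move=> u1 nQ; apply: MP => // My; apply: nQ; exact: cubeS My.
have suppi i y : ~ Q y -> partial i phi (y - x) = 0.
  move=> nQ; rewrite -[x]addr0; apply: (MiP i).2; first by rewrite normr0.
  by move=> My; apply: nQ; exact: cubeS My.
have bsh (f : 'rV[R]_d -> R) z : continuous f -> bsupp f -> bdm Q (fun y => f (y - z) * h y).
  move=> cf bf; apply: bdmM; last exact: bdm_sub bh.
  split; last by have [c _ cP] := bsupp_bounded cf bf; exists c => y _.
  by apply: measurableT_comp; [exact: continuous_measurable_rV|exact: measurable_addr].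
have bphiz z : bdm Q (fun y => phi (y - z) * h y).
  by apply: bsh => //; exact: smooth_continuous.
have bphii i : bdm Q (fun y => partial i phi (y - x) * h y).
  by apply: bsh; [exact/smooth_continuous/smooth_partial|exact: bsupp_partial].
have corrE u : `|u| <= 1 -> corr phi h (x + u) = \int[lambda]_(y in Q) (phi (y - (x + u)) * h y).
  by move=> u1; apply: Rint_support => y nQ; rewrite supp// mul0r.
have corriE i : corr (partial i phi) h x = \int[lambda]_(y in Q) (partial i phi (y - x) * h y).
  by apply: Rint_support => y nQ; rewrite suppi// mul0r.
pose g : 'rV[R]_d := \row_i (- corr (partial i phi) h x).
have [//|dc dE] := @diff_quadratic_remainder R d (corr phi h) x g (C * Ch * fine (lambda Q)).
  move=> u u1; have corr0 : corr phi h x = \int[lambda]_(y in Q) (phi (y - x) * h y).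
    by have := corrE 0; rewrite addr0; apply; rewrite normr0.
  rewrite corrE ?(ltW u1)// corr0 dotvE.
  rewrite (eq_bigr (fun i => - \int[lambda]_(y in Q) (u 0 i * (partial i phi (y - x) * h y)))); last first.
    by move=> i _; rewrite bRintZ// -corriE mulrN.
  rewrite sumrN opprK -bRint_sum//; last by move=> i; exact: bdmZ.
  rewrite -bRintB// -bRintD//; [|exact: bdmB|by apply: bdm_sum => i; exact: bdmZ].
  rewrite (le_trans (bRint_bound mQ Qfin (C := C * `|u| ^+ 2 * Ch) _ _))//.
  - by apply: bdmD; [exact: bdmB|by apply: bdm_sum => i; exact: bdmZ].
  - move=> y _.
    under eq_bigr do rewrite mulrA.
    rewrite -mulr_suml -mulrBl -mulrDl normrM ler_pM ?hC//.
    have := TC (y - x) (- u); rewrite normrN opprD addrA; congr (`|_| <= _); congr (_ + _).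
    by rewrite -sumrN; apply: eq_bigr => i _; rewrite mxE mulNr opprK.
  - by rewrite le_eqVlt; apply/orP; left; apply/eqP; ring.
split => // i.
rewrite /partial deriveE// dE /dotv (bigD1 i)//= big1 => [|j ji].
  by rewrite !mxE !eqxx mul1r addr0.
by rewrite !mxE eqxx (negPf ji) mul0r.
Qed.

Lemma corr_smooth phi h : test_function phi -> bdm setT h -> smooth (corr phi h).
Proof.
move=> tphi bh; apply/smoothP => n.
elim: n phi tphi => // n IH phi tphi; split => [x|i].
  by have [] := corr_diff x tphi bh.
rewrite (_ : partial i _ = fun x => (-1) * corr (partial i phi) h x).
  by apply: CN_M; [exact: CN_cst|apply: IH; exact: test_function_partial].
by apply/funext => x; have [_ ->] := corr_diff x tphi bh; rewrite mulN1r.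
Qed.

Lemma partial_corr phi h i x : test_function phi -> bdm setT h ->
  partial i (corr phi h) x = - corr (partial i phi) h x.
Proof. by move=> tphi bh; have [_ ->] := corr_diff x tphi bh. Qed.

End convolution.

(** * Mollifiers and cut-offs *)

Section smooth_line.
Context {R : realType}.
Implicit Types (b c : R -> R) (t : R).

Fixpoint C1N n b : Prop :=
  if n is m.+1 then (forall t, derivable b t 1) /\ C1N m (derive1 b) else True.

Lemma C1N_intro n b b' : (forall t, is_derive t 1 b (b' t)) -> C1N n b' ->
  C1N n.+1 b.
Proof.
move=> db cb; split => [t|]; first by have [] := db t.
rewrite (_ : derive1 b = b')//; apply/funext => t.
by rewrite derive1E; have [_ ->] := db t.
Qed.

Lemma C1N_is_derive n b t : C1N n.+1 b -> is_derive t 1 b (derive1 b t).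
Proof. by move=> [db _]; rewrite derive1E; exact: derivableP. Qed.

Lemma C1N_S n b : C1N n.+1 b -> C1N n b.
Proof. by elim: n b => // n IH b [db cb]; split => //; exact: IH. Qed.

Lemma C1N_cst n k : C1N n (fun=> k).
Proof.
elim: n k => // n IH k; apply: C1N_intro (IH 0) => t; exact: is_derive_cst.
Qed.

Lemma C1N_D n b c : C1N n b -> C1N n c -> C1N n (fun t => b t + c t).
Proof.
elim: n b c => // n IH b c cb cc.
apply: (@C1N_intro _ _ (fun t => derive1 b t + derive1 c t)).
  by move=> t; exact: (is_deriveD (C1N_is_derive t cb) (C1N_is_derive t cc)).
by apply: IH; [have [] := cb|have [] := cc].
Qed.

Lemma C1N_M n b c : C1N n b -> C1N n c -> C1N n (fun t => b t * c t).
Proof.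
elim: n b c => // n IH b c cb cc.
apply: (@C1N_intro _ _ (fun t => b t * derive1 c t + c t * derive1 b t)).
  by move=> t; exact: (is_deriveM (C1N_is_derive t cb) (C1N_is_derive t cc)).
by apply: C1N_D; apply: IH; rewrite //;
  [exact: C1N_S cb|have [] := cc|exact: C1N_S cc|have [] := cb].
Qed.

Lemma C1N_affine n b k a : C1N n b -> C1N n (fun t => b (k * t + a)).
Proof.
elim: n b => // n IH b cb.
apply: (@C1N_intro _ _ (fun t => derive1 b (k * t + a) * k)).
  move=> t; apply: (@is_derive1_comp _ b (fun t => k * t + a)).
    exact: C1N_is_derive cb.
  have := is_deriveD (is_deriveZ k (is_derive_id t (1 : R))) (is_derive_cst a t 1).
  by rewrite [X in is_derive _ _ _ X]addr0 [X in is_derive _ _ _ X]mulr1.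
by apply: C1N_M; [apply: IH; have [] := cb|exact: C1N_cst].
Qed.

Lemma C1N_inv n b : (forall t, b t != 0) -> C1N n b -> C1N n (fun t => (b t)^-1).
Proof.
move=> b0; elim: n => // n IH cb.
apply: (@C1N_intro _ _ (fun t => (-1) * ((b t)^-1 * (b t)^-1 * derive1 b t))).
  move=> t; have db := C1N_is_derive t cb.
  have := is_deriveV (b0 t) db; congr (is_derive _ _ _ _).
  by rewrite mulN1r -mulNr -invfM -expr2.
have cb' : C1N n (derive1 b) by have [] := cb.
have ci := IH (C1N_S cb).
by apply: C1N_M; [exact: C1N_cst|apply: C1N_M => //; exact: C1N_M].
Qed.

Lemma is_derive_quadratic_remainder b t l C :
  (forall s, `|b (t + s) - b t - l * s| <= C * s ^+ 2) -> is_derive t 1 b l.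
Proof.
wlog C0 : C / 0 < C => [hw H|H].
  apply: (hw (`|C| + 1)) => [|s]; first by rewrite ltr_wpDl.
  by rewrite (le_trans (H s))// ler_wpM2r ?sqr_ge0// (le_trans (ler_norm _))// lerDl.
have cv : s^-1 *: ((b \o shift t) (s *: (1 : R)) - b t) @[s --> 0^'] --> l.
  apply/cvgrPdist_le => e e0; near=> s.
  have s0 : s != 0 by near: s; exact: nbhs_dnbhs_neq.
  rewrite /= [_%:A]mulr1 (addrC s) -[X in `|_ - X|]/(s^-1 * (b (t + s) - b t)).
  rewrite -[l](mulKf s0) -mulrBr normrM normfV ler_pdivrMl ?normr_gt0//.
  rewrite distrC (mulrC s l) (le_trans (H s))// -(real_normK (num_real s)) expr2.
  rewrite mulrA mulrC ler_wpM2l// -ler_pdivlMl// mulrC; apply/ltW.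
  by near: s; apply: dnbhs0_lt; rewrite divr_gt0.
split; first by apply/cvg_ex; exists l.
exact: cvg_lim cv.
Unshelve. all: by end_near. Qed.

(** The classical flat function [exp (- 1 / t)] times a power of [1 / t]. The family indexed by [k]
    is closed under differentiation up to linear combinations, so smoothness is an induction with
    [k] universally quantified. *)
Definition flat k t : R := if 0 < t then t^-1 ^+ k * expR (- t^-1) else 0.

Lemma flat_ge0 k t : 0 <= flat k t.
Proof.
rewrite /flat; case: ifPn => // t0.
by rewrite mulr_ge0 ?expR_ge0// exprn_ge0// invr_ge0 ltW.
Qed.

(** The term of order [k.+2] in the exponential series at [t^-1] absorbs the negative powers and
    leaves [t ^+ 2]; this quadratic bound gives a zero derivative at the origin. *)
Lemma flat_le k t : flat k t <= k.+2`!%:R * t ^+ 2.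
Proof.
rewrite /flat; case: ifPn => [t0|_]; last by rewrite mulr_ge0// sqr_ge0.
have u0 : 0 < t^-1 by rewrite invr_gt0.
have := expR_ge1Dxn k.+1 (ltW u0).
set f : R := k.+2`!%:R; have f0 : 0 < f by rewrite ltr0n fact_gt0.
move=> h; have {h} : t^-1 ^+ k.+2 / f <= expR t^-1.
  by apply: le_trans h; rewrite lerDr.
rewrite ler_pdivrMr// => h.
rewrite expRN ler_pdivrMr ?expR_gt0//.
have -> : t^-1 ^+ k = t^-1 ^+ k.+2 * t ^+ 2.
  by rewrite -addn2 exprD -mulrA -exprMn mulVf ?lt0r_neq0// expr1n mulr1.
by rewrite [leRHS]mulrAC ler_wpM2r ?sqr_ge0// mulrC.
Qed.

Lemma is_derive_flat k t :
  is_derive t 1 (flat k) (flat k.+2 t + (- k%:R) * flat k.+1 t).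
Proof.
have [t0|t0|->] := ltgtP t 0.
- have -> : flat k.+2 t + (- k%:R) * flat k.+1 t = 0.
    by rewrite /flat !ltNge (ltW t0)/= mulr0 addr0.
  apply: (@near_eq_is_derive _ _ _ (cst 0)).
  by near=> s; rewrite /flat ifF//; apply/negbTE; rewrite -leNgt ltW//; near: s; exact: lt_nbhsl.
- apply: (@near_eq_is_derive _ _ _ (fun s : R => s^-1 ^+ k * expR (- s^-1))).
  + by near=> s; rewrite /flat ifT//; near: s; exact: lt_nbhsr.
  + rewrite /flat t0.
    have dV : is_derive t 1 (fun s : R => s^-1) (- (t^-1 ^+ 2)).
      have := is_deriveV (lt0r_neq0 t0) (is_derive_id t (1 : R)).
      by rewrite [X in is_derive _ _ _ X]mulr1 exprVn.
    have dX : is_derive t 1 (fun s : R => s^-1 ^+ k) (- k%:R * t^-1 ^+ k.+1).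
      elim: k => [|k IH].
        rewrite [X in is_derive _ _ _ X](_ : _ = 0); last by rewrite oppr0 mul0r.
        by under eq_fun do rewrite expr0; exact: is_derive_cst.
      under eq_fun do rewrite exprS.
      have := is_deriveM dV IH; congr (is_derive _ _ _ _).
      rewrite -[LHS]/(t^-1 * (- k%:R * t^-1 ^+ k.+1) + t^-1 ^+ k * (- (t^-1 ^+ 2))).
      by rewrite -natr1 !exprS; ring.
    have dE : is_derive t 1 (fun s : R => expR (- s^-1)) (expR (- t^-1) * t^-1 ^+ 2).
      have := @is_derive1_comp R expR (fun s : R => - s^-1) t _ _ (is_derive_expR _) (is_deriveN dV).
      by rewrite opprK.
    have := is_deriveM dX dE; congr (is_derive _ _ _ _).
    rewrite -[LHS]/(t^-1 ^+ k * (expR (- t^-1) * t^-1 ^+ 2) +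
      expR (- t^-1) * (- k%:R * t^-1 ^+ k.+1)) !exprS; ring.
- have -> : flat k.+2 0 + (- k%:R) * flat k.+1 0 = 0.
    by rewrite /flat ltxx mulr0 addr0.
  apply: (@is_derive_quadratic_remainder _ _ _ k.+2`!%:R) => s.
  rewrite add0r mul0r subr0 {2}/flat ltxx subr0 ger0_norm ?flat_ge0//.
  exact: flat_le.
Unshelve. all: by end_near. Qed.

Lemma C1N_flat n k : C1N n (flat k).
Proof.
elim: n k => // n IH k; apply: (C1N_intro (is_derive_flat k)).
by apply: C1N_D => //; apply: C1N_M => //; exact: C1N_cst.
Qed.

(** A smooth transition from 0 to 1 on the unit interval; the denominator never vanishes because [t]
    or [1 - t] is positive. *)
Definition step t : R := flat 0 t / (flat 0 t + flat 0 (1 - t)).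

Let flat0_gt0 t : 0 < t -> 0 < flat 0 t.
Proof. by move=> t0; rewrite /flat t0 expr0 mul1r expR_gt0. Qed.

Let step_den t : 0 < flat 0 t + flat 0 (1 - t).
Proof.
have [t0|t0] := ltP 0 t; first by rewrite ltr_pwDl ?flat0_gt0 ?flat_ge0.
by rewrite ltr_wpDl ?flat_ge0// flat0_gt0//; lra.
Qed.

Lemma C1N_step n : C1N n step.
Proof.
apply: C1N_M; first exact: C1N_flat.
apply: C1N_inv => [t|]; first by rewrite gt_eqF.
apply: C1N_D; first exact: C1N_flat.
rewrite (_ : (fun t => _) = (fun t => flat 0 ((-1) * t + 1))).
  exact/C1N_affine/C1N_flat.
by apply/funext => t; rewrite mulN1r addrC.
Qed.

Lemma step0 t : t <= 0 -> step t = 0.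
Proof. by move=> t0; rewrite /step /flat ltNge t0/= mul0r. Qed.

Lemma step1 t : 1 <= t -> step t = 1.
Proof.
move=> t1; rewrite /step [X in _ / (_ + X)](_ : _ = 0).
  by rewrite addr0 divff// gt_eqF// flat0_gt0// (lt_le_trans _ t1).
by rewrite /flat ltNge subr_le0 t1.
Qed.

Lemma step_ge0 t : 0 <= step t.
Proof. by rewrite divr_ge0 ?flat_ge0// ltW. Qed.

Lemma step_le1 t : step t <= 1.
Proof. by rewrite ler_pdivrMr// mul1r lerDl flat_ge0. Qed.

Lemma derive1_step_out t : (t < 0) || (1 < t) -> derive1 step t = 0.
Proof.
move=> h; rewrite derive1E.
have [k hk] : exists k : R, \forall s \near t, step s = k.
  move: h => /orP[t0|t1].
    by exists 0; near=> s; rewrite step0// ltW//; near: s; exact: lt_nbhsl.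
  by exists 1; near=> s; rewrite step1// ltW//; near: s; exact: lt_nbhsr.
rewrite -[RHS](derive_cst k t (1 : R)).
by apply: near_eq_derive.
Unshelve. all: by end_near. Qed.

End smooth_line.

(** * Mollifiers and their vector potentials as products of one-variable functions *)

Section product_functions.
Context {R : realType} {d : nat}.
Implicit Types (b : 'I_d -> R -> R) (x : 'rV[R]_d) (i j : 'I_d).

Definition prodf b x := \prod_i b i (x 0 i).

Definition smooth1 (c : R -> R) := forall n, C1N n c.

Lemma partial_coord (c : R -> R) i j x : derivable c (x 0 j) 1 ->
  differentiable (fun y : 'rV[R]_d => c (y 0 j)) x /\
  partial i (fun y : 'rV[R]_d => c (y 0 j)) x = (i == j)%:R * derive1 c (x 0 j).
Proof.
move=> dc.
have [|dx dxE] := @diff_quadratic_remainder R d (fun y => y 0 j) x (delta_mx 0 j) 0.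
  move=> u _; rewrite mul0r normr_le0 /dotv (bigD1 j)//= big1 => [|k kj].
    by rewrite !mxE !eqxx mulr1 addr0; apply/eqP; ring.
  by rewrite !mxE (negPf kj) andbF mulr0.
have dcd : differentiable c (x 0 j) by exact/derivable1_diffP.
have df : differentiable (fun y : 'rV[R]_d => c (y 0 j)) x.
  exact: (@differentiable_comp _ _ _ _ (fun y : 'rV[R]_d => y 0 j) c x dx dcd).
split => //.
rewrite /partial (deriveE _ df).
have -> : 'd (fun y : 'rV[R]_d => c (y 0 j)) x = 'd c (x 0 j) \o 'd (fun y => y 0 j) x
    :> ('rV[R]_d -> R).
  exact: (@diff_comp _ _ _ _ (fun y : 'rV[R]_d => y 0 j) c x dx dcd).
rewrite /= dxE diff1E// /dotv (bigD1 j)//= big1 => [|k kj].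
  by rewrite !mxE !eqxx mulr1 addr0 eq_sym.
by rewrite [X in _ * X]mxE (negPf kj) andbF mulr0.
Qed.

Lemma CN_coord n (c : R -> R) j : C1N n c -> CN n (fun y : 'rV[R]_d => c (y 0 j)).
Proof.
elim: n c => // n IH c cc; have [dc cc'] := cc; split => [x|i].
  by have [] := @partial_coord c j j x (dc _).
rewrite (_ : partial i _ = fun y => (i == j)%:R * derive1 c (y 0 j)).
  by apply: CN_M; [exact: CN_cst|exact: IH].
by apply/funext => x; have [_ ->] := @partial_coord c i j x (dc _).
Qed.

Lemma smooth_prodf b : (forall i, smooth1 (b i)) -> smooth (prodf b).
Proof.
move=> sb; apply/smoothP => n; rewrite /prodf.
elim: (index_enum _) => [|i r IH].
  by under eq_fun do rewrite big_nil; exact: CN_cst.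
under eq_fun do rewrite big_cons.
by apply: CN_M => //; exact/CN_coord/sb.
Qed.

Lemma partial_prodf b j x : (forall i, smooth1 (b i)) ->
  partial j (prodf b) x = prodf (fun i => if i == j then derive1 (b i) else b i) x.
Proof.
move=> sb.
have db i y : derivable (b i) y 1 by have [] := sb i 1%N.
have E : prodf b = fun y => b j (y 0 j) * \prod_(i < d | i != j) b i (y 0 i).
  by apply/funext => y; rewrite /prodf (bigD1 j).
have [dp pE] : differentiable (fun y : 'rV[R]_d => \prod_(i < d | i != j) b i (y 0 i)) x /\
    partial j (fun y : 'rV[R]_d => \prod_(i < d | i != j) b i (y 0 i)) x = 0.
  elim: (index_enum _) => [|i r [IH1 IH2]].
    under eq_fun do rewrite big_nil.
    by rewrite partial_cst; split => //; exact: differentiable_cst.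
  under eq_fun do rewrite big_cons.
  case: (boolP (i != j)) => // ij.
  have [dbi bE] := @partial_coord (b i) j i x (db _ _).
  split; first exact: differentiableM.
  by rewrite partialM// IH2 bE eq_sym (negPf ij) mul0r !mulr0 addr0.
have [dbj bE] := @partial_coord (b j) j j x (db _ _).
rewrite E partialM// pE bE mulr0 add0r eqxx mul1r mulrC /prodf [RHS](bigD1 j)//= eqxx.
by congr (_ * _); apply: eq_bigr => i /negPf ->.
Qed.

Lemma norm_lt_coord x C : 0 < C -> (forall i, `|x 0 i| < C) -> `|x| < C.
Proof.
move=> C0 xC; rewrite [ltLHS]/Num.norm/= mx_normrE.
by apply/bigmax_ltP; split => // -[i j] _ /=; rewrite ord1.
Qed.

Lemma bsupp_prodf b M : (forall i t, M <= `|t| -> b i t = 0) -> bsupp (prodf b).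
Proof.
move=> bM; exists (`|M| + 1) => x xM.
have [/existsP[i xi]|] := boolP [exists i : 'I_d, M <= `|x 0 i|].
  by rewrite /prodf (bigD1 i)//= bM// mul0r.
rewrite negb_exists => /forallP nx.
suff : `|x| < `|M| + 1 by rewrite ltNge xM.
apply: norm_lt_coord => [|i]; first by rewrite ltr_wpDl.
have := nx i; rewrite -ltNge => /lt_le_trans; apply.
by rewrite (le_trans (ler_norm M))// lerDl.
Qed.

Lemma smooth1_step : smooth1 (@step R).
Proof. by move=> n; exact: C1N_step. Qed.

Lemma smooth1_derive c : smooth1 c -> smooth1 (derive1 c).
Proof. by move=> sc n; have [] := sc n.+1. Qed.

Lemma smooth1M c c' : smooth1 c -> smooth1 c' -> smooth1 (fun t => c t * c' t).
Proof. by move=> sc sc' n; exact: C1N_M. Qed.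

Lemma smooth1D c c' : smooth1 c -> smooth1 c' -> smooth1 (fun t => c t + c' t).
Proof. by move=> sc sc' n; exact: C1N_D. Qed.

Lemma smooth1_affine c k a : smooth1 c -> smooth1 (fun t => c (k * t + a)).
Proof. by move=> sc n; exact: C1N_affine. Qed.

Lemma smooth1_cst k : smooth1 (fun=> k).
Proof. by move=> n; exact: C1N_cst. Qed.

Lemma smooth1_continuous c : smooth1 c -> continuous c.
Proof.
move=> sc t; apply: differentiable_continuous; apply/derivable1_diffP.
by have [] := sc 1%N.
Qed.

(* The derivative of [fun t => step (t / e)]. *)
Definition bump (e t : R) : R := e^-1 * derive1 (@step R) (e^-1 * t + 0).

Lemma is_derive_step_scaled (e t : R) :
  is_derive t 1 (fun s : R => step (e^-1 * s + 0)) (bump e t).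
Proof.
have ds := C1N_is_derive (e^-1 * t + 0) (smooth1_step 1).
have := is_deriveD (is_deriveZ e^-1 (is_derive_id t (1 : R))) (is_derive_cst (0 : R) t 1).
move=> /(@is_derive1_comp R (@step R) (fun s : R => e^-1 * s + 0) t _ _ ds).
congr (is_derive _ _ _ _).
rewrite -[LHS]/(derive1 (@step R) (e^-1 * t + 0) * (e^-1 * 1 + 0)) /bump; ring.
Qed.

Lemma smooth1_bump e : smooth1 (bump e).
Proof.
apply: smooth1M; first exact: smooth1_cst.
apply: (@smooth1_affine (derive1 (@step R))); apply: smooth1_derive; exact: smooth1_step.
Qed.

Lemma bump_out e t : 0 < e -> (t < 0) || (e < t) -> bump e t = 0.
Proof.
move=> e0 h; rewrite /bump addr0 derive1_step_out ?mulr0//.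
by rewrite pmulr_rlt0 ?invr_gt0// mulrC ltr_pdivlMr// mul1r.
Qed.

Lemma bump_bounded : exists2 C : R, 0 < C & forall e t, 0 < e -> `|bump e t| <= C / e.
Proof.
have cs : continuous (fun t => `|derive1 (@step R) t|).
  move=> t; apply: continuous_comp; last exact: norm_continuous.
  exact/smooth1_continuous/smooth1_derive/smooth1_step.
have [c c01 cmax] := @EVT_max R (fun t => `|derive1 (@step R) t|) 0 1 ler01
  (continuous_subspaceT cs).
exists (`|derive1 (@step R) c| + 1) => [|e t e0]; first by rewrite ltr_wpDl.
rewrite /bump normrM gtr0_norm ?invr_gt0// mulrC ler_wpM2r ?invr_ge0 ?(ltW e0)//.
have [tin|] := boolP (e^-1 * t + 0 \in `[0, 1]).
  by rewrite (le_trans (cmax _ tin))// lerDl.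
rewrite in_itv/= negb_and -!ltNge => h.
by rewrite derive1_step_out// normr0 addr_ge0.
Qed.

(** A mollifier supported in the closed cube of side [e] with a corner at the origin. It is used
    with small [e] as an approximate identity and with large [e] as a smoothed spatial average. *)
Definition rho (e : R) : 'rV[R]_d -> R := prodf (fun=> bump e).

(** A compactly supported vector field with divergence [rho e - rho l]. The factors [bump e] are
    exchanged for [bump l] one coordinate at a time; in coordinate [j] the difference of the two
    bumps has the primitive [step (t / e) - step (t / l)], which vanishes for large [t] because both
    bumps have mass one. *)
Definition potk (e l : R) (j : 'I_d) : 'rV[R]_d -> R :=
  prodf (fun i => if (i < j)%N then bump l else
    if i == j then (fun t => step (e^-1 * t + 0) - step (l^-1 * t + 0)) else bump e).

Lemma test_function_potk e l j : 0 < e -> 0 < l -> test_function (potk e l j).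
Proof.
move=> e0 l0; apply/test_functionP; split.
  apply: smooth_prodf => i; case: ifP => _; first exact: smooth1_bump.
  case: ifP => _; last exact: smooth1_bump.
  apply: smooth1D; first exact/smooth1_affine/smooth1_step.
  under eq_fun do rewrite -mulN1r.
  by apply: smooth1M; [exact: smooth1_cst|exact/smooth1_affine/smooth1_step].
apply: (@bsupp_prodf _ (e + l + 1)) => i t ht.
have {}ht : (t < 0) || (e + l < t).
  have [//|t0] := ltP t 0; move: ht; rewrite ger0_norm//= => ht.
  by rewrite (lt_le_trans _ ht)// ltrDl.
have he : (t < 0) || (e < t).
  by move/orP : ht => [->//|h]; rewrite orbC (le_lt_trans _ h)// lerDl ltW.
have hl : (t < 0) || (l < t).
  by move/orP : ht => [->//|h]; rewrite orbC (le_lt_trans _ h)// lerDr ltW.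
case: ifP => _; first by rewrite bump_out.
case: ifP => _; last by rewrite bump_out.
move/orP : ht => [t0|h].
  by rewrite !step0 ?subrr// addr0 pmulr_rle0 ?invr_gt0// ltW.
rewrite !step1 ?subrr// addr0 mulrC ler_pdivlMr// mul1r ltW//.
  by move: hl => /orP[|//] t0; have := lt_trans (lt_trans (addr_gt0 e0 l0) h) t0; rewrite ltxx.
by move: he => /orP[|//] t0; have := lt_trans (lt_trans (addr_gt0 e0 l0) h) t0; rewrite ltxx.
Qed.

(** The [j]-th derivative is the difference of two consecutive mixed products, with [j] and [j.+1]
    factors of scale [l], so the divergence telescopes. *)
Lemma sum_partial_potk e l x : 0 < e -> 0 < l ->
  \sum_j partial j (potk e l j) x = rho e x - rho l x.
Proof.
move=> e0 l0.
pose P (k : nat) := \prod_(i < d) (if (i < k)%N then bump l (x 0 i) else bump e (x 0 i)).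
have sb (j i : 'I_d) : smooth1 (if (i < j)%N then bump l else
    if i == j then (fun t => step (e^-1 * t + 0) - step (l^-1 * t + 0)) else bump e).
  case: ifP => _; first exact: smooth1_bump.
  case: ifP => _; last exact: smooth1_bump.
  apply: smooth1D; first exact/smooth1_affine/smooth1_step.
  under eq_fun do rewrite -mulN1r.
  by apply: smooth1M; [exact: smooth1_cst|exact/smooth1_affine/smooth1_step].
rewrite (eq_bigr (fun j : 'I_d => P j - P j.+1)) => [|j _]; last first.
  rewrite /potk partial_prodf; last exact: sb.
  rewrite /prodf /P [LHS](bigD1 j)//= [X in _ = X - _](bigD1 j)//=.
  rewrite [X in _ = _ - X](bigD1 j)//= ltnn ltnSn eqxx.
  have -> : \prod_(i < d | i != j) (if (i < j.+1)%N then bump l (x 0 i) else bump e (x 0 i)) =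
            \prod_(i < d | i != j) (if (i < j)%N then bump l (x 0 i) else bump e (x 0 i)).
    apply: eq_bigr => i ij; rewrite ltnS leq_eqVlt.
    by move: ij; rewrite -val_eqE => /negPf ->.
  rewrite -mulrBl; congr (_ * _); last first.
    by apply: eq_bigr => i ij; rewrite (negPf ij); case: ifP.
  rewrite derive1E.
  by have [_ ->] := is_deriveB (is_derive_step_scaled e (x 0 j)) (is_derive_step_scaled l (x 0 j)).
transitivity (\sum_(0 <= j < d) (P j - P j.+1)); first by rewrite big_mkord.
rewrite -[LHS]opprK -sumrN; under eq_bigr do rewrite opprB.
rewrite telescope_sumr// opprB /P /rho /prodf; congr (_ - _).
by apply: eq_bigr => i _; rewrite ltn_ord.
Qed.

Lemma test_function_rho e : 0 < e -> test_function (rho e).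
Proof.
move=> e0; apply/test_functionP; split.
  by apply: smooth_prodf => i; exact: smooth1_bump.
apply: (@bsupp_prodf _ (e + 1)) => i t ht; apply: bump_out => //.
have [//|t0] := ltP t 0; move: ht; rewrite ger0_norm//= => ht.
by rewrite (lt_le_trans _ ht)// ltrDl.
Qed.

(** Cubes are half-open while the support of [bump e] may reach [e], so the side is doubled; the
    factor 2 only affects constants. *)
Lemma rho_out e x : 0 < e -> ~ cube 0 (2 * e) x -> rho e x = 0.
Proof.
move=> e0 nx; have [/existsP[i xi]|] := boolP [exists i : 'I_d, (x 0 i < 0) || (e < x 0 i)].
  by rewrite /rho /prodf (bigD1 i)//= bump_out// mul0r.
rewrite negb_exists => /forallP h; exfalso; apply: nx => i /=.
have := h i; rewrite negb_or -!leNgt in_itv/= => /andP[-> xe].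
by rewrite (le_lt_trans xe)// mulr2n mulrDl mul1r ltrDl.
Qed.

Lemma rho_scale e x : 0 < e -> rho e x = e^-1 ^+ d * rho 1 (e^-1 *: x + 0).
Proof.
move=> e0; rewrite -[X in _ ^+ X]card_ord -prodr_const /rho /prodf -big_split/=.
by apply: eq_bigr => i _; rewrite /bump !mxE invr1 !mul1r !addr0.
Qed.

Lemma rho_bounded : exists2 C : R, 0 < C &
  forall e x, 0 < e -> `|rho e x| <= C * e^-1 ^+ d.
Proof.
have [C C0 CP] := bump_bounded.
exists (C ^+ d) => [|e x e0]; first exact: exprn_gt0.
rewrite -exprMn /rho /prodf normr_prod -[X in _ ^+ X]card_ord -prodr_const.
by apply: ler_prod => i _; rewrite normr_ge0 CP.
Qed.

(** Scaling from [e = 1]: the extra factor [e^-1], compared with the sup bound, makes averages over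
    a large scale insensitive to shifts of a fixed size. *)
Lemma rho_lipschitz : exists2 C : R, 0 < C & forall e x u, 0 < e ->
  `|rho e (x + u) - rho e x| <= C * e^-1 ^+ d.+1 * `|u|.
Proof.
have t1 := test_function_rho ltr01.
have /choice[K KP] : forall i, exists K, 0 <= K /\ forall x, `|partial i (rho 1) x| <= K.
  move=> i; have [K K0 KP] := test_function_bounded (test_function_partial i t1).
  by exists K.
have K0 : 0 <= \sum_i K i by apply: sumr_ge0 => i _; have [] := KP i.
have LP i x : `|partial i (rho 1) x| <= \sum_i K i.
  rewrite (le_trans ((KP i).2 x))// (bigD1 i)//= lerDl.
  by apply: sumr_ge0 => j _; have [] := KP j.
have d1 x : differentiable (rho 1) x.
  by have /test_functionP[s1 _] := t1; exact: smooth_differentiable.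
exists (d%:R * (\sum_i K i) + 1) => [|e x u e0]; first by rewrite ltr_wpDl// mulr_ge0.
rewrite (rho_scale (x + u) e0) (rho_scale x e0) -mulrBr normrM ger0_norm ?exprn_ge0 ?invr_ge0 ?(ltW e0)//.
have := bounded_partial_lipschitz d1 LP (e^-1 *: x + 0) (e^-1 *: u).
rewrite !addr0 -scalerDr normrZ gtr0_norm ?invr_gt0// => h.
have ed0 : 0 <= e^-1 ^+ d by rewrite exprn_ge0// invr_ge0 ltW.
apply: le_trans (ler_wpM2l ed0 h) _.
have -> : e^-1 ^+ d * (d%:R * (\sum_i K i) * (e^-1 * `|u|)) =
  (d%:R * (\sum_i K i)) * (e^-1 ^+ d.+1 * `|u|) by rewrite exprSr; ring.
rewrite -[leRHS]mulrA ler_wpM2r ?lerDl// mulr_ge0// exprn_ge0// invr_ge0 ltW//.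
Qed.

End product_functions.

(** * Integrals over cubes and integration by parts *)

Section integrals_on_cubes.
Context {R : realType}.
Implicit Types (a b c : R).

Lemma itv_co_fin a b : (lebesgue_measure `[a, b[%classic < +oo :> \bar R)%E.
Proof.
by rewrite lebesgue_measure_itv/= lte_fin; case: ifP => // _; rewrite -EFinB ltry.
Qed.

Lemma continuous_bdm_itv (f : R -> R) a b : continuous f -> bdm `[a, b[%classic f.
Proof.
move=> cf; split; first exact: continuous_measurable_fun.
have [ab|ba] := leP a b; last first.
  by exists 0 => x /=; rewrite in_itv/= => /andP[h1 h2];
    have := lt_trans (le_lt_trans h1 h2) ba; rewrite ltxx.
have cn : continuous (fun t => `|f t|).
  by move=> t; apply: continuous_comp; [exact: cf|exact: norm_continuous].
have [m _ mmax] := EVT_max ab (continuous_subspaceT cn).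
exists `|f m| => t /=; rewrite in_itv/= => /andP[h1 h2]; apply: mmax.
by rewrite in_itv/= h1 ltW.
Qed.

Lemma Rint_derive (F f : R -> R) a b : a < b -> continuous f ->
  (forall t : R, is_derive t 1 F (f t)) ->
  \int[lebesgue_measure]_(t in `[a, b[) f t = F b - F a.
Proof.
move=> ab cf dF.
have bf := continuous_bdm_itv a b cf.
have dFt t : derivable F t 1 by have [] := dF t.
have cF : continuous F.
  by move=> t; apply/differentiable_continuous/derivable1_diffP.
rewrite /Rintegral.
rewrite (@integral_itv_bndo_bndc _ _ _ (EFin \o f)); last first.
  by apply/measurable_EFinP; apply: measurable_funS (continuous_measurable_fun cf).
rewrite (@continuous_FTC2 _ f F)//.
- exact: continuous_subspaceT.
- split; first by move=> t _.
  + by apply: cvg_at_right_filter; exact: cF.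
  + by apply: cvg_at_left_filter; exact: cF.
- by move=> t _; rewrite derive1E; have [_ ->] := dF t.
Qed.

Lemma Rint_cst_cube n a b (r : R) : a <= b ->
  \int[@lebn R n]_(x in cube a b) r = r * (b - a) ^+ n.
Proof.
move=> ab; rewrite Rintegral_cst; last exact: measurable_cube.
by rewrite -[fine _]/(fine (@lebn R n (cube a b))) lebn_cube.
Qed.

Lemma Rint_prodf n (h : 'I_n -> R -> R) a b : a <= b ->
  (forall i, bdm `[a, b[%classic (h i)) ->
  \int[@lebn R n]_(x in cube a b) prodf h x =
  \prod_i \int[lebesgue_measure]_(t in `[a, b[) h i t.
Proof.
move=> ab; elim: n h => [|n IH] h bh.
  rewrite big_ord0; under eq_Rintegral do rewrite /prodf big_ord0.
  by rewrite Rint_cst_cube// mul1r expr0.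
have bp : bdm (cube a b) (prodf h).
  apply: bdm_prod => i; split.
    exact: (measurableT_comp (bh i).1 (measurable_coord_rV i)).
  by have [_ [C CP]] := bh i; exists C => x xab; apply: CP; exact: xab.
rewrite bRint_cube_cons// big_ord_recl.
have E t (x : 'rV[R]_n) : prodf h (cons_rV (t, x)) = h ord0 t * prodf (fun i => h (lift ord0 i)) x.
  rewrite /prodf big_ord_recl cons_rV0; congr (_ * _).
  by apply: eq_bigr => i _; rewrite cons_rVS.
have bp' : bdm (cube a b) (prodf (fun i => h (lift ord0 i))).
  apply: bdm_prod => i; split.
    exact: (measurableT_comp (bh (lift ord0 i)).1 (measurable_coord_rV i)).
  by have [_ [C CP]] := bh (lift ord0 i); exists C => x xab; apply: CP; exact: xab.
transitivity (\int[lebesgue_measure]_(t in `[a, b[)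
    ((\prod_(i < n) \int[lebesgue_measure]_(t in `[a, b[) h (lift ord0 i) t) * h ord0 t)); last first.
  by rewrite bRintZ; [rewrite mulrC|by []|exact: itv_co_fin|exact: bh].
apply: eq_Rintegral => t _; under eq_Rintegral do rewrite E.
rewrite bRintZ//; [|exact: measurable_cube|exact: lebn_cube_fin].
by rewrite IH// mulrC.
Qed.

Lemma Rint_rho d e : 0 < e ->
  \int[@lebn R d]_(x in cube 0 (2 * e)) rho e x = 1.
Proof.
move=> e0; have e20 : 0 < 2 * e by rewrite mulr_gt0.
rewrite Rint_prodf ?ltW//; last first.
  by move=> i; apply/continuous_bdm_itv/smooth1_continuous/smooth1_bump.
rewrite big1// => i _.
rewrite (Rint_derive e20 (smooth1_continuous (smooth1_bump e)) (is_derive_step_scaled e)).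
rewrite mulr0 add0r addr0 (step0 (lexx 0)) subr0 step1//.
by rewrite mulrCA mulVf ?gt_eqF// mulr1 ler1n.
Qed.

Definition upd n (x : 'rV[R]_n) (i : 'I_n) (t : R) : 'rV[R]_n :=
  \row_j if j == i then t else x 0 j.

(** Fubini in coordinate [i], by induction on the dimension: if [i] is the leading coordinate the
    order of integration is exchanged, otherwise the induction hypothesis applies to each slice. *)
Lemma Rint_slice0 n (i : 'I_n) (G : 'rV[R]_n -> R) a b : bdm (cube a b) G ->
  (forall x, \int[lebesgue_measure]_(t in `[a, b[) G (upd x i t) = 0) ->
  \int[@lebn R n]_(x in cube a b) G x = 0.
Proof.
elim: n i G => [[]//|n IH] i G bG G0; have [mG [C GC]] := bG.
have bGc : bdm (`[a, b[%classic `*` cube a b) (G \o @cons_rV R n).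
  split; first exact: (measurableT_comp mG (@measurable_cons_rV R n)).
  by exists C => -[t x] [ht hx]; apply: GC; apply/cube_cons.
rewrite bRint_cube_cons//.
have [j ij|i0] := unliftP ord0 i.
  rewrite [LHS](_ : _ = \int[lebesgue_measure]_(t in `[a, b[) (0 : R)); last first.
    apply: eq_Rintegral => t; rewrite inE/= => tab.
    apply: (IH j).
      split; first by apply: (measurableT_comp bGc.1); exact: measurable_pair1.
      by exists C => x xab; apply: GC; apply/cube_cons.
    move=> x; rewrite -[RHS](G0 (cons_rV (t, x))); apply: eq_Rintegral => s _.
    congr (G _); apply/rowP => k; rewrite ij [RHS]mxE.
    have [l ->|->] := unliftP ord0 k; last by rewrite !cons_rV0 eq_liftF.
    by rewrite !cons_rVS mxE (inj_eq lift_inj).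
  by rewrite Rintegral_cst// mul0r.
rewrite (@bRint_Fubini R _ _ (measurableTypeR R) 'rV[R]_n lebesgue_measure (@lebn R n) _ _
  (G \o @cons_rV R n)); [|by []|exact: measurable_cube|exact: itv_co_fin|exact: lebn_cube_fin|by []].
rewrite [LHS](_ : _ = \int[@lebn R n]_(x in cube a b) (0 : R)); last first.
  apply: eq_Rintegral => x _; rewrite -[RHS](G0 (cons_rV (a, x))).
  apply: eq_Rintegral => t _; congr (G _); apply/rowP => k; rewrite i0 [RHS]mxE.
  have [l ->|->] := unliftP ord0 k; last by rewrite !cons_rV0 eqxx.
  by rewrite !cons_rVS.
by rewrite Rintegral_cst ?mul0r//; exact: measurable_cube.
Qed.

Lemma cube_bounded n (f : 'rV[R]_n -> R) a b : continuous f -> bdm (cube a b) f.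
Proof.
move=> cf; split; first exact: continuous_measurable_rV.
have A0 : [set x : 'rV[R]_n | `|x| <= `|a| + `|b|] !=set0.
  by exists 0; rewrite /= normr0 addr_ge0.
have cf' : {within [set x : 'rV[R]_n | `|x| <= `|a| + `|b|], continuous (fun x => `|f x|)}.
  apply: continuous_subspaceT => x; apply: continuous_comp; first exact: cf.
  exact: norm_continuous.
have [c _ cmax] := EVT_max_rV A0 (@compact_norm_le R n (`|a| + `|b|)) cf'.
exists `|f c| => x xab; apply: cmax; rewrite inE/=.
apply: norm_le_coord => [|i]; first by rewrite addr_ge0.
have := xab i; rewrite /= in_itv/= => /andP[h1 h2].
rewrite ler_norml; have := ler_norm b; have := ler_norm (- a); rewrite normrN.
by have := normr_ge0 a; have := normr_ge0 b; move=> ? ? ? ?; apply/andP; split; lra.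
Qed.

Lemma smooth_cube n (f : 'rV[R]_n -> R) a b : smooth f -> bdm (cube a b) f.
Proof. by move=> sf; apply: cube_bounded; exact: smooth_continuous. Qed.

(** Equal values on opposite faces cover both uses: periodic functions, and functions that vanish on
    the faces. *)
Lemma Rint_partial0 n (i : 'I_n) (F : 'rV[R]_n -> R) a b : a < b -> smooth F ->
  (forall x, F (upd x i a) = F (upd x i b)) ->
  \int[@lebn R n]_(x in cube a b) partial i F x = 0.
Proof.
move=> ab sF Fab; apply: (@Rint_slice0 _ i); first exact/smooth_cube/smooth_partial.
move=> x.
have updE t : upd x i t = upd x i 0 + t *: delta_mx 0 i.
  apply/rowP => j; rewrite !mxE eqxx/=; case: eqP => _; first by rewrite add0r mulr1.
  by rewrite mulr0 addr0.
have dF (t : R) : is_derive t 1 (fun s : R => F (upd x i s)) (partial i F (upd x i t)).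
  under eq_fun do rewrite updE.
  have := is_derive_line (upd x i 0) (delta_mx 0 i) t (fun y => @smooth_differentiable _ _ F y sF).
  congr (is_derive _ _ _ _).
  rewrite -updE (bigD1 i)//= big1 => [|j ji]; first by rewrite mxE !eqxx mul1r addr0.
  by rewrite mxE eqxx (negPf ji) mul0r.
have cF : continuous (fun t => partial i F (upd x i t)).
  rewrite (_ : (fun t => _) = (fun t => partial i F (upd x i 0 + t *: delta_mx 0 i))).
    move=> t; have [dl _] := is_derive_line (upd x i 0) (delta_mx 0 i) t
      (fun y => @smooth_differentiable _ _ _ y (smooth_partial i sF)).
    move/derivable1_diffP in dl; exact: differentiable_continuous dl.
  by apply/funext => t; rewrite -updE.
by rewrite (Rint_derive ab cF dF) -Fab subrr.
Qed.

Lemma Rint_partial_bsupp0 n (i : 'I_n) (F : 'rV[R]_n -> R) : smooth F -> bsupp F ->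
  \int[@lebn R n]_x partial i F x = 0.
Proof.
move=> sF bF; have [M0 M00 M0P] := bsupp_cube bF.
have [M M1 M1P] := bsupp_cube (bsupp_partial i bF).
rewrite (@Rint_support _ _ (cube (- (M0 + M)) (M0 + M))) => [|x nx]; last first.
  apply: M1P => xM; apply: nx => j; have := xM j; rewrite /= !in_itv/= => /andP[h1 h2].
  by apply/andP; split; lra.
apply: Rint_partial0 => //; first lra.
move=> x; rewrite !M0P// => /(_ i); rewrite /= mxE eqxx in_itv/= => /andP[h1 h2]; lra.
Qed.

End integrals_on_cubes.

Section periodic_integrals.
Context {R : realType} {d : nat}.

Lemma cellE (N : R) : @cell R d N = cube 0 N.
Proof. by apply/seteqP; split => x xN i; have := xN i; rewrite /= in_itv. Qed.

Lemma Rint_partial_torus0 (N : R) (f : 'rV[R]_d -> R) i : 0 < N -> smooth_torus N f ->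
  \int[@lebn R d]_(x in cube 0 N) partial i f x = 0.
Proof.
move=> N0 [sf pf]; apply: Rint_partial0 => // x.
rewrite -(pf (delta_mx 0 i) (upd x i 0)); congr f; apply/rowP => j; rewrite !mxE eqxx/=.
by case: eqP => _; rewrite ?add0r ?mulr1// mulr0 addr0.
Qed.

End periodic_integrals.

Section cutoff.
Context {R : realType} {d : nat}.

(** The cut-off is built once on the unit cell and rescaled by [N^-1] later, so that its bounds do
    not depend on [N]. Each coordinate carries a rising and a falling [step], both moving over an
    interval of length [delta]. *)
Lemma cutoff_exists (delta : R) : 0 < delta -> delta < 1 / 4 ->
  exists chi : 'rV[R]_d -> R, [/\ smooth chi, (forall x, 0 <= chi x <= 1),
    (forall x : 'rV[R]_d, (exists i, x 0 i <= delta \/ 1 - delta <= x 0 i) -> chi x = 0) &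
    (forall x : 'rV[R]_d, (forall i, 2 * delta <= x 0 i <= 1 - 2 * delta) -> chi x = 1)].
Proof.
move=> d0 d4.
pose sg (t : R) := step (delta^-1 * t + (-1)) * step (- delta^-1 * t + (delta^-1 - 1)).
have sym t : - delta^-1 * t + (delta^-1 - 1) = delta^-1 * (1 - t) + (-1) by ring.
have low t : t <= delta -> delta^-1 * t + (-1) <= 0.
  by move=> h; rewrite subr_le0 mulrC ler_pdivrMr// mul1r.
have high t : 2 * delta <= t -> 1 <= delta^-1 * t + (-1).
  by move=> h; rewrite lerBrDr mulrC ler_pdivlMr// -[1 + 1]/2.
exists (prodf (fun=> sg)); split.
- apply: smooth_prodf => i; apply: smooth1M; exact/smooth1_affine/smooth1_step.
- move=> x; rewrite /prodf prodr_ge0/= => [|i _]; last by rewrite mulr_ge0 ?step_ge0.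
  rewrite -[leRHS](expr1n _ #|'I_d|) -prodr_const; apply: ler_prod => i _.
  by rewrite mulr_ge0 ?step_ge0//= mulr_ile1 ?step_ge0 ?step_le1.
- move=> x [i xi]; rewrite /prodf (bigD1 i)//= /sg; move: xi => [xi|xi].
    by rewrite step0 ?mul0r// low.
  by rewrite [X in _ * X * _]step0 ?mulr0 ?mul0r// sym low//; lra.
- move=> x hx; rewrite /prodf big1// => i _; have /andP[h1 h2] := hx i.
  by rewrite /sg sym !step1 ?mulr1// high//; lra.
Qed.

End cutoff.

(** * Averages along orbits *)

Section ergodic_action_operators.
Context {R : realType} {d : nat} {disp : measure_display}
  {X : measurableType disp} (mu : probability X R)
  (tau : 'rV[R]_d -> X -> X).
Hypothesis htau : ergodic_action mu tau.
Local Notation lambda := (@lebn R d).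
Implicit Types (f g : X -> R) (phi : 'rV[R]_d -> R) (x y : 'rV[R]_d).

Lemma muT_fin : (mu [set: X] < +oo)%E.
Proof. by rewrite probability_setT ltry. Qed.

Lemma fine_muT : fine (mu [set: X]) = 1.
Proof. by rewrite probability_setT. Qed.

Lemma tauD x y eta : tau (- (x + y)) eta = tau (- x) (tau (- y) eta).
Proof. by rewrite opprD (actionD htau). Qed.

Lemma tau0 eta : tau (- 0) eta = eta.
Proof. by rewrite oppr0 (action0 htau). Qed.

(** The hypothesis on the action speaks of real functions; the indicator of [B] and the preimage of
    1 give the version for sets. *)
Lemma measurable_tau_joint :
  measurable_fun [set: X * 'rV[R]_d] (fun p => tau (- p.2) p.1).
Proof.
move=> _ B mB; rewrite setTI.
have := action_measurable htau (@measurable_indic _ _ R setT B mB).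
move=> /(_ measurableT [set 1] (measurable_set1 1)); rewrite setTI.
congr (measurable _); apply/seteqP; split => p /=; rewrite indicE.
  by case: (boolP (_ \in B)); rewrite ?inE// => _ /eqP; rewrite eq_sym oner_eq0.
by move=> Bp; rewrite mem_set.
Qed.

Lemma measurable_tau x : measurable_fun [set: X] (tau (- x)).
Proof.
apply: (measurableT_comp (f := fun p : X * 'rV[R]_d => tau (- p.2) p.1)
  (g := fun eta => (eta, x))); first exact: measurable_tau_joint.
exact: measurable_pair2.
Qed.

Lemma measurable_orbit eta : measurable_fun [set: 'rV[R]_d] (fun x => tau (- x) eta).
Proof.
apply: (measurableT_comp (f := fun p : X * 'rV[R]_d => tau (- p.2) p.1)
  (g := fun x => (eta, x))); first exact: measurable_tau_joint.
exact: measurable_pair1.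
Qed.

Lemma mu_tau x (B : set X) : measurable B -> pushforward mu (tau (- x)) B = mu B.
Proof.
move=> mB; rewrite /pushforward -[RHS](action_invariant htau x mB); congr (mu _).
apply/seteqP; split => eta /=.
  move=> Beta; exists (tau (- x) eta) => //.
  by rewrite -(actionD htau) subrr (action0 htau).
by move=> [zeta Bz <-]; rewrite -(actionD htau) addNr (action0 htau).
Qed.

Lemma integral_tau x (f : X -> \bar R) : measurable_fun setT f ->
  (\int[mu]_eta f (tau (- x) eta) = \int[mu]_eta f eta)%E.
Proof.
move=> mf; wlog f0 : f mf / forall eta, (0 <= f eta)%E => [hw|].
  rewrite integralE [RHS]integralE; congr (_ - _)%E.
    transitivity (\int[mu]_eta (f^\+)%E (tau (- x) eta))%E; last first.
      by apply: hw => //; exact: measurable_funepos.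
    by apply: eq_integral => eta _; rewrite !funeposE.
  transitivity (\int[mu]_eta (f^\-)%E (tau (- x) eta))%E; last first.
    by apply: hw => //; exact: measurable_funeneg.
  by apply: eq_integral => eta _; rewrite !funenegE.
transitivity (\int[pushforward mu (tau (- x))]_eta f eta)%E.
  by rewrite (ge0_integral_pushforward (measurable_tau x)).
apply: (eq_measure_integral mu); first exact: measurable_tau.
by move=> mt B mB _; exact: mu_tau.
Qed.

Lemma Rint_tau x f : measurable_fun setT f ->
  \int[mu]_eta f (tau (- x) eta) = \int[mu]_eta f eta.
Proof.
by move=> mf; congr fine; apply: (integral_tau x (f := EFin \o f)); exact/measurable_EFinP.
Qed.

Lemma bdm_tau x f : bdm setT f -> bdm setT (fun eta => f (tau (- x) eta)).
Proof.
move=> [mf [C fC]]; split; last by exists C => *; exact: fC.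
exact: (measurableT_comp mf (measurable_tau x)).
Qed.

Lemma bdm_orbit eta f : bdm setT f -> bdm setT (fun x => f (tau (- x) eta)).
Proof.
move=> [mf [C fC]]; split; last by exists C => *; exact: fC.
exact: (measurableT_comp mf (measurable_orbit eta)).
Qed.

Lemma bdm_tau_joint f : bdm setT f ->
  bdm setT (fun p : X * 'rV[R]_d => f (tau (- p.2) p.1)).
Proof.
move=> [mf [C fC]]; split; last by exists C => *; exact: fC.
exact: (measurableT_comp mf measurable_tau_joint).
Qed.

Definition kern phi := bdm setT phi /\ bsupp phi.

Lemma test_function_kern phi : test_function phi -> kern phi.
Proof.
move=> tphi; have [sphi bphi] := (test_functionP phi).1 tphi; split => //; split.
  exact: smooth_measurable.
by have [C _ CP] := test_function_bounded tphi; exists C.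
Qed.

Lemma kernN phi : kern phi -> kern (fun y => phi (- y)).
Proof.
move=> [[mphi [C CP]] [M MP]]; split; last by exists M => x xM; rewrite MP// normrN.
split; last by exists C => x _; exact: CP.
exact: (measurableT_comp mphi (@measurable_opprV R d)).
Qed.

(** Convolution along orbits. Differentiating a realization of [Kop phi f] moves the derivative onto
    [phi], so differential identities become identities between operators [Kop] with differentiated
    kernels. *)
Definition Kop phi f eta := \int[lambda]_y (phi y * f (tau (- y) eta)).

Lemma Kop_cube phi f (D : set 'rV[R]_d) eta : (forall y, ~ D y -> phi y = 0) ->
  Kop phi f eta = \int[lambda]_(y in D) (phi y * f (tau (- y) eta)).
Proof. by move=> phiD; apply: Rint_support => y /phiD ->; rewrite mul0r. Qed.

Lemma bdm_Kop_joint phi f (D : set 'rV[R]_d) : kern phi -> bdm setT f ->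
  bdm (setT `*` D) (fun p : X * 'rV[R]_d => phi p.2 * f (tau (- p.2) p.1)).
Proof.
move=> [bphi _] bf; apply: (@bdm_sub _ _ _ setT) => //.
apply: bdmM; last exact: bdm_tau_joint.
split; first exact: (measurableT_comp bphi.1 measurable_snd).
by have [_ [C CP]] := bphi; exists C => p _; exact: CP.
Qed.

Lemma bdm_kern_orbit phi f (D : set 'rV[R]_d) eta : kern phi -> bdm setT f ->
  bdm D (fun y => phi y * f (tau (- y) eta)).
Proof.
move=> [bphi _] bf; apply: (@bdm_sub _ _ _ setT) => //.
by apply: bdmM => //; exact: bdm_orbit.
Qed.

Lemma bdm_Kop phi f : kern phi -> bdm setT f -> bdm setT (Kop phi f).
Proof.
move=> kphi bf; have [_ /bsupp_cube[M M0 MP]] := kphi.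
rewrite (_ : Kop phi f = fun eta => \int[lambda]_(y in cube (- M) M) (phi y * f (tau (- y) eta))).
  apply: (@bdm_Rint _ _ _ _ _ lambda setT _
    (fun p : X * 'rV[R]_d => phi p.2 * f (tau (- p.2) p.1))).
  - exact: measurable_cube.
  - exact: lebn_cube_fin.
  - exact: bdm_Kop_joint.
by apply/funext => eta; exact: Kop_cube.
Qed.

Lemma Kop_corr phi f x eta : kern phi -> bdm setT f ->
  Kop phi f (tau (- x) eta) = corr phi (fun y => f (tau (- y) eta)) x.
Proof.
move=> [bphi _] bf; rewrite /Kop /corr.
have mg : measurable_fun setT (fun y => phi (y - x) * f (tau (- y) eta)).
  apply: measurable_funM; last exact: (bdm_orbit eta bf).1.
  exact: (measurableT_comp bphi.1 (measurable_addr (- x))).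
transitivity (\int[lambda]_y (phi (y + x - x) * f (tau (- (y + x)) eta))).
  by apply: eq_Rintegral => y _; rewrite addrK tauD.
rewrite /Rintegral; congr fine.
by apply: (@integral_shift R d x (fun y => (phi (y - x) * f (tau (- y) eta))%:E)); exact/measurable_EFinP.
Qed.

Lemma KopD phi f g eta : kern phi -> bdm setT f -> bdm setT g ->
  Kop phi (fun eta => f eta + g eta) eta = Kop phi f eta + Kop phi g eta.
Proof.
move=> kphi bf bg; have [_ /bsupp_cube[M M0 MP]] := kphi.
rewrite !(Kop_cube _ _ MP) -bRintD; last 4 first.
- exact: measurable_cube.
- exact: lebn_cube_fin.
- exact: bdm_kern_orbit.
- exact: bdm_kern_orbit.
by apply: eq_Rintegral => y _; rewrite mulrDr.
Qed.

Lemma KopZ phi k f eta : kern phi -> bdm setT f ->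
  Kop phi (fun eta => k * f eta) eta = k * Kop phi f eta.
Proof.
move=> kphi bf; have [_ /bsupp_cube[M M0 MP]] := kphi.
rewrite !(Kop_cube _ _ MP) -bRintZ; last 3 first.
- exact: measurable_cube.
- exact: lebn_cube_fin.
- exact: bdm_kern_orbit.
by apply: eq_Rintegral => y _; rewrite mulrCA.
Qed.

Lemma Kop_kernD phi psi f eta : kern phi -> kern psi -> bdm setT f ->
  Kop (fun y => phi y + psi y) f eta = Kop phi f eta + Kop psi f eta.
Proof.
move=> kphi kpsi bf; have [_ /bsupp_cube[M M0 MP]] := kphi.
have [_ /bsupp_cube[M' M'0 M'P]] := kpsi.
pose D : set 'rV[R]_d := cube (- (M + M')) (M + M').
have DP y : ~ D y -> phi y = 0.
  move=> nD; apply: MP => yM; apply: nD => i; have := yM i.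
  by rewrite /= !in_itv/= => /andP[h1 h2]; apply/andP; split; lra.
have DP' y : ~ D y -> psi y = 0.
  move=> nD; apply: M'P => yM; apply: nD => i; have := yM i.
  by rewrite /= !in_itv/= => /andP[h1 h2]; apply/andP; split; lra.
rewrite (Kop_cube _ _ DP) (Kop_cube _ _ DP') (@Kop_cube (fun y => phi y + psi y) _ D); last first.
  by move=> y nD; rewrite DP// DP'// addr0.
rewrite -bRintD; last 4 first.
- exact: measurable_cube.
- exact: lebn_cube_fin.
- exact: bdm_kern_orbit.
- exact: bdm_kern_orbit.
by apply: eq_Rintegral => y _; rewrite mulrDl.
Qed.

Lemma kernD phi psi : kern phi -> kern psi -> kern (fun y => phi y + psi y).
Proof.
move=> [b1 [M MP]] [b2 [M' M'P]]; split; first exact: bdmD.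
exists (Num.max M M') => x; rewrite ge_max => /andP[h1 h2].
by rewrite MP// M'P// addr0.
Qed.

Lemma kern0 : kern (fun=> 0).
Proof. by split; [exact: bdm_cst|exists 0]. Qed.

Lemma Kop_kern0 f eta : Kop (fun=> 0) f eta = 0.
Proof. by rewrite (@Kop_cube _ _ set0) ?Rintegral_set0. Qed.

Lemma kernZ k phi : kern phi -> kern (fun y => k * phi y).
Proof.
move=> [bphi [M MP]]; split; first exact: bdmZ.
by exists M => x /MP ->; rewrite mulr0.
Qed.

Lemma Kop_kernZ k phi f eta : kern phi -> bdm setT f ->
  Kop (fun y => k * phi y) f eta = k * Kop phi f eta.
Proof.
move=> kphi bf; rewrite -KopZ//; apply: eq_Rintegral => y _.
by rewrite mulrAC mulrC mulrA.
Qed.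

Lemma Kop_kern_sum (I : Type) (r : seq I) (P : I -> 'rV[R]_d -> R) f eta :
  (forall i, kern (P i)) -> bdm setT f ->
  kern (fun y => \sum_(i <- r) P i y) /\
  Kop (fun y => \sum_(i <- r) P i y) f eta = \sum_(i <- r) Kop (P i) f eta.
Proof.
move=> kP bf; elim: r => [|i r [IH1 IH2]].
  under eq_fun do rewrite big_nil; split; first exact: kern0.
  by rewrite Kop_kern0 big_nil.
rewrite big_cons -IH2; under eq_fun do rewrite big_cons.
split; first exact: kernD.
exact: Kop_kernD.
Qed.

Lemma Rint_mul_Kop phi f g : kern phi -> bdm setT f -> bdm setT g ->
  \int[mu]_eta (g eta * Kop phi f eta) =
  \int[lambda]_y (phi y * \int[mu]_eta (g eta * f (tau (- y) eta))).
Proof.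
move=> kphi bf bg; have [_ /bsupp_cube[M M0 MP]] := kphi.
rewrite [RHS](@Rint_support _ _ (cube (- M) M)) => [|y /MP ->]; last by rewrite mul0r.
transitivity (\int[mu]_eta \int[lambda]_(y in cube (- M) M)
    (g eta * (phi y * f (tau (- y) eta)))).
  apply: eq_Rintegral => eta _; rewrite (Kop_cube _ _ MP) bRintZ//.
  - exact: measurable_cube.
  - exact: lebn_cube_fin.
  - exact: bdm_kern_orbit.
have bF : bdm (setT `*` cube (- M) M)
    (fun p : X * 'rV[R]_d => g p.1 * (phi p.2 * f (tau (- p.2) p.1))).
  apply: bdmM; last exact: bdm_Kop_joint.
  split; first exact: (measurableT_comp bg.1 measurable_fst).
  by have [_ [C CP]] := bg; exists C => p _; exact: CP.
rewrite (bRint_Fubini (m1 := mu) (m2 := lambda) measurableT (measurable_cube _ _) muT_fin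
  (lebn_cube_fin _ _ _) bF).
apply: eq_Rintegral => y _; rewrite -bRintZ//; last 2 first.
- exact: muT_fin.
- by apply: bdmM => //; exact: bdm_tau.
by apply: eq_Rintegral => eta _ /=; rewrite mulrCA.
Qed.

Lemma Rint_Kop phi f : kern phi -> bdm setT f ->
  \int[mu]_eta Kop phi f eta = (\int[lambda]_y phi y) * \int[mu]_eta f eta.
Proof.
move=> kphi bf; have := Rint_mul_Kop kphi bf (bdm_cst setT 1).
under eq_Rintegral do rewrite mul1r.
move=> ->; rewrite mulrC.
have [bphi /bsupp_cube[M M0 MP]] := kphi.
rewrite !(@Rint_support _ _ (cube (- M) M))//; last by move=> y /MP ->; rewrite mul0r.
rewrite -bRintZ; last 3 first.
- exact: measurable_cube.
- exact: lebn_cube_fin.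
- exact: bdm_sub bphi.
apply: eq_Rintegral => y _; under eq_Rintegral do rewrite mul1r.
by rewrite [RHS]mulrC; congr (_ * _); exact: (Rint_tau y bf.1).
Qed.

(** Invariance of [mu] moves the translation by [y] from one function to the other inside the
    pairing, and the reflection invariance of Lebesgue measure then reflects the kernel. *)
Lemma Kop_adjoint phi f g : kern phi -> bdm setT f -> bdm setT g ->
  \int[mu]_eta (g eta * Kop phi f eta) =
  \int[mu]_eta (f eta * Kop (fun y => phi (- y)) g eta).
Proof.
move=> kphi bf bg; rewrite (Rint_mul_Kop kphi bf bg) (Rint_mul_Kop (kernN kphi) bg bf).
pose F y := phi y * \int[mu]_eta (g eta * f (tau (- y) eta)).
have mF : measurable_fun setT F.
  apply: measurable_funM; first exact: kphi.1.1.
  apply: (@measurable_Rint _ _ _ _ _ mu setT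
    (fun p : 'rV[R]_d * X => g p.2 * f (tau (- p.1) p.2))) => //.
  apply: measurable_funM; first exact: (measurableT_comp bg.1 measurable_snd).
  apply: (measurableT_comp (f := fun p : X * 'rV[R]_d => f (tau (- p.2) p.1))
    (g := fun p : 'rV[R]_d * X => (p.2, p.1)) (bdm_tau_joint bf).1).
  by apply: measurable_fun_pair; [exact: measurable_snd|exact: measurable_fst].
transitivity (\int[lambda]_y F (- y)).
  by congr fine; apply/esym; apply: (@integral_opp R d (EFin \o F)); exact/measurable_EFinP.
apply: eq_Rintegral => y _; rewrite /F; congr (_ * _).
rewrite -(Rint_tau y (f := fun eta => g eta * f (tau (- - y) eta))).
  apply: eq_Rintegral => eta _; rewrite opprK -(actionD htau) subrr (action0 htau).
  by rewrite mulrC.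
by apply: measurable_funM; [exact: bg.1|exact: (bdm_tau (- y) bf).1].
Qed.

(** Cauchy-Schwarz in [y], followed by Fubini and invariance of [mu]. The constant is a sup bound of
    the kernel times the volume of a set carrying it, which does not depend on the scale for the
    family [rho e]. *)
Lemma Kop_L2 phi f (D : set 'rV[R]_d) c : kern phi -> measurable D ->
  (lambda D < +oo)%E -> (forall y, ~ D y -> phi y = 0) ->
  (forall y, `|phi y| <= c) -> bdm setT f ->
  \int[mu]_eta (Kop phi f eta ^+ 2) <=
  (c * fine (lambda D)) ^+ 2 * \int[mu]_eta (f eta ^+ 2).
Proof.
move=> kphi mD Dfin phiD phic bf.
have c0 : 0 <= c by apply: le_trans (phic 0); rewrite normr_ge0.
have bf2 := bdmX 2 bf.
have l0 : 0 <= fine (lambda D) by rewrite fine_ge0.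
have bG : bdm (setT `*` D) (fun p : X * 'rV[R]_d => f (tau (- p.2) p.1) ^+ 2).
  by apply: bdmX; apply: bdm_sub (bdm_tau_joint bf).
apply: (@le_trans _ _ (\int[mu]_eta ((fine (lambda D) * c ^+ 2) *
    \int[lambda]_(y in D) (f (tau (- y) eta) ^+ 2)))).
  apply: bRint_le => //; first exact: muT_fin.
  - exact/bdmX/bdm_Kop.
  - by apply: bdmZ; exact: (@bdm_Rint _ _ _ _ _ lambda setT D _ mD Dfin bG).
  move=> eta _; rewrite (Kop_cube _ _ phiD).
  apply: le_trans (bRint_sq mD Dfin (bdm_kern_orbit D eta kphi bf)) _.
  rewrite -mulrA ler_wpM2l// -bRintZ//; last exact/bdmX/bdm_sub/(bdm_orbit eta bf).
  apply: bRint_le => //.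
  - exact/bdmX/bdm_kern_orbit.
  - by apply/bdmZ/bdmX/bdm_sub/(bdm_orbit eta bf).
  move=> y _; rewrite exprMn ler_wpM2r ?sqr_ge0//.
  by rewrite -(real_normK (num_real (phi y))) lerXn2r ?nnegrE.
rewrite bRintZ//; [|exact: muT_fin|exact: (@bdm_Rint _ _ _ _ _ lambda setT D _ mD Dfin bG)].
rewrite (bRint_Fubini (m1 := mu) (m2 := lambda) measurableT mD muT_fin Dfin bG).
rewrite (@eq_Rintegral _ _ _ lambda _ (fun=> \int[mu]_eta (f eta ^+ 2))).
  by rewrite Rintegral_cst// exprMn expr2 le_eqVlt; apply/orP; left; apply/eqP; ring.
move=> y _ /=; rewrite -(Rint_tau y (f := fun eta => f eta ^+ 2))//.
exact: bf2.1.
Qed.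

End ergodic_action_operators.

(** * The pointwise ergodic theorem *)

Section bounded_limsup.
Context {R : realType}.
Implicit Types (u v : nat -> R) (C : R).

Lemma cvgnP u l : (u n @[n --> \oo] --> l) <->
  forall e, 0 < e -> exists N, forall n, (N <= n)%N -> `|u n - l| <= e.
Proof.
split=> [/cvgrPdist_le cu e e0|H].
  have [N _ NP] := cu e e0; exists N => n Nn; rewrite distrC; exact: NP.
apply/cvgrPdist_le => e /H[N NP]; exists N => // n Nn /=.
by rewrite distrC; exact: NP.
Qed.

(** Real-valued so that it can be integrated; [fine] returns 0 on an infinite upper limit, so the
    lemmas about its value assume a bound on [u]. *)
Definition rlimsup u : R := fine (limn_esup (fun n => (u n)%:E)).

Lemma limn_esup_fin u C : (forall n, `|u n| <= C) ->
  ((- C)%:E <= limn_esup (fun n => (u n)%:E))%E /\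
  (limn_esup (fun n => (u n)%:E) <= C%:E)%E.
Proof.
move=> uC; split.
  apply: le_ereal_inf_tmp => _ [V [N _ NV] <-].
  apply: (@le_trans _ _ (u N)%:E).
    by rewrite lee_fin; have := uC N; rewrite ler_norml => /andP[].
  by apply: ereal_sup_ubound; exists N => //; apply: NV => /=.
apply: (@le_trans _ _ (ereal_sup ((fun n => (u n)%:E) @` setT))).
  by apply: ereal_inf_lbound; exists setT => //; exact: filterT.
apply: ge_ereal_sup => _ [n _ <-]; rewrite lee_fin.
by have := uC n; rewrite ler_norml => /andP[].
Qed.

Lemma EFin_rlimsup u C : (forall n, `|u n| <= C) ->
  (rlimsup u)%:E = limn_esup (fun n => (u n)%:E).
Proof.
move=> uC; have [h1 h2] := limn_esup_fin uC.
by rewrite fineK// fin_numE -ltNye -ltey (lt_le_trans (ltNyr _) h1) (le_lt_trans h2 (ltry _)).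
Qed.

Lemma rlimsup_bounded u C : (forall n, `|u n| <= C) -> `|rlimsup u| <= C.
Proof.
move=> uC; have [h1 h2] := limn_esup_fin uC.
by rewrite ler_norml -!lee_fin (EFin_rlimsup uC) h1.
Qed.

Lemma rlimsup_ub u C e : (forall n, `|u n| <= C) -> 0 < e ->
  exists N, forall n, (N <= n)%N -> u n <= rlimsup u + e.
Proof.
move=> uC e0.
have : (limn_esup (fun n => (u n)%:E) < (rlimsup u + e)%:E)%E.
  by rewrite -(EFin_rlimsup uC) lte_fin ltrDl.
move=> /ereal_inf_lt[_ [V [N _ NV] <-]] h; exists N => n Nn.
rewrite -lee_fin (le_trans _ (ltW h))//; apply: ereal_sup_ubound.
by exists n => //; exact: NV.
Qed.

Lemma rlimsup_freq u C e N : (forall n, `|u n| <= C) -> 0 < e ->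
  exists2 n, (N <= n)%N & rlimsup u - e < u n.
Proof.
move=> uC e0.
have : ((rlimsup u - e)%:E < ereal_sup ((fun n => (u n)%:E) @` [set n | (N <= n)%N]))%E.
  apply: (@lt_le_trans _ _ (rlimsup u)%:E); first by rewrite lte_fin ltrBlDr ltrDl.
  rewrite (EFin_rlimsup uC); apply: ereal_inf_lbound.
  by exists [set n | (N <= n)%N] => //; exists N.
by move=> /ereal_sup_gt[_ [n /= Nn <-]]; rewrite lte_fin; exists n.
Qed.

Lemma le_rlimsup u v C C' : (forall n, `|u n| <= C) -> (forall n, `|v n| <= C') ->
  (forall e, 0 < e -> exists N, forall n, (N <= n)%N -> u n <= v n + e) ->
  rlimsup u <= rlimsup v.
Proof.
move=> uC vC uv; apply/ler_addgt0Pr => e e0.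
have e3 : 0 < e / 3 by rewrite divr_gt0.
have [N1 N1P] := rlimsup_ub vC e3.
have [N2 N2P] := uv _ e3.
have [n + un] := rlimsup_freq (maxn N1 N2) uC e3.
rewrite geq_max => /andP[/N1P h1 /N2P h2]; clear -h1 h2 un; lra.
Qed.

Lemma rlimsup_cvg u l C : (forall n, `|u n| <= C) -> u n @[n --> \oo] --> l ->
  rlimsup u = l.
Proof.
move=> uC /cvgnP ul; apply/eqP; rewrite eq_le; apply/andP; split; apply/ler_addgt0Pr => e e0.
  have e2 : 0 < e / 2 by rewrite divr_gt0.
  have [N NP] := ul _ e2; have [n /NP + h] := rlimsup_freq N uC e2.
  by rewrite ler_norml => /andP[_ h2]; clear -h h2; lra.
have e2 : 0 < e / 2 by rewrite divr_gt0.
have [N NP] := ul _ e2; have [N' N'P] := rlimsup_ub uC e2.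
have := NP _ (leq_maxl N N'); have := N'P _ (leq_maxr N N').
by rewrite ler_norml => h /andP[h2 _]; clear -h h2; lra.
Qed.

(** The upper limit of [- u] is minus the lower limit of [u], so the hypothesis says that the upper
    limit does not exceed the lower one. *)
Lemma rlimsup_pinch u C : (forall n, `|u n| <= C) ->
  rlimsup u + rlimsup (fun n => - u n) <= 0 -> u n @[n --> \oo] --> rlimsup u.
Proof.
move=> uC h; apply/cvgnP => e e0.
have uC' n : `|- u n| <= C by rewrite normrN.
have [N NP] := rlimsup_ub uC e0; have [N' N'P] := rlimsup_ub uC' e0.
exists (maxn N N') => n; rewrite geq_max => /andP[/NP h1 /N'P h2].
by rewrite ler_norml; apply/andP; clear -h h1 h2; split; lra.
Qed.

Lemma rlimsup_N_ge u C : (forall n, `|u n| <= C) ->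
  0 <= rlimsup u + rlimsup (fun n => - u n).
Proof.
move=> uC; have uC' n : `|- u n| <= C by rewrite normrN.
apply/ler_addgt0Pr => e e0; have e2 : 0 < e / 2 by rewrite divr_gt0.
have [N NP] := rlimsup_ub uC e2; have [N' N'P] := rlimsup_ub uC' e2.
have := NP _ (leq_maxl N N'); have := N'P _ (leq_maxr N N').
by move=> h1 h2; clear -h1 h2; lra.
Qed.

Lemma measurable_rlimsup d (T : measurableType d) (f : nat -> T -> R) :
  (forall n, measurable_fun setT (f n)) ->
  measurable_fun setT (fun x => rlimsup (f ^~ x)).
Proof.
move=> mf.
have mg : measurable_fun setT (fun x => limn_esup (fun n => (f n x)%:E)).
  by apply: (@measurable_fun_limn_esup _ _ _ setT (fun n x => (f n x)%:E)) => n; exact/measurable_EFinP.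
exact: (measurableT_comp (fine_measurable measurableT) mg).
Qed.

End bounded_limsup.

(** * Birkhoff's theorem for one measure-preserving map *)

Section birkhoff.
Context {R : realType} {disp : measure_display} {X : measurableType disp}.
Context (mu : probability X R).
Implicit Types (f g h : X -> R).

Let muT_fin : (mu [set: X] < +oo)%E.
Proof. by rewrite probability_setT ltry. Qed.

Lemma bounded_DCT (F : nat -> X -> R) f C : (forall n, measurable_fun setT (F n)) ->
  measurable_fun setT f -> (forall n x, `|F n x| <= C) ->
  {ae mu, forall x, F n x @[n --> \oo] --> f x} ->
  \int[mu]_x F n x @[n --> \oo] --> \int[mu]_x f x.
Proof.
move=> mF mf FC Ff.
have [] := @dominated_convergence _ _ _ mu setT measurableT (fun n x => (F n x)%:E)
  (EFin \o f) (EFin \o cst C).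
- by move=> n; exact/measurable_EFinP.
- exact/measurable_EFinP.
- by apply: filterS Ff => x Fx _; apply/fine_cvgP; split; [exact: nearW|exact: Fx].
- exact: finite_measure_integrable_cst.
- by apply: aeW => x n _; rewrite lee_fin.
move=> iF _ cF; apply: fine_cvg.
rewrite /Rintegral fineK; last exact: integrable_fin_num.
exact: cF.
Qed.

Lemma bdm_max D f g : bdm D f -> bdm D g -> bdm D (fun x => Num.max (f x) (g x)).
Proof.
move=> [mf [C CP]] [mg [C' C'P]]; split; first exact: measurable_maxr.
exists (Num.max C C') => x Dx; rewrite le_max.
by case: (leP (f x) (g x)) => _; rewrite ?CP ?C'P ?orbT.
Qed.

Lemma bdm_ge0_ae0 f : bdm setT f -> (forall x, 0 <= f x) -> \int[mu]_x f x <= 0 ->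
  {ae mu, forall x, f x = 0}.
Proof.
move=> bf f0 If.
have /ae_eq_integral_abs : measurable_fun setT (EFin \o f) by apply/measurable_EFinP; exact: bf.1.
move=> /(_ mu measurableT)[+ _].
have -> : (\int[mu]_x `|(EFin \o f) x| = 0)%E.
  under eq_integral do rewrite /= ger0_norm//.
  rewrite -(EFin_bRint measurableT muT_fin bf); congr EFin; apply/eqP.
  by rewrite eq_le If Rintegral_ge0.
by move=> /(_ erefl); apply: filterS => x /(_ I)[].
Qed.

Variable T : X -> X.
Hypothesis mT : measurable_fun setT T.
Hypothesis TI : forall f, measurable_fun setT f -> \int[mu]_x f (T x) = \int[mu]_x f x.

Lemma bdm_T f : bdm setT f -> bdm setT (fun x => f (T x)).
Proof.
move=> [mf [C fC]]; split; last by exists C => *; exact: fC.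
exact: (measurableT_comp mf mT).
Qed.

(** The maximum of 0 and the partial ergodic sums of [h] of length at most [n], in the recursive
    form on which the maximal inequality rests. *)
Fixpoint pmax h n x : R := if n is m.+1 then Num.max 0 (h x + pmax h m (T x)) else 0.

Definition bsum g n x : R := \sum_(k < n) g (iter k T x).

Lemma bsumS g n x : bsum g n.+1 x = g x + bsum g n (T x).
Proof. by rewrite /bsum big_ord_recl; congr (_ + _); apply: eq_bigr => k _; rewrite -iterSr. Qed.

Lemma bdm_iter f k : bdm setT f -> bdm setT (fun x => f (iter k T x)).
Proof.
elim: k f => // k IH f bf; under eq_fun do rewrite iterSr.
exact: (bdm_T (IH _ bf)).
Qed.

Lemma bdm_pmax h n : bdm setT h -> bdm setT (pmax h n).
Proof.
move=> bh; elim: n => [|n IH]; first exact: bdm_cst.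
by apply: bdm_max; [exact: bdm_cst|apply: bdmD => //; exact: bdm_T].
Qed.

Lemma pmax_ge0 h n x : 0 <= pmax h n x.
Proof. by case: n => //= n; rewrite le_max lexx. Qed.

Lemma pmax_incr h n x : pmax h n x <= pmax h n.+1 x.
Proof.
elim: n x => [|n IH] x; first by rewrite /= le_max lexx.
rewrite [leLHS]/= [leRHS]/=; rewrite ge_max le_max lexx/= le_max.
by apply/orP; right; rewrite lerD2l; exact: IH.
Qed.

Lemma bsum_le_pmax h n x : bsum h n x <= pmax h n x.
Proof.
elim: n x => [|n IH] x; first by rewrite /bsum big_ord0.
by rewrite bsumS /= le_max lerD2l IH orbT.
Qed.

(* Garsia's proof of the maximal ergodic theorem. *)
Lemma maximal_ergodic h : bdm setT h -> (forall x, exists n, 0 < bsum h n x) ->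
  0 <= \int[mu]_x h x.
Proof.
move=> bh hpos; have [Ch Ch0 ChP] := bdm_bound bh.
pose E n := [set x | 0 < pmax h n x].
have mE n : measurable (E n).
  rewrite -[E n]setTI; have [mp _] := bdm_pmax n bh.
  exact: (measurable_fun_ltr (measurable_cst (0 : R)) mp) measurableT [set true] _.
have key n : 0 <= \int[mu]_x (h x * \1_(E n) x).
  have bp := bdm_pmax n bh.
  apply: (@le_trans _ _ (\int[mu]_x (pmax h n x - pmax h n (T x)))).
    by rewrite bRintB//; [rewrite TI ?subrr//; exact: bp.1|exact: bdm_T].
  apply: bRint_le => //.
  - by apply: bdmB => //; exact: bdm_T.
  - by apply: bdmM => //; exact: bdm_indic.
  move=> x _; rewrite indicE; have [Ex|nEx] := pselect (E n x).
    rewrite mem_set// mulr1 lerBlDr.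
    move: Ex; rewrite /E; case: n {mE bp} => [|n] /=; first by rewrite ltxx.
    rewrite lt_max ltxx/= => pos; rewrite max_r ?(ltW pos)// lerD2l.
    exact: pmax_incr.
  rewrite memNset// mulr0 subr_le0 (le_trans _ (pmax_ge0 _ _ _))//.
  by rewrite leNgt; apply/negP.
have cv : \int[mu]_x (h x * \1_(E n) x) @[n --> \oo] --> \int[mu]_x h x.
  apply: (@bounded_DCT _ _ Ch).
  + by move=> n; apply: measurable_funM; [exact: bh.1|exact: measurable_indic].
  + exact: bh.1.
  + move=> n x; rewrite normrM indicE.
    by case: (_ \in _); rewrite ?normr1 ?normr0 ?mulr1 ?mulr0 ?ChP// ltW.
  + apply: aeW => x; apply/cvgnP => e e0; have [n npos] := hpos x.
    exists n => m nm; rewrite indicE mem_set ?mulr1 ?subrr ?normr0 ?ltW//.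
    rewrite /E /= (lt_le_trans npos)// (le_trans (bsum_le_pmax _ _ _))//.
    elim: m nm => [|m IH]; first by rewrite leqn0 => /eqP ->.
    rewrite leq_eqVlt => /orP[/eqP -> //|]; rewrite ltnS => /IH/le_trans; apply.
    exact: pmax_incr.
by rewrite -(cvg_lim _ cv)//; apply: (limr_ge (cvgP _ cv)); exact: nearW.
Qed.

Definition bavg g n x : R := n.+1%:R^-1 * bsum g n.+1 x.

Lemma bdm_bsum g n : bdm setT g -> bdm setT (bsum g n).
Proof. by move=> bg; apply: bdm_sum => k; exact: bdm_iter. Qed.

Lemma bdm_bavg g n : bdm setT g -> bdm setT (bavg g n).
Proof. by move=> bg; apply: bdmZ; exact: bdm_bsum. Qed.

Lemma bavg_bound g C n x : (forall x, `|g x| <= C) -> `|bavg g n x| <= C.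
Proof.
move=> gC; rewrite /bavg normrM ger0_norm ?invr_ge0// ler_pdivrMl//.
rewrite (le_trans (ler_norm_sum _ _ _))// mulr_natl -[X in _ *+ X](card_ord n.+1).
by rewrite -sumr_const ler_sum.
Qed.

Lemma le_bavg f g n x : (forall x, f x <= g x) -> bavg f n x <= bavg g n x.
Proof. by move=> fg; rewrite /bavg ler_wpM2l ?invr_ge0// ler_sum. Qed.

Lemma bavgB f g n x : bavg (fun x => f x - g x) n x = bavg f n x - bavg g n x.
Proof. by rewrite /bavg -mulrBr -sumrB. Qed.

Lemma bavgN g n x : bavg (fun x => - g x) n x = - bavg g n x.
Proof. by rewrite /bavg -mulrN -sumrN. Qed.

Lemma bavg_norm g n x : `|bavg g n x| <= bavg (fun x => `|g x|) n x.
Proof.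
rewrite /bavg normrM ger0_norm ?invr_ge0// ler_wpM2l ?invr_ge0//.
exact: ler_norm_sum.
Qed.

(** The sums at [x] and at [T x] share all but one term each. The invariance holds at every point,
    not just almost everywhere. *)
Lemma bavg_limsup_T g x : bdm setT g ->
  rlimsup (fun n => bavg g n (T x)) = rlimsup (fun n => bavg g n x).
Proof.
move=> bg; have [C C0 CP] := bdm_bound bg.
have gC y : `|g y| <= C by exact: CP.
have diff n : `|bavg g n (T x) - bavg g n x| <= 2 * C / n.+1%:R.
  rewrite /bavg -mulrBr normrM ger0_norm ?invr_ge0// mulrC ler_wpM2r ?invr_ge0//.
  have E : bsum g n.+1 (T x) + g x = bsum g n.+1 x + g (iter n.+1 T x).
    by rewrite addrC -bsumS /bsum big_ord_recr.
  have -> : bsum g n.+1 (T x) - bsum g n.+1 x = g (iter n.+1 T x) - g x.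
    by apply/eqP; rewrite subr_eq addrAC eq_sym subr_eq eq_sym E addrC.
  by rewrite (le_trans (ler_normB _ _))// mulr2n mulrDl mul1r lerD.
have small e : 0 < e -> exists N, forall n, (N <= n)%N -> 2 * C / n.+1%:R <= e.
  move=> e0; exists (Num.truncn (2 * C / e)) => n Nn.
  rewrite ler_pdivrMr// -ler_pdivrMl// mulrC; apply: ltW.
  by apply: lt_le_trans (truncnS_gt _) _; rewrite ler_nat.
have bC y n : `|bavg g n y| <= C by exact: bavg_bound.
apply/eqP; rewrite eq_le; apply/andP; split.
  apply: (@le_rlimsup _ _ _ C C) => // e /small[N NP]; exists N => n /NP h.
  by have := le_trans (diff n) h; rewrite ler_norml => /andP[_]; rewrite lerBlDr addrC.
apply: (@le_rlimsup _ _ _ C C) => // e /small[N NP]; exists N => n /NP h.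
have := le_trans (diff n) h; rewrite ler_norml => /andP[+ _].
by rewrite lerBrDr addrC lerBlDr.
Qed.

Lemma bdm_limsup (F : nat -> X -> R) C : (forall n, measurable_fun setT (F n)) ->
  (forall n x, `|F n x| <= C) -> bdm setT (fun x => rlimsup (F ^~ x)).
Proof.
move=> mF FC; split; first exact: measurable_rlimsup.
by exists C => x _; apply: rlimsup_bounded => n.
Qed.

(** The maximal inequality is applied to [g] minus its upper limit plus [e]: since the upper limit
    is constant along orbits, the ergodic sums of this function are positive as soon as an average
    comes within [e] of the upper limit. *)
Lemma int_limsup_le g : bdm setT g ->
  \int[mu]_x rlimsup (fun n => bavg g n x) <= \int[mu]_x g x.
Proof.
move=> bg; have [C C0 CP] := bdm_bound bg.
have gC y : `|g y| <= C by exact: CP.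
have bC y n : `|bavg g n y| <= C by exact: bavg_bound.
have bL : bdm setT (fun x => rlimsup (fun n => bavg g n x)).
  by apply: (@bdm_limsup (fun n => bavg g n) C) => // n; exact: (bdm_bavg n bg).1.
apply/ler_addgt0Pr => e e0.
have bh : bdm setT (fun x => g x - rlimsup (fun n => bavg g n x) + e).
  by apply: bdmD; [exact: bdmB|exact: bdm_cst].
have : 0 <= \int[mu]_x (g x - rlimsup (fun n => bavg g n x) + e).
  apply: maximal_ergodic => // x.
  have [n _ nP] := rlimsup_freq 0 (bC x) e0; exists n.+1.
  have LT k : rlimsup (fun n => bavg g n (iter k T x)) = rlimsup (fun n => bavg g n x).
    by elim: k => // k IH; rewrite iterS bavg_limsup_T.
  rewrite /bsum big_split/= sumrB.
  under [X in _ - X + _]eq_bigr do rewrite LT.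
  rewrite !sumr_const card_ord -/(bsum g n.+1 x).
  have -> : bsum g n.+1 x = n.+1%:R * bavg g n x by rewrite /bavg mulVKf.
  rewrite -(mulr_natl (rlimsup _)) -(mulr_natl e) -mulrBr -mulrDr mulr_gt0//.
  by rewrite ltrBlDr in nP; rewrite addrAC subr_gt0.
rewrite bRintD//; [|exact: bdmB|exact: bdm_cst].
rewrite bRintB// Rintegral_cst// -[X in _ * X]/(fine (mu [set: X])) probability_setT mulr1.
by rewrite addrAC subr_ge0.
Qed.

(** The integral bound for [g] and for [- g] shows that the upper limit minus the lower limit has
    integral at most zero; being nonnegative, it vanishes almost everywhere. *)
Lemma birkhoff g : bdm setT g -> exists2 g', bdm setT g' &
  {ae mu, forall x, bavg g n x @[n --> \oo] --> g' x}.
Proof.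
move=> bg; have [C C0 CP] := bdm_bound bg.
have gC y : `|g y| <= C by exact: CP.
have bC y n : `|bavg g n y| <= C by exact: bavg_bound.
have gC' y : `|- g y| <= C by rewrite normrN.
have bC' y n : `|bavg (fun x => - g x) n y| <= C by exact: bavg_bound.
have bL : bdm setT (fun x => rlimsup (fun n => bavg g n x)).
  by apply: (@bdm_limsup (fun n => bavg g n) C) => // n; exact: (bdm_bavg n bg).1.
have bgN := bdmN bg.
have bL' : bdm setT (fun x => rlimsup (fun n => bavg (fun x => - g x) n x)).
  by apply: (@bdm_limsup (fun n => bavg (fun x => - g x) n) C) => // n; exact: (bdm_bavg n bgN).1.
exists (fun x => rlimsup (fun n => bavg g n x)) => //.
have E x : (fun n => bavg (fun x => - g x) n x) = (fun n => - bavg g n x).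
  by apply/funext => n; exact: bavgN.
have : {ae mu, forall x, rlimsup (fun n => bavg g n x) +
    rlimsup (fun n => bavg (fun x => - g x) n x) = 0}.
  apply: bdm_ge0_ae0; first exact: bdmD.
    by move=> x; rewrite E (@rlimsup_N_ge _ _ C).
  rewrite bRintD//; have := int_limsup_le bg; have := int_limsup_le bgN.
  by rewrite bRintN// => h1 h2; rewrite -(subrr (\int[mu]_x g x)) lerD.
apply: filterS => x h; apply: (@rlimsup_pinch _ _ C) => //.
by rewrite -E h.
Qed.

(** Maker's extension of Birkhoff's theorem, needed to iterate averages over several directions,
    where the inner average depends on the same [n] as the outer one. The error [u n] is dominated
    by its tail supremum [G m], whose integral tends to zero with [m], and the averages of [G m] are
    controlled by the integral bound on upper limits. *)
Lemma birkhoff_seq (F : nat -> X -> R) f C : (forall n, measurable_fun setT (F n)) ->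
  (forall n x, `|F n x| <= C) -> bdm setT f ->
  {ae mu, forall x, F n x @[n --> \oo] --> f x} ->
  exists2 f', bdm setT f' & {ae mu, forall x, bavg (F n) n x @[n --> \oo] --> f' x}.
Proof.
move=> mF FC bf Ff; have [f' bf' f'P] := birkhoff bf; exists f' => //.
have [Cf Cf0 CfP] := bdm_bound bf.
pose K := C + Cf.
pose u n x := `|F n x - f x|.
have bF n : bdm setT (F n) by split => //; exists C => x _; exact: FC.
have bu n : bdm setT (u n) by apply: bdm_norm; exact: bdmB.
have u0 n x : 0 <= u n x by exact: normr_ge0.
have uK n x : u n x <= K.
  by rewrite /u (le_trans (ler_normB _ _))// lerD// CfP.
have uK' n x : `|u n x| <= K by rewrite ger0_norm.
pose G m x := fine (esups (fun n => (u n x)%:E) m).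
have GE m x : (G m x)%:E = esups (fun n => (u n x)%:E) m.
  rewrite fineK// fin_numE -ltNye -ltey; apply/andP; split.
    apply: (lt_le_trans (ltNyr (u m x))); apply: ereal_sup_ubound.
    by exists m => //=.
  apply: (@le_lt_trans _ _ K%:E); last exact: ltry.
  by apply: ge_ereal_sup => _ [n _ <-]; rewrite lee_fin.
have uG m n x : (m <= n)%N -> u n x <= G m x.
  by move=> mn; rewrite -lee_fin GE; apply: ereal_sup_ubound; exists n.
have G0 m x : 0 <= G m x by rewrite (le_trans (u0 m x)) ?uG.
have GK m x : G m x <= K.
  by rewrite -lee_fin GE; apply: ge_ereal_sup => _ [n _ <-]; rewrite lee_fin.
have bG m : bdm setT (G m).
  split; last by exists K => x _; rewrite ger0_norm.
  apply: (measurableT_comp (fine_measurable measurableT)).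
  by apply: (@measurable_fun_esups _ _ _ setT (fun n x => (u n x)%:E)) => n;
    apply/measurable_EFinP; exact: (bu n).1.
have IG : \int[mu]_x G m x @[m --> \oo] --> \int[mu]_x (0 : R).
  apply: (@bounded_DCT _ _ K).
  - by move=> m; exact: (bG m).1.
  - exact: measurable_cst.
  - by move=> m x; rewrite ger0_norm.
  - apply: filterS Ff => x /cvgnP Fx; apply/cvgnP => e /Fx[N NP].
    exists N => m Nm; rewrite subr0 ger0_norm// -lee_fin GE.
    apply: ge_ereal_sup => _ [n /= mn <-]; rewrite lee_fin.
    by apply: NP; exact: leq_trans mn.
pose H x := rlimsup (fun n => bavg (u n) n x).
have bavgu n x : `|bavg (u n) n x| <= K by exact: bavg_bound.
have bavgu0 n x : 0 <= bavg (u n) n x.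
  by rewrite /bavg mulr_ge0 ?invr_ge0// sumr_ge0.
have bH : bdm setT H.
  by apply: (@bdm_limsup (fun n => bavg (u n) n) K) => // n; exact: (bdm_bavg n (bu n)).1.
have H0 x : 0 <= H x.
  rewrite -[leLHS](@rlimsup_cvg _ (fun=> 0) 0 0); last 2 first.
  - by move=> n; rewrite normr0.
  - exact: cvg_cst.
  apply: (@le_rlimsup _ _ _ 0 K) => // [n|e e0]; first by rewrite normr0.
  by exists 0%N => n _; rewrite addr_ge0 ?(ltW e0).
have IH : \int[mu]_x H x <= 0.
  have bGK m n x : `|bavg (G m) n x| <= K by apply: bavg_bound => y; rewrite ger0_norm.
  have le m : \int[mu]_x H x <= \int[mu]_x G m x.
    apply: le_trans (int_limsup_le (bG m)); apply: bRint_le => //.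
      by apply: (@bdm_limsup (fun n => bavg (G m) n) K) => // n; exact: (bdm_bavg n (bG m)).1.
    move=> x _; apply: (@le_rlimsup _ _ _ K K) => // e e0.
    exists m => n mn; apply: (@le_trans _ _ (bavg (G m) n x)); last by rewrite lerDl ltW.
    by apply: le_bavg => y; exact: uG.
  rewrite -(Rint0 mu measurableT) -(cvg_lim _ IG)//.
  by apply: (limr_ge (cvgP _ IG)); exact: nearW.
have aeH := bdm_ge0_ae0 bH H0 IH.
apply: filterS2 f'P aeH => x f'x Hx; apply/cvgnP => e e0.
have e2 : 0 < e / 2 by rewrite divr_gt0.
have /cvgnP/(_ _ e2)[N NP] := f'x.
have [N' N'P] := rlimsup_ub (bavgu ^~ x) e2.
exists (maxn N N') => n; rewrite geq_max => /andP[/NP h1 /N'P].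
rewrite -/(H x) Hx add0r => h2.
have h3 : `|bavg (F n) n x - bavg f n x| <= e / 2.
  by rewrite -bavgB (le_trans (bavg_norm _ _ _)).
rewrite -(subrK (bavg f n x) (bavg (F n) n x)) -addrA (le_trans (ler_normD _ _))//.
by rewrite (splitr e) lerD.
Qed.

End birkhoff.

Lemma bRint_setU {R : realType} {disp : measure_display} {T : measurableType disp}
    (m : {measure set T -> \bar R}) (A B : set T) (f : T -> R) :
  measurable A -> measurable B -> (m (A `|` B) < +oo)%E -> (forall x, A x -> ~ B x) ->
  bdm (A `|` B) f ->
  \int[m]_(x in A `|` B) f x = \int[m]_(x in A) f x + \int[m]_(x in B) f x.
Proof.
move=> mA mB fin dis bf; apply: Rintegral_setU => //.
  by apply: bdm_int => //; exact: measurableU.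
by apply/disj_setPLR => x Ax; exact: dis.
Qed.

Lemma bRint_setB {R : realType} {disp : measure_display} {T : measurableType disp}
    (m : {measure set T -> \bar R}) (D E : set T) (f : T -> R) (C : R) :
  measurable D -> measurable E -> (m D < +oo)%E -> E `<=` D -> bdm D f ->
  (forall x, D x -> `|f x| <= C) ->
  `|\int[m]_(x in D) f x - \int[m]_(x in E) f x| <= C * (fine (m D) - fine (m E)).
Proof.
move=> mD mE Dfin ED bf fC.
have Efin : (m E < +oo)%E by apply: le_lt_trans Dfin; apply: le_measure => //; rewrite inE.
have b1 : bdm D (\1_E : T -> R) by exact: bdm_indic.
have E1 g : bdm D g -> \int[m]_(x in E) g x = \int[m]_(x in D) (g x * \1_E x).
  move=> bg; rewrite (@bRint_sub _ _ _ m D E)//.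
  - by apply: eq_Rintegral => x xE; rewrite indicE xE mulr1.
  - exact: bdmM.
  - by move=> x Dx nE; rewrite indicE memNset// mulr0.
have cst1 (S : set T) : measurable S -> \int[m]_(x in S) (1 : R) = fine (m S).
  by move=> mS; rewrite Rintegral_cst// mul1r.
have -> : fine (m D) - fine (m E) = \int[m]_(x in D) (1 - \1_E x).
  rewrite bRintB//; [|exact: bdm_cst].
  rewrite (cst1 D mD) -(cst1 E mE) (E1 _ (bdm_cst D 1)).
  by under eq_Rintegral do rewrite mul1r.
rewrite (E1 f bf) -bRintB//; last exact: bdmM.
have b2 : bdm D (fun x => f x - f x * \1_E x) by apply: bdmB => //; exact: bdmM.
have b3 := bdmB (bdm_cst D (1 : R)) b1.
apply: le_trans (bRint_norm mD Dfin b2) _; rewrite -bRintZ//.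
apply: bRint_le => //; [exact: bdm_norm|exact: bdmZ|].
move=> x Dx; rewrite indicE; case: (x \in E); rewrite ?mulr1 ?subrr ?normr0 ?mulr0//.
by rewrite !subr0 mulr1 fC.
Qed.

(** * The ergodic theorem for the action of R^d *)

Section multidimensional_ergodic_theorem.
Context {R : realType} {d : nat} {disp : measure_display}
  {X : measurableType disp} (mu : probability X R)
  (tau : 'rV[R]_d -> X -> X).
Hypothesis htau : ergodic_action mu tau.
Local Notation lambda := (@lebn R d).
Implicit Types (f g : X -> R) (L : 'I_d -> nat).

Let T i : X -> X := tau (- delta_mx 0 i).

Let iterT k i eta : iter k (T i) eta = tau (- (k%:R *: delta_mx 0 i)) eta.
Proof.
elim: k => [|k IH]; first by rewrite scale0r (tau0 htau).
by rewrite iterS IH /T -(tauD htau) -[k.+1%:R]natr1 scalerDl scale1r addrC.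
Qed.

Definition intbox L : set 'rV[R]_d := boxn (fun j => `[0, (L j)%:R[%classic).

Lemma measurable_intbox L : measurable (intbox L).
Proof. by apply: measurable_boxn => i; exact: measurable_itv. Qed.

Lemma intbox_fin L : (lambda (intbox L) < +oo)%E.
Proof.
apply: le_lt_trans (lebn_cube_fin d 0 (\sum_j L j)%:R).
apply: le_measure; rewrite ?inE; [exact: measurable_intbox|exact: measurable_cube|].
move=> x Lx j; have := Lx j; rewrite /= !in_itv/= => /andP[-> h].
by rewrite (lt_le_trans h)// ler_nat (bigD1 j)//= leq_addr.
Qed.

Definition boxint L f eta := \int[lambda]_(x in intbox L) f (tau (- x) eta).

Let updn L i m : 'I_d -> nat := fun j => if j == i then m else L j.

Let boxintS L i m f eta : bdm setT f -> boxint (updn L i m.+1) f eta =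
  boxint (updn L i m) f eta + boxint (updn L i 1) f (tau (- (m%:R *: delta_mx 0 i)) eta).
Proof.
move=> bf; pose a : 'rV[R]_d := m%:R *: delta_mx 0 i.
pose D : set 'rV[R]_d := [set x | intbox (updn L i 1) (x - a)].
have xaE (x : 'rV[R]_d) j : (x - a) 0 j = x 0 j - if j == i then m%:R else 0.
  by rewrite !mxE eqxx/=; case: eqP => _; rewrite ?mulr1 ?mulr0.
have mD : measurable D.
  rewrite -[D]setTI; apply: (measurable_addr (- a)) => //; exact: measurable_intbox.
have bo := bdm_orbit htau eta bf.
have -> : boxint (updn L i 1) f (tau (- a) eta) = \int[lambda]_(x in D) f (tau (- x) eta).
  rewrite -(Rint_shift a mD bo.1) /boxint.
  have -> : [set x | D (x + a)] = intbox (updn L i 1).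
    by apply/seteqP; split => x; rewrite /D /= addrK.
  by apply: eq_Rintegral => x _; rewrite (tauD htau).
have U : intbox (updn L i m.+1) = intbox (updn L i m) `|` D.
  apply/seteqP; split => x.
    move=> xL; have [h|h] := ltP (x 0 i) m%:R; [left|right] => j; have := xL j;
      rewrite /= /updn ?xaE !in_itv/=; case: eqP => [->|_]//; rewrite ?subr0//.
      by rewrite h andbT => /andP[].
    by rewrite subr_ge0 h ltrBlDr nat1r => /andP[].
  move=> [xL|xL] j; have := xL j; rewrite /= /updn ?xaE !in_itv/=;
    case: eqP => [_|_]//; rewrite ?subr0//.
    by move=> /andP[-> h]; rewrite (lt_trans h)// ltr_nat.
  rewrite subr_ge0 ltrBlDr nat1r => /andP[h ->]; rewrite andbT.
  by apply: le_trans h; rewrite ler0n.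
rewrite {1}/boxint U bRint_setU//.
- exact: measurable_intbox.
- by rewrite -U; exact: intbox_fin.
- move=> x /(_ i) + /(_ i); rewrite /= /updn ?xaE eqxx !in_itv/=.
  by move=> /andP[_ h] /andP[+ _]; rewrite subr_ge0 leNgt h.
- exact: bdm_sub bo.
Qed.

Let boxint_sum L i m f eta : bdm setT f ->
  boxint (updn L i m) f eta = \sum_(k < m) boxint (updn L i 1) f (iter k (T i) eta).
Proof.
move=> bf; elim: m => [|m IH].
  rewrite big_ord0 /boxint (_ : intbox _ = set0) ?Rintegral_set0//.
  apply/seteqP; split => x // /(_ i); rewrite /= /updn eqxx in_itv/= => /andP[h].
  by rewrite ltNge h.
by rewrite boxintS// IH big_ord_recr/= iterT.
Qed.

(** Successive Birkhoff averages in the directions listed by [s], all of the same length. Over all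
    directions, starting from the integral over the unit cell, they reproduce the average over a
    cube of integer side. *)
Fixpoint itavg (s : seq 'I_d) n f : X -> R :=
  if s is i :: s' then bavg (T i) (itavg s' n f) n else f.

Let boxint_itavg (s : seq 'I_d) n f eta : bdm setT f -> uniq s ->
  boxint (fun j => if j \in s then n.+1 else 1%N) f eta =
  n.+1%:R ^+ size s * itavg s n (boxint (fun=> 1%N) f) eta.
Proof.
move=> bf; elim: s eta => [|i s IH] eta /=; first by rewrite expr0 mul1r.
move=> /andP[is_ us].
have -> : (fun j => if j \in i :: s then n.+1 else 1%N) =
    updn (fun j => if j \in s then n.+1 else 1%N) i n.+1.
  by apply/funext => j; rewrite inE /updn; case: eqP.
rewrite boxint_sum//.
have -> : updn (fun j => if j \in s then n.+1 else 1%N) i 1 =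
    fun j => if j \in s then n.+1 else 1%N.
  by apply/funext => j; rewrite /updn; case: eqP => // ->; rewrite (negPf is_).
under eq_bigr do rewrite IH//.
by rewrite -mulr_sumr /bavg exprSr -mulrA mulVKf.
Qed.

Definition davg f (N : R) eta := N^-1 ^+ d * \int[lambda]_(x in cube 0 N) f (tau (- x) eta).

Lemma bdm_davg f N : bdm setT f -> bdm setT (davg f N).
Proof.
move=> bf; apply: bdmZ.
apply: (@bdm_Rint _ _ _ _ _ lambda setT _ (fun p => f (tau (- p.2) p.1))).
- exact: measurable_cube.
- exact: lebn_cube_fin.
- by apply: bdm_sub (bdm_tau_joint htau bf).
Qed.

Lemma davg_itavg f n eta : bdm setT f ->
  davg f n.+1%:R eta = itavg (enum 'I_d) n (boxint (fun=> 1%N) f) eta.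
Proof.
move=> bf; have := boxint_itavg n eta bf (enum_uniq 'I_d).
rewrite size_enum_ord => h; rewrite /davg.
have -> : cube 0 n.+1%:R = intbox (fun j => if j \in enum 'I_d then n.+1 else 1%N).
  by rewrite /cube /intbox; congr boxn; apply/funext => j; rewrite mem_enum.
by rewrite -/(boxint _ f eta) h mulrA -exprMn mulVf// expr1n mul1r.
Qed.

Lemma davg_bound f C N eta : bdm setT f -> (forall eta, `|f eta| <= C) -> 0 < N ->
  `|davg f N eta| <= C.
Proof.
move=> bf fC N0; rewrite normrM ger0_norm ?exprn_ge0 ?invr_ge0 ?(ltW N0)//.
have bo := bdm_orbit htau eta bf.
have h : `|\int[lambda]_(x in cube 0 N) f (tau (- x) eta)| <=
    C * fine (@lebn R d (cube 0 N)).
  exact: (bRint_bound (measurable_cube _ _) (lebn_cube_fin _ _ _)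
    (bdm_sub (subsetT _) bo) (fun x _ => fC _)).
rewrite lebn_cube ?(ltW N0)//= subr0 in h.
rewrite exprVn ler_pdivrMl ?exprn_gt0// mulrC; exact: h.
Qed.

Lemma Rint_davg f N : bdm setT f -> 0 < N -> \int[mu]_eta davg f N eta = \int[mu]_eta f eta.
Proof.
move=> bf N0; have bG : bdm (setT `*` cube 0 N) (fun p : X * 'rV[R]_d => f (tau (- p.2) p.1)).
  by apply: bdm_sub (bdm_tau_joint htau bf).
have mC := @measurable_cube R d 0 N; have fC := @lebn_cube_fin R d 0 N.
rewrite bRintZ//; [|exact: (muT_fin mu)|
  exact: (@bdm_Rint _ _ _ _ _ lambda setT _ _ mC fC bG)].
rewrite (bRint_Fubini (m1 := mu) (m2 := lambda) measurableT mC (muT_fin mu) fC bG).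
rewrite (@eq_Rintegral _ _ _ lambda _ (fun=> \int[mu]_eta f eta)); last first.
  by move=> y _ /=; rewrite (Rint_tau htau y bf.1).
rewrite Rint_cst_cube ?(ltW N0)// subr0 mulrCA -exprMn mulVf ?gt_eqF// expr1n mulr1//.
Qed.

Let mT i : measurable_fun setT (T i). Proof. exact: (measurable_tau htau). Qed.

Let TI i f : measurable_fun setT f -> \int[mu]_x f (T i x) = \int[mu]_x f x.
Proof. exact: (Rint_tau htau). Qed.

Let bdm_boxint f : bdm setT f -> bdm setT (boxint (fun=> 1%N) f).
Proof.
move=> bf; apply: (@bdm_Rint _ _ _ _ _ lambda setT _ (fun p => f (tau (- p.2) p.1))).
- exact: measurable_intbox.
- exact: intbox_fin.
- by apply: bdm_sub (bdm_tau_joint htau bf).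
Qed.

Let itavg_cvg s f : bdm setT f -> exists2 f', bdm setT f' &
  {ae mu, forall eta, itavg s n f eta @[n --> \oo] --> f' eta}.
Proof.
move=> bf; have [C C0 CP] := bdm_bound bf.
suff [H1 [H2 H3]] : (forall n, bdm setT (itavg s n f)) /\
   (forall n eta, `|itavg s n f eta| <= C) /\ exists2 f', bdm setT f' &
    {ae mu, forall eta, itavg s n f eta @[n --> \oo] --> f' eta} by [].
elim: s => [|i s [IH1 [IH2 [f' bf' IH3]]]]; split => //=.
- split => [n eta|]; first exact: CP.
  by exists f => //; apply: aeW => eta; exact: cvg_cst.
- by move=> n; exact: bdm_bavg.
split => [n eta|]; first by apply: bavg_bound => x; exact: IH2.
exact: (@birkhoff_seq _ _ _ mu (T i) (@mT i) (@TI i) (fun n => itavg s n f) f' C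
  (fun n => (IH1 n).1) IH2 bf' IH3).
Qed.

Lemma norm_coord_le (y : 'rV[R]_d) (M : R) j : `|y| <= M -> - M <= y 0 j <= M.
Proof. by move=> yM; rewrite -ler_norml (le_trans (coord_le_norm y j)). Qed.

Lemma bernoulli_expr (t : R) n : 0 <= t <= 1 -> 1 - (1 - t) ^+ n <= n%:R * t.
Proof.
move=> /andP[t0 t1]; elim: n => [|n IH]; first by rewrite expr0 subrr mul0r.
rewrite exprS -natr1 [(n%:R + 1) * t]mulrDl mul1r.
have h : 0 <= (1 - t) ^+ n <= 1 by rewrite exprn_ge0 ?exprn_ile1//; lra.
move: h IH; move: (_ ^+ n) (_ * t) => a b /andP[a0 a1] IH.
have h : t * a <= t by rewrite ler_piMr.
lra.
Qed.

(** The cube and its translate both contain the cube with all coordinates between [M] and [N - M];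
    by Bernoulli's inequality each loses at most a fraction [2 * M * d / N] of its volume. *)
Let davg_shift f C N y M eta : bdm setT f -> (forall eta, `|f eta| <= C) ->
  `|y| <= M -> 0 < N -> 2 * M <= N ->
  `|davg f N (tau (- y) eta) - davg f N eta| <= C * (d%:R * (2 * M / N)) *+ 2.
Proof.
move=> bf fC yM N0 MN.
have M0 : 0 <= M by apply: le_trans yM.
have bo := bdm_orbit htau eta bf.
have C0 : 0 <= C by apply: le_trans (fC eta).
pose K : set 'rV[R]_d := cube M (N - M).
pose D : set 'rV[R]_d := [set x | cube 0 N (x - y)].
have mD : measurable D.
  rewrite -[D]setTI; apply: (measurable_addr (- y)) => //; exact: measurable_cube.
have E : \int[lambda]_(x in cube 0 N) f (tau (- x) (tau (- y) eta)) =
    \int[lambda]_(x in D) f (tau (- x) eta).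
  rewrite -(Rint_shift y mD bo.1).
  have -> : [set x | D (x + y)] = cube 0 N.
    by apply/seteqP; split => x; rewrite /D /= addrK.
  by apply: eq_Rintegral => x _; rewrite (tauD htau).
have lD : lambda D = lambda (cube 0 N).
  by rewrite -[RHS](lebn_shift (- y) (measurable_cube 0 N)).
have KD : K `<=` D.
  move=> x xK j; have := xK j; have := norm_coord_le j yM; rewrite /= !mxE !in_itv/=.
  by move=> /andP[h1 h2] /andP[h3 h4]; apply/andP; split; lra.
have KC : K `<=` cube 0 N.
  move=> x xK j; have := xK j; rewrite /= !in_itv/=.
  by move=> /andP[h3 h4]; apply/andP; split; lra.
have l1 : `|\int[lambda]_(x in D) f (tau (- x) eta) -
      \int[lambda]_(x in K) f (tau (- x) eta)| <=
    C * (fine (lambda (cube 0 N)) - fine (lambda K)).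
  rewrite -lD; apply: (bRint_setB mD (measurable_cube _ _) _ KD
    (bdm_sub (subsetT _) bo) (fun x _ => fC _)).
  by have := lebn_cube_fin d 0 N; rewrite -lD.
have l2 : `|\int[lambda]_(x in cube 0 N) f (tau (- x) eta) -
      \int[lambda]_(x in K) f (tau (- x) eta)| <=
    C * (fine (lambda (cube 0 N)) - fine (lambda K)).
  have := @bRint_setB _ _ _ lambda (cube 0 N) K _ C (measurable_cube _ _)
  (measurable_cube _ _) (lebn_cube_fin _ _ _) KC
  (bdm_sub (subsetT _) bo) (fun x _ => fC _).
  exact.
rewrite /davg E -mulrBr normrM ger0_norm ?exprn_ge0 ?invr_ge0 ?(ltW N0)//.
have key : fine (lambda (cube 0 N)) - fine (lambda K) <= N ^+ d * (d%:R * (2 * M / N)).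
  rewrite !lebn_cube//=; [|lra|lra].
  rewrite subr0 (_ : N - M - M = N * (1 - 2 * M / N)); last by field; rewrite gt_eqF.
  rewrite exprMn -{1}[N ^+ d]mulr1 -mulrBr ler_pM2l ?exprn_gt0//.
  apply: bernoulli_expr; rewrite divr_ge0 ?mulr_ge0 ?(ltW N0)//=.
  by rewrite ler_pdivrMr// mul1r.
rewrite exprVn ler_pdivrMl ?exprn_gt0//.
have {}l1 := le_trans l1 (ler_wpM2l C0 key); have {}l2 := le_trans l2 (ler_wpM2l C0 key).
rewrite -(subrKA (\int[lambda]_(x in K) f (tau (- x) eta))) (le_trans (ler_normD _ _))//.
rewrite [X in _ + X <= _]distrC mulrnAr mulr2n lerD//; 
  by rewrite mulrCA.
Qed.

(** The superlevel set at the mean is invariant, so its measure is 0 or 1 and [f] minus its mean has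
    a constant sign almost everywhere; a function of constant sign with zero integral vanishes
    almost everywhere. *)
Lemma ergodic_constant f : bdm setT f ->
  (forall y eta, f (tau (- y) eta) = f eta) ->
  {ae mu, forall eta, f eta = \int[mu]_eta f eta}.
Proof.
move=> bf finv; pose c := \int[mu]_eta f eta.
have bg : bdm setT (fun eta => f eta - c) by apply: bdmB => //; exact: bdm_cst.
have I0 : \int[mu]_eta (f eta - c) = 0.
  rewrite bRintB//; [|exact: (muT_fin mu)|exact: bdm_cst].
  by rewrite Rintegral_cst// (fine_muT mu) mulr1 subrr.
pose B := [set eta | 0 < f eta - c].
have mB : measurable B.
  rewrite -[B]setTI.
  exact: (measurable_fun_ltr (measurable_cst (0 : R)) bg.1) measurableT [set true] _.
have Binv x : tau x @` B = B.
  have finv' eta : f (tau x eta) = f eta by rewrite -[x]opprK finv.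
  apply/seteqP; split => eta /=; first by move=> [z Bz <-]; rewrite /B /= finv'.
  move=> Beta; exists (tau (- x) eta); first by rewrite /B /= finv.
  by rewrite -(actionD htau) subrr (action0 htau).
have ae0 (s : R) : s ^+ 2 = 1 -> {ae mu, forall eta, 0 <= s * (f eta - c)} ->
    {ae mu, forall eta, f eta = c}.
  move=> s1 aes; have bsg := bdmZ s bg.
  have abs eta : `|s * (f eta - c)| = `|f eta - c|.
    rewrite normrM; suff -> : `|s| = 1 by rewrite mul1r.
    by apply/eqP; rewrite -(@pexpr_eq1 _ _ 2)// real_normK ?num_real// s1.
  have : {ae mu, forall eta, `|f eta - c| = 0}.
    apply: bdm_ge0_ae0; [exact: bdm_norm|by move=> ?; exact: normr_ge0|].
    have -> : \int[mu]_x `|f x - c| = \int[mu]_x (s * (f x - c)).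
      rewrite /Rintegral; congr fine; apply: ae_eq_integral => //.
      - by apply/measurable_EFinP; exact: (bdm_norm bg).1.
      - by apply/measurable_EFinP; exact: bsg.1.
      - by apply: filterS aes => eta h _; rewrite -abs ger0_norm.
    by rewrite bRintZ ?I0 ?mulr0//; exact: (muT_fin mu).
  by apply: filterS => eta /eqP; rewrite normr_eq0 subr_eq0 => /eqP.
have [B0|B1] := action_ergodic htau mB Binv.
  apply: (ae0 (-1)); first by rewrite sqrrN expr1n.
  exists B; split => // eta /= h; rewrite /B /= ltNge; apply/negP => h'; apply: h.
  by rewrite mulN1r oppr_ge0.
apply: (ae0 1); first by rewrite expr1n.
exists (~` B); split; [exact: measurableC| |].
  by rewrite probability_setC// B1 subee.
by move=> eta /= h h'; apply: h; rewrite mul1r ltW.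
Qed.

(** The ergodicity hypothesis concerns strictly invariant sets, whereas the limit of the averages
    exists only almost everywhere. The upper limit is defined and invariant under all translations
    at every point, so ergodicity applies to it; its integral is found by dominated convergence. *)
Let ergodic_nat f : bdm setT f ->
  {ae mu, forall eta, davg f n.+1%:R eta @[n --> \oo] --> \int[mu]_eta f eta}.
Proof.
move=> bf; have [C C0 CP] := bdm_bound bf.
have fC eta : `|f eta| <= C by exact: CP.
pose a n eta := davg f n.+1%:R eta.
have aC n eta : `|a n eta| <= C by apply: davg_bound.
have ma n : measurable_fun setT (a n) by exact: (bdm_davg _ bf).1.
have [f' bf' f'P] := itavg_cvg (enum 'I_d) (bdm_boxint bf).
have {}f'P : {ae mu, forall eta, a n eta @[n --> \oo] --> f' eta}.
  apply: filterS f'P => eta.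
  have -> : (fun n => itavg (enum 'I_d) n (boxint (fun=> 1%N) f) eta) = a ^~ eta by
    apply/funext => n; rewrite /a davg_itavg.
  exact.
pose L eta := rlimsup (a ^~ eta).
have bL : bdm setT L by exact: (@bdm_limsup _ _ _ a C).
have Linv y eta : L (tau (- y) eta) = L eta.
  have small e : 0 < e -> exists N, forall n, (N <= n)%N -> 
      `|a n (tau (- y) eta) - a n eta| <= e.
    move=> e0; pose K := C * (d%:R * (2 * `|y|)) *+ 2 + 2 * `|y|.
    have K0 : 0 <= K by rewrite addr_ge0// ?mulrn_wge0// ?mulr_ge0// ltW.
    exists (Num.truncn (K / e + K)) => n Nn.
    have h : K / e + K <= n.+1%:R.
      by apply: ltW; apply: lt_le_trans (truncnS_gt _) _; rewrite ler_nat.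
    apply: le_trans (@davg_shift f C n.+1%:R y `|y| eta bf fC _ _ _) _ => //.
      apply: le_trans h; rewrite -[leLHS]add0r lerD ?divr_ge0 ?(ltW e0)//.
      by rewrite lerDr mulrn_wge0// !mulr_ge0// ltW.
    have -> : C * (d%:R * (2 * `|y| / n.+1%:R)) *+ 2 =
        C * (d%:R * (2 * `|y|)) *+ 2 / n.+1%:R by ring.
    rewrite ler_pdivrMr// -ler_pdivrMl// mulrC; apply: le_trans h.
    rewrite -[leLHS]addr0 lerD// ler_pM2r ?invr_gt0// /K lerDl mulr_ge0//.
  apply/eqP; rewrite eq_le; apply/andP; split.
    apply: (@le_rlimsup _ _ _ C C) => // e /small[N NP]; exists N => n /NP.
    by rewrite ler_norml => /andP[_]; rewrite lerBlDr addrC.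
  apply: (@le_rlimsup _ _ _ C C) => // e /small[N NP]; exists N => n /NP.
  by rewrite ler_norml => /andP[+ _]; rewrite lerBrDr addrC lerBlDr.
have Lae := ergodic_constant bL Linv.
have Lf' : {ae mu, forall eta, a n eta @[n --> \oo] --> L eta}.
  apply: filterS f'P => eta h.
  by rewrite /L (rlimsup_cvg (aC ^~ eta) h).
have E : \int[mu]_eta L eta = \int[mu]_eta f eta.
  have := @bounded_DCT _ _ _ mu a L C ma bL.1 aC Lf'.
  rewrite (_ : (fun n => _) = fun=> \int[mu]_eta f eta); last first.
    by apply/funext => n; exact: Rint_davg.
  by move=> /cvg_lim <-//; rewrite lim_cst.
apply: filterS2 Lae Lf' => eta h1; rewrite h1 E; exact.
Qed.

(** A real side is compared with its integer part: the shell that separates the two cubes has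
    relative volume at most [d / N], and the change of normalization costs as much, each weighted by
    the bound [C]. No null set is added to that of the integer sides. *)
Theorem multidimensional_ergodic_theorem f : bdm setT f ->
  {ae mu, forall eta, davg f N eta @[N --> +oo] --> \int[mu]_eta f eta}.
Proof.
move=> bf; have [C C0 CP] := bdm_bound bf.
have fC eta : `|f eta| <= C by exact: CP.
apply: filterS (ergodic_nat bf) => eta /cvgnP H; apply/cvgrPdist_le => e e0.
have e2 : 0 < e / 2 by rewrite divr_gt0.
have [n0 n0P] := H _ e2.
pose M := n0.+1%:R + 1 + (C *+ 2 * d%:R) / (e / 2).
near=> N.
have NM : M <= N by near: N; apply: nbhs_pinfty_ge; exact: num_real.
have K0 : 0 <= (C *+ 2 * d%:R) / (e / 2).
  by rewrite divr_ge0 ?(ltW e2)// mulr_ge0// mulrn_wge0// ltW.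
have Nn0 : n0.+1%:R + 1 <= N by apply: le_trans NM; rewrite /M lerDl.
have N1 : 1 <= N by apply: le_trans Nn0; rewrite lerDr.
have N0 : 0 < N by lra.
have NK : (C *+ 2 * d%:R) / (e / 2) <= N by apply: le_trans NM; rewrite /M lerDr.
pose m := Num.truncn N.
have /andP[mN Nm] : m%:R <= N < m.+1%:R by apply: truncn_itv; exact: ltW.
have n0m : (n0.+1 <= m)%N.
  by rewrite -ltnS -(@ltr_nat R); apply: le_lt_trans Nm; lra.
have m0 : 0 < m%:R :> R by rewrite ltr0n (leq_trans _ n0m).
have D1 := n0P m.-1; rewrite prednK ?(leq_trans _ n0m)// in D1.
have {}D1 : `|davg f m%:R eta - \int[mu]_eta f eta| <= e / 2.
  by apply: D1; rewrite -ltnS prednK ?(leq_trans _ n0m).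
rewrite distrC -(subrKA (davg f m%:R eta)) (splitr e) (le_trans (ler_normD _ _))// lerD//.
have bo := bdm_orbit htau eta bf.
have MC : cube 0 m%:R `<=` @cube R d 0 N.
  by move=> x xm j; have := xm j; rewrite /= !in_itv/= => /andP[-> h]; exact: lt_le_trans h mN.
have l2 : `|\int[lambda]_(x in cube 0 N) f (tau (- x) eta) -
      \int[lambda]_(x in cube 0 m%:R) f (tau (- x) eta)| <=
    C * (fine (lambda (cube 0 N)) - fine (lambda (cube 0 m%:R))).
  exact: (bRint_setB (measurable_cube _ _) (measurable_cube _ _) (lebn_cube_fin _ _ _) MC
    (bdm_sub (subsetT _) bo) (fun x _ => fC _)).
rewrite !lebn_cube ?(ltW N0) ?(ltW m0)//= !subr0 in l2.
have mE : m%:R = N * (1 - (N - m%:R) / N) :> R by field; rewrite gt_eqF.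
have t01 : 0 <= (N - m%:R) / N <= 1.
  by rewrite divr_ge0 ?subr_ge0 ?(ltW N0)//= ler_pdivrMr// mul1r gerBl ltW.
have bern := bernoulli_expr d t01.
have tN : (N - m%:R) / N <= N^-1.
  rewrite -[leRHS]mul1r ler_pM2r ?invr_gt0//; rewrite -natr1 in Nm; lra.
have bern2 : 1 - (1 - (N - m%:R) / N) ^+ d <= d%:R / N.
  by apply: le_trans bern _; rewrite ler_wpM2l.
have key1 : N^-1 ^+ d * (N ^+ d - m%:R ^+ d) <= d%:R / N.
  rewrite mE exprMn -{1}[N ^+ d]mulr1 -mulrBr mulrA -exprMn mulVf ?gt_eqF// expr1n mul1r.
  exact: bern2.
set IN := \int[lambda]_(x in cube 0 N) _ in l2.
set Im := \int[lambda]_(x in cube 0 m%:R) _ in l2.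
have dm : `|davg f m%:R eta| <= C by exact: davg_bound.
have -> : davg f N eta - davg f m%:R eta = N^-1 ^+ d * (IN - Im) +
    davg f m%:R eta * (N^-1 ^+ d * m%:R ^+ d - 1).
  rewrite /davg -/IN -/Im.
  have : m%:R^-1 ^+ d * m%:R ^+ d = 1 :> R by rewrite -exprMn mulVf ?gt_eqF// expr1n.
  move: (_^-1 ^+ d) (m%:R ^+ d) (N^-1 ^+ d) => a b c ab.
  have -> : a * Im * (c * b - 1) = (a * b) * c * Im - a * Im by ring.
  by rewrite ab; ring.
have N1d : N^-1 ^+ d * N ^+ d = 1 by rewrite -exprMn mulVf ?gt_eqF// expr1n.
have key2 : `|N^-1 ^+ d * m%:R ^+ d - 1| <= d%:R / N.
  rewrite distrC -[X in X - _]N1d -mulrBr ger0_norm//.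
  rewrite mulr_ge0 ?exprn_ge0 ?invr_ge0 ?(ltW N0)//.
  by rewrite subr_ge0 lerXn2r ?nnegrE ?(ltW N0) ?(ltW m0).
apply: (@le_trans _ _ (C * (d%:R / N) + C * (d%:R / N))).
  rewrite (le_trans (ler_normD _ _))// lerD// normrM; last exact: ler_pM.
  rewrite ger0_norm ?exprn_ge0 ?invr_ge0 ?(ltW N0)//.
  apply: le_trans (ler_wpM2l _ l2) _; first by rewrite exprn_ge0 ?invr_ge0 ?(ltW N0).
  by rewrite mulrCA ler_wpM2l// ltW.
rewrite -mulr2n -mulrnAl mulrA ler_pdivrMr//.
by rewrite mulrC [e/2 * N]mulrC -ler_pdivrMr// mulrC.
Unshelve. all: by end_near. Qed.

(** The mean ergodic theorem along integer sides; one large cube is all that the long-range averages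
    require. *)
Lemma davg_L2 f : bdm setT f ->
  \int[mu]_eta ((davg f n.+1%:R eta - \int[mu]_eta f eta) ^+ 2) @[n --> \oo] --> (0 : R).
Proof.
move=> bf; have [C C0 CP] := bdm_bound bf.
have fC eta : `|f eta| <= C by exact: CP.
have aC n eta : `|davg f n.+1%:R eta| <= C by apply: davg_bound.
have -> : 0 = \int[mu]_eta (0 : R) by rewrite Rint0.
have bg n : bdm setT (fun eta => (davg f n.+1%:R eta - \int[mu]_eta f eta) ^+ 2).
  by apply/bdmX/bdmB; [exact: bdm_davg|exact: bdm_cst].
apply: (@bounded_DCT _ _ _ mu _ (fun=> 0) ((C + C) ^+ 2)).
- by move=> n; exact: (bg n).1.
- exact: measurable_cst.
- move=> n x; rewrite normrX lerXn2r ?nnegrE ?addr_ge0 ?(ltW C0)//.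
  rewrite (le_trans (ler_normB _ _))// lerD//.
  have := bRint_bound measurableT (muT_fin mu) bf CP.
  by rewrite (fine_muT mu) mulr1.
- apply: filterS (ergodic_nat bf) => eta h.
  suff: (davg f n.+1%:R eta - \int[mu]_eta f eta) ^+ 2 @[n --> \oo] -->
      (\int[mu]_eta f eta - \int[mu]_eta f eta) ^+ 2 by rewrite subrr expr0n.
  apply: (@cvg_comp _ _ _ _ (fun t : R => t ^+ 2)); last exact: exprn_continuous.
  by apply: cvgB => //; exact: cvg_cst.
Qed.

End multidimensional_ergodic_theorem.

Lemma bRint_DCT {R : realType} {disp : measure_display} {T : measurableType disp}
    (m : {measure set T -> \bar R}) (D : set T) (F : nat -> T -> R) (f : T -> R) (C : R) :
  measurable D -> (m D < +oo)%E -> (forall n, measurable_fun setT (F n)) ->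
  measurable_fun setT f -> (forall n x, D x -> `|F n x| <= C) ->
  {ae m, forall x, D x -> F n x @[n --> \oo] --> f x} ->
  \int[m]_(x in D) F n x @[n --> \oo] --> \int[m]_(x in D) f x.
Proof.
move=> mD Dfin mF mf FC Ff.
have [] := @dominated_convergence _ _ _ m D mD (fun n x => (F n x)%:E)
  (EFin \o f) (EFin \o cst C).
- by move=> n; apply/measurable_EFinP; exact: measurable_funTS.
- by apply/measurable_EFinP; exact: measurable_funTS.
- by apply: filterS Ff => x + Dx => /(_ Dx) Fx; apply/fine_cvgP; split; [exact: nearW|exact: Fx].
- apply: (bdm_int mD Dfin); exact: bdm_cst.
- by apply: aeW => x n Dx; rewrite lee_fin FC.
move=> iF _ cF; apply: fine_cvg.
rewrite /Rintegral fineK; last exact: integrable_fin_num.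
exact: cF.
Qed.

Lemma bRint_DCT0 {R : realType} {disp : measure_display} {T : measurableType disp}
    (m : {measure set T -> \bar R}) (D : set T) (F : nat -> T -> R) (C : R) :
  measurable D -> (m D < +oo)%E -> (forall n, measurable_fun setT (F n)) ->
  (forall n x, D x -> `|F n x| <= C) ->
  {ae m, forall x, D x -> F n x @[n --> \oo] --> (0 : R)} ->
  \int[m]_(x in D) F n x @[n --> \oo] --> (0 : R).
Proof.
move=> mD Dfin mF FC F0; rewrite -[X in _ --> X](Rint0 m mD).
exact: (bRint_DCT mD Dfin mF (measurable_cst (0 : R)) FC F0).
Qed.

Lemma ltr_perturb {R : realType} (a b c : R) : a != c -> `|b| <= `|a - c| / 2 ->
  (c < a + b) = (c < a).
Proof.
move=> ac; rewrite ler_norml; case: (ltrgtP a c) ac => // h _.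
  by move=> /andP[h1 h2]; apply/negbTE; rewrite -leNgt; lra.
by move=> /andP[h1 h2]; lra.
Qed.

Import HBNNSimple.

(** * Approximate identities along orbits *)

Section translation_continuity.
Context {R : realType} {d : nat}.
Local Notation lambda := (@lebn R d).
Implicit Types (h g : 'rV[R]_d -> R) (y : nat -> 'rV[R]_d).

(** Continuity of translations in L^1 of the unit cube, in sequential form so that dominated
    convergence applies. It is extended from half-spaces to all bounded measurable functions by
    measure-theoretic induction, without density of continuous functions. *)
Definition tcont h := bdm setT h /\
  forall y, (forall n, `|y n| <= 1) -> `|y n| @[n --> \oo] --> (0 : R) ->
  \int[lambda]_(x in cube 0 1) `|h (x + y n) - h x| @[n --> \oo] --> (0 : R).

Let mQ (a b : R) : measurable (@cube R d a b) := measurable_cube a b.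
Let fQ (a b : R) : (lambda (@cube R d a b) < +oo)%E := lebn_cube_fin d a b.

Let bdm_shift h (a : 'rV[R]_d) : bdm setT h ->
  bdm setT (fun x : 'rV[R]_d => h (x + a)).
Proof.
move=> [mh [C hC]]; split; last by exists C => *; exact: hC.
exact: (measurableT_comp mh (measurable_addr a)).
Qed.

Let bdm_diff h (a : 'rV[R]_d) (D : set 'rV[R]_d) : bdm setT h ->
  bdm D (fun x => `|h (x + a) - h x|).
Proof.
by move=> bh; apply/bdm_norm/(@bdm_sub _ _ _ setT)/bdmB => //; exact: bdm_shift.
Qed.

(** A single domination criterion that yields closure under sums, scalar multiples and products of
    indicators. *)
Lemma tcont_dom h g1 g2 K : bdm setT h -> tcont g1 -> tcont g2 -> 0 <= K ->
  (forall x x', `|h x - h x'| <= K * (`|g1 x - g1 x'| + `|g2 x - g2 x'|)) -> tcont h.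
Proof.
move=> bh [b1 c1] [b2 c2] K0 hK; split => // y y1 y0.
have {}c1 := c1 y y1 y0; have {}c2 := c2 y y1 y0.
have c : K * (\int[lambda]_(x in cube 0 1) `|g1 (x + y n) - g1 x| +
   \int[lambda]_(x in cube 0 1) `|g2 (x + y n) - g2 x|) @[n --> \oo] --> (0 : R).
  rewrite -[X in _ --> X](mulr0 K) -[X in _ --> K * X](addr0 0).
  by apply: cvgMr; exact: cvgD.
apply: (@squeeze_cvgr _ _ _ _ (fun=> 0) _ _ _ _ _ c); last exact: cvg_cst.
apply: nearW => n; apply/andP; split; first exact: Rintegral_ge0.
have B1 := bdm_diff (y n) (cube 0 1) b1; have B2 := bdm_diff (y n) (cube 0 1) b2.
rewrite -(bRintD (mQ 0 1) (fQ 0 1) B1 B2) -(bRintZ (mQ 0 1) (fQ 0 1)); last exact: bdmD.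
apply: bRint_le => [||||x _]; [exact: mQ|exact: fQ|exact: bdm_diff|by apply/bdmZ/bdmD|].
exact: hK.
Qed.

Lemma tcont_cst c : tcont (fun=> c).
Proof.
split=> [|y _ _]; first exact: bdm_cst.
under eq_fun do (under eq_Rintegral do rewrite subrr normr0).
by rewrite Rint0//; exact: cvg_cst.
Qed.

Lemma tcontD h g : tcont h -> tcont g -> tcont (fun x => h x + g x).
Proof.
move=> th tg; apply: (@tcont_dom _ h g 1) => //; first exact: bdmD th.1 tg.1.
move=> x x'; rewrite mul1r opprD addrACA; exact: ler_normD.
Qed.

Lemma tcontZ c h : tcont h -> tcont (fun x => c * h x).
Proof.
move=> th; apply: (@tcont_dom _ h h `|c|) => //; first exact: bdmZ th.1.
by move=> x x'; rewrite -mulrBr normrM ler_wpM2l// lerDl.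
Qed.

Lemma tcont_sum (I : Type) (r : seq I) (F : I -> 'rV[R]_d -> R) :
  (forall i, tcont (F i)) -> tcont (fun x => \sum_(i <- r) F i x).
Proof.
move=> tF; elim: r => [|i r IH].
  by under eq_fun do rewrite big_nil; exact: tcont_cst.
by under eq_fun do rewrite big_cons; exact: tcontD.
Qed.

Lemma tcont_setI (A B : set 'rV[R]_d) : tcont (\1_A : _ -> R) -> tcont (\1_B : _ -> R) ->
  tcont (\1_(A `&` B) : _ -> R).
Proof.
move=> tA tB; rewrite indicI; apply: (@tcont_dom _ (\1_A) (\1_B) 1) => //.
  exact: bdmM tA.1 tB.1.
move=> x x'; rewrite mul1r /= !indicE.
by case: (_ \in A); case: (_ \in B); case: (_ \in A); case: (_ \in B);
  rewrite ?mulr1 ?mulr0 ?subrr ?subr0 ?sub0r ?normrN ?normr0 ?normr1 ?addr0 ?add0r ?ler01 ?lerDl ?ler01.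
Qed.

Lemma tcont_setC (A : set 'rV[R]_d) : tcont (\1_A : _ -> R) -> tcont (\1_(~` A) : _ -> R).
Proof.
move=> tA; have -> : \1_(~` A) = (fun x => 1 + -1 * \1_A x) :> (_ -> R).
  apply/funext => x; rewrite !indicE; have [Ax|nAx] := pselect (A x).
    by rewrite memNset ?mem_set//= ?mulN1r ?subrr// => nA; exact: nA.
  by rewrite mem_set// memNset//= mulr0 addr0.
by apply: tcontD; [exact: tcont_cst|exact: tcontZ].
Qed.

(** A three-epsilon argument. The approximation is made on the cube from [-1] to [2], which contains
    every translate of the unit cube by a vector of norm at most one. *)
Lemma tcont_lim (F : nat -> 'rV[R]_d -> R) h C : (forall k, tcont (F k)) ->
  bdm setT h -> (forall k x, `|F k x| <= C) ->
  (forall x, F k x @[k --> \oo] --> h x) -> tcont h.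
Proof.
move=> tF bh FC Fh; split=> // y y1 y0; apply/cvgnP => e e0.
have e3 : 0 < e / 3 by rewrite divr_gt0.
have [Ch Ch0 ChP] := bdm_bound bh.
have bFh k : bdm setT (fun x => `|F k x - h x|).
  by apply/bdm_norm/bdmB => //; exact: (tF k).1.
have cI : \int[lambda]_(x in cube (-1) 2) `|F k x - h x| @[k --> \oo] --> (0 : R).
  apply: (@bRint_DCT0 _ _ _ lambda _ _ (C + Ch)) => //.
  - exact: fQ.
  - by move=> k; exact: (bFh k).1.
  - move=> k x _; rewrite normr_id (le_trans (ler_normB _ _))// lerD//; exact: ChP.
  - apply: aeW => x _; apply/cvgnP => e' e'0.
    have /cvgnP/(_ _ e'0)[N NP] := Fh x; exists N => k /NP.
    by rewrite subr0 normr_id.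
move: cI => /cvgnP/(_ _ e3)[k /(_ k (leqnn k))]; rewrite subr0.
rewrite ger0_norm ?Rintegral_ge0// => hk.
have /cvgnP/(_ _ e3)[N NP] := (tF k).2 y y1 y0; exists N => n /NP.
rewrite !subr0 !ger0_norm ?Rintegral_ge0// => hn.
have sub D : D `<=` cube (-1) 2 -> measurable D ->
    \int[lambda]_(x in D) `|F k x - h x| <= e / 3.
  move=> DQ mD; apply: le_trans hk; rewrite -subr_ge0.
  have -> : \int[lambda]_(x in D) `|F k x - h x| =
      \int[lambda]_(x in cube (-1) 2) (`|F k x - h x| * \1_D x).
    rewrite (@bRint_sub _ _ _ lambda (cube (-1) 2) D)//.
    - by apply: eq_Rintegral => x xD; rewrite indicE xD mulr1.
    - by apply: bdmM; [exact: bdm_sub (bFh k)|exact: bdm_indic].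
    - by move=> x _ nD; rewrite indicE memNset// mulr0.
  rewrite subr_ge0; apply: bRint_le => //.
  - exact: fQ.
  - by apply: bdmM; [exact: bdm_sub (bFh k)|exact: bdm_indic].
  - exact: bdm_sub (bFh k).
  by move=> x _; rewrite indicE ler_piMr//; case: (_ \in _).
have s1 : \int[lambda]_(x in cube 0 1) `|F k x - h x| <= e / 3.
  apply: sub => // x xQ i; have := xQ i; rewrite /= !in_itv/= => /andP[h1 h2].
  by apply/andP; split; lra.
have bS := bdm_shift (y n) (bFh k).
have s2 : \int[lambda]_(x in cube 0 1) `|F k (x + y n) - h (x + y n)| <= e / 3.
  pose D : set 'rV[R]_d := [set x | cube 0 1 (x - y n)].
  have mD : measurable D.
    rewrite -[D]setTI; apply: (measurable_addr (- y n)) => //.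
  have -> : cube 0 1 = [set x | D (x + y n)].
    by apply/seteqP; split => x; rewrite /D /= addrK.
  rewrite (Rint_shift (y n) (f := fun x => `|F k x - h x|) mD (bFh k).1).
  apply: sub => // x xQ i; have := xQ i; have := le_trans (coord_le_norm (y n) i) (y1 n).
  rewrite ler_norml /= !mxE !in_itv/= => /andP[h1 h2] /andP[h3 h4].
  by apply/andP; split; lra.
have bk := bdm_diff (y n) (cube 0 1) (tF k).1.
apply: (@le_trans _ _ (\int[lambda]_(x in cube 0 1) (`|F k (x + y n) - h (x + y n)| +
    `|F k (x + y n) - F k x| + `|F k x - h x|))).
  apply: bRint_le => [||||x _]; [exact: mQ|exact: fQ|exact: bdm_diff| |].
    by apply: bdmD; [apply: bdmD => //; exact: bdm_sub bS|exact: bdm_sub (bFh k)].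
   rewrite -(subrKA (F k (x + y n))) (le_trans (ler_normD _ _))// -addrA lerD//.
    by rewrite distrC.
  by rewrite -(subrKA (F k x)) ler_normD.
rewrite !(bRintD (mQ 0 1) (fQ 0 1)).
- by move: s1 s2 hn => /=; lra.
- exact: bdm_sub bS.
- exact: bk.
- by apply: bdmD => //; exact: bdm_sub bS.
- exact: bdm_sub (bFh k).
Qed.

(** Off the bounding hyperplane, which is a null set, small shifts do not change membership. *)
Lemma tcont_halfspace i (c : R) : tcont (\1_[set x : 'rV[R]_d | c < x 0 i] : _ -> R).
Proof.
pose H := [set x : 'rV[R]_d | c < x 0 i].
have mH : measurable H.
  have := measurable_coord_rV (R := R) i measurableT (measurable_itv `]c, +oo[).
  by rewrite setTI; congr measurable; apply/seteqP; split => x; rewrite /H /= in_itv/= andbT.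
split=> [|y y1 y0]; first exact: bdm_indic.
have bi : bdm setT (\1_H : _ -> R) by exact: bdm_indic.
apply: (@bRint_DCT0 _ _ _ lambda _ _ 2) => //.
- exact: fQ.
- by move=> n; exact: (bdm_diff (y n) setT bi).1.
- move=> n x _; rewrite normr_id (le_trans (ler_normB _ _))// !indicE.
  by do 2 case: (_ \in _); rewrite ?normr0 ?normr1; lra.
have null : lambda [set x : 'rV[R]_d | x 0 i = c] = 0%E.
  have -> : [set x : 'rV[R]_d | x 0 i = c] =
      boxn (fun j => if j == i then [set c] else setT).
    apply/seteqP; split => x /=; last by move=> /(_ i); rewrite eqxx.
    by move=> xi j; case: eqP => [->|].
  rewrite lebn_boxn; last by move=> j; case: eqP.
  by rewrite (bigD1 i)//= eqxx lebesgue_measure_set1 mul0e.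
exists [set x : 'rV[R]_d | x 0 i = c]; split => //.
  have := measurable_coord_rV (R := R) i measurableT (measurable_set1 c).
  by rewrite setTI.
move=> x /= nx; apply/not_notP => /eqP xc; apply: nx => _.
have xc0 : 0 < `|x 0 i - c| by rewrite normr_gt0 subr_eq0.
apply/cvgnP => e e0; have /cvgnP y0' := y0.
have [N NP] := y0' (`|x 0 i - c| / 2) (divr_gt0 xc0 (ltr0Sn R 1)).
exists N => n /NP; rewrite subr0 normr_id => yn.
have yi := le_trans (coord_le_norm (y n) i) yn.
suff -> : (\1_H (x + y n) : R) = \1_H x by rewrite subrr normr0 subr0 normr0 ltW.
rewrite !indicE; congr (nat_of_bool _)%:R; apply/idP/idP; rewrite !inE /H /= mxE;
  by rewrite (ltr_perturb xc yi).
Qed.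

Let good : set (set 'rV[R]_d) := [set A | measurable A /\ tcont (\1_A : _ -> R)].

Let good_setC A : good A -> good (~` A).
Proof. by move=> [mA tA]; split; [exact: measurableC|exact: tcont_setC]. Qed.

Let good0 : good set0.
Proof. by split=> //; rewrite indic0; exact: tcont_cst. Qed.

(** The complement of the union is the pointwise limit of the finite intersections [G k] of
    complements, so complements, finite intersections and bounded limits are enough. *)
Let good_bigcup (F : nat -> set 'rV[R]_d) : (forall k, good (F k)) -> good (\bigcup_k F k).
Proof.
move=> gF; have mF k : measurable (F k) := (gF k).1.
have mU : measurable (\bigcup_k F k) by exact: bigcup_measurable.
split=> //; rewrite -[\bigcup_k F k]setCK; apply: tcont_setC.
pose fix G k : set 'rV[R]_d := if k is k'.+1 then G k' `&` ~` F k' else setT.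
have GE k x : G k x <-> forall j, (j < k)%N -> ~ F j x.
  elim: k => [|k IH] //=; split => [[/IH h1 h2] j|h].
    by rewrite ltnS leq_eqVlt => /orP[/eqP -> //|]; exact: h1.
  by split; [apply/IH => j jk; apply: h; exact: ltnW|exact: h].
have tG k : tcont (\1_(G k) : _ -> R).
  elim: k => [|k IH] /=; first by rewrite indicT; exact: tcont_cst.
  by apply: tcont_setI => //; exact/tcont_setC/(gF k).2.
apply: (@tcont_lim (fun k => \1_(G k)) _ 1) => //.
- by apply: bdm_indic; exact: measurableC.
- by move=> k x; rewrite indicE; case: (_ \in _); rewrite ?normr0 ?normr1.
move=> x; apply/cvgnP => e e0; have [[j _ Fj]|nU] := pselect ((\bigcup_k F k) x).
  exists j.+1 => n jn; rewrite !indicE !memNset ?subrr ?normr0 ?ltW//.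
    by move=> h; apply: h; exists j.
  by move=> /GE/(_ j jn); exact.
exists 0%N => n _; rewrite !indicE !mem_set ?subrr ?normr0 ?ltW//.
by apply/GE => j _ Fj; apply: nU; exists j.
Qed.

Lemma tcont_measurable (A : set 'rV[R]_d) : measurable A -> tcont (\1_A : _ -> R).
Proof.
suff H : measurable `<=` good by move=> /H[].
apply: smallest_sub.
  split=> //; first by move=> B gB; rewrite setTD; exact: good_setC.
rewrite -bigcup_seq => B [i /= _ [C mC <-]]; rewrite setTI.
pose P : set (set R) := [set C | good ((fun x : 'rV[R]_d => x 0 i) @^-1` C)].
suff : P C by [].
have sP : sigma_algebra setT P.
  split=> [|E gE|F gF]; rewrite /P /=.
  - by rewrite preimage_set0.
  - by rewrite setTD preimage_setC; exact: good_setC.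
  - by rewrite preimage_bigcup; exact: good_bigcup.
have {}mC : <<s RGenOInfty.G (R := R) >> C.
  by have := mC; rewrite [X in X C](RGenOInfty.measurableE R).
apply: (smallest_sub sP _ mC).
move=> _ [c ->]; rewrite /P /=.
have -> : (fun x : 'rV[R]_d => x 0 i) @^-1` `]c, +oo[%classic = [set x | c < x 0 i].
  by apply/seteqP; split => x; rewrite /= in_itv/= andbT.
split; last exact: tcont_halfspace.
have := measurable_coord_rV (R := R) i measurableT (measurable_itv `]c, +oo[).
by rewrite setTI; congr measurable; apply/seteqP; split => x; rewrite /= in_itv/= andbT.
Qed.

Lemma translation_continuity h : bdm setT h -> tcont h.
Proof.
move=> bh; have [C C0 CP] := bdm_bound bh.
(* Adding the bound makes the function nonnegative, as the approximation by simple functions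
   requires. *)
pose g x := h x + C; pose f := EFin \o g.
have bg : bdm setT g by apply: bdmD => //; exact: bdm_cst.
have g0 x : 0 <= g x.
  by have := CP x Logic.I; rewrite ler_norml /g -lerBlDr sub0r => /andP[].
have mf : measurable_fun setT f by apply/measurable_EFinP; exact: bg.1.
pose F k := nnsfun_approx measurableT mf k.
suff tg : tcont g.
  have -> : h = fun x => g x + - C by apply/funext => x; rewrite /g addrK.
  by apply: tcontD => //; exact: tcont_cst.
have f0 x : setT x -> (0 <= f x)%E by move=> _; rewrite lee_fin.
refine (@tcont_lim (fun k x => F k x) g (C + C) _ bg _ _).
- move=> k; have -> : (F k : _ -> R) = fun x => \sum_(y <- finmap.enum_fset (fset_set (range (F k))))
      y * \1_(F k @^-1` [set y]) x.
    apply/funext => x; rewrite [LHS]fimfunE fsbig_finite//.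
  apply: tcont_sum => c; apply/tcontZ/tcont_measurable.
  by rewrite -[X in measurable X]setTI; exact: measurable_funPT.
- move=> k x; rewrite ger0_norm; last exact: fun_ge0.
  have := le_approx k f0 (Logic.I : setT x); rewrite -/(nnsfun_approx _ _ _).
  rewrite -(nnsfun_approxE measurableT mf) lee_fin => /le_trans; apply.
  by rewrite /g lerD2r; have := CP x Logic.I; rewrite ler_norml => /andP[].
- move=> x; have := cvg_nnsfun_approx measurableT mf f0 (Logic.I : setT x).
  by move=> /fine_cvgP[_]; exact.
Qed.

End translation_continuity.

(** * Strong continuity of the action *)

Section strong_continuity.
Context {R : realType} {d : nat} {disp : measure_display}
  {X : measurableType disp} (mu : probability X R)
  (tau : 'rV[R]_d -> X -> X).
Hypothesis htau : ergodic_action mu tau.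
Local Notation lambda := (@lebn R d).
Implicit Types (f : X -> R).

(** By invariance the integral over [X] equals the integral of its average over the unit cube along
    each orbit. For fixed [eta] this average is an L^1 increment of a realization, which tends to
    zero by continuity of translations. *)
Let strong_continuity_seq f (y : nat -> 'rV[R]_d) : bdm setT f ->
  (forall n, `|y n| <= 1) -> `|y n| @[n --> \oo] --> (0 : R) ->
  \int[mu]_eta `|f (tau (- y n) eta) - f eta| @[n --> \oo] --> (0 : R).
Proof.
move=> bf y1 y0; have [C C0 CP] := bdm_bound bf.
pose F n eta := `|f (tau (- y n) eta) - f eta|.
have bF n : bdm setT (F n) by apply/bdm_norm/bdmB => //; exact: (bdm_tau htau).
have FC n eta : `|F n eta| <= C + C.
  by rewrite normr_id (le_trans (ler_normB _ _))// lerD//; exact: CP.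
pose G n eta := \int[lambda]_(x in cube 0 1) F n (tau (- x) eta).
have mQ := @measurable_cube R d 0 1; have fQ := lebn_cube_fin d (0 : R) 1.
have lQ : fine (@lebn R d (cube 0 1)) = 1.
  by rewrite lebn_cube// subr0 expr1n.
have bFj n : bdm (setT `*` cube 0 1) (fun p : X * 'rV[R]_d => F n (tau (- p.2) p.1)).
  by apply: bdm_sub (bdm_tau_joint htau (bF n)).
have E n : \int[mu]_eta F n eta = \int[mu]_eta G n eta.
  rewrite (bRint_Fubini (m1 := mu) (m2 := lambda) measurableT mQ (muT_fin mu) fQ (bFj n)).
  rewrite (@eq_Rintegral _ _ _ lambda _ (fun=> \int[mu]_eta F n eta)).
    by rewrite Rint_cst_cube// subr0 expr1n mulr1.
  by move=> x _ /=; rewrite (Rint_tau htau x (bF n).1).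
under eq_cvg do rewrite E.
apply: (@bRint_DCT0 _ _ _ mu setT G (C + C)) => //; first exact: (muT_fin mu).
- by move=> n; exact: (@bdm_Rint _ _ _ _ _ lambda setT _ _ mQ fQ (bFj n)).1.
- move=> n eta _; rewrite -[leRHS]mulr1 -lQ.
  apply: (bRint_bound mQ fQ (bdm_sub (subsetT _) (bdm_orbit htau eta (bF n))) (fun x _ => FC n _)).
- apply: aeW => eta _.
  have [_ /(_ y y1 y0)] := translation_continuity (bdm_orbit htau eta bf).
  have -> : (fun n => G n eta) = fun n =>
      \int[lambda]_(x in cube 0 1) `|f (tau (- (x + y n)) eta) - f (tau (- x) eta)|.
    apply/funext => n; apply: eq_Rintegral => x _.
    by rewrite /F [x + y n]addrC (tauD htau).
  exact.
Qed.

Theorem strong_continuity f (e : R) : bdm setT f -> 0 < e ->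
  exists2 delta, 0 < delta & forall y, `|y| <= delta ->
    \int[mu]_eta `|f (tau (- y) eta) - f eta| <= e.
Proof.
move=> bf e0; apply/not_exists2P => H.
have {}H n : exists y : 'rV[R]_d, `|y| <= n.+1%:R^-1 /\
    e < \int[mu]_eta `|f (tau (- y) eta) - f eta|.
  have [|] := H n.+1%:R^-1; first by rewrite invr_gt0.
  move=> /existsNP[y /not_implyP[h1 h2]]; exists y; split => //.
  by rewrite ltNge; exact/negP.
have [y yP] := choice H.
have y1 n : `|y n| <= 1 by rewrite (le_trans (yP n).1)// invf_le1// ler1n.
have y0 : `|y n| @[n --> \oo] --> (0 : R).
  apply: (@squeeze_cvgr _ _ _ _ (fun=> 0) _ _ _ _ _ (@cvg_harmonic R)); last exact: cvg_cst.
  by apply: nearW => n; rewrite normr_ge0 /harmonic/=; exact: (yP n).1.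
have /cvgnP/(_ _ e0)[N /(_ N (leqnn N))] := strong_continuity_seq bf y1 y0.
rewrite subr0 ger0_norm ?Rintegral_ge0// => h.
by have := lt_le_trans (yP N).2 h; rewrite ltxx.
Qed.

End strong_continuity.

Lemma ler_quarters {R : realType} (a b c : R) : a <= c / 4 -> b <= c / 4 ->
  2 * a + 2 * b <= c.
Proof. lra. Qed.

(** A sum of reciprocals instead of a minimum: the added 1 covers an empty index type. *)
Lemma fin_lower_bound {R : realType} (I : finType) (u : I -> R) :
  (forall i, 0 < u i) -> exists2 e, 0 < e & forall i, e <= u i.
Proof.
move=> u0; have s0 (P : pred I) : 0 <= \sum_(i | P i) (u i)^-1.
  by apply: sumr_ge0 => i _; rewrite invr_ge0 ltW.
have p0 : 0 < 1 + \sum_i (u i)^-1 by rewrite ltr_wpDr.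
exists (1 + \sum_i (u i)^-1)^-1; first by rewrite invr_gt0.
move=> i; rewrite -[leRHS]invrK lef_pV2 ?posrE ?invr_gt0//.
by rewrite (bigD1 i)//= addrCA lerDl addr_ge0.
Qed.

Lemma fin_upper_bound {R : realType} (I : finType) (u : I -> R) :
  exists2 l, 0 < l & forall i, u i <= l.
Proof.
exists (1 + \sum_i `|u i|); first by rewrite ltr_wpDr// sumr_ge0.
move=> i; rewrite (bigD1 i)//= addrCA; apply: le_trans (ler_norm _) _.
by rewrite lerDl addr_ge0// sumr_ge0.
Qed.

(** * Approximate identities and long-range averages along orbits *)

Section approximate_identity.
Context {R : realType} {d : nat} {disp : measure_display}
  {X : measurableType disp} (mu : probability X R)
  (tau : 'rV[R]_d -> X -> X).
Hypothesis htau : ergodic_action mu tau.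
Local Notation lambda := (@lebn R d).
Local Notation Kop := (Kop tau).
Implicit Types (f g : X -> R) (phi : 'rV[R]_d -> R).

Let mT := @measurableT _ X.
Let fT := muT_fin mu.

Definition nsq f : R := \int[mu]_eta (f eta ^+ 2).

Lemma nsq_ge0 f : 0 <= nsq f.
Proof. by apply: Rintegral_ge0 => x _; exact: sqr_ge0. Qed.

Lemma nsqD f g : bdm setT f -> bdm setT g ->
  nsq (fun eta => f eta + g eta) <= 2 * nsq f + 2 * nsq g.
Proof.
move=> bf bg; rewrite /nsq -!bRintZ//; try exact: bdmX.
rewrite -bRintD//; try exact/bdmZ/bdmX.
apply: bRint_le => //; first exact/bdmX/bdmD.
  by apply: bdmD; exact/bdmZ/bdmX.
move=> x _; have := sqr_ge0 (f x - g x); move: (f x) (g x) => a b.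
by rewrite -!mulrDr => h; rewrite -subr_ge0; move: h; congr (_ <= _); ring.
Qed.

Lemma le_nsq f C : bdm setT f -> (forall x, `|f x| <= C) -> nsq f <= C ^+ 2.
Proof.
move=> bf fC; have := bRint_le mT fT (bdmX 2 bf) (bdm_cst setT (C ^+ 2)).
rewrite Rintegral_cst// (fine_muT mu) mulr1; apply => x _.
by rewrite -real_normK ?num_real// lerXn2r ?nnegrE// (le_trans _ (fC x)).
Qed.

Lemma Kop_bound phi f (D : set 'rV[R]_d) c C eta : kern phi -> measurable D ->
  (lambda D < +oo)%E -> (forall y, ~ D y -> phi y = 0) ->
  (forall y, `|phi y| <= c) -> bdm setT f -> (forall x, `|f x| <= C) ->
  `|Kop phi f eta| <= c * C * fine (lambda D).
Proof.
move=> kphi mD fD phiD phic bf fC; rewrite (Kop_cube _ _ _ phiD).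
apply: (bRint_bound mD fD); first exact: (bdm_kern_orbit htau).
by move=> x _; rewrite normrM ler_pM.
Qed.

Let kern_rho e : 0 < e -> kern (rho e : 'rV[R]_d -> R).
Proof. by move=> e0; exact/test_function_kern/test_function_rho. Qed.

Let lQ e : 0 < e -> fine (lambda (cube 0 (2 * e))) = (2 * e) ^+ d.
Proof.
by move=> e0; rewrite -[lambda _]/(@lebn R d _) lebn_cube ?mulr_ge0 ?(ltW e0)//= subr0.
Qed.

Let scale_pow (C e : R) : 0 < e -> C * e^-1 ^+ d * (2 * e) ^+ d = C * 2 ^+ d.
Proof.
move=> e0; have : e^-1 ^+ d * e ^+ d = 1 by rewrite -exprMn mulVf ?gt_eqF// expr1n.
rewrite exprMn; move: (e^-1 ^+ d) (e ^+ d) (2 ^+ d) => a b c ab.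
by transitivity (C * c * (a * b)); [ring|rewrite ab mulr1].
Qed.

Lemma nsq_Kop_rho : exists2 C, 0 < C & forall e f, 0 < e -> bdm setT f ->
  nsq (Kop (rho e) f) <= C * nsq f.
Proof.
have [C C0 CP] := @rho_bounded R d; exists ((C * 2 ^+ d) ^+ 2).
  by rewrite exprn_gt0// mulr_gt0// exprn_gt0.
move=> e f e0 bf; rewrite -(scale_pow C e0) -lQ//.
apply: (Kop_L2 htau (kern_rho e0)) => //.
- exact: measurable_cube.
- exact: lebn_cube_fin.
- by move=> y; exact: rho_out.
- by move=> y; exact: CP.
Qed.

Lemma Kop_rho_bound f C : bdm setT f -> (forall x, `|f x| <= C) ->
  exists2 K, 0 < K & forall e eta, 0 < e -> `|Kop (rho e) f eta| <= K.
Proof.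
move=> bf fC; have [c c0 cP] := @rho_bounded R d.
exists (c * 2 ^+ d * `|C| + 1).
  by rewrite ltr_wpDl// mulr_ge0// mulr_ge0 ?(ltW c0)// exprn_ge0.
move=> e eta e0; rewrite -(scale_pow c e0) -lQ//.
have := Kop_bound eta (kern_rho e0) (measurable_cube _ _) (lebn_cube_fin _ _ _)
  (fun y => rho_out e0) (cP e ^~ e0) bf fC.
move/le_trans; apply; rewrite -[leLHS]addr0 lerD// mulrAC; apply: ler_wpM2l; last exact: ler_norm.
by rewrite lQ// !mulr_ge0 ?exprn_ge0 ?invr_ge0 ?mulr_ge0 ?(ltW e0) ?(ltW c0).
Qed.

Lemma Kop_rho_cst c e eta : 0 < e -> Kop (rho e) (fun=> c) eta = c.
Proof.
move=> e0; rewrite (Kop_cube _ _ _ (fun y => rho_out e0)).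
transitivity (c * \int[lambda]_(y in cube 0 (2 * e)) rho e y); last first.
  by rewrite Rint_rho// mulr1.
rewrite -bRintZ.
- by apply: eq_Rintegral => x _; rewrite mulrC.
- exact: measurable_cube.
- exact: lebn_cube_fin.
- exact: bdm_sub (kern_rho e0).1.
Qed.

(** Since [rho e] has integral one, the error is an average of increments of [f] over a small cube,
    whose L^1 norm is small by strong continuity. The uniform bound [K + C] on the error turns the
    L^1 estimate into one for its square. *)
Lemma Kop_rho_small f (eps : R) : bdm setT f -> 0 < eps ->
  exists2 e1, 0 < e1 & forall e, 0 < e -> e <= e1 ->
    nsq (fun eta => Kop (rho e) f eta - f eta) <= eps.
Proof.
move=> bf eps0; have [C C0 CP] := bdm_bound bf.
have fC x : `|f x| <= C by exact: CP.
have [K K0 KP] := Kop_rho_bound bf fC.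
have [c c0 cP] := @rho_bounded R d.
have KC0 : 0 < K + C by exact: addr_gt0.
have c20 : 0 < c * 2 ^+ d by rewrite mulr_gt0// exprn_gt0.
have den0 : 0 < (K + C) * (c * 2 ^+ d) by exact: mulr_gt0.
have [delta delta0 deltaP] := strong_continuity htau bf (divr_gt0 eps0 den0).
(* The kernel is carried by a cube of side [2 * e], hence half of the modulus. *)
exists (delta / 2) => [|e e0 ee]; first by rewrite divr_gt0.
have kr := kern_rho e0.
have bK := bdm_Kop htau kr bf.
have mQ := @measurable_cube R d 0 (2 * e); have fQ := lebn_cube_fin d (0 : R) (2 * e).
pose G eta := \int[lambda]_(y in cube 0 (2 * e)) (c * e^-1 ^+ d * `|f (tau (- y) eta) - f eta|).
have bGj : bdm (setT `*` cube 0 (2 * e))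
    (fun p : X * 'rV[R]_d => c * e^-1 ^+ d * `|f (tau (- p.2) p.1) - f p.1|).
  apply: (@bdm_sub _ _ _ setT) => //; apply/bdmZ/bdm_norm/bdmB; first exact: (bdm_tau_joint htau).
  split; first exact: (measurableT_comp bf.1 measurable_fst).
  by exists C => p _; exact: fC.
have bG : bdm setT G := @bdm_Rint _ _ _ _ _ lambda setT _ _ mQ fQ bGj.
have le1 eta : `|Kop (rho e) f eta - f eta| <= G eta.
  rewrite -[X in _ - X](@Kop_rho_cst _ e eta e0) (Kop_cube _ _ _ (fun y => rho_out e0)).
  rewrite (Kop_cube _ _ _ (fun y => rho_out e0)).
  have b1 : bdm (cube 0 (2 * e)) (fun y => rho e y * f (tau (- y) eta)).
    exact: (bdm_kern_orbit htau).
  have b2 : bdm (cube 0 (2 * e)) (fun y : 'rV[R]_d => rho e y * f eta).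
    by apply: (@bdm_sub _ _ _ setT) => //; apply: bdmM; [exact: kr.1|exact: bdm_cst].
  rewrite -(bRintB mQ fQ b1 b2).
  apply: le_trans (bRint_norm mQ fQ (bdmB b1 b2)) _.
  apply: bRint_le => [||||y _]; [exact: mQ|exact: fQ|exact/bdm_norm/bdmB| |].
    apply: (@bdm_sub _ _ _ setT) => //; apply/bdmZ/bdm_norm/bdmB; last exact: bdm_cst.
    exact: (bdm_orbit htau).
  by rewrite -mulrBr normrM ler_wpM2r// cP.
have IG : \int[mu]_eta G eta <= eps / (K + C).
  rewrite (bRint_Fubini (m1 := mu) (m2 := lambda) mT mQ fT fQ bGj).
  apply: (@le_trans _ _ (\int[lambda]_(y in cube 0 (2 * e))
     (c * e^-1 ^+ d * (eps / ((K + C) * (c * 2 ^+ d)))))).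
    apply: bRint_le => [||||y yQ]; [exact: mQ|exact: fQ| |exact: bdm_cst|].
      have bS : bdm (cube 0 (2 * e) `*` setT)
          (fun p : 'rV[R]_d * X => c * e^-1 ^+ d * `|f (tau (- p.1) p.2) - f p.2|).
        apply: (@bdm_sub _ _ _ setT) => //; apply/bdmZ/bdm_norm/bdmB.
          split; last by exists C => p _; exact: fC.
          exact: (measurableT_comp (bdm_tau_joint htau bf).1
            (measurable_fun_pair measurable_snd measurable_fst)).
        split; first exact: (measurableT_comp bf.1 measurable_snd).
        by exists C => p _; exact: fC.
      exact: (@bdm_Rint _ _ _ _ _ mu (cube 0 (2 * e)) setT _ mT fT bS).
    rewrite /= bRintZ//; last by apply/bdm_norm/bdmB => //; exact: (bdm_tau htau).
    rewrite ler_wpM2l ?mulr_ge0 ?exprn_ge0 ?invr_ge0 ?(ltW e0) ?(ltW c0)//.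
    apply: deltaP; apply: norm_le_coord; first exact: ltW.
    move=> i; have := yQ i; rewrite /= in_itv/= => /andP[h1 h2].
    by rewrite ger0_norm// (le_trans (ltW h2))// mulrC -ler_pdivlMr.
  rewrite Rint_cst_cube ?mulr_ge0 ?(ltW e0)// subr0.
  rewrite mulrAC scale_pow//; move: (c * 2 ^+ d) c20 KC0 => q q0 KC0.
  rewrite le_eqVlt; apply/orP; left; apply/eqP; field.
  by rewrite !gt_eqF.
rewrite /nsq; apply: (@le_trans _ _ (\int[mu]_eta ((K + C) * G eta))).
  apply: bRint_le => //; [exact/bdmX/bdmB|exact: bdmZ|move=> eta _].
  rewrite -real_normK ?num_real// expr2 ler_pM//.
  by rewrite (le_trans (ler_normB _ _))// lerD// KP.
rewrite bRintZ//; apply: le_trans (ler_wpM2l (ltW KC0) IG) _.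
by rewrite mulrC divfK ?gt_eqF.
Qed.

Lemma Kop_davg phi f N eta : kern phi -> bdm setT f ->
  Kop phi (davg tau f N) eta = davg tau (Kop phi f) N eta.
Proof.
move=> kphi bf; have [_ /bsupp_cube[M M0 MP]] := kphi.
have bg : bdm setT (fun eta => \int[lambda]_(x in cube 0 N) f (tau (- x) eta)).
  apply: (@bdm_Rint _ _ _ _ _ lambda setT _ (fun p => f (tau (- p.2) p.1))).
  - exact: measurable_cube.
  - exact: lebn_cube_fin.
  - by apply: bdm_sub (bdm_tau_joint htau bf).
rewrite (KopZ htau _ _ kphi bg) /davg; congr (_ * _).
rewrite (Kop_cube _ _ _ MP) (@eq_Rintegral _ _ _ lambda (cube 0 N)
  (fun x => \int[lambda]_(y in cube (- M) M) (phi y * f (tau (- y) (tau (- x) eta))))); last first.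
  by move=> x _; rewrite (Kop_cube _ _ _ MP).
pose F (p : 'rV[R]_d * 'rV[R]_d) := phi p.1 * f (tau (- (p.1 + p.2)) eta).
have mF : bdm (cube (- M) M `*` cube 0 N) F.
  apply: (@bdm_sub _ _ _ setT) => //; apply: bdmM.
    split; first exact: (measurableT_comp kphi.1.1 measurable_fst).
    by have [C CP] := kphi.1.2; exists C => p _; exact: CP.
  split; last by have [C CP] := bf.2; exists C => p _; exact: CP.
  apply: (measurableT_comp (bdm_orbit htau eta bf).1).
  apply: measurable_fun_rV => i; under eq_fun do rewrite mxE.
  apply: measurable_funD; apply: (measurableT_comp (measurable_coord_rV i)).
    exact: measurable_fst.
  exact: measurable_snd.
transitivity (\int[lambda]_(y in cube (- M) M) \int[lambda]_(x in cube 0 N) F (y, x)).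
  apply: eq_Rintegral => y _; rewrite -bRintZ.
  - by apply: eq_Rintegral => x _; rewrite /F /= addrC (tauD htau).
  - exact: measurable_cube.
  - exact: lebn_cube_fin.
  - exact/(@bdm_sub _ _ _ setT)/(bdm_orbit htau (tau (- y) eta) bf).
rewrite (bRint_Fubini (m1 := lambda) (m2 := lambda) (measurable_cube _ _) (measurable_cube _ _)
  (lebn_cube_fin _ _ _) (lebn_cube_fin _ _ _) mF).
by apply: eq_Rintegral => x _; apply: eq_Rintegral => y _; rewrite /F /= (tauD htau).
Qed.

(** The Lipschitz constant of [rho l] is smaller than its size by a factor of order [l^-1], and both
    shifted kernels live in a cube of side [3 * l]; a shift by at most [N] therefore changes a
    long-range average by order [N / l], uniformly on [X]. *)
Lemma Kop_rho_shift f C : bdm setT f -> (forall x, `|f x| <= C) ->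
  exists2 K, 0 < K & forall l N x eta, 0 < N -> N <= l -> cube 0 N x ->
    `|Kop (rho l) f (tau (- x) eta) - Kop (rho l) f eta| <= K * N / l.
Proof.
move=> bf fC; have [c c0 cP] := @rho_lipschitz R d.
exists (c * 3 ^+ d * (`|C| + 1)).
  by rewrite mulr_gt0 ?mulr_gt0 ?exprn_gt0// ltr_wpDl.
move=> l N x eta N0 Nl xN; have l0 : 0 < l by exact: lt_le_trans Nl.
have kr := kern_rho l0; have bo := bdm_orbit htau eta bf.
rewrite (Kop_corr htau _ _ kr bf) /corr.
have mQ := @measurable_cube R d 0 (3 * l); have fQ := lebn_cube_fin d (0 : R) (3 * l).
have s1 (y : 'rV[R]_d) : ~ cube 0 (3 * l) y -> rho l (y - x) = 0.
  move=> nQ; apply: rho_out => // yx; apply: nQ => i; have := yx i; have := xN i.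
  rewrite /= !mxE !in_itv/= => /andP[h1 h2] /andP[h3 h4]; apply/andP; split; lra.
have s2 (y : 'rV[R]_d) : ~ cube 0 (3 * l) y -> rho l y = 0.
  move=> nQ; apply: rho_out => // yx; apply: nQ => i; have := yx i.
  rewrite /= !in_itv/= => /andP[h1 h2]; apply/andP; split; lra.
rewrite (@Rint_support _ _ (cube 0 (3 * l))); last by move=> y /s1 ->; rewrite mul0r.
rewrite (Kop_cube _ _ _ s2).
have b1 : bdm (cube 0 (3 * l)) (fun y => rho l (y - x) * f (tau (- y) eta)).
  apply: (@bdm_sub _ _ _ setT) => //; apply: bdmM => //.
  split; last by have [k kP] := kr.1.2; exists k => p _; exact: kP.
  exact: (measurableT_comp kr.1.1 (measurable_addr (- x))).
have b2 : bdm (cube 0 (3 * l)) (fun y => rho l y * f (tau (- y) eta)).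
  exact: (bdm_kern_orbit htau).
rewrite -(bRintB mQ fQ b1 b2).
have xl : `|- x| <= N.
  rewrite normrN; apply: norm_le_coord; first exact: ltW.
  by move=> i; have := xN i; rewrite /= in_itv/= => /andP[h1 /ltW h2]; rewrite ger0_norm.
have := @bRint_bound _ _ _ lambda _ mQ fQ _ (c * l^-1 ^+ d.+1 * N * (`|C| + 1)) (bdmB b1 b2).
have -> : c * l^-1 ^+ d.+1 * N * (`|C| + 1) * fine (lambda (cube 0 (3 * l))) =
   c * 3 ^+ d * (`|C| + 1) * N / l.
  rewrite -[lambda _]/(@lebn R d _) lebn_cube ?mulr_ge0 ?(ltW l0)//= subr0 exprMn exprSr.
  have : l^-1 ^+ d * l ^+ d = 1 by rewrite -exprMn mulVf ?gt_eqF// expr1n.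
  move: (l^-1 ^+ d) (l ^+ d) (3 ^+ d) (`|C| + 1) => a b t k ab.
  transitivity (c * t * k * N / l * (a * b)); last by rewrite ab mulr1.
  by ring.
apply => y _; rewrite -mulrBl normrM ler_pM//.
  apply: le_trans (cP l y (- x) l0) _; rewrite ler_wpM2l//.
  by rewrite mulr_ge0 ?exprn_ge0 ?invr_ge0 ?(ltW l0) ?(ltW c0).
by rewrite (le_trans (fC _))// (le_trans (ler_norm C))// lerDl.
Qed.

(** The error is split by averaging over a fixed cube of side [N]. This changes the long-range
    average little, and it commutes with [Kop], so what remains is [Kop (rho l)] applied to an error
    that is small by the mean ergodic theorem; the L^2 bound for [Kop (rho l)] is uniform in [l]. *)
Lemma Kop_rho_large f (eps : R) : bdm setT f -> 0 < eps ->
  exists2 l1, 0 < l1 & forall l, l1 <= l ->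
    nsq (fun eta => Kop (rho l) f eta - \int[mu]_eta f eta) <= eps.
Proof.
move=> bf eps0; have [C C0 CP] := bdm_bound bf.
have fC x : `|f x| <= C by exact: CP.
have [K K0 KP] := Kop_rho_shift bf fC.
have [Cs Cs0 CsP] := nsq_Kop_rho.
pose m := \int[mu]_eta f eta.
have e40 : 0 < eps / (4 * Cs) by rewrite divr_gt0// mulr_gt0.
have /cvgnP/(_ _ e40)[n /(_ n (leqnn n))] := davg_L2 htau bf.
pose N : R := n.+1%:R; have N0 : 0 < N by rewrite ltr0n.
rewrite -/m -/N -/(nsq _) subr0 ger0_norm ?nsq_ge0// => hN.
(* The three summands give [N <= l], [K * N / l <= eps / 2] and [K * N / l <= 1 / 2]; the product of
   the last two bounds the square by [eps / 4]. *)
pose l1 := N + K * N * 2 / eps + K * N * 2; 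
have KN : 0 < K * N by exact: mulr_gt0.
have q1 : 0 <= K * N * 2 by rewrite mulr_ge0// ltW.
have q2 : 0 <= K * N * 2 / eps by rewrite divr_ge0// ltW.
have l1N : N <= l1 by rewrite /l1 -addrA lerDl addr_ge0.
exists l1 => [|l ll]; first exact: lt_le_trans l1N.
have Nl : N <= l by exact: le_trans l1N ll.
have l0 : 0 < l by exact: lt_le_trans Nl.
have kr := kern_rho l0.
have bK := bdm_Kop htau kr bf.
have bdv := bdm_davg htau N bf.
have bd1 : bdm setT (fun eta => Kop (rho l) f eta - davg tau (Kop (rho l) f) N eta).
  by apply: bdmB => //; exact: (bdm_davg htau).
have bd2 : bdm setT (fun eta => davg tau f N eta - m) by apply: bdmB => //; exact: bdm_cst.
have E eta : Kop (rho l) f eta - m =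
    (Kop (rho l) f eta - davg tau (Kop (rho l) f) N eta) +
    Kop (rho l) (fun eta => davg tau f N eta - m) eta.
  have -> : Kop (rho l) (fun eta => davg tau f N eta - m) eta =
      davg tau (Kop (rho l) f) N eta - m.
    rewrite (KopD htau _ kr bdv (bdm_cst setT (- m))) (Kop_rho_cst _ _ l0).
    by rewrite Kop_davg.
  by rewrite addrA subrK.
rewrite (_ : (fun eta => Kop (rho l) f eta - m) = fun eta =>
  (Kop (rho l) f eta - davg tau (Kop (rho l) f) N eta) +
    Kop (rho l) (fun eta => davg tau f N eta - m) eta); last exact/funext.
apply: le_trans (nsqD bd1 (bdm_Kop htau kr bd2)) _.
have h2 := CsP l _ l0 bd2.
have h1 : nsq (fun eta => Kop (rho l) f eta - davg tau (Kop (rho l) f) N eta) <=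
    (K * N / l) ^+ 2.
  apply: le_nsq => // eta; rewrite distrC.
  have mQ := @measurable_cube R d 0 N; have fQ := lebn_cube_fin d (0 : R) N.
  have bo := bdm_sub (subsetT (cube 0 N)) (bdm_orbit htau eta bK).
  have -> : davg tau (Kop (rho l) f) N eta - Kop (rho l) f eta = N^-1 ^+ d *
      \int[lambda]_(x in cube 0 N) (Kop (rho l) f (tau (- x) eta) - Kop (rho l) f eta).
    rewrite (bRintB mQ fQ bo (bdm_cst _ _)) mulrBr; congr (_ - _).
    rewrite Rint_cst_cube ?(ltW N0)// subr0 mulrCA -exprMn mulVf ?gt_eqF//.
    by rewrite expr1n mulr1.
  rewrite normrM ger0_norm ?exprn_ge0 ?invr_ge0 ?(ltW N0)//.
  rewrite exprVn ler_pdivrMl ?exprn_gt0// mulrC.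
  have h : `|\int[lambda]_(x in cube 0 N) (Kop (rho l) f (tau (- x) eta) - Kop (rho l) f eta)| <=
      K * N / l * fine (@lebn R d (cube 0 N)).
    exact: (bRint_bound mQ fQ (bdmB bo (bdm_cst _ (Kop (rho l) f eta)))
      (fun x xN => KP l N x eta N0 Nl xN)).
  by rewrite lebn_cube ?(ltW N0)//= subr0 in h.
have h3 : (K * N / l) ^+ 2 <= eps / 4.
  have a1 : K * N / l <= eps / 2.
    have : K * N * 2 / eps <= l by apply: le_trans ll; rewrite /l1 addrAC lerDr addr_ge0// ltW.
    rewrite !ler_pdivrMr//; move: (K * N) => kn; lra.
  have a2 : K * N / l <= 1 / 2.
    have : K * N * 2 <= l by apply: le_trans ll; rewrite /l1 lerDr addr_ge0// ltW.
    rewrite ler_pdivrMr//; move: (K * N) => kn; lra.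
  have a0 : 0 <= K * N / l by rewrite divr_ge0 ?(ltW KN) ?(ltW l0).
  rewrite expr2; apply: le_trans (ler_pM a0 a0 a1 a2) _.
  by rewrite mulf_div mulr1 -natrM.
have h4 : Cs * nsq (fun eta => davg tau f N eta - m) <= eps / 4.
  apply: le_trans (ler_wpM2l (ltW Cs0) hN) _.
  move: Cs0; move: (Cs) => q q0; rewrite le_eqVlt; apply/orP; left; apply/eqP.
  by field; rewrite gt_eqF.
have {}h2 := le_trans h2 h4; have {}h1 := le_trans h1 h3.
exact: ler_quarters.
Qed.

(** The divergence of the field [potk e l], which links the kernels to gradients and divergences.
    For small [e] and large [l] the operator is close to the one that subtracts the mean. *)
Definition pkern (e l : R) : 'rV[R]_d -> R := fun y => rho e y - rho l y.

Lemma kern_pkern e l : 0 < e -> 0 < l -> kern (pkern e l).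
Proof.
move=> e0 l0; rewrite (_ : pkern e l = fun y => rho e y + -1 * rho l y).
  by apply: kernD; [exact: kern_rho|apply: kernZ; exact: kern_rho].
by apply/funext => y; rewrite mulN1r.
Qed.

Lemma Kop_pkern e l f eta : 0 < e -> 0 < l -> bdm setT f ->
  Kop (pkern e l) f eta = Kop (rho e) f eta - Kop (rho l) f eta.
Proof.
move=> e0 l0 bf; rewrite (_ : pkern e l = fun y => rho e y + -1 * rho l y); last first.
  by apply/funext => y; rewrite mulN1r.
rewrite (Kop_kernD htau _ (kern_rho e0) (kernZ _ (kern_rho l0)) bf).
by rewrite (Kop_kernZ htau _ _ (kern_rho l0) bf) mulN1r.
Qed.

Lemma nsq_Kop_pkern : exists2 C, 0 < C & forall e l f, 0 < e -> 0 < l -> bdm setT f ->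
  nsq (Kop (pkern e l) f) <= C * nsq f.
Proof.
have [C C0 CP] := nsq_Kop_rho; exists (4 * C); first exact: mulr_gt0.
move=> e l f e0 l0 bf; have b1 := bdm_Kop htau (kern_rho e0) bf.
have b2 := bdm_Kop htau (kern_rho l0) bf.
rewrite (_ : Kop (pkern e l) f = fun eta => Kop (rho e) f eta + - Kop (rho l) f eta); last first.
  by apply/funext => eta; rewrite Kop_pkern.
apply: le_trans (nsqD b1 (bdmN b2)) _.
have -> : nsq (fun eta => - Kop (rho l) f eta) = nsq (Kop (rho l) f).
  by apply: eq_Rintegral => x _; rewrite sqrrN.
apply: ler_quarters; rewrite -mulrA mulrC mulKf//; [exact: CP e f e0 bf|exact: CP l f l0 bf].
Qed.

(** One pair of scales must serve the whole family, since the same fields [potk e l] act on all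
    components at once. *)
Lemma pkern_approx (I : finType) (F : I -> X -> R) (eps : R) : (forall i, bdm setT (F i)) ->
  0 < eps -> exists e l, [/\ (0 < e), (0 < l) & forall i,
    nsq (fun eta => Kop (pkern e l) (F i) eta - (F i eta - \int[mu]_z F i z)) <= eps].
Proof.
move=> bF eps0; have e40 : 0 < eps / 4 by rewrite divr_gt0.
have H1 i : exists u : R, 0 < u /\ forall e, 0 < e -> e <= u ->
    nsq (fun eta => Kop (rho e) (F i) eta - F i eta) <= eps / 4.
  by have [u u0 uP] := Kop_rho_small (bF i) e40; exists u.
have H2 i : exists u : R, forall l, u <= l ->
    nsq (fun eta => Kop (rho l) (F i) eta - \int[mu]_z F i z) <= eps / 4.
  by have [u u0 uP] := Kop_rho_large (bF i) e40; exists u.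
have [e1 e1P] := choice H1; have [l1 l1P] := choice H2.
have [e e0 eP] := fin_lower_bound (fun i => (e1P i).1).
have [l l0 lP] := fin_upper_bound l1.
exists e, l; split => // i.
pose m := \int[mu]_z F i z.
have bd1 : bdm setT (fun eta => Kop (rho e) (F i) eta - F i eta).
  by apply: bdmB => //; exact: (bdm_Kop htau (kern_rho e0)).
have bd2 : bdm setT (fun eta => Kop (rho l) (F i) eta - m).
  by apply: bdmB; [exact: (bdm_Kop htau (kern_rho l0))|exact: bdm_cst].
rewrite (_ : (fun eta => _) = fun eta => (Kop (rho e) (F i) eta - F i eta) +
    - (Kop (rho l) (F i) eta - m)); last first.
  apply/funext => eta; rewrite Kop_pkern// -/m.
  move: (Kop (rho e) (F i) eta) (Kop (rho l) (F i) eta) (F i eta) (m) => a b c q.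
  ring.
apply: le_trans (nsqD bd1 (bdmN bd2)) _; apply: ler_quarters; first exact: (e1P i).2.
rewrite (_ : nsq _ = nsq (fun eta => Kop (rho l) (F i) eta - m)); first exact: l1P.
by apply: eq_Rintegral => x _; rewrite sqrrN.
Qed.

End approximate_identity.

(** * Square-integrable functions *)

Section square_integrable.
Context {R : realType} {disp : measure_display} {T : measurableType disp}.
Context (m : {measure set T -> \bar R}) (D : set T).
Hypotheses (mD : measurable D) (Dfin : (m D < +oo)%E).
Implicit Types (f g : T -> R).

(** Members of [F2pot] are only square integrable, so part of the calculus of [bdm] is redone at
    this level. Measurability remains global. *)
Definition sqint f := measurable_fun setT f /\ m.-integrable D (fun x => (f x ^+ 2)%:E).

Lemma int_dom f g : measurable_fun setT f -> m.-integrable D (EFin \o g) ->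
  (forall x, D x -> `|f x| <= g x) -> m.-integrable D (EFin \o f).
Proof.
move=> mf ig fg; apply: (@le_integrable _ _ _ m D mD _ (EFin \o g)) => //.
  by apply/measurable_EFinP; exact: measurable_funTS.
move=> x Dx; rewrite /= lee_fin (le_trans (fg x Dx))//; exact: ler_norm.
Qed.

Lemma int_cst (c : R) : m.-integrable D (EFin \o (fun=> c)).
Proof. exact: (bdm_int mD Dfin (bdm_cst D c)). Qed.

Lemma intD f g : m.-integrable D (EFin \o f) -> m.-integrable D (EFin \o g) ->
  m.-integrable D (EFin \o (fun x => f x + g x)).
Proof. by move=> h1 h2; exact: (integrableD mD h1 h2). Qed.

Lemma intZ c f : m.-integrable D (EFin \o f) -> m.-integrable D (EFin \o (fun x => c * f x)).
Proof. by move=> h; exact: (integrableZl mD c h). Qed.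

Lemma sqint_int f : sqint f -> m.-integrable D (EFin \o f).
Proof.
move=> [mf f2]; apply: (@int_dom _ (fun x => 1 + f x ^+ 2)) => //.
  by apply: intD; [exact: int_cst|exact: f2].
move=> x _; rewrite ler_norml; have := sqr_ge0 (f x - 1); have := sqr_ge0 (f x + 1).
by rewrite sqrrB sqrrD; move: (f x) => a h1 h2; apply/andP; split; lra.
Qed.

Lemma sqint_bdm f : bdm D f -> sqint f.
Proof. by move=> bf; split; [exact: bf.1|exact: (bdm_int mD Dfin (bdmX 2 bf))]. Qed.

Lemma sqint_mul f g : sqint f -> sqint g -> m.-integrable D (EFin \o (fun x => f x * g x)).
Proof.
move=> [mf f2] [mg g2]; apply: (@int_dom _ (fun x => f x ^+ 2 + g x ^+ 2)).
- exact: measurable_funM.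
- exact: intD.
move=> x _; rewrite ler_norml; have := sqr_ge0 (f x - g x); have := sqr_ge0 (f x + g x).
rewrite sqrrB sqrrD; have := sqr_ge0 (f x); have := sqr_ge0 (g x).
by move: (f x) (g x) => a b h1 h2 h3 h4; apply/andP; split; nra.
Qed.

Lemma sqintD f g : sqint f -> sqint g -> sqint (fun x => f x + g x).
Proof.
move=> sf sg; have [mf f2] := sf; have [mg g2] := sg; split; first exact: measurable_funD.
have := intD (intD f2 g2) (intZ 2 (sqint_mul sf sg)).
by congr (m.-integrable D _); apply/funext => x /=; congr EFin; ring.
Qed.

Lemma sqintZ c f : sqint f -> sqint (fun x => c * f x).
Proof.
move=> [mf f2]; split; first exact: measurable_funM.
have := intZ (c ^+ 2) f2.
by congr (m.-integrable D _); apply/funext => x /=; rewrite exprMn.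
Qed.

Lemma sqintB f g : sqint f -> sqint g -> sqint (fun x => f x - g x).
Proof.
move=> sf sg; have := sqintD sf (sqintZ (-1) sg).
by congr sqint; apply/funext => x; rewrite mulN1r.
Qed.

Lemma sqint_sum (I : Type) (r : seq I) (F : I -> T -> R) :
  (forall i, sqint (F i)) -> sqint (fun x => \sum_(i <- r) F i x).
Proof.
move=> sF; elim: r => [|i r IH].
  under eq_fun do rewrite big_nil; exact: sqint_bdm (bdm_cst D 0).
by under eq_fun do rewrite big_cons; exact: sqintD.
Qed.

Lemma sqint_dom f g : measurable_fun setT f -> sqint g ->
  (forall x, D x -> `|f x| <= `|g x|) -> sqint f.
Proof.
move=> mf [mg g2] fg; split => //.
apply: (@int_dom (fun x => f x ^+ 2) (fun x => g x ^+ 2)) => //.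
  exact: measurable_funX.
move=> x Dx; rewrite normrX -[leRHS]real_normK ?num_real//.
by rewrite lerXn2r ?nnegrE// fg.
Qed.

(** The nonnegative integral of the square of [f - a] is expanded and optimized in [a]; on a domain
    of measure zero the inequality is linear in [a] and forces a zero integral. *)
Lemma sqint_mean f : sqint f ->
  (\int[m]_(x in D) f x) ^+ 2 <= fine (m D) * \int[m]_(x in D) (f x ^+ 2).
Proof.
move=> sf; have i1 := sqint_int sf; have [mf i2] := sf.
set K := \int[m]_(x in D) f x; set S := \int[m]_(x in D) (f x ^+ 2).
have key a : 2 * a * K - a ^+ 2 * fine (m D) <= S.
  have h : 0 <= \int[m]_(x in D) ((f x - a) ^+ 2).
    by apply: Rintegral_ge0 => x _; exact: sqr_ge0.
  have E : \int[m]_(x in D) ((f x - a) ^+ 2) = S - (2 * a * K - a ^+ 2 * fine (m D)).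
    rewrite (@eq_Rintegral _ _ _ m D (fun x => f x ^+ 2 + (- (2 * a) * f x + a ^+ 2))).
      rewrite RintegralD//; last by apply: intD; [exact: intZ|exact: int_cst].
      rewrite RintegralD//; [|exact: intZ|exact: int_cst].
      by rewrite RintegralZl// Rintegral_cst// -/K -/S; ring.
    by move=> x _; ring.
  by rewrite -subr_ge0 -E.
have l0 : 0 <= fine (m D) by rewrite fine_ge0.
have S0 : 0 <= S by apply: Rintegral_ge0 => x _; exact: sqr_ge0.
have [l00|lpos] := leP (fine (m D)) 0.
  have lz : fine (m D) = 0 by apply/eqP; rewrite eq_le l00 l0.
  rewrite lz mul0r; have [->|K0] := eqVneq K 0; first by rewrite expr0n.
  have := key ((S + 1) / (2 * K)); rewrite lz mulr0 subr0.
  have -> : 2 * ((S + 1) / (2 * K)) * K = S + 1 by field.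
  by rewrite gerDl ler10.
have := key (K / fine (m D)).
have -> : 2 * (K / fine (m D)) * K - (K / fine (m D)) ^+ 2 * fine (m D) = K ^+ 2 / fine (m D).
  by field; rewrite gt_eqF.
by rewrite ler_pdivrMr// mulrC.
Qed.

End square_integrable.

(** * Convolution along orbits for square-integrable functions *)

Section square_integrable_action.
Context {R : realType} {d : nat} {disp : measure_display}
  {X : measurableType disp} (mu : probability X R)
  (tau : 'rV[R]_d -> X -> X).
Hypothesis htau : ergodic_action mu tau.
Local Notation lambda := (@lebn R d).
Local Notation Kop := (Kop tau).
Implicit Types (f g : X -> R) (phi : 'rV[R]_d -> R).

Let mT := @measurableT _ X.
Let fT := muT_fin mu.

Definition L2 f := sqint mu setT f.

Lemma bdm_L2 f : bdm setT f -> L2 f. Proof. exact: sqint_bdm. Qed.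

Lemma L2_Lfun f : f \in Lfun mu 2%:E -> L2 f.
Proof.
move=> fL; split; last exact: Lfun2_integrable_sqr.
by have := sub_Lfun_mfun fL; rewrite inE.
Qed.

Lemma bdm_Lfun f : bdm setT f -> f \in Lfun mu 2%:E.
Proof.
move=> bf; have [C C0 CP] := bdm_bound bf; rewrite inE/=; apply/andP; split; rewrite inE/=.
  exact: bf.1.
rewrite /finite_norm unlock poweR_lty//.
under eq_integral => x _/= do rewrite powR_mulrn// real_normK ?num_real//.
by apply: integrable_lty => //; exact: (bdm_L2 bf).2.
Qed.

Lemma le_nsq2 f g : L2 f -> L2 g -> (forall x, `|f x| <= `|g x|) -> nsq mu f <= nsq mu g.
Proof.
move=> [mf f2] [mg g2] fg; apply: le_Rintegral => // x _.
rewrite -real_normK ?num_real// -[leRHS]real_normK ?num_real//.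
by rewrite lerXn2r ?nnegrE.
Qed.

Lemma nsqD2 f g : L2 f -> L2 g ->
  nsq mu (fun eta => f eta + g eta) <= 2 * nsq mu f + 2 * nsq mu g.
Proof.
move=> sf sg; have [mf f2] := sf; have [mg g2] := sg.
rewrite /nsq -!RintegralZl// -RintegralD//; try exact: intZ.
apply: le_Rintegral => //.
- exact: (sqintD mT sf sg).2.
- by apply: intD => //; exact: intZ.
move=> x _; have := sqr_ge0 (f x - g x); move: (f x) (g x) => a b.
by move=> h; rewrite -subr_ge0; move: h; congr (_ <= _); ring.
Qed.

Lemma nsqZ c f : L2 f -> nsq mu (fun eta => c * f eta) = c ^+ 2 * nsq mu f.
Proof.
move=> [mf f2]; rewrite /nsq -RintegralZl//.
by apply: eq_Rintegral => x _; rewrite exprMn.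
Qed.

Lemma nsqN f : nsq mu (fun eta => - f eta) = nsq mu f.
Proof. by apply: eq_Rintegral => x _; rewrite sqrrN. Qed.

Lemma nsqB2 f g : L2 f -> L2 g ->
  nsq mu (fun eta => f eta - g eta) <= 2 * nsq mu f + 2 * nsq mu g.
Proof.
move=> sf sg; have := nsqD2 sf (sqintZ mT (-1) sg).
rewrite (_ : nsq mu (fun x => -1 * g x) = nsq mu g); last first.
  by rewrite nsqZ// sqrrN expr1n mul1r.
by congr (nsq mu _ <= _); apply/funext => x; rewrite mulN1r.
Qed.

Lemma nsq_sum (I : Type) (r : seq I) (F : I -> X -> R) : (forall i, L2 (F i)) ->
  nsq mu (fun x => \sum_(i <- r) F i x) <= 2 ^+ size r * \sum_(i <- r) nsq mu (F i).
Proof.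
move=> sF; elim: r => [|i r IH].
  rewrite big_nil mulr0 (_ : (fun x => _) = fun=> 0); last by apply/funext => x; rewrite big_nil.
  by rewrite /nsq; under eq_Rintegral do rewrite expr0n; rewrite Rint0.
rewrite (_ : (fun x => _) = fun x => F i x + \sum_(j <- r) F j x); last first.
  by apply/funext => x; rewrite big_cons.
apply: le_trans (nsqD2 (sF i) (sqint_sum mT fT r sF)) _.
rewrite big_cons mulrDr exprS; apply: lerD.
  rewrite -mulrA ler_wpM2l// ler_peMl ?nsq_ge0//.
  by rewrite exprn_ege1// ler1n.
by rewrite -mulrA ler_wpM2l.
Qed.

Lemma ae_nsq f g : measurable_fun setT f -> measurable_fun setT g ->
  {ae mu, forall x, f x = g x} -> nsq mu f = nsq mu g.
Proof.
move=> mf mg fg; rewrite /nsq /Rintegral; congr fine; apply: ae_eq_integral => //.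
- by apply/measurable_EFinP; exact: measurable_funX.
- by apply/measurable_EFinP; exact: measurable_funX.
- by apply: filterS fg => x ->.
Qed.

(** Large values are set to zero rather than clamped: the error is then either 0 or [f] itself, so
    it decreases in [k] and one threshold serves every larger level. *)
Definition trunc (k : R) f eta := if `|f eta| <= k then f eta else 0.

Lemma bdm_trunc k f : measurable_fun setT f -> bdm setT (trunc k f).
Proof.
move=> mf; split.
  apply: measurable_fun_ifT => //.
  have mn : measurable_fun setT (fun x => `|f x|) by exact: measurableT_comp.
  exact: (measurable_fun_ler mn (measurable_cst k)).
exists `|k| => x _; rewrite /trunc; case: ifP => [h|_]; last by rewrite normr0.
by rewrite (le_trans h)// ler_norm.
Qed.

Lemma trunc_approx f (eps : R) : L2 f -> 0 < eps -> exists k0, forall k, k0 <= k ->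
  nsq mu (fun eta => f eta - trunc k f eta) <= eps.
Proof.
move=> sf eps0; have [mf f2] := sf.
have mt k : measurable_fun setT (fun eta => f eta - trunc k f eta).
  by apply: measurable_funB => //; exact: (bdm_trunc k mf).1.
have dom k x : `|f x - trunc k f x| <= `|f x|.
  by rewrite /trunc; case: ifP => _; rewrite ?subrr ?normr0 ?subr0.
have st k : L2 (fun eta => f eta - trunc k f eta) by apply: (sqint_dom mT (mt k) sf).
have : nsq mu (fun eta => f eta - trunc n%:R f eta) @[n --> \oo] --> (0 : R).
  have [] := @dominated_convergence _ _ _ mu setT mT
    (fun n x => ((f x - trunc n%:R f x) ^+ 2)%:E) (cst 0%E) (fun x => (f x ^+ 2)%:E).
  - by move=> n; apply/measurable_EFinP; exact: measurable_funX.
  - exact: measurable_cst.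
  - apply: aeW => x _; apply/fine_cvgP; split; first exact: nearW.
    apply/cvgnP => e e0; exists (Num.truncn `|f x|).+1 => n Nn /=.
    rewrite /trunc ifT ?subrr ?expr0n ?normr0 ?ltW//= ?subrr ?normr0 ?ltW//.
    by apply: lt_le_trans (truncnS_gt _) _; rewrite ler_nat.
  - exact: f2.
  - apply: aeW => x n _; rewrite /= lee_fin normrX -[leRHS]real_normK ?num_real//.
    by rewrite lerXn2r ?nnegrE.
  move=> _ _; rewrite integral0 => cF.
  by apply: (fine_cvg (f := fun n => (\int[mu]_x ((f x - trunc n%:R f x) ^+ 2)%:E)%E)).
move=> /cvgnP/(_ _ eps0)[n /(_ n (leqnn n))]; rewrite subr0 ger0_norm ?nsq_ge0// => hn.
exists n%:R => k nk; apply: le_trans hn; apply: le_nsq2 => // x.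
rewrite /trunc; have [h|h] := leP `|f x| n%:R.
  by rewrite (le_trans h nk).
by case: ifP => _; rewrite ?subrr ?normr0 ?subr0.
Qed.

Let mQ (M : R) : measurable (@cube R d (- M) M) := measurable_cube _ _.
Let fQ (M : R) : (lambda (@cube R d (- M) M) < +oo)%E := lebn_cube_fin d _ _.

Lemma measurable_orbit_comp f eta : measurable_fun setT f ->
  measurable_fun [set: 'rV[R]_d] (fun y => f (tau (- y) eta)).
Proof. by move=> mf; exact: (measurableT_comp mf (measurable_orbit htau eta)). Qed.

Lemma orbit_Tonelli f (D : set 'rV[R]_d) : measurable D -> measurable_fun setT f ->
  (\int[mu]_eta \int[lambda]_(y in D) (f (tau (- y) eta) ^+ 2)%:E =
   lambda D * \int[mu]_eta (f eta ^+ 2)%:E)%E.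
Proof.
move=> mDD mf.
pose G (p : X * 'rV[R]_d) : \bar R := (f (tau (- p.2) p.1) ^+ 2 * \1_D p.2)%:E.
have G0 p : (0 <= G p)%E by rewrite lee_fin mulr_ge0// sqr_ge0.
have mG : measurable_fun setT G.
  apply/measurable_EFinP; apply: measurable_funM.
    by apply: measurable_funX; exact: (measurableT_comp mf (measurable_tau_joint htau)).
  exact: (measurableT_comp (measurable_indic mDD) measurable_snd).
transitivity (\int[mu]_eta \int[lambda]_y G (eta, y))%E.
  apply: eq_integral => eta _; rewrite integral_mkcond; apply: eq_integral => y _.
  rewrite patchE /G /= indicE; case: ifPn => yD; rewrite ?mulr1 ?mulr0//.
rewrite (fubini_tonelli (m1 := mu) (m2 := lambda) G mG G0).
transitivity (\int[lambda]_y ((\int[mu]_eta (f eta ^+ 2)%:E) * (\1_D y)%:E))%E.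
  apply: eq_integral => y _ /=; rewrite /G /=.
  have mf2 : measurable_fun setT (fun x => (f x ^+ 2)%:E).
    by apply/measurable_EFinP; exact: measurable_funX.
  rewrite -[in RHS](integral_tau htau y mf2).
  rewrite -ge0_integralZr//.
  - exact: (measurableT_comp mf2 (measurable_tau htau y)).
  - by move=> x _; rewrite lee_fin sqr_ge0.
rewrite ge0_integralZl//.
- by rewrite integral_indic// setIT muleC.
- by apply/measurable_EFinP; exact: measurable_indic.
- by apply: integral_ge0 => x _; rewrite lee_fin sqr_ge0.
Qed.

Lemma measurable_orbit_int f M : measurable_fun setT f ->
  measurable_fun setT (fun eta =>
    \int[lambda]_(y in cube (- M) M) (f (tau (- y) eta) ^+ 2)%:E)%E.
Proof.
move=> mf; rewrite (_ : (fun eta => _) = fun eta => \int[lambda]_y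
      ((f (tau (- y) eta) ^+ 2 * \1_(cube (- M) M) y)%:E))%E; last first.
  apply/funext => eta; rewrite integral_mkcond; apply: eq_integral => y _.
    by rewrite patchE indicE; case: ifPn => yD; rewrite ?mulr1 ?mulr0.
  apply: (@measurable_fun_fubini_tonelli_F _ _ _ _ _ lambda
    (fun p => (f (tau (- p.2) p.1) ^+ 2 * \1_(cube (- M) M) p.2)%:E)).
    apply/measurable_EFinP; apply: measurable_funM.
      by apply: measurable_funX; exact: (measurableT_comp mf (measurable_tau_joint htau)).
    exact: (measurableT_comp (measurable_indic (mQ M)) measurable_snd).
  by move=> p; rewrite lee_fin mulr_ge0// sqr_ge0.
Qed.

(** By Tonelli and invariance, the local squared norm of the realization has a finite integral over
    [X]. Off the exceptional set the integrals that define [Kop] are genuine, and [Kop] is linear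
    there. *)
Lemma ae_orbit_sqint f M : L2 f ->
  {ae mu, forall eta, sqint lambda (cube (- M) M) (fun y => f (tau (- y) eta))}.
Proof.
move=> [mf f2].
pose S eta := (\int[lambda]_(y in cube (- M) M) (f (tau (- y) eta) ^+ 2)%:E)%E.
have S0 eta : (0 <= S eta)%E by apply: integral_ge0 => y _; rewrite lee_fin sqr_ge0.
have mS := measurable_orbit_int M mf.
have iS : mu.-integrable setT S.
  apply/integrableP; split=> //.
  under eq_integral do rewrite gee0_abs//.
  rewrite (orbit_Tonelli (mQ M) mf).
  have h1 := integrable_fin_num mT f2; rewrite -(fineK h1).
  have h2 : lambda (cube (- M) M) \is a fin_num.
    by rewrite ge0_fin_numE//; exact: fQ.
  by rewrite -(fineK h2) -EFinM ltry.
apply: filterS (integrable_ae mT iS) => eta /(_ Logic.I) Sfin; split.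
  exact: measurable_orbit_comp.
apply/integrableP; split.
  apply/measurable_EFinP; apply: measurable_funTS; apply: measurable_funX.
  exact: measurable_orbit_comp.
under eq_integral do rewrite gee0_abs ?lee_fin ?sqr_ge0//.
by rewrite -/(S eta) -ge0_fin_numE.
Qed.

Lemma sqint_kern phi h M : kern phi ->
  sqint lambda (cube (- M) M) h -> sqint lambda (cube (- M) M) (fun y => phi y * h y).
Proof.
move=> kphi sh; have [C C0 CP] := bdm_bound kphi.1.
apply: (sqint_dom (mQ M) _ (sqintZ (mQ M) C sh)).
  by apply: measurable_funM; [exact: kphi.1.1|exact: sh.1].
by move=> x _; rewrite !normrM ler_wpM2r// (le_trans (CP x _))// ler_norm.
Qed.

Lemma measurable_Kop phi f : kern phi -> measurable_fun setT f ->
  measurable_fun setT (Kop phi f).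
Proof.
move=> kphi mf; apply: (@measurable_Rint _ _ _ _ _ lambda setT
  (fun p => phi p.2 * f (tau (- p.2) p.1))) => //.
apply: measurable_funM; first exact: (measurableT_comp kphi.1.1 measurable_snd).
exact: (measurableT_comp mf (measurable_tau_joint htau)).
Qed.

(** The pointwise Cauchy-Schwarz bound is obtained only where the realization is locally square
    integrable, so the integrals are compared through an almost everywhere inequality. The constant
    depends on the kernel in an uncontrolled way. *)
Lemma L2_Kop phi : kern phi -> exists2 C, 0 < C & forall f, L2 f ->
  L2 (Kop phi f) /\ nsq mu (Kop phi f) <= C * nsq mu f.
Proof.
move=> kphi; have [c c0 cP] := bdm_bound kphi.1.
have [_ /bsupp_cube[M M0 MP]] := kphi.
have lE : lambda (cube (- M) M) = ((2 * M) ^+ d)%:E.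
  by rewrite -[lambda _]/(@lebn R d _) lebn_cube ?ge0_cp ?(ltW M0)// opprK mulrC mulr_natr mulr2n.
have l0 : 0 < (2 * M) ^+ d by rewrite exprn_gt0// mulr_gt0.
exists (c ^+ 2 * (2 * M) ^+ d * (2 * M) ^+ d); first by rewrite !mulr_gt0// exprn_gt0.
move=> f sf; have [mf f2] := sf.
have mK := measurable_Kop kphi mf.
pose S eta := (\int[lambda]_(y in cube (- M) M) (f (tau (- y) eta) ^+ 2)%:E)%E.
have S0 eta : (0 <= S eta)%E by apply: integral_ge0 => y _; rewrite lee_fin sqr_ge0.
have pt : {ae mu, forall eta, setT eta -> (((Kop phi f eta) ^+ 2)%:E <=
    (c ^+ 2 * (2 * M) ^+ d)%:E * S eta)%E}.
  apply: filterS (ae_orbit_sqint M sf) => eta so _.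
  have sk := sqint_kern kphi so.
  rewrite (Kop_cube _ _ _ MP).
  have h : (\int[lambda]_(y in cube (- M) M) (phi y * f (tau (- y) eta))) ^+ 2 <=
      fine (lambda (cube (- M) M)) *
      \int[lambda]_(y in cube (- M) M) ((phi y * f (tau (- y) eta)) ^+ 2).
    exact: (sqint_mean (mQ M) (fQ M) sk).
  rewrite lE/= in h.
  have SE : S eta = (\int[lambda]_(y in cube (- M) M) (f (tau (- y) eta) ^+ 2))%:E.
    rewrite /Rintegral fineK//; exact: integrable_fin_num so.2.
  rewrite SE -EFinM lee_fin; apply: le_trans h _.
  rewrite [c ^+ 2 * _]mulrC -mulrA ler_wpM2l ?(ltW l0)//.
  rewrite -RintegralZl//; last exact: so.2.
  apply: le_Rintegral => //; [exact: sk.2|exact: (intZ _ _ so.2)|].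
  move=> y _; rewrite exprMn ler_wpM2r ?sqr_ge0//.
  by rewrite -real_normK ?num_real// lerXn2r ?nnegrE ?(ltW c0)// cP.
have IS : (\int[mu]_eta ((Kop phi f eta) ^+ 2)%:E <=
    (c ^+ 2 * (2 * M) ^+ d * (2 * M) ^+ d)%:E * \int[mu]_eta (f eta ^+ 2)%:E)%E.
  rewrite [(_ * (2 * M) ^+ d)%:E]EFinM -muleA -lE -(orbit_Tonelli (mQ M) mf).
  have mS := measurable_orbit_int M mf.
  rewrite -ge0_integralZl//; last by rewrite lee_fin; apply: mulr_ge0; [exact: sqr_ge0|exact: ltW].
  apply: ae_ge0_le_integral => //.
  - by move=> x _; rewrite lee_fin sqr_ge0.
  - by apply/measurable_EFinP; exact: measurable_funX.
  - move=> x _; apply: mule_ge0; last exact: (S0 x).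
    by rewrite lee_fin; apply: mulr_ge0; [exact: sqr_ge0|exact: ltW].
  - exact: measurable_funeM.
  - by move=> x _; exact: (S0 x).
have fin := integrable_fin_num mT f2.
have sK : L2 (Kop phi f).
  split => //; apply/integrableP; split.
    by apply/measurable_EFinP; exact: measurable_funX.
  under eq_integral do rewrite gee0_abs ?lee_fin ?sqr_ge0//.
  by apply: le_lt_trans IS _; rewrite -(fineK fin) -EFinM ltry.
split => //; rewrite -lee_fin EFinM /nsq /Rintegral !fineK//.
exact: (integrable_fin_num mT sK.2).
Qed.

Lemma ae_KopB phi f g : kern phi -> L2 f -> L2 g ->
  {ae mu, forall eta, Kop phi (fun eta => f eta - g eta) eta = Kop phi f eta - Kop phi g eta}.
Proof.
move=> kphi sf sg; have [_ /bsupp_cube[M M0 MP]] := kphi.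
apply: filterS2 (ae_orbit_sqint M sf) (ae_orbit_sqint M sg) => eta s1 s2.
rewrite !(Kop_cube _ _ _ MP) -RintegralB//.
- by apply: eq_Rintegral => y _; rewrite mulrBr.
- exact: (sqint_int (mQ M) (fQ M) (sqint_kern kphi s1)).
- exact: (sqint_int (mQ M) (fQ M) (sqint_kern kphi s2)).
Qed.

(** [Kop] with a differentiated kernel is exactly the integral that tests the realization, so
    vortex-freeness becomes an identity on [X]; local integrability serves to split the integral of
    the difference. *)
Lemma F2pot_curl_free (v : X -> 'rV[R]_d) i j phi : F2pot mu tau v -> test_function phi ->
  {ae mu, forall eta, Kop (partial j phi) (fun eta => v eta 0 i) eta =
     Kop (partial i phi) (fun eta => v eta 0 j) eta}.
Proof.
move=> [vL _ vp] tphi.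
have sv k : L2 (fun eta => v eta 0 k) by exact: L2_Lfun.
have ki := test_function_kern (test_function_partial i tphi).
have kj := test_function_kern (test_function_partial j tphi).
have [M1 M10 M1P] := bsupp_cube ki.2; have [M2 M20 M2P] := bsupp_cube kj.2.
pose M := M1 + M2.
have MP1 y : ~ cube (- M) M y -> partial i phi y = 0.
  move=> nQ; apply: M1P => yM; apply: nQ => k; have := yM k.
  by rewrite /= !in_itv/= /M => /andP[h1 h2]; apply/andP; split; lra.
have MP2 y : ~ cube (- M) M y -> partial j phi y = 0.
  move=> nQ; apply: M2P => yM; apply: nQ => k; have := yM k.
  by rewrite /= !in_itv/= /M => /andP[h1 h2]; apply/andP; split; lra.
apply: filterS3 vp (ae_orbit_sqint M (sv i)) (ae_orbit_sqint M (sv j)) => eta vpe s1 s2.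
have := vpe i j phi tphi; move=> /(congr1 fine).
have i1 := sqint_int (mQ M) (fQ M) (sqint_kern kj s1).
have i2 := sqint_int (mQ M) (fQ M) (sqint_kern ki s2).
rewrite -/(Rintegral lambda setT (fun x => v (tau (- x) eta) 0 i * partial j phi x -
     v (tau (- x) eta) 0 j * partial i phi x)).
rewrite (@Rint_support _ _ (cube (- M) M)); last first.
  by move=> y yM; rewrite MP1// MP2// !mulr0 subrr.
rewrite (Kop_cube _ _ _ MP1) (Kop_cube _ _ _ MP2) => h.
apply/eqP; rewrite -subr_eq0 -RintegralB//.
by rewrite -[X in _ == X]h; apply/eqP; apply: eq_Rintegral => y _; rewrite ![_ * v _ _ _]mulrC.
Qed.

End square_integrable_action.

Lemma curl_alg {R : realType} (x1 x2 y1 y2 p q : R) :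
  x1 = x2 -> y2 = x2 - p -> y1 = x1 - q -> p - q = y1 - y2.
Proof. by move=> -> -> ->; ring. Qed.

(** * Gradient fields and their density in [F2pot] *)

Section gradient_fields.
Context {R : realType} {d : nat} {disp : measure_display}
  {X : measurableType disp} (mu : probability X R)
  (tau : 'rV[R]_d -> X -> X).
Hypothesis htau : ergodic_action mu tau.
Local Notation lambda := (@lebn R d).
Local Notation Kop := (Kop tau).
Implicit Types (f g : X -> R) (w : 'I_d -> X -> R) (phi : 'rV[R]_d -> R) (i j : 'I_d).

Let mT := @measurableT _ X.
Let fT := muT_fin mu.

Lemma L2B f g : L2 mu f -> L2 mu g -> L2 mu (fun eta => f eta - g eta).
Proof. by move=> sf sg; exact: (sqintB mT sf sg). Qed.

Record is_grad g w : Prop := IsGrad {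
  grad_bdm : bdm setT g ;
  gradw_bdm : forall i, bdm setT (w i) ;
  grad_smooth : forall eta, smooth (fun x => g (tau (- x) eta)) ;
  grad_partial : forall eta i x,
    partial i (fun x => g (tau (- x) eta)) x = w i (tau (- x) eta) ;
  grad_mean : forall i, \int[mu]_eta w i eta = 0 }.

Lemma Kop_orbit phi f eta : test_function phi -> bdm setT f ->
  (fun x => Kop phi f (tau (- x) eta)) = corr phi (fun y => f (tau (- y) eta)).
Proof.
by move=> tphi bf; apply/funext => x; rewrite (Kop_corr htau)//; exact: test_function_kern.
Qed.

Lemma KopB phi f g eta : kern phi -> bdm setT f -> bdm setT g ->
  Kop phi (fun eta => f eta - g eta) eta = Kop phi f eta - Kop phi g eta.
Proof.
move=> kphi bf bg; rewrite -[X in _ + X]mulN1r -(KopZ htau _ _ kphi bg).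
rewrite -(KopD htau _ kphi bf (bdmZ _ bg)); congr (Kop _ _ _).
by apply/funext => z; rewrite mulN1r.
Qed.

(** The source of all gradient fields used later. The sign comes from the correlation, and the mean
    vanishes because a partial derivative of a test function has zero integral. *)
Lemma is_grad_Kop phi f : test_function phi -> bdm setT f ->
  is_grad (Kop phi f) (fun i eta => - Kop (partial i phi) f eta).
Proof.
move=> tphi bf; have k i := test_function_kern (test_function_partial i tphi).
have bK i := bdm_Kop htau (k i) bf.
split.
- exact: (bdm_Kop htau (test_function_kern tphi) bf).
- by move=> i; exact: bdmN.
- by move=> eta; rewrite Kop_orbit//; apply: corr_smooth => //; exact: (bdm_orbit htau).
- move=> eta i x; rewrite Kop_orbit// partial_corr//; last exact: (bdm_orbit htau).
  by congr (- _); rewrite (Kop_corr htau).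
- move=> i; rewrite bRintN// (Rint_Kop htau (k i) bf).
  have [sphi bphi] := (test_functionP phi).1 tphi.
  by rewrite Rint_partial_bsupp0// mul0r oppr0.
Qed.

Lemma is_grad0 : is_grad (fun=> 0) (fun _ _ => 0).
Proof.
split=> [|i|eta|eta i x|i]; try exact: bdm_cst; first exact: smooth_cst.
  exact: partial_cst.
exact: Rint0.
Qed.

Lemma is_gradD g w g' w' : is_grad g w -> is_grad g' w' ->
  is_grad (fun eta => g eta + g' eta) (fun i eta => w i eta + w' i eta).
Proof.
move=> [b1 bw1 s1 p1 m1] [b2 bw2 s2 p2 m2]; split.
- exact: bdmD.
- by move=> i; exact: bdmD.
- by move=> eta; exact: smoothD.
- move=> eta i x; rewrite partialD ?p1 ?p2//; exact: smooth_differentiable.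
- by move=> i; rewrite bRintD// m1 m2 addr0.
Qed.

Lemma is_gradZ c g w : is_grad g w ->
  is_grad (fun eta => c * g eta) (fun i eta => c * w i eta).
Proof.
move=> [b1 bw1 s1 p1 m1]; split.
- exact: bdmZ.
- by move=> i; exact: bdmZ.
- by move=> eta; exact: smoothZ.
- move=> eta i x; rewrite partialZ ?p1//; exact: smooth_differentiable.
- by move=> i; rewrite bRintZ// m1 mulr0.
Qed.

Lemma is_grad_sum (I : Type) (r : seq I) (G : I -> X -> R) (W : I -> 'I_d -> X -> R) :
  (forall k, is_grad (G k) (W k)) ->
  is_grad (fun eta => \sum_(k <- r) G k eta) (fun i eta => \sum_(k <- r) W k i eta).
Proof.
move=> gG; elim: r => [|k r IH].
  rewrite (_ : (fun eta => _) = fun=> 0); last by apply/funext => eta; rewrite big_nil.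
  rewrite (_ : (fun i eta => _) = fun _ _ => 0); first exact: is_grad0.
  by apply/funext => i; apply/funext => eta; rewrite big_nil.
rewrite (_ : (fun eta => _) = fun eta => G k eta + \sum_(k <- r) G k eta); last first.
  by apply/funext => eta; rewrite big_cons.
rewrite (_ : (fun i eta => _) = fun i eta => W k i eta + \sum_(k <- r) W k i eta); last first.
  by apply/funext => i; apply/funext => eta; rewrite big_cons.
exact: is_gradD.
Qed.

Lemma integrable_kern phi : kern phi -> lambda.-integrable setT (EFin \o phi).
Proof.
move=> [bphi /bsupp_cube[M M0 MP]].
have -> : EFin \o phi = (EFin \o phi) \_ (cube (- M) M).
  apply/funext => x; rewrite patchE; case: ifPn => //; rewrite notin_setE => /MP /= -> //.
apply/(integrable_mkcond _ (measurable_cube _ _)).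
apply: (bdm_int (measurable_cube _ _) (lebn_cube_fin _ _ _)).
exact: bdm_sub bphi.
Qed.

Lemma integralB_eq0 (a b : 'rV[R]_d -> R) : lambda.-integrable setT (EFin \o a) ->
  lambda.-integrable setT (EFin \o b) -> \int[lambda]_x a x = 0 ->
  \int[lambda]_x b x = 0 -> (\int[lebesgue_rV d]_x (a x - b x)%:E = 0)%E.
Proof.
move=> ia ib a0 b0; transitivity (\int[lambda]_x (a x - b x))%:E; last first.
  by rewrite (RintegralB measurableT ia ib) a0 b0 subrr.
by rewrite /Rintegral fineK//; exact: (integrable_fin_num measurableT (integrableB measurableT ia ib)).
Qed.

Definition vec w eta : 'rV[R]_d := \row_i w i eta.

(** With [G] the realization of [g], equality of mixed derivatives turns the integrand into
    [partial j] of [phi * partial i G] minus [partial i] of [phi * partial j G], and both terms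
    integrate to zero. *)
Lemma is_grad_F2pot g w : is_grad g w -> F2pot mu tau (vec w).
Proof.
move=> [bg bw sg pg mg]; split.
- move=> i; rewrite (_ : (fun eta => _) = w i); first exact: bdm_Lfun.
  by apply/funext => eta; rewrite mxE.
- move=> i; transitivity (\int[mu]_eta w i eta)%:E; last by rewrite mg.
  by rewrite (EFin_bRint mT fT (bw i)); apply: eq_integral => eta _; rewrite mxE.
- apply: aeW => eta i j phi tphi; have [sphi bphi] := (test_functionP phi).1 tphi.
  pose G (x : 'rV[R]_d) : R := g (tau (- x) eta).
  have sGp k : smooth (fun x => phi x * partial k G x).
    apply: smoothM; [exact: sphi|exact: (smooth_partial k (sg eta))].
  have bGp k : bsupp (fun x => phi x * partial k G x) by exact: bsuppMl.
  have tGp k : test_function (fun x => phi x * partial k G x) by apply/test_functionP.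
  have E x : vec w (tau (- x) eta) 0 i * partial j phi x -
      vec w (tau (- x) eta) 0 j * partial i phi x =
    partial j (fun x => phi x * partial i G x) x - partial i (fun x => phi x * partial j G x) x.
    have dphi y : differentiable phi y by exact: smooth_differentiable.
    have sG : smooth G := sg eta.
    have dG k y : differentiable (partial k G) y.
      by apply: smooth_differentiable; exact: smooth_partial.
    rewrite !mxE -!pg -/G (partialM j (dphi x) (dG i x)) (partialM i (dphi x) (dG j x)).
    rewrite (partial_comm i j x sG).
    move: (phi x) (partial i phi x) (partial j phi x) (partial i G x) (partial j G x)
      (partial j (partial i G) x) => a b c a' b' c'.
    ring.
  under eq_integral do rewrite E.
  have kk k l : kern (partial l (fun x => phi x * partial k G x)).
    exact/test_function_kern/test_function_partial.
  have i1 := integrable_kern (kk i j); have i2 := integrable_kern (kk j i).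
  by apply: (integralB_eq0 i1 i2); exact: Rint_partial_bsupp0.
Qed.

(** As [v] is curl-free, the curl of bounded approximations of its components is minus the curl of
    the remainders, hence small when the approximation is fine. *)
Lemma F2pot_curl_remainder (v : X -> 'rV[R]_d) (a b : X -> R) i j phi :
  F2pot mu tau v -> bdm setT a -> bdm setT b -> test_function phi ->
  {ae mu, forall eta, Kop (partial i phi) a eta - Kop (partial j phi) b eta =
     Kop (partial j phi) (fun eta => v eta 0 i - b eta) eta -
     Kop (partial i phi) (fun eta => v eta 0 j - a eta) eta}.
Proof.
move=> vF ba bb tphi; have [vL _ _] := vF.
have sv k : L2 mu (fun eta => v eta 0 k) by exact: L2_Lfun.
have k l := test_function_kern (test_function_partial l tphi).
apply: filterS3 (F2pot_curl_free htau i j vF tphi) (ae_KopB htau (k i) (sv j) (bdm_L2 mu ba))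
  (ae_KopB htau (k j) (sv i) (bdm_L2 mu bb)) => eta h1 h2 h3.
exact: curl_alg h1 h2 h3.
Qed.

(* The gradient of [sum_j Kop m_j v_j], with [sum_j partial j m_j] an approximate
   identity minus a long-range average, is close to [v] when [v] is curl-free
   with mean zero. *)
Lemma F2pot_grad_approx (v : X -> 'rV[R]_d) (eps : R) : F2pot mu tau v -> 0 < eps ->
  exists g w, is_grad g w /\ forall i, nsq mu (fun eta => v eta 0 i - w i eta) <= eps.
Proof.
move=> vF eps0; have [vL vm _] := vF.
pose vi i eta : R := v eta 0 i.
have sv i : L2 mu (vi i) by exact: (L2_Lfun (vL i)).
have [C1 C10 C1P] := nsq_Kop_pkern htau.
(* Repeated doubling in the squared norms of sums of error terms costs at most [64 * eps1] plus
   [64 * C1 * eps1]. *)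
pose eps1 := eps / (64 * (1 + C1)).
have eps10 : 0 < eps1 by rewrite divr_gt0// mulr_gt0// addr_gt0.
have H1 i := trunc_approx (sv i) eps10.
have [k1 k1P] := choice H1; have [k k0 kP] := fin_upper_bound k1.
pose u1 i := trunc k (vi i).
have bu1 i : bdm setT (u1 i) by exact: bdm_trunc (sv i).1.
have vu1 i : nsq mu (fun eta => vi i eta - u1 i eta) <= eps1 by exact: k1P.
have [e [l [e0 l0 pkP]]] := pkern_approx htau bu1 eps10.
pose m j : 'rV[R]_d -> R := potk e l j.
have tm j : test_function (m j) by exact: test_function_potk.
have kp i j : kern (partial i (m j)) by exact/test_function_kern/test_function_partial.
have H2 (p : 'I_d * 'I_d) : exists C, 0 < C /\ forall f, L2 mu f ->
    L2 mu (Kop (partial p.1 (m p.2)) f) /\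
    nsq mu (Kop (partial p.1 (m p.2)) f) <= C * nsq mu f.
  by have [C C0 CP] := L2_Kop htau (kp p.1 p.2); exists C.
have [C2f C2fP] := choice H2; have [C2 C20 C2P] := fin_upper_bound C2f.
have K2 i j f : L2 mu f -> nsq mu (Kop (partial i (m j)) f) <= C2 * nsq mu f.
  move=> sf; apply: le_trans ((C2fP (i, j)).2 f sf).2 _.
  by rewrite ler_wpM2r ?nsq_ge0// C2P.
have sK i j f : L2 mu f -> L2 mu (Kop (partial i (m j)) f).
  by move=> sf; exact: ((C2fP (i, j)).2 f sf).1.
(* The kernels are now fixed, and [C2] bounds the operators they define, possibly by a large number.
   A second truncation [u] is taken with an error [eps2] small compared with [C2], so that the curl
   remainder, summed over [j], is at most [B * eps2 <= eps1]. *)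
pose B : R := 2 ^+ d * d%:R * (4 * C2) + 1.
have B0 : 0 < B by rewrite ltr_wpDl// !mulr_ge0 ?exprn_ge0// ltW.
pose eps2 := Num.min eps1 (eps1 / B).
have eps20 : 0 < eps2 by rewrite lt_min eps10 divr_gt0.
have H3 i := trunc_approx (sv i) eps20.
have [k2 k2P] := choice H3; have [k' k'0 k'P] := fin_upper_bound k2.
pose u i := trunc k' (vi i).
have bu i : bdm setT (u i) by exact: bdm_trunc (sv i).1.
have vu i : nsq mu (fun eta => vi i eta - u i eta) <= eps2 by exact: k2P.
have su i : L2 mu (u i) by exact: bdm_L2.
have su1 i : L2 mu (u1 i) by exact: bdm_L2.
pose g eta := \sum_j Kop (m j) (fun eta => -1 * u j eta) eta.
pose w i eta := \sum_j - Kop (partial i (m j)) (fun eta => -1 * u j eta) eta.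
have gw : is_grad g w.
  by apply: is_grad_sum => j; apply: is_grad_Kop => //; exact: bdmZ.
exists g, w; split=> // i.
(* Exchanging the index of the derivative with that of the component leaves the divergence of [m]
   acting on [u i], which is [Kop (pkern e l)]; [Rem] collects the curl. *)
pose Rem eta := \sum_j (Kop (partial i (m j)) (u j) eta - Kop (partial j (m j)) (u i) eta).
have wE eta : w i eta = Kop (pkern e l) (u i) eta + Rem eta.
  rewrite /Rem sumrB addrCA.
  have -> : Kop (pkern e l) (u i) eta = \sum_j Kop (partial j (m j)) (u i) eta.
    have [_ <-] := Kop_kern_sum htau (index_enum 'I_d) eta (fun j => kp j j) (bu i).
    by congr (Kop _ _ _); apply/funext => y; rewrite sum_partial_potk.
  rewrite subrr addr0; apply: eq_bigr => j _.
  by rewrite (KopZ htau _ _ (kp i j) (bu j)) mulN1r opprK.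
have bRem : bdm setT Rem.
  by apply: bdm_sum => j; apply: bdmB; exact: (bdm_Kop htau).
have nRem : nsq mu Rem <= eps1.
  pose D j eta := Kop (partial i (m j)) (fun eta => vi j eta - u j eta) eta.
  pose D' j eta := Kop (partial j (m j)) (fun eta => vi i eta - u i eta) eta.
  have svu j : L2 mu (fun eta => vi j eta - u j eta) by exact: L2B.
  have sD j : L2 mu (D j) by exact: sK.
  have sD' j : L2 mu (D' j) by exact: sK.
  have sDD j : L2 mu (fun eta => D' j eta - D j eta) by exact: L2B.
  have -> : nsq mu Rem = nsq mu (fun eta => \sum_j (D' j eta - D j eta)).
    apply: ae_nsq; [exact: bRem.1|exact: (sqint_sum mT fT _ sDD).1|].
    have ae1 : {ae mu, forall eta, forall j, Kop (partial i (m j)) (u j) eta -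
        Kop (partial j (m j)) (u i) eta = D' j eta - D j eta}.
      apply: filter_forall => j.
      exact: F2pot_curl_remainder.
    by apply: filterS ae1 => eta h; apply: eq_bigr => j _; exact: h.
  apply: le_trans (nsq_sum (index_enum 'I_d) sDD) _.
  have -> : size (index_enum 'I_d) = d.
    by rewrite -[RHS]card_ord cardE enumT.
  have le1 j : nsq mu (fun eta => D' j eta - D j eta) <= 4 * C2 * eps2.
    apply: le_trans (nsqB2 (sD' j) (sD j)) _; apply: ler_quarters.
      have -> : 4 * C2 * eps2 / 4 = C2 * eps2 by field.
      by apply: le_trans (K2 _ _ _ (svu i)) _; rewrite ler_wpM2l// ltW.
    have -> : 4 * C2 * eps2 / 4 = C2 * eps2 by field.
    by apply: le_trans (K2 _ _ _ (svu j)) _; rewrite ler_wpM2l// ltW.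
  apply: (@le_trans _ _ (2 ^+ d * (d%:R * (4 * C2 * eps2)))).
    rewrite ler_wpM2l ?exprn_ge0//.
    apply: le_trans (ler_sum _ (fun j _ => le1 j)) _.
    by rewrite sumr_const card_ord -[leLHS]mulr_natl.
  apply: (@le_trans _ _ (B * eps2)).
    by rewrite !mulrA /B !mulrA ler_wpM2r ?(ltW eps20)// lerDl.
  by rewrite -ler_pdivlMl// mulrC /eps2 ge_min lexx orbT.
have su1u : L2 mu (fun eta => u1 i eta - u i eta) by exact: L2B.
pose mean := \int[mu]_eta u1 i eta.
(* The component of [v] has mean zero, so the mean of its truncation is minus the mean of the error
   and is small with it. *)
have mean2 : mean ^+ 2 <= eps1.
  have svu1 : L2 mu (fun eta => vi i eta - u1 i eta) by exact: L2B.
  have := sqint_mean mT fT svu1; rewrite (fine_muT mu) mul1r.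
  have -> : \int[mu]_eta (vi i eta - u1 i eta) = - mean.
    rewrite (RintegralB mT (sqint_int mT fT (sv i)) (sqint_int mT fT (su1 i))).
    by rewrite /mean {1}/Rintegral (vm i) /= sub0r.
  by rewrite sqrrN => h; exact: le_trans (vu1 i).
have n4 : nsq mu (Kop (pkern e l) (fun eta => u1 i eta - u i eta)) <= C1 * (4 * eps1).
  apply: le_trans (C1P e l _ e0 l0 (bdmB (bu1 i) (bu i))) _.
  rewrite ler_wpM2l ?(ltW C10)//.
  rewrite (_ : (fun eta => _) = fun eta => (vi i eta - u i eta) - (vi i eta - u1 i eta)); last first.
    by apply/funext => eta; move: (u1 i eta) (u i eta) (vi i eta) => a b c; ring.
  apply: le_trans (nsqB2 (L2B (sv i) (su i)) (L2B (sv i) (su1 i))) _.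
  have h1 := vu1 i; have h2 : nsq mu (fun eta => vi i eta - u i eta) <= eps1.
    by apply: le_trans (vu i) _; rewrite /eps2 ge_min lexx.
  by apply: ler_quarters; rewrite mulrC mulKf.
have bKp f : bdm setT f -> bdm setT (Kop (pkern e l) f).
  by move=> bf; apply: (bdm_Kop htau) => //; exact: kern_pkern.
pose f1 eta := vi i eta - u1 i eta.
pose f2 eta := Kop (pkern e l) (u1 i) eta - (u1 i eta - mean).
pose f3 eta := Kop (pkern e l) (fun eta => u1 i eta - u i eta) eta.
have sf1 : L2 mu f1 by exact: L2B.
have sf2 : L2 mu f2.
  by apply: bdm_L2; apply: bdmB; [exact: bKp|apply: bdmB => //; exact: bdm_cst].
have sf3 : L2 mu f3 by apply: bdm_L2; apply: bKp; exact: bdmB.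
have E : (fun eta => v eta 0 i - w i eta) = fun eta =>
   ((f1 eta - f2 eta) + (f3 eta + mean)) - Rem eta.
  apply/funext => eta; rewrite wE /f1 /f2 /f3.
  have -> : Kop (pkern e l) (fun eta => u1 i eta - u i eta) eta =
      Kop (pkern e l) (u1 i) eta - Kop (pkern e l) (u i) eta.
    by apply: KopB; [exact: kern_pkern|exact: bu1|exact: bu].
  rewrite /vi; move: (v eta 0 i) (Kop (pkern e l) (u i) eta) (Rem eta) (u1 i eta)
    (Kop (pkern e l) (u1 i) eta) (mean) => a b c a' b' c'.
  ring.
have scst : L2 mu (fun=> mean) by apply: bdm_L2; exact: bdm_cst.
have sRem : L2 mu Rem by exact: bdm_L2.
have ncst : nsq mu (fun=> mean) <= eps1.
  by rewrite /nsq Rintegral_cst// (fine_muT mu) mulr1.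
have n12 := nsqB2 sf1 sf2; have n34 := nsqD2 sf3 scst.
have n14 := nsqD2 (L2B sf1 sf2) (sqintD mT sf3 scst).
have n5 := nsqB2 (sqintD mT (L2B sf1 sf2) (sqintD mT sf3 scst)) sRem.
rewrite E; apply: le_trans n5 _.
have epsE : eps = 64 * eps1 + 64 * (C1 * eps1).
  by rewrite /eps1; field; rewrite gt_eqF// addr_gt0.
have h2 := pkP i; have h1 := vu1 i.
move: n12 n34 n14 n4 ncst nRem; rewrite -/f3 -/f2.
move: h1 h2; rewrite -/f1 -/mean -/f2.
have C1e : 0 <= C1 * eps1 by rewrite mulr_ge0 ?ltW.
rewrite (mulrCA C1) epsE.
move: (nsq mu f1) (nsq mu f2) (nsq mu f3) (nsq mu (fun=> mean)) (nsq mu Rem)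
  (nsq mu (fun eta => f1 eta - f2 eta)) (nsq mu (fun eta => f3 eta + mean))
  (nsq mu (fun eta => f1 eta - f2 eta + (f3 eta + mean))) (C1 * eps1) (eps1) C1e eps10.
clear => a1 a2 a3 a4 a5 a6 a7 a8 q e1 q0 e10 *. lra.
Qed.

End gradient_fields.

(** * Elliptic forms and the upper bound *)

Section elliptic_forms.
Context {R : realType} {d : nat}.
Implicit Types (M : 'M[R]_d) (x y : 'rV[R]_d).

Definition bform M x y : R := \sum_j (x *m M) 0 j * y 0 j.

Lemma qformE M x : qform M x = bform M x x.
Proof. by rewrite /qform mxE; apply: eq_bigr => j _; rewrite [x^T _ _]mxE. Qed.

Lemma bformE M x y : bform M x y = \sum_j \sum_i x 0 i * M i j * y 0 j.
Proof. by apply: eq_bigr => j _; rewrite mxE mulr_suml. Qed.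

Lemma bformC M x y : M^T = M -> bform M x y = bform M y x.
Proof.
move=> Ms; rewrite !bformE exchange_big/=; apply: eq_bigr => i _; apply: eq_bigr => j _.
have -> : M j i = M i j by rewrite -[in LHS]Ms mxE.
by rewrite mulrC mulrA mulrAC -!mulrA; congr (_ * _); rewrite mulrC.
Qed.

Lemma bformDr M x y z : bform M x (y + z) = bform M x y + bform M x z.
Proof. by rewrite -big_split; apply: eq_bigr => j _; rewrite [(y + z) _ _]mxE mulrDr. Qed.

Lemma bformZr M c x y : bform M x (c *: y) = c * bform M x y.
Proof. by rewrite mulr_sumr; apply: eq_bigr => j _; rewrite [(c *: y) _ _]mxE mulrCA. Qed.

Lemma bformDl M x y z : bform M (x + y) z = bform M x z + bform M y z.
Proof. by rewrite -big_split; apply: eq_bigr => j _; rewrite mulmxDl mxE mulrDl. Qed.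

Lemma bformZl M c x y : bform M (c *: x) y = c * bform M x y.
Proof. by rewrite mulr_sumr; apply: eq_bigr => j _; rewrite -scalemxAl mxE mulrA. Qed.

Lemma qformZ M c x : qform M (c *: x) = c ^+ 2 * qform M x.
Proof. by rewrite !qformE bformZr bformZl mulrA expr2. Qed.

Lemma qformD M x y : M^T = M -> qform M (x + y) = qform M x + 2 * bform M x y + qform M y.
Proof.
move=> Ms; rewrite !qformE !bformDr !bformDl [bform M y x]bformC//.
by move: (bform M x x) (bform M x y) (bform M y y) => a b c; ring.
Qed.

Lemma sqnorm_ge0 x : 0 <= sqnorm x.
Proof. by apply: sumr_ge0 => i _; exact: sqr_ge0. Qed.

Definition elliptic (nu1 nu2 : R) M := M^T = M /\
  forall xi : 'rV[R]_d, nu1 * sqnorm xi <= qform M xi <= nu2 * sqnorm xi.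

Variables (nu1 nu2 : R).
Hypotheses (nu10 : 0 < nu1) (nu20 : 0 < nu2).

Lemma elliptic_ge0 M x : elliptic nu1 nu2 M -> 0 <= qform M x.
Proof.
move=> [_ /(_ x)/andP[h _]]; apply: le_trans h.
by rewrite mulr_ge0 ?sqnorm_ge0// ltW.
Qed.

(** Expand the nonnegative value of the form at [theta *: x - y] and divide by [theta]. *)
Lemma elliptic_young M x y theta : elliptic nu1 nu2 M -> 0 < theta ->
  qform M (x + y) <= (1 + theta) * qform M x + (1 + theta^-1) * qform M y.
Proof.
move=> eM t0; have := elliptic_ge0 (theta *: x + -1 *: y) eM; have [Ms _] := eM.
rewrite !qformD// !qformZ bformZl bformZr.
move: (qform M x) (qform M y) (bform M x y) => a b c h.
have : 0 <= theta^-1 * (theta ^+ 2 * a + 2 * (theta * (-1 * c)) + (-1) ^+ 2 * b).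
  by rewrite mulr_ge0// invr_ge0 ltW.
have -> : theta^-1 * (theta ^+ 2 * a + 2 * (theta * (-1 * c)) + (-1) ^+ 2 * b) =
  theta * a - 2 * c + theta^-1 * b by field; rewrite gt_eqF.
by rewrite -subr_ge0 => h'; rewrite -subr_ge0; move: h'; congr (_ <= _); ring.
Qed.

(** The gap between the two sides is [c * (1 - c) * qform M y]. *)
Lemma elliptic_convex M x y c : elliptic nu1 nu2 M -> 0 <= c <= 1 ->
  qform M (x + c *: y) <= (1 - c) * qform M x + c * qform M (x + y).
Proof.
move=> eM /andP[c0 c1]; have [Ms _] := eM; have y0 := elliptic_ge0 y eM.
rewrite !qformD// qformZ bformZr.
move: (qform M x) (qform M y) y0 (bform M x y) => a b b0 e.
rewrite -subr_ge0.
have -> : (1 - c) * a + c * (a + 2 * e + b) - (a + 2 * (c * e) + c ^+ 2 * b) =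
  c * (1 - c) * b by ring.
by rewrite !mulr_ge0// subr_ge0.
Qed.

(** The form at [x - y], expanded. This duality makes a lower bound on the energy affine in the
    competitor [y]. *)
Lemma elliptic_lower M x y : elliptic nu1 nu2 M ->
  2 * bform M x y - qform M x <= qform M y.
Proof.
move=> eM; have := elliptic_ge0 (x + -1 *: y) eM; have [Ms _] := eM.
rewrite qformD// qformZ bformZr.
by move: (qform M x) (qform M y) (bform M x y) => a b c h; lra.
Qed.

Lemma sqnorm_flux M x : elliptic nu1 nu2 M -> sqnorm (x *m M) <= nu2 ^+ 2 * sqnorm x.
Proof.
move=> eM; have := elliptic_lower x (nu2^-1 *: (x *m M)) eM; rewrite bformZr qformZ.
have -> : bform M x (x *m M) = sqnorm (x *m M) by apply: eq_bigr => i _; rewrite expr2.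
have [_ eq] := eM; have /andP[_ h1] := eq x; have /andP[_ h2] := eq (x *m M).
move: (sqnorm (x *m M)) (sqnorm x) (qform M x) (qform M (x *m M)) h1 h2 => a b p q h1 h2 h3.
have h4 : nu2^-1 ^+ 2 * q <= nu2^-1 * a.
  rewrite expr2 -mulrA ler_pM2l ?invr_gt0//.
  by rewrite ler_pdivrMl.
have : nu2^-1 * a <= nu2 * b by lra.
by rewrite ler_pdivrMl// mulrA -expr2.
Qed.

Lemma sqnorm_delta i : sqnorm (delta_mx 0 i : 'rV[R]_d) = 1.
Proof.
rewrite /sqnorm (bigD1 i)//= big1 => [|j ji]; first by rewrite addr0 mxE !eqxx expr1n.
by rewrite mxE (negPf ji) andbF expr0n.
Qed.

(** Duality between the basis vector [j] and plus or minus the basis vector [i] bounds the entry on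
    both sides. *)
Lemma elliptic_entry M i j : elliptic nu1 nu2 M -> `|M i j| <= nu2.
Proof.
move=> eM; have bE : bform M (delta_mx 0 i) (delta_mx 0 j) = M i j.
  rewrite /bform -rowE (bigD1 j)//= big1 => [|k kj]; first by rewrite addr0 !mxE !eqxx mulr1.
  by rewrite !mxE (negPf kj) andbF mulr0.
have [_ eq] := eM.
have /andP[_ hi] := eq (delta_mx 0 i); have /andP[_ hj] := eq (delta_mx 0 j).
have h1 := elliptic_lower (delta_mx 0 i) (delta_mx 0 j) eM.
have h2 := elliptic_lower (-1 *: delta_mx 0 i) (delta_mx 0 j) eM.
rewrite bformZl qformZ in h2.
rewrite !sqnorm_delta in hi hj; rewrite bE in h1 h2.
by rewrite ler_norml; apply/andP; split; lra.
Qed.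

Lemma sqnorm_qform M x : elliptic nu1 nu2 M -> sqnorm x <= nu1^-1 * qform M x.
Proof. by move=> [_ /(_ x)/andP[h _]]; rewrite ler_pdivlMl. Qed.

Lemma bdm_bform {disp : measure_display} {T : measurableType disp} (D : set T)
    (F : T -> 'M[R]_d) (u v : T -> 'rV[R]_d) :
  (forall i j, bdm D (fun t => F t i j)) -> (forall i, bdm D (fun t => u t 0 i)) ->
  (forall i, bdm D (fun t => v t 0 i)) -> bdm D (fun t => bform (F t) (u t) (v t)).
Proof.
move=> bF bu bv; under eq_fun do rewrite bformE.
by apply: bdm_sum => j; apply: bdm_sum => i; apply: bdmM => //; exact: bdmM.
Qed.

Lemma bdm_qform {disp : measure_display} {T : measurableType disp} (D : set T)
    (F : T -> 'M[R]_d) (u : T -> 'rV[R]_d) :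
  (forall i j, bdm D (fun t => F t i j)) -> (forall i, bdm D (fun t => u t 0 i)) ->
  bdm D (fun t => qform (F t) (u t)).
Proof. by move=> bF bu; under eq_fun do rewrite qformE; exact: bdm_bform. Qed.

Lemma bdm_sqnorm {disp : measure_display} {T : measurableType disp} (D : set T)
    (u : T -> 'rV[R]_d) : (forall i, bdm D (fun t => u t 0 i)) ->
  bdm D (fun t => sqnorm (u t)).
Proof. by move=> bu; apply: bdm_sum => i; exact: bdmX. Qed.

End elliptic_forms.

(** * Periodization of functions supported inside the cell *)

Section periodization.
Context {R : realType} {d : nat}.
Implicit Types (F : 'rV[R]_d -> R) (N delta : R) (x : 'rV[R]_d).

Definition periodize N F x : R := F (x - N *: intpart (N^-1 *: x)).

Lemma intpart_coord N x i : intpart (N^-1 *: x) 0 i = (Num.floor (N^-1 * x 0 i))%:~R.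
Proof. by rewrite !mxE. Qed.

Lemma intpart_cell N x : 0 < N -> cube 0 N x -> intpart (N^-1 *: x) = 0.
Proof.
move=> N0 xN; apply/rowP => i; rewrite intpart_coord mxE.
have := xN i; rewrite /= in_itv/= => /andP[h1 h2].
suff -> : Num.floor (N^-1 * x 0 i) = 0 by [].
by apply: floor_def; rewrite add0r mulr_ge0 ?invr_ge0 ?(ltW N0)//= mulrC ltr_pdivrMr// mul1r.
Qed.

(** A single coordinate outside the inner range is enough, so [F] vanishes near the faces and also
    everywhere outside the cell. *)
Definition inner_support N delta F :=
  forall x, (exists i, x 0 i <= delta * N \/ (1 - delta) * N <= x 0 i) -> F x = 0.

(** A point within [delta * N] of [x0] either lies in the same cell, where the two formulas agree,
    or has crossed a face. In the second case both sides vanish, because relative to either cell the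
    crossing coordinate is within [delta * N] of a face or beyond it. *)
Lemma periodize_near N delta F x0 : 0 < N -> 0 < delta -> inner_support N delta F ->
  \forall y \near x0, periodize N F y = F (1 *: y + - (N *: intpart (N^-1 *: x0))).
Proof.
move=> N0 delta0 FN; have dN0 : 0 < delta * N by exact: mulr_gt0.
have fl (t : R) : N * (Num.floor (N^-1 * t))%:~R <= t < N * (Num.floor (N^-1 * t))%:~R + N.
  have /andP[h1 h2] := floor_itv (N^-1 * t).
  rewrite ler_pdivlMl// in h1; rewrite h1/=.
  by rewrite intrD ltr_pdivrMl// mulrDr mulr1 in h2.
apply/nbhs_normP; exists (delta * N) => // y /= yx.
rewrite scale1r /periodize.
have [same|/existsNP[i ki]] := pselect (forall i, Num.floor (N^-1 * y 0 i) = Num.floor (N^-1 * x0 0 i)).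
  by congr (F (_ - _ *: _)); apply/rowP => i; rewrite !intpart_coord same.
have yxi : `|x0 0 i - y 0 i| < delta * N.
  by apply: le_lt_trans yx; have := coord_le_norm (x0 - y) i; rewrite !mxE.
have cE (z : 'rV[R]_d) : (y - N *: intpart (N^-1 *: z)) 0 i =
    y 0 i - N * (Num.floor (N^-1 * z 0 i))%:~R by rewrite !mxE.
have /andP[a1 a2] := fl (y 0 i); have /andP[b1 b2] := fl (x0 0 i).
move: yxi; rewrite ltr_norml => /andP[c1 c2].
have step (p q : int) : p < q -> N * p%:~R + N <= N * q%:~R.
  move=> pq; rewrite -{2}[N]mulr1 -mulrDr ler_pM2l//.
  by rewrite -[1]/(1%:~R) -intrD ler_int lezD1.
have e1 : (1 - delta) * N = N - delta * N by rewrite mulrBl mul1r.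
rewrite !FN//; exists i; rewrite cE e1; move/eqP: ki; rewrite neq_lt => /orP[] /step h.
- by left; lra.
- by right; lra.
- by right; lra.
- by left; lra.
Qed.

Lemma smooth_periodize N delta F : 0 < N -> 0 < delta -> inner_support N delta F ->
  smooth F -> smooth_torus N (periodize N F).
Proof.
move=> N0 delta0 FN sF; split.
  apply: near_smooth => x; exists (fun y => F (1 *: y + - (N *: intpart (N^-1 *: x)))).
    exact: smooth_affine.
  exact: periodize_near FN.
move=> k x; rewrite /periodize; congr F; apply/rowP => i; rewrite !mxE.
have -> : N^-1 * (x 0 i + N * (k 0 i)%:~R) = N^-1 * x 0 i + (k 0 i)%:~R.
  by rewrite mulrDr mulKf ?gt_eqF.
have fk : Num.floor ((k 0 i)%:~R : R) = k 0 i.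
  by apply: floor_def; rewrite lexx/= ltr_int ltrDl.
rewrite floorDrz ?intr_int// fk intrD mulrDr opprD addrACA subrr addr0//.
Qed.

Lemma periodize_partial N delta F i x : 0 < N -> 0 < delta -> inner_support N delta F ->
  smooth F -> cube 0 N x -> partial i (periodize N F) x = partial i F x.
Proof.
move=> N0 delta0 FN sF xN.
have := near_eq_partial i (@periodize_near N delta F x N0 delta0 FN).
move=> /nbhs_singleton ->; rewrite (intpart_cell N0 xN) scaler0 oppr0.
rewrite partial_affine; last exact: smooth_differentiable.
by rewrite scale1r addr0 mul1r.
Qed.

End periodization.

(** * Cell energies and the upper bound *)

Section energy.
Context {R : realType} {d : nat} {disp : measure_display}
  {X : measurableType disp} (mu : probability X R)
  (tau : 'rV[R]_d -> X -> X).
Hypothesis htau : ergodic_action mu tau.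
Local Notation lambda := (@lebn R d).
Context (A : X -> 'M[R]_d) (nu1 nu2 : R).
Hypotheses (nu10 : 0 < nu1) (nu20 : 0 < nu2).
Hypothesis mA : forall i j, measurable_fun setT (fun eta => A eta i j).
Hypothesis ellA : forall eta, elliptic nu1 nu2 (A eta).
Implicit Types (xi : 'rV[R]_d) (w : 'I_d -> X -> R) (N : R).

Let mT := @measurableT _ X.
Let fT := muT_fin mu.

Lemma bdmA i j : bdm setT (fun eta => A eta i j).
Proof. by split => //; exists nu2 => eta _; apply: (elliptic_entry (nu1 := nu1)). Qed.

Lemma bdm_vec xi w i : (forall i, bdm setT (w i)) ->
  bdm setT (fun eta => (xi + vec w eta) 0 i).
Proof.
move=> bw; rewrite (_ : (fun eta => _) = fun eta => xi 0 i + w i eta).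
  by apply: bdmD => //; exact: bdm_cst.
by apply/funext => eta; rewrite !mxE.
Qed.

Definition density xi w eta : R := qform (A eta) (xi + vec w eta).

Definition energy xi w : R := \int[mu]_eta density xi w eta.

Lemma bdm_density xi w : (forall i, bdm setT (w i)) -> bdm setT (density xi w).
Proof.
move=> bw; apply: bdm_qform => [i j|i]; first exact: bdmA.
exact: bdm_vec.
Qed.

Lemma density_ge0 xi w eta : 0 <= density xi w eta.
Proof. exact: (elliptic_ge0 nu10). Qed.

Lemma energy_ge0 xi w : 0 <= energy xi w.
Proof. by apply: Rintegral_ge0 => eta _; exact: density_ge0. Qed.

Definition cell_energy N eta xi (f : 'rV[R]_d -> R) : R :=
  N^-1 ^+ d * \int[lambda]_(x in cube 0 N) qform (A (tau (- x) eta)) (xi + gradient f x).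

Lemma bdm_grad_cube N f xi i : smooth f -> bdm (cube 0 N) (fun x => (xi + gradient f x) 0 i).
Proof.
move=> sf; rewrite (_ : (fun x => _) = fun x => xi 0 i + partial i f x); last first.
  by apply/funext => x; rewrite !mxE.
apply: bdmD; first exact: bdm_cst.
by apply: smooth_cube; exact: smooth_partial.
Qed.

Lemma bdm_orbitA eta (D : set 'rV[R]_d) i j : bdm D (fun x : 'rV[R]_d => A (tau (- x) eta) i j).
Proof. by apply: (@bdm_sub _ _ _ setT) => //; exact: (bdm_orbit htau eta (bdmA i j)). Qed.

Lemma bdm_cell_density N eta xi f : smooth f ->
  bdm (cube 0 N) (fun x => qform (A (tau (- x) eta)) (xi + gradient f x)).
Proof.
move=> sf; apply: bdm_qform => [i j|i]; [exact: bdm_orbitA|exact: bdm_grad_cube].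
Qed.

Lemma cell_energyE N eta xi f : 0 < N -> smooth f ->
  ((N ^- d)%:E * \int[lebesgue_rV d]_(x in cell N)
        (qform (periodized tau A N x eta) (xi + gradient f x))%:E)%E =
  (cell_energy N eta xi f)%:E.
Proof.
move=> N0 sf; rewrite /cell_energy exprVn EFinM; congr (_ * _)%E.
rewrite (EFin_bRint (measurable_cube _ _) (lebn_cube_fin _ _ _) (bdm_cell_density N eta xi sf)).
rewrite cellE; apply: eq_integral => x; rewrite inE => xN.
by rewrite /periodized (intpart_cell N0 xN) scaler0 subr0.
Qed.

Lemma periodized_form_le N eta xi f : 0 < N -> smooth_torus N f ->
  (periodized_form tau A N eta xi <= (cell_energy N eta xi f)%:E)%E.
Proof.
move=> N0 sf; have [s1 _] := sf; apply: ereal_inf_lbound; exists f => //.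
exact: cell_energyE.
Qed.

(** The integrand lives in a boundary layer of relative volume at most [1 - (1 - 4 * delta) ^+ d],
    which Bernoulli's inequality estimates. *)
Lemma cutoff_average (chi : 'rV[R]_d -> R) (delta N : R) : 0 < delta -> delta < 1 / 4 ->
  smooth chi -> (forall x, 0 <= chi x <= 1) ->
  (forall x : 'rV[R]_d, (forall i, 2 * delta <= x 0 i <= 1 - 2 * delta) -> chi x = 1) ->
  0 < N ->
  N^-1 ^+ d * \int[lambda]_(x in cube 0 N) (1 - chi (N^-1 *: x + 0)) <= d%:R * (4 * delta).
Proof.
move=> d0 d1 schi chi01 chi1 N0.
have bh (D : set 'rV[R]_d) : bdm D (fun x : 'rV[R]_d => 1 - chi (N^-1 *: x + 0)).
  split; last first.
    exists 1 => x _; have /andP[h1 h2] := chi01 (N^-1 *: x + 0).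
    by rewrite ger0_norm ?subr_ge0// gerBl.
  apply: measurable_funB; first exact: measurable_cst.
  by apply: smooth_measurable; exact: smooth_affine.
pose K : set 'rV[R]_d := cube (2 * delta * N) ((1 - 2 * delta) * N).
have dN0 : 0 < delta * N by exact: mulr_gt0.
have dN1 : delta * N < N / 4.
  have h : delta * N < 1 / 4 * N by rewrite ltr_pM2r.
  lra.
have KC : K `<=` cube 0 N.
  move=> x xK i; have := xK i; rewrite /= !in_itv/= mulrBl mul1r -mulrA => /andP[h1 h2].
  by apply/andP; split; lra.
have h : `|\int[lambda]_(x in cube 0 N) (1 - chi (N^-1 *: x + 0)) -
    \int[lambda]_(x in K) (1 - chi (N^-1 *: x + 0))| <=
    1 * (fine (@lebn R d (cube 0 N)) - fine (@lebn R d K)).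
  apply: (bRint_setB (measurable_cube _ _) (measurable_cube _ _) (lebn_cube_fin _ _ _) KC (bh _)).
  move=> x _; have /andP[h1 h2] := chi01 (N^-1 *: x + 0).
  by rewrite ger0_norm ?subr_ge0// gerBl.
have K0 : \int[lambda]_(x in K) (1 - chi (N^-1 *: x + 0)) = 0.
  rewrite -(Rint0 lambda (measurable_cube (2 * delta * N) ((1 - 2 * delta) * N))).
  apply: eq_Rintegral => x; rewrite inE => xK; rewrite chi1 ?subrr// => i.
  have := xK i; rewrite /= addr0 mxE in_itv/= => /andP[h1 h2].
  by rewrite ler_pdivlMl// ler_pdivrMl// mulrC h1 mulrC (ltW h2).
have KK : 2 * delta * N <= (1 - 2 * delta) * N by rewrite mulrBl mul1r -!mulrA; lra.
rewrite K0 subr0 mul1r (lebn_cube d (ltW N0)) /K (lebn_cube d KK) /= in h.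
rewrite subr0 in h; have {}h := le_trans (ler_norm _) h.
rewrite exprVn ler_pdivrMl ?exprn_gt0//; apply: le_trans h _.
have -> : (1 - 2 * delta) * N - 2 * delta * N = N * (1 - 4 * delta) by ring.
rewrite exprMn -{1}[N ^+ d]mulr1 -mulrBr ler_pM2l ?exprn_gt0//.
by apply: bernoulli_expr; apply/andP; split; lra.
Qed.

(** The gradient of the rescaled cut-off times the realization of [g] is the cut-off times [w] plus
    a term of order [N^-1], which Young's inequality splits off. Convexity in the cut-off bounds the
    rest by the density of [w] plus the density of [xi] alone weighted by one minus the cut-off, a
    boundary layer term. [C] depends on neither [N] nor [eta]. *)
Lemma energy_cutoff g w xi chi delta theta : is_grad mu tau g w -> 0 < delta -> delta < 1 / 4 ->
  smooth chi -> (forall x : 'rV[R]_d, 0 <= chi x <= 1) ->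
  (forall x : 'rV[R]_d, (exists i, x 0 i <= delta \/ 1 - delta <= x 0 i) -> chi x = 0) ->
  (forall x : 'rV[R]_d, (forall i, 2 * delta <= x 0 i <= 1 - 2 * delta) -> chi x = 1) ->
  0 < theta -> exists2 C, 0 <= C & forall N eta, 0 < N ->
  (periodized_form tau A N eta xi <=
   ((1 + theta) * (nu2 * sqnorm xi * (d%:R * (4 * delta)) + davg tau (density xi w) N eta) +
    C * N^-1 ^+ 2)%:E)%E.
Proof.
move=> gw delta0 delta1 schi chi01 chi0 chi1 theta0.
have [Cg Cg0 CgP] := bdm_bound (grad_bdm gw).
have bS : bdm (cube 0 1) (fun x => sqnorm (gradient chi x)).
  apply: bdm_sqnorm => i; rewrite (_ : (fun x => _) = partial i chi).
    by apply: smooth_cube; exact: smooth_partial.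
  by apply/funext => x; rewrite mxE.
have [S S0 SP] := bdm_bound bS.
have t1 : 0 < 1 + theta^-1 by rewrite addr_gt0// invr_gt0.
have t2 : 0 < 1 + theta by rewrite addr_gt0.
pose C := (1 + theta^-1) * (nu2 * (Cg ^+ 2 * S)).
have C0 : 0 <= C by rewrite !mulr_ge0 ?sqr_ge0// ltW.
exists C => // N eta N0.
pose chiN (x : 'rV[R]_d) := chi (N^-1 *: x + 0).
pose F x := chiN x * g (tau (- x) eta).
have schiN : smooth chiN by exact: smooth_affine.
have sg := grad_smooth gw eta.
have sF : smooth F by exact: smoothM.
have FN : inner_support N delta F.
  move=> x [i xi']; rewrite /F /chiN chi0 ?mul0r//; exists i.
  by rewrite addr0 mxE ler_pdivrMl// ler_pdivlMl// mulrC [N * (1 - _)]mulrC.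
pose f := periodize N F.
have sf : smooth_torus N f by exact: smooth_periodize FN sF.
apply: le_trans (periodized_form_le eta xi N0 sf) _; rewrite lee_fin.
have gE x : cube 0 N x -> gradient f x = chiN x *: vec w (tau (- x) eta) +
    (N^-1 * g (tau (- x) eta)) *: gradient chi (N^-1 *: x + 0).
  move=> xN; apply/rowP => i; rewrite !mxE (periodize_partial i N0 delta0 FN sF xN).
  rewrite /F partialM; try exact: smooth_differentiable.
  rewrite (grad_partial gw) /chiN partial_affine; last exact: smooth_differentiable.
  by rewrite mulrCA mulrA.
pose D x := (1 + theta) * (nu2 * sqnorm xi * (1 - chiN x) + density xi w (tau (- x) eta)) +
   C * N^-1 ^+ 2.
have mQ := @measurable_cube R d 0 N; have fQ := lebn_cube_fin d (0 : R) N.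
have bchi : bdm (cube 0 N) (fun x => 1 - chiN x).
  by apply: bdmB; [exact: bdm_cst|exact: smooth_cube].
have bdens : bdm (cube 0 N) (fun x => density xi w (tau (- x) eta)).
  apply: (@bdm_sub _ _ _ setT) => //; apply: (bdm_orbit htau); apply: bdm_density.
  exact: gradw_bdm gw.
have bD1 : bdm (cube 0 N) (fun x => nu2 * sqnorm xi * (1 - chiN x) + density xi w (tau (- x) eta)).
  by apply: bdmD => //; exact: bdmZ.
have le1 x : cube 0 N x -> qform (A (tau (- x) eta)) (xi + gradient f x) <= D x.
  move=> xN; rewrite gE// addrA; have eA := ellA (tau (- x) eta).
  apply: le_trans (elliptic_young nu10 _ _ eA theta0) _.
  apply: lerD.
    rewrite ler_wpM2l ?(ltW t2)//.
    apply: le_trans (elliptic_convex nu10 xi (vec w (tau (- x) eta)) eA (chi01 _)) _.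
    have /andP[c0 c1] := chi01 (N^-1 *: x + 0).
    apply: lerD.
      rewrite mulrC ler_wpM2r ?subr_ge0//.
      by have [_ /(_ xi)/andP[]] := eA.
    by apply: ler_piMl; [exact: (elliptic_ge0 nu10 _ eA)|exact: c1].
  rewrite /C -!mulrA ler_wpM2l ?(ltW t1)//.
  have [_ /(_ ((N^-1 * g (tau (- x) eta)) *: gradient chi (N^-1 *: x + 0)))/andP[_ h]] := eA.
  apply: le_trans h _; rewrite ler_wpM2l ?(ltW nu20)//.
  rewrite /sqnorm (eq_bigr (fun i => (N^-1 * g (tau (- x) eta)) ^+ 2 *
    gradient chi (N^-1 *: x + 0) 0 i ^+ 2)); last by move=> i _; rewrite mxE exprMn.
  rewrite -mulr_sumr -/(sqnorm _) exprMn -mulrA [leRHS](_ : _ = N^-1 ^+ 2 * (Cg ^+ 2 * S)); last by ring.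
  rewrite ler_wpM2l ?exprn_ge0 ?invr_ge0 ?(ltW N0)//.
  rewrite ler_pM ?sqr_ge0 ?sqnorm_ge0//.
    rewrite -real_normK ?num_real// lerXn2r ?nnegrE ?(ltW Cg0)//.
    exact: CgP.
  have xN1 : cube 0 1 (N^-1 *: x + 0).
    move=> i; have := xN i; rewrite /= addr0 mxE !in_itv/= => /andP[h1 h2].
    by rewrite mulr_ge0 ?invr_ge0 ?(ltW N0)//= ltr_pdivrMl// mulr1.
  by apply: le_trans (SP _ xN1); exact: ler_norm.
rewrite /cell_energy.
have sf1 : smooth f by have [] := sf.
apply: (@le_trans _ _ (N^-1 ^+ d * \int[lambda]_(x in cube 0 N) D x)).
  rewrite ler_wpM2l ?exprn_ge0 ?invr_ge0 ?(ltW N0)//.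
  apply: bRint_le => [||||x xN]; [exact: mQ|exact: fQ|exact: bdm_cell_density| |exact: le1].
  by apply: bdmD; [exact: bdmZ|exact: bdm_cst].
rewrite /D (bRintD mQ fQ (bdmZ _ bD1) (bdm_cst _ _)) (bRintZ mQ fQ _ bD1).
rewrite (bRintD mQ fQ (bdmZ _ bchi) bdens) (bRintZ mQ fQ _ bchi).
rewrite Rint_cst_cube ?(ltW N0)// subr0 mulrDr [_ * (C * _ * _)]mulrCA -exprMn mulVf ?gt_eqF//.
rewrite expr1n mulr1 lerD2r mulrCA ler_wpM2l ?(ltW t2)// mulrDr lerD2r mulrCA.
rewrite ler_wpM2l ?mulr_ge0 ?sqnorm_ge0 ?(ltW nu20)//.
exact: cutoff_average.
Qed.

Lemma periodized_form_upper g w xi eps : is_grad mu tau g w -> 0 < eps ->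
  {ae mu, forall eta, \forall N \near +oo,
    (periodized_form tau A N eta xi <= (energy xi w + eps)%:E)%E}.
Proof.
move=> gw eps0; have J0 := energy_ge0 xi w; set J := energy xi w in J0 *.
pose a := nu2 * sqnorm xi * (d%:R * 4).
have a0 : 0 <= a by rewrite !mulr_ge0 ?sqnorm_ge0// ltW.
(* [delta] makes the boundary layer cost at most [eps / 8], and [theta] below is at most 1 and
   multiplies the energy to at most [eps / 4]. Both are fixed before [C], whose term is then removed
   by taking [N] large. *)
pose delta := Num.min (1 / 8) (eps / (8 * (a + 1))).
have a1 : 0 < 8 * (a + 1) by rewrite mulr_gt0// ltr_wpDl.
have delta0 : 0 < delta by rewrite lt_min !divr_gt0.
have delta1 : delta < 1 / 4.
  by apply: (@le_lt_trans _ _ (1 / 8)); [rewrite /delta ge_min lexx|lra].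
have delta2 : a * delta <= eps / 8.
  have h : delta <= eps / (8 * (a + 1)) by rewrite /delta ge_min lexx orbT.
  have {h} : delta * (8 * (a + 1)) <= eps by rewrite -ler_pdivlMr.
  by have : 0 <= a * delta by [exact: mulr_ge0 a0 (ltW delta0)]; nra.
pose theta := Num.min 1 (eps / (4 * (J + 1))).
have J1 : 0 < 4 * (J + 1) by rewrite mulr_gt0// ltr_wpDl.
have theta0 : 0 < theta by rewrite lt_min ltr01 divr_gt0.
have theta1 : theta <= 1 by rewrite /theta ge_min lexx.
have theta2 : theta * J <= eps / 4.
  have h : theta <= eps / (4 * (J + 1)) by rewrite /theta ge_min lexx orbT.
  have {h} : theta * (4 * (J + 1)) <= eps by rewrite -ler_pdivlMr.
  by nra.
have [chi [schi chi01 chi0 chi1]] := @cutoff_exists R d delta delta0 delta1.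
have [C C0 CP] := energy_cutoff xi gw delta0 delta1 schi chi01 chi0 chi1 theta0.
have bw := gradw_bdm gw.
have e8 : 0 < eps / 8 by rewrite divr_gt0.
apply: filterS (multidimensional_ergodic_theorem htau (bdm_density xi bw)) => eta.
rewrite -/(energy xi w) -/J => /cvgrPdist_le/(_ _ e8) hJ.
near=> N.
have N1 : 1 <= N by near: N; apply: nbhs_pinfty_ge; exact: num_real.
have N0 : 0 < N by exact: lt_le_trans N1.
have NC : C * 4 / eps <= N by near: N; apply: nbhs_pinfty_ge; exact: num_real.
have hN : `|J - davg tau (density xi w) N eta| <= eps / 8 by near: N.
apply: le_trans (CP N eta N0) _; rewrite lee_fin.
have h1 : C * N^-1 ^+ 2 <= eps / 4.
  rewrite ler_pdivrMr// in NC; rewrite exprVn ler_pdivrMr ?exprn_gt0// expr2.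
  have : eps * N <= eps * (N * N) by rewrite ler_pM2l// ler_peMl// ltW.
  by rewrite mulrC in NC; lra.
move: hN; rewrite ler_norml => /andP[h2 h3].
have -> : nu2 * sqnorm xi * (d%:R * (4 * delta)) = a * delta by rewrite /a; ring.
move: (davg _ _ _ _) h2 h3 => D h2 h3.
have ad0 : 0 <= a * delta by exact: mulr_ge0 a0 (ltW delta0).
move: (C * N^-1 ^+ 2) h1 => q h1.
move: (a * delta) delta2 ad0 => p p1 p0.
have tp : theta * p <= p by rewrite ler_piMl.
have tD : theta * (D - J) <= eps / 8.
  apply: (@le_trans _ _ (theta * (eps / 8))); first by rewrite ler_pM2l//; lra.
  by rewrite ler_piMl// ltW.
rewrite mulrBr in tD; rewrite mulrDl mul1r mulrDr.
move: (theta * J) (theta * D) (theta * p) theta2 tD tp => x1 x2 x3 h4 h5 h6.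
lra.
Unshelve. all: by end_near. Qed.

End energy.

(** The trinomial is evaluated at its minimizer [- b / c]; when [c = 0], an affine function bounded
    below forces [b = 0]. *)
Lemma discriminant {R : realType} (a b c : R) : 0 <= a -> 0 <= c ->
  (forall t, 0 <= a + 2 * t * b + t ^+ 2 * c) -> b ^+ 2 <= a * c.
Proof.
move=> a0 c0 H; have [c00|cn0] := eqVneq c 0.
  have [->|bn0] := eqVneq b 0; first by rewrite expr0n mulr_ge0.
  have := H (- (a + 1) / (2 * b)); rewrite c00 mulr0 addr0.
  have -> : a + 2 * (- (a + 1) / (2 * b)) * b = -1 by field.
  by rewrite oppr_ge0 ler10.
have c1 : 0 < c by rewrite lt_neqAle eq_sym cn0.
have := H (- b / c).
have -> : a + 2 * (- b / c) * b + (- b / c) ^+ 2 * c = a - b ^+ 2 / c by field.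
by rewrite subr_ge0 ler_pdivrMr.
Qed.

(** * Fluxes of near-minimizers and the lower bound *)

Section effective_form_grad.
Context {R : realType} {d : nat} {disp : measure_display}
  {X : measurableType disp} (mu : probability X R)
  (tau : 'rV[R]_d -> X -> X).
Hypothesis htau : ergodic_action mu tau.
Local Notation Kop := (Kop tau).
Context (A : X -> 'M[R]_d) (nu1 nu2 : R).
Hypotheses (nu10 : 0 < nu1) (nu20 : 0 < nu2).
Hypothesis mA : forall i j, measurable_fun setT (fun eta => A eta i j).
Hypothesis ellA : forall eta, elliptic nu1 nu2 (A eta).
Implicit Types (xi : 'rV[R]_d) (w : 'I_d -> X -> R).

Let mT := @measurableT _ X.
Let fT := muT_fin mu.
Local Notation energy := (energy mu A).

Definition bounded_field w := forall i, bdm setT (w i).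

Definition add_field w (t : R) w' : 'I_d -> X -> R := fun i eta => w i eta + t * w' i eta.

Lemma vec_add_field w t w' eta : vec (add_field w t w') eta = vec w eta + t *: vec w' eta.
Proof. by apply/rowP => i; rewrite !mxE. Qed.

Lemma bounded_add_field w t w' : bounded_field w -> bounded_field w' ->
  bounded_field (add_field w t w').
Proof. by move=> bw bw' i; apply: bdmD => //; exact: bdmZ. Qed.

Lemma is_grad_add_field g w t g' w' : is_grad mu tau g w -> is_grad mu tau g' w' ->
  is_grad mu tau (fun eta => g eta + t * g' eta) (add_field w t w').
Proof. by move=> gw gw'; apply: is_gradD => //; exact: is_gradZ. Qed.

Definition normsq w : R := \sum_i nsq mu (w i).

Definition pairing xi w w' : R := \int[mu]_eta bform (A eta) (xi + vec w eta) (vec w' eta).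

Lemma bdm_vec0 w i : bounded_field w -> bdm setT (fun eta => vec w eta 0 i).
Proof.
move=> bw; rewrite (_ : (fun eta => _) = w i)//; apply/funext => eta.
by rewrite mxE.
Qed.

Lemma Rint_sqnorm w : bounded_field w -> \int[mu]_eta sqnorm (vec w eta) = normsq w.
Proof.
move=> bw; transitivity (\int[mu]_eta \sum_i w i eta ^+ 2).
  by apply: eq_Rintegral => eta _; apply: eq_bigr => i _; rewrite mxE.
by rewrite (bRint_sum mT fT)// => i; exact: bdmX.
Qed.

Let bA := bdmA nu10 mA ellA.

Lemma bdm_pairing xi w w' : bounded_field w -> bounded_field w' ->
  bdm setT (fun eta => bform (A eta) (xi + vec w eta) (vec w' eta)).
Proof.
move=> bw bw'; apply: bdm_bform => [i j|i|i]; [exact: bA|exact: bdm_vec|exact: bdm_vec0].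
Qed.

Lemma density0E w eta : density A 0 w eta = qform (A eta) (vec w eta).
Proof. by rewrite /density add0r. Qed.

Lemma energy0_ge w : bounded_field w -> nu1 * normsq w <= energy 0 w.
Proof.
move=> bw; rewrite -Rint_sqnorm// -bRintZ//; last by apply: bdm_sqnorm => i; exact: bdm_vec0.
apply: bRint_le => //.
- by apply/bdmZ/bdm_sqnorm => i; exact: bdm_vec0.
- exact: (bdm_density nu10 mA ellA).
- by move=> eta _; rewrite density0E; have [_ /(_ (vec w eta))/andP[]] := ellA eta.
Qed.

Lemma energy0_le w : bounded_field w -> energy 0 w <= nu2 * normsq w.
Proof.
move=> bw; rewrite -Rint_sqnorm// -bRintZ//; last by apply: bdm_sqnorm => i; exact: bdm_vec0.
apply: bRint_le => //.
- exact: (bdm_density nu10 mA ellA).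
- by apply/bdmZ/bdm_sqnorm => i; exact: bdm_vec0.
- by move=> eta _; rewrite density0E; have [_ /(_ (vec w eta))/andP[]] := ellA eta.
Qed.

Lemma energy_add_field xi w t w' : bounded_field w -> bounded_field w' ->
  energy xi (add_field w t w') = energy xi w + 2 * t * pairing xi w w' + t ^+ 2 * energy 0 w'.
Proof.
move=> bw bw'; have b1 := bdm_density nu10 mA ellA xi bw.
have b2 := bdm_pairing xi bw bw'; have b3 := bdm_density nu10 mA ellA 0 bw'.
rewrite /energy /pairing -(bRintZ mT fT (2 * t) b2) -(bRintZ mT fT (t ^+ 2) b3).
rewrite -(bRintD mT fT b1 (bdmZ _ b2)) -(bRintD mT fT (bdmD b1 (bdmZ _ b2)) (bdmZ _ b3)).
apply: eq_Rintegral => eta _; rewrite density0E /density vec_add_field addrA.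
have [As _] := ellA eta; rewrite [LHS]qformD// qformZ bformZr.
by rewrite mulrA.
Qed.

Lemma effective_form_le g w xi : is_grad mu tau g w ->
  (effective_form mu tau A xi <= (energy xi w)%:E)%E.
Proof.
move=> gw; apply: ereal_inf_lbound; exists (vec w); first exact: is_grad_F2pot gw.
rewrite (EFin_bRint mT fT)//; apply: (bdm_density nu10 mA ellA).
exact: gradw_bdm gw.
Qed.

Lemma effective_form_ge0 xi : (0 <= effective_form mu tau A xi)%E.
Proof.
apply: le_ereal_inf_tmp => _ [v _ <-]; apply: integral_ge0 => eta _.
by rewrite lee_fin; apply: (elliptic_ge0 nu10 _ (ellA eta)).
Qed.

Lemma effective_form_fin xi : effective_form mu tau A xi \is a fin_num.
Proof.
rewrite ge0_fin_numE ?effective_form_ge0//.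
exact: le_lt_trans (effective_form_le xi (is_grad0 mu tau)) (ltry _).
Qed.

Definition qeff xi : R := fine (effective_form mu tau A xi).

Lemma qeffE xi : (qeff xi)%:E = effective_form mu tau A xi.
Proof. by rewrite fineK// effective_form_fin. Qed.

Lemma qeff_le g w xi : is_grad mu tau g w -> qeff xi <= energy xi w.
Proof. by move=> gw; rewrite -lee_fin qeffE; exact: effective_form_le gw. Qed.

Lemma qeff_ge0 xi : 0 <= qeff xi.
Proof. by rewrite -lee_fin qeffE effective_form_ge0. Qed.

(** A nearly optimal member of [F2pot] is approximated by a gradient field. As the former is only
    square integrable, Young's inequality is integrated in the extended reals, where nonnegativity
    replaces integrability. *)
Lemma qeff_approx xi (eps : R) : 0 < eps -> exists g w, is_grad mu tau g w /\
  energy xi w <= qeff xi + eps.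
Proof.
move=> eps0; have q0 := qeff_ge0 xi; set q := qeff xi in q0 *.
have e2 : 0 < eps / 2 by rewrite divr_gt0.
have [v vF vq] : exists2 v, F2pot mu tau v &
    (\int[mu]_eta (qform (A eta) (xi + v eta))%:E < (q + eps / 2)%:E)%E.
  have : (effective_form mu tau A xi < (q + eps / 2)%:E)%E.
    by rewrite -qeffE -/q lte_fin ltrDl.
  by move=> /ereal_inf_lt[_ [v vF <-]] h; exists v.
have [vL _ _] := vF.
have sv i : L2 mu (fun eta => v eta 0 i) by exact: L2_Lfun.
(* [theta] costs at most [eps / 4] on the energy of [v], and [eps'] is adapted to the resulting
   factor [c] so that the approximation costs another [eps / 4]; the choice of [v] accounts for the
   remaining [eps / 2]. *)
pose theta := eps / (4 * (q + eps)).
have qe : 0 < 4 * (q + eps) by rewrite mulr_gt0// ltr_wpDl.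
have theta0 : 0 < theta by rewrite divr_gt0.
have t1 : 0 < 1 + theta by rewrite addr_gt0.
have t2 : 0 < 1 + theta^-1 by rewrite addr_gt0// invr_gt0.
pose c := (1 + theta^-1) * nu2.
have c0 : 0 < c by rewrite mulr_gt0.
pose eps' := eps / (4 * (c * d%:R + 1)).
have cd : 0 < 4 * (c * d%:R + 1) by rewrite mulr_gt0// ltr_wpDl// mulr_ge0// ltW.
have eps'0 : 0 < eps' by rewrite divr_gt0.
have [g [w [gw wv]]] := F2pot_grad_approx htau vF eps'0.
exists g, w; split => //.
have bw := gradw_bdm gw.
have sd i : L2 mu (fun eta => v eta 0 i - w i eta).
  by apply: L2B => //; apply: bdm_L2; exact: bw.
pose q1 eta := qform (A eta) (xi + v eta).
pose n1 eta := \sum_i (v eta 0 i - w i eta) ^+ 2.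
have mq1 : measurable_fun setT q1.
  rewrite (_ : q1 = fun eta => \sum_j \sum_i
    (xi 0 i + v eta 0 i) * A eta i j * (xi 0 j + v eta 0 j)); last first.
    apply/funext => eta; rewrite /q1 qformE bformE; apply: eq_bigr => j _; apply: eq_bigr => i _.
    by rewrite !mxE.
  apply: measurable_sum => j; apply: measurable_sum => i.
  apply: measurable_funM; first apply: measurable_funM => //;
    by apply: measurable_funD => //; exact: (sv _).1.
have mn1 : measurable_fun setT n1.
  by apply: measurable_sum => i; apply: measurable_funX; exact: (sd i).1.
have q10 eta : 0 <= q1 eta by exact: (elliptic_ge0 nu10 _ (ellA eta)).
have n10 eta : 0 <= n1 eta by apply: sumr_ge0 => i _; exact: sqr_ge0.
have le1 eta : density A xi w eta <= (1 + theta) * q1 eta + c * n1 eta.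
  have -> : density A xi w eta = qform (A eta) ((xi + v eta) + (vec w eta - v eta)).
    by rewrite /density -addrA [v eta + _]addrC subrK.
  apply: le_trans (elliptic_young nu10 _ _ (ellA eta) theta0) _.
  rewrite lerD2l /c -mulrA ler_pM2l//.
  have [_ /(_ (vec w eta - v eta))/andP[_ h]] := ellA eta; apply: le_trans h _.
  rewrite ler_pM2l// le_eqVlt; apply/orP; left; apply/eqP; apply: eq_bigr => i _.
  by rewrite !mxE -sqrrN opprB.
have In1 : (\int[mu]_eta (n1 eta)%:E <= (d%:R * eps')%:E)%E.
  have in1 i : mu.-integrable setT (EFin \o (fun eta => (v eta 0 i - w i eta) ^+ 2)).
    exact: (sd i).2.
  rewrite /n1; under eq_integral do rewrite -sumEFin.
  rewrite ge0_integral_sum//; first last.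
  - by move=> i eta _; rewrite lee_fin sqr_ge0.
  - by move=> i; apply/measurable_EFinP; apply: measurable_funX; exact: (sd i).1.
  have -> : (d%:R * eps')%:E = (\sum_(i < d) eps'%:E)%E.
    by rewrite sumEFin sumr_const card_ord mulr_natl.
  apply: lee_sum => i _; have := wv i; rewrite -lee_fin /nsq /Rintegral fineK//.
  exact: (integrable_fin_num mT (in1 i)).
rewrite -lee_fin (EFin_bRint mT fT (bdm_density nu10 mA ellA xi bw)).
apply: (@le_trans _ _ (\int[mu]_eta (((1 + theta) * q1 eta)%:E + (c * n1 eta)%:E))%E).
  apply: ge0_le_integral => //.
  - by move=> eta _; rewrite lee_fin; exact: (density_ge0 nu10 ellA).
  - by apply/measurable_EFinP; exact: (bdm_density nu10 mA ellA xi bw).1.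
  - by apply/measurable_EFinP; apply: measurable_funD; exact: measurable_funM.
  - by move=> eta _; rewrite -EFinD lee_fin.
rewrite ge0_integralD//; first last.
- by apply/measurable_EFinP; exact: measurable_funM.
- by move=> eta _; rewrite lee_fin mulr_ge0// ltW.
- by apply/measurable_EFinP; exact: measurable_funM.
- by move=> eta _; rewrite lee_fin mulr_ge0// ltW.
rewrite (@eq_integral _ _ _ mu setT (fun eta => (1 + theta)%:E * (q1 eta)%:E)%E)//.
rewrite (@eq_integral _ _ _ mu setT (fun eta => c%:E * (n1 eta)%:E)%E
  (fun eta => (c * n1 eta)%:E))//.
rewrite !ge0_integralZl//; first last.
- by rewrite lee_fin ltW.
- by move=> x _; rewrite lee_fin.
- by apply/measurable_EFinP.
- by rewrite lee_fin ltW.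
- by move=> x _; rewrite lee_fin.
- by apply/measurable_EFinP.
apply: (@le_trans _ _ ((1 + theta)%:E * (q + eps / 2)%:E + c%:E * (d%:R * eps')%:E)%E).
  apply: leeD; apply: lee_wpmul2l => //; rewrite ?lee_fin ?ltW//.
rewrite -!EFinM -EFinD lee_fin.
have h1 : theta * (q + eps / 2) <= eps / 4.
  have : theta * (q + eps) = eps / 4 by rewrite /theta; field; rewrite gt_eqF// ltr_wpDl.
  move=> <-; rewrite ler_pM2l// lerD2l; lra.
have h2 : c * (d%:R * eps') <= eps / 4.
  rewrite /eps'; have : 0 <= c * d%:R by rewrite mulr_ge0// ltW.
  rewrite (mulrA c d%:R); move: (c * d%:R) => k k0.
  have -> : k * (eps / (4 * (k + 1))) = (k * (eps / 4)) / (k + 1).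
    by field; rewrite gt_eqF// ltr_wpDl.
  rewrite ler_pdivrMr ?ltr_wpDl// mulrDr mulr1 mulrC lerDl; lra.
by rewrite mulrDl mul1r; lra.
Qed.

(** An approximate Euler-Lagrange equation: along the line from [w] in direction [w'] the energy is
    a quadratic polynomial bounded below by [qeff xi], so its discriminant is controlled by the gap
    [eps]. *)
Lemma near_orthogonal xi g w g' w' (eps : R) : is_grad mu tau g w -> is_grad mu tau g' w' ->
  0 <= eps -> energy xi w <= qeff xi + eps ->
  pairing xi w w' ^+ 2 <= eps * (nu2 * normsq w').
Proof.
move=> gw gw' eps0 h; have bw := gradw_bdm gw; have bw' := gradw_bdm gw'.
apply: (@le_trans _ _ (eps * energy 0 w')); last by rewrite ler_wpM2l// energy0_le.
apply: discriminant => // [|t]; first exact: (energy_ge0 mu nu10 ellA).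
have := qeff_le xi (is_grad_add_field t gw gw'); rewrite energy_add_field//.
move: (energy xi w) (2 * t * _) (t ^+ 2 * _) h => a b c h1 h2; lra.
Qed.

(** Uniform convexity at the midpoint: the energy there is at least [qeff xi], and it lies below the
    mean of the two energies by a quarter of the quadratic energy of the difference. *)
Lemma near_minimizers_close xi g w g' w' (eps : R) : is_grad mu tau g w ->
  is_grad mu tau g' w' -> energy xi w <= qeff xi + eps -> energy xi w' <= qeff xi + eps ->
  nu1 * normsq (add_field w' (-1) w) <= 4 * eps.
Proof.
move=> gw gw' h h'; have bw := gradw_bdm gw; have bw' := gradw_bdm gw'.
have bd := bounded_add_field (-1) bw' bw.
apply: le_trans (energy0_ge bd) _.
have gd := is_grad_add_field (-1) gw' gw.
have E1 : w' = add_field w 1 (add_field w' (-1) w).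
  by apply/funext => i; apply/funext => eta; rewrite /add_field; ring.
have := energy_add_field xi 1 bw bd; rewrite -E1.
have := qeff_le xi (is_grad_add_field (1 / 2) gw gd); rewrite energy_add_field//.
move: (pairing _ _ _) (energy 0 _) (energy xi w) (energy xi w') (qeff xi) h h' => p e a a' q.
by move=> h1 h2 h3 h4; lra.
Qed.

Definition flux xi w i eta : R := ((xi + vec w eta) *m A eta) 0 i.

Lemma bdm_flux xi w i : bounded_field w -> bdm setT (flux xi w i).
Proof.
move=> bw; rewrite (_ : flux xi w i = fun eta => \sum_k (xi + vec w eta) 0 k * A eta k i).
  by apply: bdm_sum => k; apply: bdmM; [exact: bdm_vec|exact: bA].
by apply/funext => eta; rewrite /flux mxE.
Qed.

Lemma pairing_flux xi w w' : bounded_field w -> bounded_field w' ->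
  pairing xi w w' = \sum_i \int[mu]_eta (flux xi w i eta * w' i eta).
Proof.
move=> bw bw'; transitivity (\int[mu]_eta \sum_i flux xi w i eta * w' i eta).
  by apply: eq_Rintegral => eta _; apply: eq_bigr => i _; rewrite [vec _ _ _ _]mxE.
rewrite (bRint_sum mT fT)// => i; apply: bdmM => //; exact: bdm_flux.
Qed.

Lemma nsq_flux_diff xi w w' i : bounded_field w -> bounded_field w' ->
  nsq mu (fun eta => flux xi w' i eta - flux xi w i eta) <=
  nu2 ^+ 2 * normsq (add_field w' (-1) w).
Proof.
move=> bw bw'; have bd := bounded_add_field (-1) bw' bw.
have bs : bdm setT (fun eta => sqnorm (vec (add_field w' (-1) w) eta)).
  by apply: bdm_sqnorm => k; exact: bdm_vec0.
rewrite -Rint_sqnorm// -(bRintZ mT fT _ bs).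
apply: bRint_le => //; [by apply/bdmX/bdmB; exact: bdm_flux|exact: bdmZ|move=> eta _].
apply: le_trans (sqnorm_flux nu10 nu20 _ (ellA eta)).
have -> : flux xi w' i eta - flux xi w i eta =
    (vec (add_field w' (-1) w) eta *m A eta) 0 i.
  rewrite /flux; have -> : vec (add_field w' (-1) w) eta = (xi + vec w' eta) - (xi + vec w eta).
    by rewrite vec_add_field scaleN1r opprD addrACA subrr add0r.
  by rewrite mulmxBl [in RHS]mxE [in X in _ = _ + X]mxE.
rewrite /sqnorm (bigD1 i)//= lerDl; apply: sumr_ge0 => k _; exact: sqr_ge0.
Qed.

End effective_form_grad.

Lemma sq_le_cancel {R : realType} (x k : R) : 0 <= k -> x ^+ 2 <= k * x -> x <= k.
Proof.
move=> k0 h; rewrite leNgt; apply/negP => kx.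
have x0 : 0 < x by exact: le_lt_trans kx.
by move: h; rewrite expr2 ler_pM2r// leNgt kx.
Qed.

Lemma dual_gap_bound {R : realType} (p e q eps : R) :
  p <= eps / 2 -> q <= e -> q - eps <= 2 * (e - p) - e.
Proof. lra. Qed.

(** * Skew potentials for the flux of a near-minimizer *)

Section corrector.
Context {R : realType} {d : nat} {disp : measure_display}
  {X : measurableType disp} (mu : probability X R)
  (tau : 'rV[R]_d -> X -> X).
Hypothesis htau : ergodic_action mu tau.
Local Notation Kop := (Kop tau).
Context (A : X -> 'M[R]_d) (nu1 nu2 : R).
Hypotheses (nu10 : 0 < nu1) (nu20 : 0 < nu2).
Hypothesis mA : forall i j, measurable_fun setT (fun eta => A eta i j).
Hypothesis ellA : forall eta, elliptic nu1 nu2 (A eta).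
Implicit Types (xi : 'rV[R]_d) (w : 'I_d -> X -> R).

Let mT := @measurableT _ X.
Let fT := muT_fin mu.
Local Notation energy := (energy mu A).
Local Notation qeff := (qeff mu tau A).
Local Notation flux := (flux A).
Local Notation pairing := (pairing mu A).

Definition mean (f : X -> R) : R := \int[mu]_eta f eta.

Lemma nsq_center f : bdm setT f -> nsq mu (fun eta => f eta - mean f) <= 4 * nsq mu f.
Proof.
move=> bf; have bc : bdm setT (fun _ : X => mean f) by exact: bdm_cst.
apply: le_trans (nsqB2 (bdm_L2 mu bf) (bdm_L2 mu bc)) _.
have : nsq mu (fun _ : X => mean f) <= nsq mu f.
  rewrite /nsq Rintegral_cst// (fine_muT mu) mulr1.
  by have := bRint_sq mT fT bf; rewrite (fine_muT mu) mul1r.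
by move=> h; apply: ler_quarters; rewrite mulrC mulKf.
Qed.

(** The reflection is written as an affine map so that the lemmas on affine changes of variable
    apply. *)
Let reflect (phi : 'rV[R]_d -> R) : 'rV[R]_d -> R := fun y => phi (-1 *: y + 0).

Let test_function_reflect phi : test_function phi -> test_function (reflect phi).
Proof.
move=> /test_functionP[sphi [M MP]]; apply/test_functionP; split; first exact: smooth_affine.
by exists M => x Mx; rewrite /reflect MP// addr0 scaleN1r normrN.
Qed.

Let partial_reflect phi i y : test_function phi ->
  partial i (reflect phi) y = - partial i phi (- y).
Proof.
move=> /test_functionP[sphi _]; rewrite /reflect partial_affine; last exact: smooth_differentiable.
by rewrite mulN1r addr0 scaleN1r.
Qed.

(* The component of the flux seen by [sum_j Kop (partial j phi)] is small for a
   near-minimizer: testing it against itself produces a gradient field. *)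
Lemma flux_divergence_small xi phi g w (eps C : R) : test_function phi -> is_grad mu tau g w ->
  0 <= eps -> energy xi w <= qeff xi + eps -> 0 <= C ->
  (forall j f, L2 mu f -> nsq mu (Kop (partial j (reflect phi)) f) <= C * nsq mu f) ->
  nsq mu (fun eta => \sum_j Kop (partial j phi) (flux xi w j) eta) <=
    eps * (nu2 * (d%:R * C)).
Proof.
move=> tphi gw eps0 h C0 HC; have bw := gradw_bdm gw.
have bP j : bdm setT (flux xi w j) by exact: (bdm_flux nu10 mA ellA).
have k j : kern (partial j phi) by exact/test_function_kern/test_function_partial.
pose G eta := \sum_j Kop (partial j phi) (flux xi w j) eta.
have bKP j : bdm setT (Kop (partial j phi) (flux xi w j)) by exact: (bdm_Kop htau).
have bG : bdm setT G by exact: bdm_sum.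
have tr := test_function_reflect tphi.
pose w' j eta := - Kop (partial j (reflect phi)) G eta.
have gw' : is_grad mu tau (Kop (reflect phi) G) w' by exact: is_grad_Kop.
have bw' := gradw_bdm gw'.
have E : nsq mu G = pairing xi w w'.
  rewrite (pairing_flux mu nu10 mA ellA)// /nsq.
  transitivity (\int[mu]_eta \sum_j (G eta * Kop (partial j phi) (flux xi w j) eta)).
    by apply: eq_Rintegral => eta _; rewrite -mulr_sumr expr2.
  rewrite (bRint_sum mT fT); last by move=> j; exact: bdmM.
  apply: eq_bigr => j _; rewrite (Kop_adjoint htau (k j) (bP j) bG).
  apply: eq_Rintegral => eta _; congr (_ * _); rewrite /w' -mulN1r -(Kop_kernZ htau) => //.
    by congr (Kop _ _ _); apply/funext => y; rewrite partial_reflect// mulN1r opprK.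
  exact/test_function_kern/test_function_partial.
apply: sq_le_cancel; first by rewrite !mulr_ge0// ltW.
rewrite -/G {1}E.
apply: le_trans (near_orthogonal nu10 mA ellA gw gw' eps0 h) _.
rewrite -mulrA ler_wpM2l// -mulrA ler_wpM2l ?(ltW nu20)//.
rewrite /normsq -mulrA mulr_natl -[X in _ *+ X]card_ord -sumr_const.
apply: ler_sum => j _; rewrite nsqN; apply: HC; exact: bdm_L2.
Qed.

(** With [P] the flux, [B i j] is [Kop m_i P_j - Kop m_j P_i] and [W i j k] is its derivative in
    direction [k]. The divergence of [B] is [Kop (pkern e l) P_i], close to [P_i] minus its mean,
    less a term that tests the divergence of [P] and is small for a near-minimizer. The inequality
    on the mean flux says that [xi + w] is almost optimal in the dual bound as well. *)
Lemma corrector_exists xi (eps : R) : 0 < eps -> exists g w B W, [/\ is_grad mu tau g w,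
  (energy xi w <= qeff xi + eps),
  (qeff xi - eps <= 2 * \sum_i xi 0 i * mean (flux xi w i) - energy xi w),
  (forall i j, is_grad mu tau (B i j) (W i j)) &
  (forall i j eta, B i j eta = - B j i eta) /\
  (forall i, nsq mu (fun eta => flux xi w i eta - mean (flux xi w i) -
    \sum_j W i j j eta) <= eps)].
Proof.
move=> eps0; have q0 := qeff_ge0 mu tau nu10 mA ellA xi.
have [C1 C10 C1P] := nsq_Kop_pkern htau.
(* Converts an energy gap into a squared distance between the fluxes of two near-minimizers:
   [4 / nu1] comes from convexity and coercivity, [nu2 ^+ 2] from the bound on the flux. *)
pose kap := nu2 ^+ 2 * (4 / nu1).
have kap0 : 0 < kap by rewrite mulr_gt0 ?exprn_gt0// divr_gt0.
pose den := 8 + 4 * C1 * kap + 16 * kap.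
have den0 : 0 < den by rewrite /den; have := mulr_gt0 C10 kap0; lra.
pose eps0' := eps / (8 * den).
have eps0'0 : 0 < eps0' by rewrite divr_gt0// mulr_gt0.
(* The coarse near-minimizer [w0] only serves to choose the scales [e] and [l]. The final [w] has a
   gap [eps1] adapted to these kernels, and its flux is close enough to that of [w0] for the same
   scales to work. *)
have [g0 [w0 [gw0 h0]]] := qeff_approx htau nu10 nu20 mA ellA xi eps0'0.
have bw0 := gradw_bdm gw0.
have bP0 i : bdm setT (flux xi w0 i) by exact: (bdm_flux nu10 mA ellA).
have [e [l [e0 l0 pkP]]] := pkern_approx htau bP0 eps0'0.
pose m j : 'rV[R]_d -> R := potk e l j.
have tm j : test_function (m j) by exact: test_function_potk.
have kp i j : kern (partial i (m j)) by exact/test_function_kern/test_function_partial.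
have H2 (p : 'I_d * 'I_d) : exists C, 0 < C /\ forall f, L2 mu f ->
    nsq mu (Kop (partial p.1 (reflect (m p.2))) f) <= C * nsq mu f.
  have [C C0 CP] := L2_Kop htau (test_function_kern (test_function_partial p.1
    (test_function_reflect (tm p.2)))).
  by exists C; split => // f sf; exact: (CP f sf).2.
have [C2f C2fP] := choice H2; have [C2 C20 C2P] := fin_upper_bound C2f.
have K2 i j f : L2 mu f -> nsq mu (Kop (partial i (reflect (m j))) f) <= C2 * nsq mu f.
  move=> sf; apply: le_trans ((C2fP (i, j)).2 f sf) _.
  by rewrite ler_wpM2r ?nsq_ge0// (C2P (i, j)).
(* Bounds the squared norm of [w], by at most twice that of [xi + w], estimated by coercivity, plus
   twice that of [xi]. *)
pose Kq := 2 * ((qeff xi + eps0') / nu1) + 2 * sqnorm xi.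
have Kq0 : 0 <= Kq.
  by rewrite addr_ge0// mulr_ge0 ?sqnorm_ge0// divr_ge0 ?(ltW nu10)// addr_ge0// ltW.
pose D := nu2 * (d%:R * C2) + nu2 * Kq + 1.
have D1 : 0 <= nu2 * (d%:R * C2) by rewrite !mulr_ge0// ltW.
have D2 : 0 <= nu2 * Kq by rewrite mulr_ge0// ltW.
have D0 : 0 < D by rewrite /D; lra.
(* The three bounds serve the closeness to [w0], the smallness of the divergence of the flux, and
   the near-orthogonality of [w] to its own flux. *)
pose eps1 := Num.min eps0' (Num.min (eps0' / D) (eps ^+ 2 / (4 * D))).
have eps10 : 0 < eps1 by rewrite !lt_min eps0'0 !divr_gt0 ?exprn_gt0// mulr_gt0.
have [g [w [gw h]]] := qeff_approx htau nu10 nu20 mA ellA xi eps10.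
have bw := gradw_bdm gw.
have e1e0 : eps1 <= eps0' by rewrite /eps1 ge_min lexx.
have e1D : eps1 * D <= eps0'.
  by rewrite -ler_pdivlMr// /eps1 !ge_min lexx ?orbT.
have e1D2 : eps1 * D * 4 <= eps ^+ 2.
  by rewrite -mulrA [D * 4]mulrC -ler_pdivlMr ?mulr_gt0// /eps1 !ge_min lexx ?orbT.
have bP i : bdm setT (flux xi w i) by exact: (bdm_flux nu10 mA ellA).
pose B i j eta := Kop (m i) (flux xi w j) eta + -1 * Kop (m j) (flux xi w i) eta.
pose W i j k eta := - Kop (partial k (m i)) (flux xi w j) eta +
   -1 * - Kop (partial k (m j)) (flux xi w i) eta.
have e0eps : eps0' * (8 * den) = eps by rewrite divfK// gt_eqF// mulr_gt0.
exists g, w, B, W; split => //.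
- apply: le_trans h _; rewrite lerD2l (le_trans e1e0)// -e0eps ler_peMr// ?ltW//.
  have := mulr_gt0 C10 kap0; rewrite /den; lra.
- have b2 : pairing xi w w ^+ 2 <= (eps / 2) ^+ 2.
    apply: le_trans (near_orthogonal nu10 mA ellA gw gw (ltW eps10) h) _.
    have nw : normsq mu w <= Kq.
      rewrite -Rint_sqnorm//.
      have bdens := bdm_density nu10 mA ellA xi bw.
      apply: (@le_trans _ _ (\int[mu]_eta (2 * (nu1^-1 * density A xi w eta) + 2 * sqnorm xi))).
        apply: bRint_le => //.
        - by apply: bdm_sqnorm => i; exact: bdm_vec0.
        - by apply: bdmD; [apply/bdmZ/bdmZ|exact: bdm_cst].
        move=> eta _; have := sqnorm_qform nu10 (xi + vec w eta) (ellA eta).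
        rewrite -/(density A xi w eta); move: (density _ _ _ _) => D' hD.
        apply: (@le_trans _ _ (2 * sqnorm (xi + vec w eta) + 2 * sqnorm xi)); last first.
          by rewrite lerD2r ler_pM2l.
        rewrite /sqnorm !mulr_sumr -big_split/=; apply: ler_sum => i _; rewrite !mxE.
        move: (xi 0 i) (w i eta) => a b; have := sqr_ge0 (2 * a + b).
        by rewrite -subr_ge0 => h'; rewrite -subr_ge0; move: h'; congr (_ <= _); ring.
      rewrite (bRintD mT fT (bdmZ 2 (bdmZ nu1^-1 bdens)) (bdm_cst _ _)).
      rewrite (bRintZ mT fT 2 (bdmZ nu1^-1 bdens)) (bRintZ mT fT nu1^-1 bdens).
      rewrite Rintegral_cst// (fine_muT mu) mulr1.
      rewrite lerD2r ler_pM2l// mulrC ler_pM2r ?invr_gt0//.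
      by apply: le_trans h _; rewrite lerD2l.
    apply: (@le_trans _ _ (eps1 * D)).
      rewrite ler_pM2l//; apply: (@le_trans _ _ (nu2 * Kq)); first by rewrite ler_pM2l.
      by rewrite /D; lra.
    by rewrite expr_div_n ler_pdivlMr ?exprn_gt0// -natrX; exact: e1D2.
  have b3 : pairing xi w w <= eps / 2.
    apply: le_trans (ler_norm _) _.
    by rewrite -(@ler_pXn2r _ 2) ?nnegrE ?divr_ge0 ?(ltW eps0)// real_normK ?num_real.
  (* Testing the flux against [xi] is testing it against [xi + w] and subtracting the test against
     [w]: the energy minus a nearly vanishing pairing. *)
  have -> : \sum_i xi 0 i * mean (flux xi w i) = energy xi w - pairing xi w w.
    have b1 := bdm_density nu10 mA ellA xi bw.
    have b4 := bdm_pairing nu10 mA ellA xi bw bw.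
    rewrite -(bRintB mT fT b1 b4).
    rewrite (@eq_Rintegral _ _ _ mu setT (fun eta => \sum_i xi 0 i * flux xi w i eta)).
      rewrite (bRint_sum mT fT); last by move=> i; exact: bdmZ.
      by apply: eq_bigr => i _; rewrite bRintZ.
    move=> eta _; rewrite /density qformE bformDr addrK.
    by apply: eq_bigr => i _; rewrite mulrC.
  exact: dual_gap_bound b3 (qeff_le nu10 mA ellA xi gw).
- move=> i j; apply: is_gradD; first exact: is_grad_Kop.
  by apply: is_gradZ; exact: is_grad_Kop.
split => [i j eta|i]; first by rewrite /B; ring.
pose G eta := \sum_j Kop (partial j (m i)) (flux xi w j) eta.
pose dl eta := flux xi w i eta - flux xi w0 i eta.
have bdl : bdm setT dl by exact: bdmB.
have ndl : nsq mu dl <= kap * eps0'.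
  apply: le_trans (nsq_flux_diff mu nu10 nu20 mA ellA xi i bw0 bw) _.
  rewrite /kap -mulrA ler_wpM2l ?sqr_ge0//.
  rewrite -(ler_pM2l nu10); apply: le_trans (near_minimizers_close nu10 mA ellA gw0 gw h0 _) _.
    by apply: le_trans h _; rewrite lerD2l.
  by rewrite [leRHS]mulrA [nu1 * _]mulrC divfK// gt_eqF.
have nG : nsq mu G <= eps0'.
  apply: le_trans (flux_divergence_small (tm i) gw (ltW eps10) h (ltW C20) (K2 ^~ i)) _.
  by apply: le_trans e1D; rewrite ler_pM2l// /D; lra.
have bG : bdm setT G by apply: bdm_sum => j; exact: (bdm_Kop htau).
have kpk : kern (pkern e l : 'rV[R]_d -> R) by exact: kern_pkern.
pose f1 eta := Kop (pkern e l) (flux xi w0 i) eta -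
  (flux xi w0 i eta - mean (flux xi w0 i)).
pose f2 eta := Kop (pkern e l) dl eta.
pose f3 eta := dl eta - mean dl.
have bf1 : bdm setT f1.
  by apply: bdmB; [exact: (bdm_Kop htau)|apply: bdmB => //; exact: bdm_cst].
have bf2 : bdm setT f2 by exact: (bdm_Kop htau).
have bf3 : bdm setT f3 by apply: bdmB => //; exact: bdm_cst.
have mdl : mean dl = mean (flux xi w i) - mean (flux xi w0 i) by rewrite /mean bRintB.
(* The error is routed through [w0]: [f1] is the kernel error at [w0], [f2] and [f3] carry the
   difference of the two fluxes, and [G] carries the divergence. *)
have E : (fun eta => flux xi w i eta - mean (flux xi w i) - \sum_j W i j j eta) =
    fun eta => (f3 eta - f1 eta) + (G eta - f2 eta).
  apply/funext => eta.
  have -> : \sum_j W i j j eta = Kop (pkern e l) (flux xi w i) eta - G eta.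
    have -> : Kop (pkern e l) (flux xi w i) eta = \sum_j Kop (partial j (m j)) (flux xi w i) eta.
      have [_ <-] := Kop_kern_sum htau (index_enum 'I_d) eta (fun j => kp j j) (bP i).
      by congr (Kop _ _ _); apply/funext => y; rewrite sum_partial_potk.
    rewrite /G -sumrB; apply: eq_bigr => j _; rewrite /W mulN1r opprK.
    by rewrite addrC.
  rewrite /f3 /f1 /f2 (KopB htau _ kpk (bP i) (bP0 i)) mdl /dl.
  move: (flux xi w i eta) (mean (flux xi w i)) (G eta) (flux xi w0 i eta)
    (mean (flux xi w0 i)) (Kop (pkern e l) (flux xi w i) eta)
    (Kop (pkern e l) (flux xi w0 i) eta) => a b c a' b' c' k'.
  ring.
have n1 := pkP i; rewrite -/f1 in n1.
have n2 : nsq mu f2 <= C1 * (kap * eps0').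
  by apply: le_trans (C1P e l dl e0 l0 bdl) _; rewrite ler_pM2l.
have n3 := nsq_center bdl; rewrite -/f3 in n3.
have n31 := nsqB2 (bdm_L2 mu bf3) (bdm_L2 mu bf1).
have nG2 := nsqB2 (bdm_L2 mu bG) (bdm_L2 mu bf2).
have nn := nsqD2 (bdm_L2 mu (bdmB bf3 bf1)) (bdm_L2 mu (bdmB bG bf2)).
rewrite E; apply: le_trans nn _; rewrite -e0eps /den.
have p1 := ltW (mulr_gt0 C10 (mulr_gt0 kap0 eps0'0)).
have p2 := ltW (mulr_gt0 kap0 eps0'0).
have -> : eps0' * (8 * (8 + 4 * C1 * kap + 16 * kap)) =
  64 * eps0' + 32 * (C1 * (kap * eps0')) + 128 * (kap * eps0') by ring.
move: (nsq mu f1) (nsq mu f2) (nsq mu f3) (nsq mu G) (nsq mu dl)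
  (nsq mu (fun eta => f3 eta - f1 eta)) (nsq mu (fun eta => G eta - f2 eta))
  (C1 * (kap * eps0')) (kap * eps0') (eps0') n1 n2 n3 n31 nG2 nG ndl p1 p2 eps0'0.
clear => a1 a2 a3 a4 a5 a6 a7 x y z *. lra.
Qed.

End corrector.

Section skew_fields.
Context {R : realType} {d : nat}.
Local Notation lambda := (@lebn R d).

Lemma skew_sym_sum (C S : 'I_d -> 'I_d -> R) : (forall i j, C i j = - C j i) ->
  (forall i j, S i j = S j i) -> \sum_i \sum_j C i j * S j i = 0.
Proof.
move=> Cs Ss; set T := (X in X = 0).
suff : T = - T by move=> /eqP; rewrite -addr_eq0 -mulr2n mulrn_eq0 => /eqP.
rewrite {1}/T exchange_big/= -sumrN; apply: eq_bigr => i _.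
by rewrite -sumrN; apply: eq_bigr => j _; rewrite Cs Ss mulNr.
Qed.

(* By parts, the left side pairs the skew field [C] with the symmetric Hessian of [f]. *)
Lemma Rint_skew_divergence0 (N : R) (xi : 'rV[R]_d) (f : 'rV[R]_d -> R)
    (C : 'I_d -> 'I_d -> 'rV[R]_d -> R) : 0 < N -> smooth f ->
  (forall i j, smooth (C i j)) -> (forall i j x, C i j x = - C j i x) ->
  (forall i j x, C i j (upd x j 0) = 0) -> (forall i j x, C i j (upd x j N) = 0) ->
  \int[lambda]_(x in cube 0 N)
    (\sum_i (xi 0 i + partial i f x) * \sum_j partial j (C i j) x) = 0.
Proof.
move=> N0 sf sC Cs C0 CN.
pose e i x := xi 0 i + partial i f x.
have sfi i : smooth (partial i f) by exact: smooth_partial.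
have se i : smooth (e i) by apply: smoothD => //; exact: smooth_cst.
have seC i j : smooth (fun x => e i x * C i j x) by exact: smoothM.
have E x : \sum_i (xi 0 i + partial i f x) * \sum_j partial j (C i j) x =
    \sum_i \sum_j partial j (fun x => e i x * C i j x) x.
  transitivity (\sum_i \sum_j partial j (fun x => e i x * C i j x) x -
      \sum_i \sum_j C i j x * partial j (partial i f) x).
    rewrite -sumrB; apply: eq_bigr => i _; rewrite mulr_sumr -sumrB; apply: eq_bigr => j _.
    rewrite partialM; [|exact: smooth_differentiable|exact: smooth_differentiable].
    have -> : partial j (e i) x = partial j (partial i f) x.
      rewrite /e partialD; [|exact: smooth_differentiable (smooth_cst _)|exact: smooth_differentiable].
      by rewrite partial_cst add0r.
    by rewrite addrK.
  rewrite (skew_sym_sum (C := fun i j => C i j x) (S := fun j i => partial j (partial i f) x)).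
  - by rewrite subr0.
  - by move=> i j; exact: Cs.
  - by move=> i j; exact: partial_comm.
under eq_Rintegral do rewrite E.
have bp i j : bdm (cube 0 N) (partial j (fun x => e i x * C i j x)).
  by apply: smooth_cube; exact: smooth_partial.
rewrite (bRint_sum (measurable_cube _ _) (lebn_cube_fin _ _ _)); last first.
  by move=> i; exact: bdm_sum.
rewrite big1// => i _; rewrite (bRint_sum (measurable_cube _ _) (lebn_cube_fin _ _ _))//.
by rewrite big1// => j _; apply: Rint_partial0 => // x; rewrite C0 CN !mulr0.
Qed.

End skew_fields.

(** For one component: [a] is the mean flux, [D] the divergence of the skew potential, [r] the
    defect, [e] the component of [xi + grad f], [c] the cut-off, and [y] the divergence of the
    cut-off potential. Replacing [r + D] by [y] costs [2 * theta * e ^+ 2] by Young's inequality,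
    and [(1 - c) ^+ 2 <= 1 - c] turns the term in [D] into a boundary layer term. *)
Lemma young_lower {R : realType} (theta e a r D c b y : R) : 0 < theta -> 0 <= c <= 1 ->
  y = c * D + b ->
  2 * (a * e) + 2 * (e * y) - 2 * theta * e ^+ 2 -
    theta^-1 * (r ^+ 2 + (2 * D ^+ 2 * (1 - c) + 2 * b ^+ 2)) <= 2 * ((a + r + D) * e).
Proof.
move=> t0 /andP[c0 c1] ->.
pose z := (1 - c) * D - b.
have h1 : 0 <= theta^-1 * (theta * e + r) ^+ 2 by rewrite mulr_ge0 ?invr_ge0 ?sqr_ge0// ltW.
have h2 : 0 <= theta^-1 * (theta * e + z) ^+ 2 by rewrite mulr_ge0 ?invr_ge0 ?sqr_ge0// ltW.
have h3 : 0 <= theta^-1 * (((1 - c) * D + b) ^+ 2 + 2 * (c * (1 - c) * D ^+ 2)).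
  apply: mulr_ge0; first by rewrite invr_ge0 ltW.
  apply: addr_ge0; first exact: sqr_ge0.
  apply: mulr_ge0 => //; apply: mulr_ge0; last exact: sqr_ge0.
  by rewrite mulr_ge0// subr_ge0.
rewrite -subr_ge0.
have -> : 2 * ((a + r + D) * e) - (2 * (a * e) + 2 * (e * (c * D + b)) - 2 * theta * e ^+ 2 -
    theta^-1 * (r ^+ 2 + (2 * D ^+ 2 * (1 - c) + 2 * b ^+ 2))) =
  theta^-1 * (theta * e + r) ^+ 2 + theta^-1 * (theta * e + z) ^+ 2 +
  theta^-1 * (((1 - c) * D + b) ^+ 2 + 2 * (c * (1 - c) * D ^+ 2)).
  by rewrite /z; field; rewrite gt_eqF.
by rewrite !addr_ge0.
Qed.

(** * The lower bound on the cell energy *)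

Section lower_bound.
Context {R : realType} {d : nat} {disp : measure_display}
  {X : measurableType disp} (mu : probability X R)
  (tau : 'rV[R]_d -> X -> X).
Hypothesis htau : ergodic_action mu tau.
Local Notation lambda := (@lebn R d).
Context (A : X -> 'M[R]_d) (nu1 nu2 : R).
Hypotheses (nu10 : 0 < nu1) (nu20 : 0 < nu2).
Hypothesis mA : forall i j, measurable_fun setT (fun eta => A eta i j).
Hypothesis ellA : forall eta, elliptic nu1 nu2 (A eta).
Implicit Types (xi : 'rV[R]_d) (w : 'I_d -> X -> R).

Let mT := @measurableT _ X.
Let fT := muT_fin mu.
Local Notation energy := (energy mu A).
Local Notation qeff := (qeff mu tau A).
Local Notation flux := (flux A).
Local Notation mean := (mean mu).

Definition defect xi w (W : 'I_d -> 'I_d -> 'I_d -> X -> R) eta : R :=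
  \sum_i (flux xi w i eta - mean (flux xi w i) - \sum_j W i j j eta) ^+ 2.

(** After the cut-off, the divergence part of the flux integrates to zero against [xi + grad f], and
    the mean flux sees only [xi]. The quadratic terms in [f] lost to Young's inequality are absorbed
    by coercivity into the factor [1 + 2 * theta / nu1], so that [K] can be chosen before [f], [N]
    and [eta]. *)
Lemma cell_energy_lower xi w (B : 'I_d -> 'I_d -> X -> R) W CD chi delta theta :
  bounded_field w ->
  (forall i j, is_grad mu tau (B i j) (W i j)) -> (forall i j eta, B i j eta = - B j i eta) ->
  (forall i eta, `|\sum_j W i j j eta| <= CD) ->
  0 < delta -> delta < 1 / 4 ->
  smooth chi -> (forall x : 'rV[R]_d, 0 <= chi x <= 1) ->
  (forall x : 'rV[R]_d, (exists i, x 0 i <= delta \/ 1 - delta <= x 0 i) -> chi x = 0) ->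
  (forall x : 'rV[R]_d, (forall i, 2 * delta <= x 0 i <= 1 - 2 * delta) -> chi x = 1) ->
  0 < theta -> exists2 K, 0 <= K & forall N eta f, 0 < N -> smooth_torus N f ->
    2 * (\sum_i xi 0 i * mean (flux xi w i)) - davg tau (density A xi w) N eta -
     theta^-1 * (davg tau (defect xi w W) N eta +
        (2 * d%:R * CD ^+ 2 * (d%:R * (4 * delta)) + K * N^-1 ^+ 2)) <=
    (1 + 2 * theta / nu1) * cell_energy tau A N eta xi f.
Proof.
move=> bw gB Bs WCD delta0 delta1 schi chi01 chi0 chi1 theta0.
have [CB CB0 CBP] : exists2 CB, 0 < CB & forall i j eta, `|B i j eta| <= CB.
  have H (p : 'I_d * 'I_d) : exists c, forall eta, `|B p.1 p.2 eta| <= c.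
    by have [c c0 cP] := bdm_bound (grad_bdm (gB p.1 p.2)); exists c => eta; exact: cP.
  have [cf cfP] := choice H; have [CB CB0 CBP] := fin_upper_bound cf; exists CB => // i j eta.
  exact: le_trans (cfP (i, j) eta) (CBP (i, j)).
have [CX CX0 CXP] : exists2 CX, 0 < CX & forall i x, cube 0 1 x -> `|partial i chi x| <= CX.
  have H (i : 'I_d) : exists c, forall x, cube 0 1 x -> `|partial i chi x| <= c.
    have [c c0 cP] := bdm_bound (smooth_cube 0 1 (smooth_partial i schi)).
    by exists c.
  have [cf cfP] := choice H; have [CX CX0 CXP] := fin_upper_bound cf; exists CX => // i x xQ.
  exact: le_trans (cfP i x xQ) (CXP i).
(* Controls twice the squared norm of [b] below, the part of the divergence in which the derivative
   falls on the cut-off and brings out [N^-1]. *)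
pose K := d%:R * (2 * (d%:R * CX * CB) ^+ 2).
have K0 : 0 <= K by apply: mulr_ge0 => //; apply: mulr_ge0 => //; exact: sqr_ge0.
exists K => // N eta f N0 sft; have [sf _] := sft.
pose chiN (x : 'rV[R]_d) := chi (N^-1 *: x + 0).
have schiN : smooth chiN by exact: smooth_affine.
pose C i j x := chiN x * B i j (tau (- x) eta).
have sC i j : smooth (C i j) by apply: smoothM => //; exact: (grad_smooth (gB i j) eta).
have Cskew i j x : C i j x = - C j i x by rewrite /C Bs mulrN.
have chiN0 j x t : t <= delta * N \/ (1 - delta) * N <= t -> chiN (upd x j t) = 0.
  move=> ht; rewrite /chiN chi0//; exists j; rewrite addr0 !mxE eqxx.
  by rewrite ler_pdivrMl// ler_pdivlMl// mulrC [N * (1 - _)]mulrC.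
have C0 i j x : C i j (upd x j 0) = 0.
  by rewrite /C chiN0 ?mul0r//; left; rewrite mulr_ge0// ltW.
have CN i j x : C i j (upd x j N) = 0.
  by rewrite /C chiN0 ?mul0r//; right; rewrite ler_piMl ?(ltW N0)// gerBl ltW.
have IBP := Rint_skew_divergence0 xi N0 sf sC Cskew C0 CN.
pose e i x := xi 0 i + partial i f x.
pose Y i x := \sum_j partial j (C i j) x.
pose D i x := \sum_j W i j j (tau (- x) eta).
pose b i x := \sum_j N^-1 * partial j chi (N^-1 *: x + 0) * B i j (tau (- x) eta).
have YE i x : Y i x = chiN x * D i x + b i x.
  rewrite /Y /D /b mulr_sumr -big_split; apply: eq_bigr => j _.
  rewrite partialM; [|exact: smooth_differentiable|
    exact: smooth_differentiable (grad_smooth (gB i j) eta)].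
  rewrite (grad_partial (gB i j)) /chiN partial_affine; last exact: smooth_differentiable.
  by congr (_ + _); rewrite mulrC.
pose a i := mean (flux xi w i).
pose r i eta := flux xi w i eta - a i - \sum_j W i j j eta.
have mQ := @measurable_cube R d 0 N; have fQ := lebn_cube_fin d (0 : R) N.
have bW i j k : bdm setT (W i j k) := gradw_bdm (gB i j) k.
have bP i : bdm setT (flux xi w i) by exact: (bdm_flux nu10 mA ellA).
have bdef : bdm setT (defect xi w W).
  apply: bdm_sum => i; apply: bdmX; apply: bdmB; first by apply: bdmB => //; exact: bdm_cst.
  exact: bdm_sum.
have bde := bdm_density nu10 mA ellA xi bw.
have bdo : bdm (cube 0 N) (fun x => density A xi w (tau (- x) eta)).
  by apply: (@bdm_sub _ _ _ setT) => //; exact: (bdm_orbit htau).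
have bso : bdm (cube 0 N) (fun x => defect xi w W (tau (- x) eta)).
  by apply: (@bdm_sub _ _ _ setT) => //; exact: (bdm_orbit htau).
have bchi : bdm (cube 0 N) (fun x => 1 - chiN x).
  by apply: bdmB; [exact: bdm_cst|exact: smooth_cube].
have be i : bdm (cube 0 N) (e i).
  by apply: bdmD; [exact: bdm_cst|apply: smooth_cube; exact: smooth_partial].
have bY i : bdm (cube 0 N) (Y i).
  by apply: bdm_sum => j; apply: smooth_cube; exact: smooth_partial.
pose k1 := 2 * d%:R * CD ^+ 2.
pose L1 x := 2 * (\sum_i a i * e i x) + 2 * (\sum_i e i x * Y i x).
pose L2 x := theta^-1 * (defect xi w W (tau (- x) eta) + (k1 * (1 - chiN x) + K * N^-1 ^+ 2)).
have bL1a : bdm (cube 0 N) (fun x => \sum_i a i * e i x) by apply: bdm_sum => i; exact: bdmZ.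
have bL1b : bdm (cube 0 N) (fun x => \sum_i e i x * Y i x) by apply: bdm_sum => i; exact: bdmM.
have bL1 : bdm (cube 0 N) L1 by apply: bdmD; exact: bdmZ.
have bk : bdm (cube 0 N) (fun x => k1 * (1 - chiN x) + K * N^-1 ^+ 2).
  by apply: bdmD; [exact: bdmZ|exact: bdm_cst].
have bL2 : bdm (cube 0 N) L2 by apply: bdmZ; exact: bdmD.
have pt x : cube 0 N x -> L1 x - density A xi w (tau (- x) eta) - L2 x <=
    (1 + 2 * theta / nu1) * qform (A (tau (- x) eta)) (xi + gradient f x).
  move=> xN; set z := tau (- x) eta; have eA := ellA z.
  have eE i : (xi + gradient f x) 0 i = e i x by rewrite !mxE.
  have h1 := elliptic_lower nu10 (xi + vec w z) (xi + gradient f x) eA.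
  rewrite -/(density A xi w z) in h1.
  have h2 := sqnorm_qform nu10 (xi + gradient f x) eA.
  have xN1 : cube 0 1 (N^-1 *: x + 0).
    move=> i; have := xN i; rewrite /= addr0 mxE !in_itv/= => /andP[h3 h4].
    by rewrite mulr_ge0 ?invr_ge0 ?(ltW N0)//= ltr_pdivrMl// mulr1.
  have bbound i : b i x ^+ 2 <= (d%:R * CX * CB) ^+ 2 * N^-1 ^+ 2.
    rewrite -exprMn -real_normK ?num_real// lerXn2r ?nnegrE//.
      by rewrite !mulr_ge0 ?invr_ge0// ltW.
    apply: le_trans (ler_norm_sum _ _ _) _.
    apply: (@le_trans _ _ (\sum_(j < d) N^-1 * CX * CB)); last first.
      by rewrite sumr_const card_ord -[leLHS]mulr_natl le_eqVlt; apply/orP; left; apply/eqP; ring.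
    apply: ler_sum => j _; rewrite !normrM ler_pM ?mulr_ge0//.
    by rewrite ger0_norm ?invr_ge0 ?(ltW N0)// ler_wpM2l ?invr_ge0 ?(ltW N0)// CXP.
  have Dbound i : D i x ^+ 2 <= CD ^+ 2.
    by rewrite -real_normK ?num_real// lerXn2r ?nnegrE// ?(le_trans _ (WCD i z))// WCD.
  have /andP[c0 c1] := chi01 (N^-1 *: x + 0).
  have sumle : 2 * (\sum_i a i * e i x) + 2 * (\sum_i e i x * Y i x) -
      2 * theta * sqnorm (xi + gradient f x) - L2 x <=
      2 * bform (A z) (xi + vec w z) (xi + gradient f x).
    rewrite /L2 /defect /sqnorm /bform !mulr_sumr.
    apply: (@le_trans _ _ (\sum_i (2 * (a i * e i x) + 2 * (e i x * Y i x) -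
       2 * theta * e i x ^+ 2 - theta^-1 * (r i z ^+ 2 +
       (2 * D i x ^+ 2 * (1 - chiN x) + 2 * b i x ^+ 2))))); last first.
      apply: ler_sum => i _; rewrite eE.
      have -> : ((xi + vec w z) *m A z) 0 i = a i + r i z + D i x.
        by rewrite /r /D -/z -/(flux xi w i z); ring.
      apply: young_lower => //.
      by rewrite c0 c1.
    rewrite !sumrB big_split/= -!mulr_sumr.
    have -> : \sum_i (xi + gradient f x) 0 i ^+ 2 = \sum_i e i x ^+ 2.
      by apply: eq_bigr => i _; rewrite eE.
    rewrite lerD2l lerN2 ler_wpM2l ?invr_ge0 ?(ltW theta0)// big_split/= lerD2l.
    rewrite big_split/=; apply: lerD.
      apply: (@le_trans _ _ (\sum_(i < d) 2 * CD ^+ 2 * (1 - chiN x))).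
        by apply: ler_sum => i _; rewrite ler_wpM2r ?subr_ge0// ler_pM2l.
      rewrite sumr_const card_ord -[leLHS]mulr_natl /k1 le_eqVlt; apply/orP; left; apply/eqP.
      by move: (1 - chiN x) => q; ring.
    apply: (@le_trans _ _ (\sum_(i < d) 2 * ((d%:R * CX * CB) ^+ 2 * N^-1 ^+ 2))).
      by apply: ler_sum => i _; rewrite ler_pM2l.
    rewrite sumr_const card_ord -[leLHS]mulr_natl /K.
    by rewrite le_eqVlt; apply/orP; left; apply/eqP; ring.
  have h3 : 2 * theta * sqnorm (xi + gradient f x) <=
      2 * theta / nu1 * qform (A z) (xi + gradient f x).
    by rewrite -[leRHS]mulrA ler_pM2l// mulr_gt0.
  rewrite mulrDl mul1r; rewrite -/(L1 x) in sumle.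
  move: (L1 x) (L2 x) (density A xi w z) (bform _ _ _) (qform _ _)
    (2 * theta * _) (2 * theta / nu1 * _) h1 h3 sumle => l1 l2 q1 q2 q3 q4 q5 h1 h3 h4.
  lra.
have intle : N^-1 ^+ d * \int[lambda]_(x in cube 0 N)
      (L1 x - density A xi w (tau (- x) eta) - L2 x) <=
    (1 + 2 * theta / nu1) * cell_energy tau A N eta xi f.
  rewrite /cell_energy mulrCA ler_wpM2l ?exprn_ge0 ?invr_ge0 ?(ltW N0)//.
  have bq := bdm_cell_density htau nu10 mA ellA N eta xi sf.
  rewrite -(bRintZ mQ fQ _ bq); apply: bRint_le => //.
  - by apply: bdmB => //; exact: bdmB.
  - exact: bdmZ.
apply: le_trans intle.
rewrite (bRintB mQ fQ (bdmB bL1 bdo) bL2) (bRintB mQ fQ bL1 bdo).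
have I1 : \int[lambda]_(x in cube 0 N) L1 x = 2 * \sum_i a i * (xi 0 i * N ^+ d).
  rewrite (bRintD mQ fQ (bdmZ 2 bL1a) (bdmZ 2 bL1b)) (bRintZ mQ fQ 2 bL1a) (bRintZ mQ fQ 2 bL1b).
  rewrite IBP mulr0 addr0 (bRint_sum mQ fQ); last by move=> i; exact: bdmZ.
  congr (_ * _); apply: eq_bigr => i _; rewrite (bRintZ mQ fQ _ (be i)); congr (_ * _).
  rewrite (bRintD mQ fQ (bdm_cst _ _) (smooth_cube 0 N (smooth_partial i sf))).
  by rewrite (Rint_partial_torus0 i N0 sft) addr0 Rint_cst_cube ?(ltW N0)// subr0.
have I2 : \int[lambda]_(x in cube 0 N) L2 x = theta^-1 *
   (\int[lambda]_(x in cube 0 N) defect xi w W (tau (- x) eta) +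
    (k1 * \int[lambda]_(x in cube 0 N) (1 - chiN x) + K * N^-1 ^+ 2 * N ^+ d)).
  rewrite (bRintZ mQ fQ _ (bdmD bso bk)) (bRintD mQ fQ bso bk).
  rewrite (bRintD mQ fQ (bdmZ k1 bchi) (bdm_cst _ _)) (bRintZ mQ fQ _ bchi).
  by rewrite Rint_cst_cube ?(ltW N0)// subr0.
have ca := cutoff_average delta0 delta1 schi chi01 chi1 N0.
have k10 : 0 <= k1 by apply: mulr_ge0; [exact: mulr_ge0|exact: sqr_ge0].
have {}ca := ler_wpM2l k10 ca; rewrite -/chiN in ca.
have NN : N^-1 ^+ d * N ^+ d = 1 by rewrite -exprMn mulVf ?gt_eqF// expr1n.
rewrite I1 I2 !mulrBr -!addrA; apply: lerD.
  rewrite mulrCA le_eqVlt; apply/orP; left; apply/eqP; congr (_ * _).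
  rewrite mulr_sumr; apply: eq_bigr => i _; rewrite -/(a i).
  move: (N^-1 ^+ d) (N ^+ d) NN => p q pq.
  by transitivity (xi 0 i * a i * (p * q)); [rewrite pq mulr1|ring].
rewrite -/(davg _ _ _ _) lerD2l lerN2 mulrCA ler_wpM2l ?invr_ge0 ?(ltW theta0)//.
rewrite mulrDr -/(davg _ _ _ _) lerD2l mulrDr; apply: lerD; first by rewrite mulrCA.
rewrite mulrCA mulrA -mulrA NN mulr1//.
Qed.

(** [theta] is fixed from [qeff xi] so that the factor in front of the cell energy is harmless. Only
    afterwards are the quality of the corrector and the width of the boundary layer chosen, because
    both enter divided by [theta]. *)
Lemma periodized_form_lower xi (eps : R) : 0 < eps ->
  {ae mu, forall eta, \forall N \near +oo,
    ((qeff xi - eps)%:E <= periodized_form tau A N eta xi)%E}.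
Proof.
move=> eps0; have q0 := qeff_ge0 mu tau nu10 mA ellA xi; set q := qeff xi in q0 *.
pose theta := eps * nu1 / (8 * (q + 1)).
have q1 : 0 < 8 * (q + 1) by rewrite mulr_gt0// ltr_wpDl.
have theta0 : 0 < theta by rewrite divr_gt0// mulr_gt0.
have tq : 2 * theta / nu1 * q <= eps / 4.
  have -> : 2 * theta / nu1 * q = (eps / 4 * q) / (q + 1).
    by rewrite /theta; field; rewrite !gt_eqF// ltr_wpDl.
  rewrite ler_pdivrMr ?ltr_wpDl// ler_pM2l ?divr_gt0//; lra.
pose epc := Num.min (eps / 16) (theta * eps / (16 * (d%:R + 1))).
have d1 : 0 < 16 * (d%:R + 1) :> R by rewrite mulr_gt0// ltr_wpDl.
have epc0 : 0 < epc by rewrite lt_min !divr_gt0// mulr_gt0.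
have epc1 : epc <= eps / 16 by rewrite /epc ge_min lexx.
have epc2 : theta^-1 * (d%:R * epc) <= eps / 16.
  rewrite ler_pdivrMl//.
  have h : epc <= theta * eps / (16 * (d%:R + 1)) by rewrite /epc ge_min lexx orbT.
  have {}h : epc * (16 * (d%:R + 1)) <= theta * eps by rewrite -ler_pdivlMr.
  rewrite mulrA ler_pdivlMr//; apply: le_trans h.
  by rewrite [d%:R * epc]mulrC -mulrA ler_pM2l//; lra.
have [g [w [B [W [gw h1 h2 gB [Bs hB]]]]]] := corrector_exists htau nu10 nu20 mA ellA xi epc0.
have bw := gradw_bdm gw.
have bW i j k : bdm setT (W i j k) := gradw_bdm (gB i j) k.
have [CD CD0 CDP] : exists2 CD, 0 < CD & forall i eta, `|\sum_j W i j j eta| <= CD.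
  have H (i : 'I_d) : exists c, forall eta, `|\sum_j W i j j eta| <= c.
    have bS : bdm setT (fun eta => \sum_j W i j j eta) by exact: bdm_sum.
    by have [c c0 cP] := bdm_bound bS; exists c => eta; exact: cP.
  have [cf cfP] := choice H; have [CD CD0 CDP] := fin_upper_bound cf; exists CD => // i eta.
  exact: le_trans (cfP i eta) (CDP i).
pose k1 : R := 2 * d%:R * CD ^+ 2 * (d%:R * 4).
have k10 : 0 <= k1.
  by apply: mulr_ge0; [apply: mulr_ge0; [exact: mulr_ge0|exact: sqr_ge0]|exact: mulr_ge0].
pose delta := Num.min (1 / 8) (theta * eps / (16 * (k1 + 1))).
have k11 : 0 < 16 * (k1 + 1) by rewrite mulr_gt0// ltr_wpDl.
have delta0 : 0 < delta by rewrite lt_min !divr_gt0// mulr_gt0.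
have delta1 : delta < 1 / 4.
  by apply: (@le_lt_trans _ _ (1 / 8)); [rewrite /delta ge_min lexx|lra].
have delta2 : theta^-1 * (k1 * delta) <= eps / 16.
  rewrite ler_pdivrMl//.
  have h : delta <= theta * eps / (16 * (k1 + 1)) by rewrite /delta ge_min lexx orbT.
  have {}h : delta * (16 * (k1 + 1)) <= theta * eps by rewrite -ler_pdivlMr.
  rewrite mulrA ler_pdivlMr//; apply: le_trans h.
  by rewrite [k1 * delta]mulrC -mulrA ler_pM2l//; lra.
have [chi [schi chi01 chi0 chi1]] := @cutoff_exists R d delta delta0 delta1.
have [K K0 KP] := cell_energy_lower xi bw gB Bs CDP delta0 delta1 schi chi01 chi0 chi1 theta0.
have bP i : bdm setT (flux xi w i) by exact: (bdm_flux nu10 mA ellA).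
have br i : bdm setT (fun eta => flux xi w i eta - mean (flux xi w i) - \sum_j W i j j eta).
  apply: bdmB; first by apply: bdmB => //; exact: bdm_cst.
  exact: bdm_sum.
have bdef : bdm setT (defect xi w W) by apply: bdm_sum => i; exact: bdmX.
have mdef : \int[mu]_eta defect xi w W eta <= d%:R * epc.
  rewrite (bRint_sum mT fT); last by move=> i; exact: bdmX.
  apply: le_trans (ler_sum _ (fun i _ => hB i)) _.
  by rewrite sumr_const card_ord -[leLHS]mulr_natl.
have e16 : 0 < eps / 16 by rewrite divr_gt0.
have te16 : 0 < theta * (eps / 16) by rewrite mulr_gt0.
apply: filterS2 (multidimensional_ergodic_theorem htau (bdm_density nu10 mA ellA xi bw))
  (multidimensional_ergodic_theorem htau bdef) => eta.
rewrite -/(energy xi w) => /cvgrPdist_le/(_ _ e16) hJ /cvgrPdist_le/(_ _ te16) hS.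
near=> N.
have N1 : 1 <= N by near: N; apply: nbhs_pinfty_ge; exact: num_real.
have N0 : 0 < N by exact: lt_le_trans N1.
have NK : K * 16 / (theta * eps) <= N by near: N; apply: nbhs_pinfty_ge; exact: num_real.
have hN : `|energy xi w - davg tau (density A xi w) N eta| <= eps / 16 by near: N.
have hM : `|\int[mu]_eta defect xi w W eta - davg tau (defect xi w W) N eta| <=
   theta * (eps / 16) by near: N.
apply: le_ereal_inf_tmp => _ [f sf <-].
rewrite (cell_energyE htau nu10 mA ellA eta xi N0 sf.1) lee_fin.
have := KP N eta f N0 sf; set J := cell_energy _ _ _ _ _ _.
have -> : 2 * d%:R * CD ^+ 2 * (d%:R * (4 * delta)) = k1 * delta by rewrite /k1; ring.
have hK : theta^-1 * (K * N^-1 ^+ 2) <= eps / 16.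
  rewrite ler_pdivrMl// exprVn ler_pdivrMr ?exprn_gt0//.
  have te : 0 < theta * eps by rewrite mulr_gt0.
  move: NK; rewrite ler_pdivrMr// => NK.
  have : theta * eps * N <= theta * eps * N ^+ 2.
    by rewrite ler_pM2l// expr2 ler_peMl// ltW.
  have -> : theta * (eps / 16) * N ^+ 2 = theta * eps * N ^+ 2 / 16 by field.
  move: NK; rewrite [N * _]mulrC; move: (theta * eps * N) (theta * eps * _) => z y NK hy.
  by lra.
have hD : theta^-1 * davg tau (defect xi w W) N eta <= eps / 16 + eps / 16.
  move: hM; rewrite ler_norml => /andP[hM1 _].
  have hM2 : davg tau (defect xi w W) N eta <= d%:R * epc + theta * (eps / 16) by lra.
  apply: le_trans (ler_wpM2l _ hM2) _; first by rewrite invr_ge0 ltW.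
  by rewrite mulrDr mulKf ?gt_eqF// lerD2r.
rewrite !mulrDr [leRHS]mulrDl mul1r.
move: hN; rewrite ler_norml => /andP[hN1 _].
move: hK hD delta2.
move: (theta^-1 * (K * _)) (theta^-1 * davg _ _ _ _) (theta^-1 * (k1 * _)) => y1 y2 y3 a1 a2 a3.
move: (davg _ _ _ _) (energy xi w) (\sum_i _) hN1 h1 h2 => y4 y5 y6 a4 a5 a6.
(* A competitor of energy at least [q - eps] needs no argument; for the others the extra factor
   costs at most [eps / 4], since [J] is below [q]. *)
have [//|Jq] := leP (q - eps) J.
have : 2 * theta / nu1 * J <= 2 * theta / nu1 * q.
  rewrite ler_pM2l; last by rewrite divr_gt0// mulr_gt0.
  lra.
move: (2 * theta / nu1 * J) (2 * theta / nu1 * q) tq => y7 y8 a7 a8 a9.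
rewrite -/q in a5 a6.
lra.
Unshelve. all: by end_near. Qed.

End lower_bound.

(** * Infima of quadratic forms and convergence *)

Section inf_of_quadratics.
Context {R : realType} {d : nat}.
Variables (E : 'rV[R]_d -> set R) (q : 'rV[R]_d -> R).
(** [E x] stands for the set of energies attained at [x], and [c] for the cross term of two
    competitors. The infimum need not be attained, so identities for [q] are proved as pairs of
    inequalities with an arbitrary error. *)
Hypothesis E_comb : forall x y a b, E x a -> E y b ->
  exists c, forall s t, E (s *: x + t *: y) (s ^+ 2 * a + 2 * (s * t) * c + t ^+ 2 * b).
Hypothesis E_ge0 : forall x a, E x a -> 0 <= a.
Hypothesis q_lb : forall x a, E x a -> q x <= a.
Hypothesis q_approx : forall x eps, 0 < eps -> exists2 a, E x a & a <= q x + eps.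

Let q_ge0 x : 0 <= q x.
Proof.
apply/ler_addgt0Pr => e e0; have [a Ea aq] := q_approx x e0.
exact: le_trans (E_ge0 Ea) aq.
Qed.

Let q_comb x y eps : 0 < eps -> exists a b c, [/\ a <= q x + eps, b <= q y + eps &
  forall s t, q (s *: x + t *: y) <= s ^+ 2 * a + 2 * (s * t) * c + t ^+ 2 * b].
Proof.
move=> e0; have [a Ea aq] := q_approx x e0; have [b Eb bq] := q_approx y e0.
have [c Ec] := E_comb Ea Eb; exists a, b, c; split => // s t; exact: q_lb (Ec s t).
Qed.

Let qZ_le s x : q (s *: x) <= s ^+ 2 * q x.
Proof.
apply/ler_addgt0Pr => e e0; have s0 := sqr_ge0 s.
have e1 : 0 < e / (s ^+ 2 + 1) by rewrite divr_gt0// ltr_wpDl.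
have [a [b [c [aq bq]]]] := q_comb x x e1; move=> /(_ s 0).
rewrite scale0r addr0 mulr0 mulr0 mul0r expr0n/= mul0r !addr0 => h.
apply: le_trans h _; apply: (le_trans (ler_wpM2l s0 aq)).
rewrite mulrDr lerD2l mulrCA ger_pMr// ler_pdivrMr ?ltr_wpDl// mul1r; lra.
Qed.

Let q0 : q 0 = 0.
Proof.
apply/eqP; rewrite eq_le q_ge0 andbT; have := qZ_le 0 0.
by rewrite scale0r expr0n mul0r.
Qed.

Let qZ s x : q (s *: x) = s ^+ 2 * q x.
Proof.
have [->|s0] := eqVneq s 0; first by rewrite scale0r q0 expr0n mul0r.
apply/eqP; rewrite eq_le qZ_le/=.
have := qZ_le s^-1 (s *: x); rewrite scalerA mulVf// scale1r exprVn.
by rewrite ler_pdivlMl// exprn_even_gt0.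
Qed.

(** Adding the bound at coefficients [t] and [1 - t] to [t * (1 - t)] times the bound at [1] and
    [-1] cancels the unknown cross term. *)
Let jensen_ge t x y : 0 <= t <= 1 ->
  q (t *: x + (1 - t) *: y) + t * (1 - t) * q (x - y) <= t * q x + (1 - t) * q y.
Proof.
move=> /andP[t0 t1]; apply/ler_addgt0Pr => e e0.
have [a [b [c [aq bq h]]]] := q_comb x y e0.
have h1 := h t (1 - t); have := h 1 (-1); rewrite scale1r scaleN1r => h2.
have t2 : 0 <= t * (1 - t) by rewrite mulr_ge0// subr_ge0.
have {}h2 := ler_wpM2l t2 h2; have a1 := ler_wpM2l t0 aq.
have t3 : 0 <= 1 - t by rewrite subr_ge0.
have b1 := ler_wpM2l t3 bq.
apply: le_trans (lerD h1 h2) _; apply: (@le_trans _ _ (t * a + (1 - t) * b)).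
  by rewrite le_eqVlt; apply/orP; left; apply/eqP; ring.
apply: le_trans (lerD a1 b1) _.
by rewrite le_eqVlt; apply/orP; left; apply/eqP; ring.
Qed.

(** Here the bounds at coefficients [1, 1 - t] and [1, - t], weighted by [t] and [1 - t], cancel the
    cross term. *)
Let jensen_le t x y : 0 <= t <= 1 ->
  t * q (x + (1 - t) *: y) + (1 - t) * q (x - t *: y) <= q x + t * (1 - t) * q y.
Proof.
move=> /andP[t0 t1]; apply/ler_addgt0Pr => e e0.
have e2 : 0 < e / 2 by rewrite divr_gt0.
have [a [b [c [aq bq h]]]] := q_comb x y e2.
have := h 1 (1 - t); have := h 1 (- t); rewrite !scale1r scaleNr => h1 h2.
have t3 : 0 <= 1 - t by rewrite subr_ge0.
have {}h1 := ler_wpM2l t3 h1; have {}h2 := ler_wpM2l t0 h2.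
have t2 : 0 <= t * (1 - t) by rewrite mulr_ge0.
have b1 := ler_wpM2l t2 bq.
apply: le_trans (lerD h2 h1) _; apply: (@le_trans _ _ (a + t * (1 - t) * b)).
  by rewrite le_eqVlt; apply/orP; left; apply/eqP; ring.
apply: le_trans (lerD aq b1) _.
have t4 : t * (1 - t) <= 1.
  by apply: (@le_trans _ _ (1 * 1)); [apply: ler_pM => //; rewrite gerBl|rewrite mulr1].
rewrite mulrDr; have := ler_wpM2r (ltW e2) t4; rewrite mul1r.
move: (t * (1 - t) * (e / 2)) (t * (1 - t) * q y) (q x) => z1 z2 z3; lra.
Qed.

(** Equality for every [t] in the unit interval, not only at the midpoint, makes [q] exactly
    quadratic on segments. Real homogeneity of the polar form then follows without the continuity
    argument of the Jordan-von Neumann theorem. *)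
Let jensen t x y : 0 <= t <= 1 ->
  t * q (x + (1 - t) *: y) + (1 - t) * q (x - t *: y) = q x + t * (1 - t) * q y.
Proof.
move=> t01; apply/eqP; rewrite eq_le jensen_le//=.
have := jensen_ge (x + (1 - t) *: y) (x - t *: y) t01.
have -> : t *: (x + (1 - t) *: y) + (1 - t) *: (x - t *: y) = x.
  by apply/rowP => i; rewrite !mxE; ring.
have -> // : x + (1 - t) *: y - (x - t *: y) = y.
by apply/rowP => i; rewrite !mxE; ring.
Qed.

Let B x y := (q (x + y) - q x - q y) / 2.

Let q_line1 x y s : 0 <= s <= 1 -> q (x + s *: y) = q x + 2 * s * B x y + s ^+ 2 * q y.
Proof.
move=> s01; have := jensen (x + s *: y) y s01.
have -> : x + s *: y + (1 - s) *: y = x + y by apply/rowP => i; rewrite !mxE; ring.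
rewrite addrK /B; move: (q (x + y)) (q x) (q (x + s *: y)) (q y) => a b c e h.
have -> : c = s * a + (1 - s) * b - s * (1 - s) * e by rewrite h addrK.
by field.
Qed.

(** For [s > 1] the identity on segments is used at [s^-1], with [s *: y] in place of [y]. *)
Let B_nn x y s : 0 <= s -> B x (s *: y) = s * B x y.
Proof.
move=> s0; have [s1|s1] := leP s 1.
  have s01 : 0 <= s <= 1 by rewrite s0.
  rewrite {1}/B (q_line1 x y s01) qZ; move: (B x y) (q x) (q y) => a b c; by field.
have si : 0 <= s^-1 <= 1 by rewrite invr_ge0 s0 invf_le1 ?ltW// (lt_trans ltr01).
have sn : s != 0 by rewrite gt_eqF// (lt_trans ltr01).
have := q_line1 x (s *: y) si; rewrite scalerA mulVf// scale1r qZ.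
rewrite {3}/B; move: (B x (s *: y)) (q x) (q y) (q (x + y)) => a b c e ->; field.
exact: sn.
Qed.

Let parallelogram x y : q (x + y) + q (x - y) = 2 * q x + 2 * q y.
Proof.
have h : 0 <= (1 / 2 : R) <= 1 by apply/andP; split; lra.
have := jensen x (2 *: y) h; rewrite !scalerA qZ.
have -> : (1 - 1 / 2) * 2 = 1 :> R by field.
have -> : 1 / 2 * 2 = 1 :> R by field.
rewrite scale1r; move: (q (x + y)) (q x) (q (x - y)) (q y) => a b c e h1.
by lra.
Qed.

Let BC x y : B x y = B y x.
Proof. by rewrite /B [y + x]addrC addrAC. Qed.

Let BN x y : B x (- y) = - B x y.
Proof.
have := parallelogram x y; have := qZ (-1) y; rewrite scaleN1r expr2 mulrNN !mul1r /B => ->.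
by move: (q (x + y)) (q (x - y)) (q x) (q y) => a b c e h; lra.
Qed.

Let BZ x y s : B x (s *: y) = s * B x y.
Proof.
have [s0|s0] := leP 0 s; first exact: B_nn.
rewrite -[s]opprK scaleNr BN B_nn ?oppr_ge0 1?ltW// [in RHS]mulNr.
done.
Qed.

Let B4 x y : q (x + y) - q (x - y) = 4 * B x y.
Proof.
have := BN x y; have := qZ (-1) y; rewrite scaleN1r expr2 mulrNN !mul1r /B => ->.
by move: (q _) (q _) (q _) (q _) => a b c e h; lra.
Qed.

(** With [x = u + v] and [y = u - v], the parallelogram identities at [u + z] and [u - z] share the
    term in [v], which cancels in their difference. *)
Let BD x y z : B (x + y) z = B x z + B y z.
Proof.
pose u := (1 / 2 : R) *: (x + y); pose v := (1 / 2 : R) *: (x - y).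
have uv : u + v = x by apply/rowP => i; rewrite !mxE; field.
have uv' : u - v = y by apply/rowP => i; rewrite !mxE; field.
have := parallelogram (u + z) v; have := parallelogram (u - z) v.
have -> : u + z + v = x + z by rewrite addrAC uv.
have -> : u + z - v = y + z by rewrite addrAC uv'.
have -> : u - z + v = x - z by rewrite addrAC uv.
have -> : u - z - v = y - z by rewrite addrAC uv'.
have := B4 x z; have := B4 y z; have := B4 u z.
have -> : B (x + y) z = 2 * B u z.
  rewrite [RHS]mulrC [B u z]BC BZ [B (x + y) z]BC; by field.
move: (B x z) (B y z) (B u z) (q v) (q (x + z)) (q (x - z)) (q (y + z)) (q (y - z))
  (q (u + z)) (q (u - z)) => b1 b2 b3 a1 a2 a3 a4 a5 a6 a7; lra.
Qed.

Let BxxE x : B x x = q x.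
Proof. by rewrite /B -[x + x]mulr2n -scaler_nat qZ; move: (q x) => a; field. Qed.

Lemma inf_of_quadratics_form :
  exists S : 'M[R]_d, S^T = S /\ forall x, qform S x = q x.
Proof.
exists (\matrix_(i, j) B (delta_mx 0 i) (delta_mx 0 j)); split.
  by apply/matrixP => i j; rewrite !mxE BC.
have B_sum (I : Type) (r : seq I) (F : I -> 'rV[R]_d) z :
    B (\sum_(k <- r) F k) z = \sum_(k <- r) B (F k) z.
  elim: r => [|k r IH]; last by rewrite !big_cons BD IH.
  by rewrite !big_nil BC -(scale0r z) BZ mul0r.
move=> x; rewrite qformE bformE -BxxE [in RHS](row_sum_delta x) B_sum exchange_big/=.
apply: eq_bigr => i _; rewrite BC BZ B_sum mulr_sumr; apply: eq_bigr => j _.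
rewrite mxE [B (_ *: _) _]BC BZ [B 'e_i 'e_j]BC; ring.
Qed.

End inf_of_quadratics.

(** [form_matrix] is a choice with a default value, so its specification amounts to the existence of
    a matrix; coercivity of the attained values passes to the infimum and gives positive
    definiteness. *)
Lemma form_matrixP {R : realType} {d : nat} (Q : 'rV[R]_d -> \bar R) (q : 'rV[R]_d -> R)
    (E : 'rV[R]_d -> set R) (c : R) : (forall x, (q x)%:E = Q x) ->
  (forall x y a b, E x a -> E y b ->
   exists c, forall s t, E (s *: x + t *: y) (s ^+ 2 * a + 2 * (s * t) * c + t ^+ 2 * b)) ->
  (forall x a, E x a -> q x <= a) ->
  (forall x eps, 0 < eps -> exists2 a, E x a & a <= q x + eps) ->
  0 < c -> (forall x a, E x a -> c * sqnorm x <= a) ->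
  is_form_matrix Q (form_matrix Q).
Proof.
move=> qQ Ec Elb Eap c0 coer.
have E0 x a : E x a -> 0 <= a.
  by move=> /coer; apply: le_trans; rewrite mulr_ge0 ?sqnorm_ge0// ltW.
have [S [Ss Sq]] := inf_of_quadratics_form Ec E0 Elb Eap.
suff H : exists S, is_form_matrix Q S by exact: (getPex H).
exists S; split => // [x x0|x]; last by rewrite Sq.
have sx : 0 < sqnorm x.
  rewrite lt_neqAle sqnorm_ge0 andbT eq_sym; apply: contra x0.
  rewrite psumr_eq0 => [/allP h|i _]; last exact: sqr_ge0.
  apply/eqP/rowP => i; rewrite mxE; apply/eqP; rewrite -sqrf_eq0.
  by apply: h; rewrite mem_index_enum.
rewrite Sq; apply: lt_le_trans (mulr_gt0 c0 sx) _.
apply/ler_addgt0Pr => e e0; have [a Ea aq] := Eap x e e0.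
exact: le_trans (coer _ _ Ea) aq.
Qed.

Section quadratic_integrals.
Context {R : realType} {d : nat} {disp : measure_display} {T : measurableType disp}
  (m : {measure set T -> \bar R}) (D : set T) (M : T -> 'M[R]_d) (nu1 nu2 : R).
Hypotheses (mD : measurable D) (fD : (m D < +oo)%E).
Hypothesis bM : forall i j, bdm D (fun t => M t i j).
Hypothesis ellM : forall t, elliptic nu1 nu2 (M t).
Hypothesis nu10 : 0 < nu1.

Lemma Rint_qform_comb (u v : T -> 'rV[R]_d) (s t : R) :
  (forall i, bdm D (fun x => u x 0 i)) -> (forall i, bdm D (fun x => v x 0 i)) ->
  \int[m]_(x in D) qform (M x) (s *: u x + t *: v x) =
  s ^+ 2 * \int[m]_(x in D) qform (M x) (u x) +
  2 * (s * t) * \int[m]_(x in D) bform (M x) (u x) (v x) +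
  t ^+ 2 * \int[m]_(x in D) qform (M x) (v x).
Proof.
move=> bu bv; have b1 := bdm_qform bM bu; have b2 := bdm_qform bM bv.
have b3 := bdm_bform bM bu bv.
rewrite -(bRintZ mD fD _ b1) -(bRintZ mD fD _ b2) -(bRintZ mD fD _ b3).
rewrite -(bRintD mD fD (bdmZ _ b1) (bdmZ _ b3)).
rewrite -(bRintD mD fD (bdmD (bdmZ _ b1) (bdmZ _ b3)) (bdmZ _ b2)).
apply: eq_Rintegral => x _; have [Ms _] := ellM x.
rewrite qformD// !qformZ bformZl bformZr.
move: (qform _ _) (qform _ _) (bform _ _ _) => a b c; ring.
Qed.

(** [sqnorm (xi + u)] is at least [sqnorm xi] plus a term linear in [u], which integrates to
    zero. *)
Lemma Rint_qform_coercive (xi : 'rV[R]_d) (u : T -> 'rV[R]_d) :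
  (forall i, bdm D (fun x => u x 0 i)) -> (forall i, \int[m]_(x in D) u x 0 i = 0) ->
  nu1 * sqnorm xi * fine (m D) <= \int[m]_(x in D) qform (M x) (xi + u x).
Proof.
move=> bu u0.
have bs : bdm D (fun x => \sum_i 2 * (nu1 * xi 0 i) * u x 0 i) by apply: bdm_sum => i; exact: bdmZ.
have -> : nu1 * sqnorm xi * fine (m D) =
    \int[m]_(x in D) (nu1 * sqnorm xi + \sum_i 2 * (nu1 * xi 0 i) * u x 0 i).
  rewrite (bRintD mD fD (bdm_cst _ _) bs) Rintegral_cst// (bRint_sum mD fD); last first.
    by move=> i; exact: bdmZ.
  by rewrite big1 ?addr0// => i _; rewrite (bRintZ mD fD _ (bu i)) u0 mulr0.
apply: bRint_le => //.
- by apply: bdmD => //; exact: bdm_cst.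
- apply: bdm_qform => // i; rewrite (_ : (fun x => _) = fun x => xi 0 i + u x 0 i).
    by apply: bdmD => //; exact: bdm_cst.
  by apply/funext => x; rewrite mxE.
move=> x _; have [_ /(_ (xi + u x))/andP[h _]] := ellM x; apply: le_trans h.
rewrite /sqnorm !mulr_sumr -big_split/=; apply: ler_sum => i _.
rewrite mxE; have := sqr_ge0 (u x 0 i); move: (u x 0 i) (xi 0 i) => a b h.
have := mulr_ge0 (ltW nu10) h.
have -> : nu1 * (b + a) ^+ 2 = nu1 * b ^+ 2 + 2 * (nu1 * b) * a + nu1 * a ^+ 2 by ring.
by rewrite lerDl.
Qed.

End quadratic_integrals.

(** * The effective and periodized matrices and the convergence of their forms *)

Section form_matrices.
Context {R : realType} {d : nat} {disp : measure_display}
  {X : measurableType disp} (mu : probability X R)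
  (tau : 'rV[R]_d -> X -> X).
Hypothesis htau : ergodic_action mu tau.
Local Notation lambda := (@lebn R d).
Context (A : X -> 'M[R]_d) (nu1 nu2 : R).
Hypotheses (nu10 : 0 < nu1) (nu20 : 0 < nu2).
Hypothesis mA : forall i j, measurable_fun setT (fun eta => A eta i j).
Hypothesis ellA : forall eta, elliptic nu1 nu2 (A eta).
Implicit Types (xi : 'rV[R]_d) (w : 'I_d -> X -> R) (N : R).

Let mT := @measurableT _ X.
Let fT := muT_fin mu.
Local Notation energy := (energy mu A).
Local Notation qeff := (qeff mu tau A).
Local Notation bounded_field := (@bounded_field R d disp X).

Let bA i j : bdm setT (fun eta => A eta i j) := bdmA nu10 mA ellA i j.

(** The energies are taken over gradient fields instead of [F2pot]: the infimum is the same, and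
    densities are bounded, so cross terms are ordinary integrals. *)
Lemma effective_form_matrix :
  is_form_matrix (effective_form mu tau A) (form_matrix (effective_form mu tau A)).
Proof.
pose E (xi : 'rV[R]_d) : set R :=
  [set a | exists g w, is_grad mu tau g w /\ a = energy xi w].
apply: (@form_matrixP _ _ _ qeff E nu1) => //.
- by move=> x; exact: (qeffE mu tau nu10 mA ellA).
- move=> x y _ _ [g [w [gw ->]]] [g' [w' [gw' ->]]].
  have bw := gradw_bdm gw; have bw' := gradw_bdm gw'.
  exists (\int[mu]_eta bform (A eta) (x + vec w eta) (y + vec w' eta)) => s t.
  exists (fun eta => s * g eta + t * g' eta), (fun i eta => s * w i eta + t * w' i eta).
  split; first by apply: is_gradD; exact: is_gradZ.
  rewrite /energy -(Rint_qform_comb mT fT bA ellA); last 2 first.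
  - by move=> i; exact: bdm_vec.
  - by move=> i; exact: bdm_vec.
  apply: eq_Rintegral => eta _; rewrite /density; congr (qform _ _).
  by apply/rowP => i; rewrite !mxE; ring.
- by move=> x _ [g [w [gw ->]]]; exact: (qeff_le nu10 mA ellA x gw).
- move=> x e e0; have [g [w [gw h]]] := qeff_approx htau nu10 nu20 mA ellA x e0.
  by exists (energy x w) => //; exists g, w.
- move=> x _ [g [w [gw ->]]]; have bw := gradw_bdm gw.
  have b0 i : bdm setT (fun eta => vec w eta 0 i) by exact: bdm_vec0.
  have := Rint_qform_coercive mT fT bA ellA nu10 x b0.
  have -> : fine (mu setT) = 1 by rewrite probability_setT.
rewrite mulr1; apply => i.
  rewrite -[RHS](grad_mean gw i); apply: eq_Rintegral => eta _.
  by rewrite mxE.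
Qed.

Definition qper N eta xi : R := fine (periodized_form tau A N eta xi).

Lemma qperE N eta xi : 0 < N -> (qper N eta xi)%:E = periodized_form tau A N eta xi.
Proof.
move=> N0; rewrite fineK// ge0_fin_numE.
  have sf0 : smooth_torus N (fun _ : 'rV[R]_d => 0 : R) by split => //; exact: smooth_cst.
  apply: le_lt_trans (ltry _); exact: (periodized_form_le htau nu10 mA ellA eta xi N0 sf0).
apply: le_ereal_inf_tmp => _ [f sf <-].
rewrite (cell_energyE htau nu10 mA ellA eta xi N0 sf.1) lee_fin /cell_energy.
rewrite mulr_ge0 ?exprn_ge0 ?invr_ge0 ?(ltW N0)//; apply: Rintegral_ge0 => x _.
exact: (elliptic_ge0 nu10).
Qed.

Lemma smooth_torusD N f g s t : smooth_torus N f -> smooth_torus N g ->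
  smooth_torus N (fun x : 'rV[R]_d => s * f x + t * g x).
Proof.
move=> [sf pf] [sg pg]; split; last by move=> k x; rewrite pf pg.
by apply: smoothD; exact: smoothZ.
Qed.

Lemma periodized_form_matrix N eta : 0 < N ->
  is_form_matrix (periodized_form tau A N eta) (sigma_per tau A N eta).
Proof.
move=> N0; have mQ := @measurable_cube R d 0 N; have fQ := lebn_cube_fin d (0 : R) N.
have N00 : 0 <= N^-1 ^+ d by rewrite exprn_ge0// invr_ge0 ltW.
have bO i j : bdm (cube 0 N) (fun x : 'rV[R]_d => A (tau (- x) eta) i j).
  exact: (bdm_orbitA htau nu10 mA ellA).
pose E (xi : 'rV[R]_d) : set R :=
  [set a | exists f, smooth_torus N f /\ a = cell_energy tau A N eta xi f].
apply: (@form_matrixP _ _ _ (qper N eta) E nu1) => //.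
- by move=> x; exact: qperE.
- move=> x y _ _ [f [sf ->]] [g [sg ->]].
  exists (N^-1 ^+ d * \int[lambda]_(z in cube 0 N)
     bform (A (tau (- z) eta)) (x + gradient f z) (y + gradient g z)) => s t.
  exists (fun z => s * f z + t * g z); split; first exact: smooth_torusD.
  have [sf1 _] := sf; have [sg1 _] := sg.
  have ell z : elliptic nu1 nu2 (A (tau (- z) eta)) by exact: ellA.
  transitivity (N^-1 ^+ d * \int[lambda]_(z in cube 0 N) qform (A (tau (- z) eta))
      (s *: (x + gradient f z) + t *: (y + gradient g z))).
    rewrite (Rint_qform_comb mQ fQ bO ell s t (bdm_grad_cube N x ^~ sf1)
       (bdm_grad_cube N y ^~ sg1)) /cell_energy.
    move: (\int[_]_(_ in _) _) (\int[_]_(_ in _) _) (\int[_]_(_ in _) _) => a b c; ring.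
  congr (_ * _); apply: eq_Rintegral => z _; congr (qform _ _).
  apply/rowP => i; rewrite !mxE partialD; [|exact/smooth_differentiable/smoothZ..].
  by rewrite !partialZ; [ring|exact: smooth_differentiable..].
- move=> x _ [f [sf ->]]; rewrite -lee_fin qperE//.
  exact: (periodized_form_le htau nu10 mA ellA).
- move=> x e e0; have h : (periodized_form tau A N eta x < (qper N eta x + e)%:E)%E.
    by rewrite -qperE// lte_fin ltrDl.
  have [_ [f sf <-]] := ereal_inf_lt h.
  rewrite (cell_energyE htau nu10 mA ellA eta x N0 sf.1) lte_fin => h1.
  by exists (cell_energy tau A N eta x f); [exists f|exact: ltW].
- move=> x _ [f [sf ->]]; have [sf1 _] := sf.
  have ell z : elliptic nu1 nu2 (A (tau (- z) eta)) by exact: ellA.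
  have bg i : bdm (cube 0 N) (fun z => gradient f z 0 i).
    rewrite (_ : (fun z => _) = partial i f); last by apply/funext => z; rewrite mxE.
    by apply: smooth_cube; exact: smooth_partial.
  have := Rint_qform_coercive mQ fQ bO ell nu10 x bg.
  have c1 : fine (@lebn R d (cube 0 N)) = N ^+ d.
    by have := @Rint_cst_cube R d 0 N 1 (ltW N0); rewrite Rintegral_cst// !mul1r subr0.
  rewrite c1 => h; rewrite -[leLHS]mulr1 /cell_energy.
  have -> : 1 = N ^+ d * N^-1 ^+ d by rewrite -exprMn mulfV ?gt_eqF// expr1n.
  rewrite mulrA mulrC ler_wpM2l// h// => i.
  rewrite -[RHS](Rint_partial_torus0 i N0 sf); apply: eq_Rintegral => z _.
  by rewrite mxE.
Qed.

(** The null set of each one-sided bound depends on the tolerance, so tolerances run over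
    [n.+1%:R^-1] and countably many null sets are united. *)
Lemma qper_cvg xi : {ae mu, forall eta, qper N eta xi @[N --> +oo] --> qeff xi}.
Proof.
have up n : {ae mu, forall eta, \forall N \near +oo,
    (periodized_form tau A N eta xi <= (qeff xi + n.+1%:R^-1)%:E)%E}.
  have e0 : 0 < n.+1%:R^-1 / 2 :> R by rewrite divr_gt0.
  have [g [w [gw h]]] := qeff_approx htau nu10 nu20 mA ellA xi e0.
  apply: filterS (periodized_form_upper htau nu10 nu20 mA ellA xi gw e0) => eta.
  apply: filterS => N h1; apply: le_trans h1 _; rewrite lee_fin.
  move: (n.+1%:R^-1) h => r h; lra.
have lo n : {ae mu, forall eta, \forall N \near +oo,
    ((qeff xi - n.+1%:R^-1)%:E <= periodized_form tau A N eta xi)%E}.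
  by apply: (periodized_form_lower htau nu10 nu20 mA ellA); rewrite invr_gt0.
apply: filterS2 (ae_foralln up) (ae_foralln lo) => eta hu hl.
apply/cvgrPdist_le => e e0.
have [n ne] : exists n, n.+1%:R^-1 <= e.
  have [n _ h] := near_infty_natSinv_lt (PosNum e0); exists n.
  by apply/ltW; exact: (h n (leqnn n)).
near=> N; have N0 : 0 < N by near: N; exact: nbhs_pinfty_gt.
have h1 : (periodized_form tau A N eta xi <= (qeff xi + n.+1%:R^-1)%:E)%E.
  by near: N; exact: hu.
have h2 : ((qeff xi - n.+1%:R^-1)%:E <= periodized_form tau A N eta xi)%E.
  by near: N; exact: hl.
move: h1 h2; rewrite -qperE// !lee_fin ler_norml.
by move: (n.+1%:R^-1) ne (qper N eta xi) => r re z h1 h2; apply/andP; split; lra.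
Unshelve. all: by end_near. Qed.

End form_matrices.

(** Polarization: entries depend on finitely many values of the form, so one set of full measure
    suffices for the convergence of the matrices. *)
Lemma form_matrix_entry {R : realType} {d : nat} (Q : 'rV[R]_d -> \bar R) (S : 'M[R]_d) i j :
  is_form_matrix Q S -> S i j = (fine (Q (delta_mx 0 i + delta_mx 0 j)) -
    fine (Q (delta_mx 0 i)) - fine (Q (delta_mx 0 j))) / 2.
Proof.
move=> [Ss _ SQ]; rewrite -!SQ/= qformD//.
have -> : S i j = bform S (delta_mx 0 i) (delta_mx 0 j).
  rewrite /bform -rowE (bigD1 j)//= big1 => [|k kj]; first by rewrite addr0 !mxE !eqxx mulr1.
  by rewrite !mxE (negPf kj) andbF mulr0.
by move: (qform S _) (qform S _) (bform S _ _) => a b c; field.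
Qed.

Lemma cvg_matrix_entries {R : realType} {m n : nat} {T : Type} (F : set_system T)
    {FF : Filter F} (f : T -> 'M[R]_(m, n)) (L : 'M[R]_(m, n)) :
  (forall i j, f x i j @[x --> F] --> L i j) -> f x @[x --> F] --> L.
Proof.
move=> h; apply/cvg_ballP => e e0; suff : \forall x \near F, forall i j, ball (L i j) e (f x i j).
  by apply: filterS => x hx; split.
apply: filter_forall => {}i; apply: filter_forall => {}j.
exact: (cvg_ball (h i j)).
Qed.

(** * Changing the coefficients on a null set *)

Section almost_everywhere_equal_coefficients.
Context {R : realType} {d : nat} {disp : measure_display}
  {X : measurableType disp} (mu : probability X R)
  (tau : 'rV[R]_d -> X -> X).
Hypothesis htau : ergodic_action mu tau.
Local Notation lambda := (@lebn R d).

(** By Tonelli and invariance, the Lebesgue measure of the set of [x] for which the orbit is in [Z]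
    has zero integral over [X], so it vanishes for almost every [eta]. *)
Lemma ae_orbit_avoids_null (Z : set X) : measurable Z -> mu Z = 0%E ->
  {ae mu, forall eta, {ae lambda, forall x, ~ Z (tau (- x) eta)}}.
Proof.
move=> mZ Z0.
pose G (p : X * 'rV[R]_d) : \bar R := (\1_Z (tau (- p.2) p.1))%:E.
have mG : measurable_fun setT G.
  apply/measurable_EFinP; exact: (measurableT_comp (measurable_indic mZ)
    (measurable_tau_joint htau)).
have G0 p : (0 <= G p)%E by rewrite lee_fin.
have mS : measurable_fun setT (fun eta => \int[lambda]_y G (eta, y))%E.
  exact: (@measurable_fun_fubini_tonelli_F _ _ _ _ _ lambda G).
have IS : (\int[mu]_eta `|\int[lambda]_y G (eta, y)|)%E = 0%E.
  under eq_integral do rewrite gee0_abs ?integral_ge0//.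
  rewrite (fubini_tonelli (m1 := mu) (m2 := lambda) G mG G0) integral0_eq// => y _.
  have mi : measurable_fun setT (EFin \o (\1_Z : X -> R)).
    by apply/measurable_EFinP; exact: measurable_indic.
  by rewrite /G /= (integral_tau htau y mi) integral_indic// setIT.
move/(ae_eq_integral_abs mu measurableT mS) : IS; apply: filterS => eta /(_ Logic.I) /= h.
have mo : measurable_fun setT (fun y => G (eta, y)).
  apply/measurable_EFinP; exact: (measurableT_comp (measurable_indic mZ)
    (measurable_orbit htau eta)).
have h2 : (\int[lambda]_y `|G (eta, y)|)%E = 0%E.
  by under eq_integral do rewrite gee0_abs//.
move/(ae_eq_integral_abs lambda measurableT mo) : h2; apply: filterS => x /(_ Logic.I) /=.
by rewrite /G /= indicE => -[] + Zx; rewrite mem_set// => /eqP; rewrite oner_eq0.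
Qed.

Context (A A' : X -> 'M[R]_d) (Z : set X).
Hypothesis mZ : measurable Z.
Hypothesis Z0 : mu Z = 0%E.
Hypothesis mA : forall i j, measurable_fun setT (fun eta => A eta i j).
Hypothesis mA' : forall i j, measurable_fun setT (fun eta => A' eta i j).
Hypothesis AA' : forall eta, ~ Z eta -> A eta = A' eta.

Lemma measurable_qform {dT : measure_display} {T : measurableType dT} (D : set T)
    (F : T -> 'M[R]_d) (u : T -> 'rV[R]_d) :
  (forall i j, measurable_fun D (fun t => F t i j)) ->
  (forall i, measurable_fun D (fun t => u t 0 i)) ->
  measurable_fun D (fun t => qform (F t) (u t)).
Proof.
move=> mF mu'; under eq_fun do rewrite qformE bformE.
apply: measurable_sum => j; apply: measurable_sum => i.
by apply: measurable_funM => //; apply: measurable_funM.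
Qed.

Lemma ae_eq_effective_form : effective_form mu tau A = effective_form mu tau A'.
Proof.
apply/funext => xi; rewrite /effective_form; congr ereal_inf; apply: eq_imagel => v [vL _ _].
have mv i : measurable_fun setT (fun eta => (xi + v eta) 0 i).
  under eq_fun do rewrite mxE.
  by apply: measurable_funD => //; have [] := L2_Lfun (vL i).
apply: ae_eq_integral => //.
- by apply/measurable_EFinP; exact: measurable_qform.
- by apply/measurable_EFinP; exact: measurable_qform.
exists Z; split => //= eta; apply: contra_notP => nZ _.
by rewrite AA'.
Qed.

(** One null set serves all [N] and [xi], since the orbit avoids [Z] at almost every point of the
    whole space. *)
Lemma ae_eq_periodized_form : {ae mu, forall eta, forall N, 0 < N ->
  periodized_form tau A N eta = periodized_form tau A' N eta}.
Proof.
apply: filterS (ae_orbit_avoids_null mZ Z0) => eta hZ N N0.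
apply/funext => xi; rewrite /periodized_form; congr ereal_inf; apply: eq_imagel => f [sf _].
congr (_ * _)%E; rewrite cellE; have mQ := @measurable_cube R d 0 N.
have perE (B : X -> 'M[R]_d) : (\int[lebesgue_rV d]_(x in cube 0 N)
     (qform (periodized tau B N x eta) (xi + gradient f x))%:E =
   \int[lambda]_(x in cube 0 N) (qform (B (tau (- x) eta)) (xi + gradient f x))%:E)%E.
  apply: eq_integral => x; rewrite inE => xN.
  by rewrite /periodized (intpart_cell N0 xN) scaler0 subr0.
rewrite !perE.
have mu' i : measurable_fun (cube 0 N) (fun x => (xi + gradient f x) 0 i).
  by apply: measurable_funTS; have [] := bdm_grad_cube N xi i sf.
have mo (B : X -> 'M[R]_d) : (forall i j, measurable_fun setT (fun eta => B eta i j)) ->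
    forall i j, measurable_fun (cube 0 N) (fun x : 'rV[R]_d => B (tau (- x) eta) i j).
  move=> mB i j; apply: measurable_funTS.
  exact: (measurableT_comp (mB i j) (measurable_orbit htau eta)).
apply: ae_eq_integral => //.
- by apply/measurable_EFinP/measurable_qform => //; exact: mo.
- by apply/measurable_EFinP/measurable_qform => //; exact: mo.
by apply: filterS hZ => x nZ _; rewrite AA'.
Qed.

End almost_everywhere_equal_coefficients.

Section homogenization.
Context {R : realType} {d : nat} {disp : measure_display}
  {X : measurableType disp} (mu : probability X R)
  (tau : 'rV[R]_d -> X -> X).
Hypothesis htau : ergodic_action mu tau.
Context (A : X -> 'M[R]_d) (nu1 nu2 : R).
Hypotheses (nu10 : 0 < nu1) (nu20 : 0 < nu2).
Hypothesis mA : forall i j, measurable_fun setT (fun eta => A eta i j).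
Hypothesis ellA : forall eta, elliptic nu1 nu2 (A eta).

Lemma sigma_per_cvg : {ae mu, forall eta,
  sigma_per tau A N eta @[N --> +oo] --> sigma_eff mu tau A}.
Proof.
have effP := effective_form_matrix htau nu10 nu20 mA ellA.
pose e i : 'rV[R]_d := delta_mx 0 i.
have cv1 : {ae mu, forall eta, forall i,
    qper tau A N eta (e i) @[N --> +oo] --> qeff mu tau A (e i)}.
  by apply: filter_forall => i; exact: (qper_cvg htau nu10 nu20 mA ellA).
have cv2 : {ae mu, forall eta, forall i j,
    qper tau A N eta (e i + e j) @[N --> +oo] --> qeff mu tau A (e i + e j)}.
  apply: filter_forall => i; apply: filter_forall => j.
  exact: (qper_cvg htau nu10 nu20 mA ellA).
apply: filterS2 cv1 cv2 => eta h1 h2; apply: cvg_matrix_entries => i j.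
rewrite (form_matrix_entry i j effP).
(* The entry formula is available for [sigma_per] at [0 < N], which holds eventually. *)
apply: (@cvg_trans _ ((qper tau A N eta (e i + e j) - qper tau A N eta (e i) -
   qper tau A N eta (e j)) / 2 @[N --> +oo])).
  apply: near_eq_cvg; near=> N; have N0 : 0 < N by near: N; exact: nbhs_pinfty_gt.
  by rewrite (form_matrix_entry i j (periodized_form_matrix htau nu10 mA ellA eta N0)).
by apply: cvgMl; apply: cvgB; [apply: cvgB|].
Unshelve. all: by end_near. Qed.

End homogenization.

(** [sigma_eff] and [sigma_per] are choices that would be arbitrary if a form had no matrix; the
    conclusions with [is_form_matrix] certify that they are the matrices of the two infima. *)
Theorem theorem4p1 (R : realType) (d : nat) (hd : (0 < d)%N)
    (disp : measure_display) (X : measurableType disp) (mu : probability X R)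
    (tau : 'rV[R]_d -> X -> X) (htau : ergodic_action mu tau)
    (A : X -> 'M[R]_d) (nu1 nu2 : R) (hnu1 : 0 < nu1)
    (hAsym : {ae mu, forall eta, (A eta)^T = A eta})
    (hAbdd : forall i j, (fun eta => A eta i j) \in Lfun mu +oo%E)
    (hAell : {ae mu, forall eta, forall xi : 'rV[R]_d,
       nu1 * sqnorm xi <= qform (A eta) xi <= nu2 * sqnorm xi}) :
  is_form_matrix (effective_form mu tau A) (sigma_eff mu tau A) /\
  {ae mu, forall eta,
     (forall N : R, 0 < N ->
        is_form_matrix (periodized_form tau A N eta) (sigma_per tau A N eta)) /\
     sigma_per tau A N eta @[N --> +oo] --> sigma_eff mu tau A}.
Proof.
have mA i j : measurable_fun setT (fun eta => A eta i j).
  by have := sub_Lfun_mfun (hAbdd i j); rewrite inE.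
have [Z [mZ Z0 ZP]] : {ae mu, forall eta, elliptic nu1 nu2 (A eta)}.
  by apply: filterS2 hAsym hAell => eta h1 h2; split.
have ellZ eta : ~ Z eta -> elliptic nu1 nu2 (A eta).
  by move=> nZ; apply: contrapT => h; apply: nZ; exact: ZP.
(* A probability measure leaves a point outside [Z]; ellipticity there, tested on a basis vector,
   which exists as [d] is positive, gives [nu1 <= nu2] and hence [0 < nu2]. *)
have [eta0 nZ0] : exists eta, ~ Z eta.
  apply: contrapT => h; have ZT : Z = setT.
    by apply/seteqP; split => // eta _; apply: contrapT => nZ; apply: h; exists eta.
  by move: Z0; rewrite ZT probability_setT => /eqP; rewrite onee_eq0.
have nu12 : nu1 <= nu2.
  have [_ /(_ (delta_mx 0 (Ordinal hd)))] := ellZ _ nZ0.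
  by rewrite sqnorm_delta !mulr1 => /andP[h1 h2]; exact: le_trans h1 h2.
have nu20 : 0 < nu2 by exact: lt_le_trans nu12.
(* On [Z] the matrix becomes [nu1] times the identity, which has the same ellipticity constants
   because [nu1 <= nu2]. *)
pose A' eta : 'M[R]_d := \1_Z eta *: (nu1%:M) + (1 - \1_Z eta) *: A eta.
have A'Z eta : Z eta -> A' eta = nu1%:M.
  by move=> Ze; rewrite /A' indicE mem_set// subrr scale1r scale0r addr0.
have AA' eta : ~ Z eta -> A eta = A' eta.
  by move=> nZ; rewrite /A' indicE memNset// subr0 scale1r scale0r add0r.
have mA' i j : measurable_fun setT (fun eta => A' eta i j).
  rewrite (_ : (fun eta => _) = fun eta => \1_Z eta * (nu1%:M : 'M[R]_d) i j +
    (1 - \1_Z eta) * A eta i j); last by apply/funext => eta; rewrite mxE [X in X + _]mxE [X in _ + X]mxE.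
  have m1 : measurable_fun setT (\1_Z : X -> R) by exact: measurable_indic.
  by apply: measurable_funD; apply: measurable_funM => //; exact: measurable_funB.
have ellA' eta : elliptic nu1 nu2 (A' eta).
  have [Ze|nZ] := pselect (Z eta); last by rewrite -AA'//; exact: ellZ.
  rewrite A'Z//; split; first exact: tr_scalar_mx.
  move=> xi; have -> : qform nu1%:M xi = nu1 * sqnorm xi.
    rewrite qformE /bform /sqnorm mulr_sumr; apply: eq_bigr => i _.
    by rewrite mul_mx_scalar mxE expr2 mulrA.
  by rewrite lexx/= ler_wpM2r// sqnorm_ge0.
have eE := ae_eq_effective_form tau mZ Z0 mA mA' AA'.
have effP := effective_form_matrix htau hnu1 nu20 mA' ellA'.
rewrite /sigma_eff eE; split=> //.
apply: filterS2 (ae_eq_periodized_form htau mZ Z0 mA mA' AA')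
  (sigma_per_cvg htau hnu1 nu20 mA' ellA') => eta pE cv.
have sE N : 0 < N -> sigma_per tau A N eta = sigma_per tau A' N eta.
  by move=> N0; rewrite /sigma_per pE.
split=> [N N0|].
  rewrite (sE N N0) (pE N N0); exact: (periodized_form_matrix htau hnu1 mA' ellA' eta N0).
apply: cvg_trans cv; apply: near_eq_cvg; near=> N.
rewrite sE//; near: N; exact: nbhs_pinfty_gt.
Unshelve. all: by end_near. Qed.
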